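(* Let $\lambda^0$ be a (non-empty) Young diagram with interlacing coordinates $a_0<b_1<a_1<\dots<b_m<a_m$. The following assertions are equivalent: 1. The limiting surface $T^\infty$ of $\lambda^0$ is continuous in the whole domain $D_{\lambda^0}$. 2. The interlacing coordinates satisfy $$\sum_{\substack{i=0\\ i\ne i_0}}^m\frac1{a_{i_0}-a_i}=\sum_{i=1}^m\frac1{a_{i_0}-b_i}\qquad\text{for all }i_0=1,\dots,m-1.$$
   Context: **Young diagrams.** A partition $\lambda=(\lambda_1\ge\dots\ge\lambda_l>0)$ has length $\ell(\lambda)=l$ and size $|\lambda|=\sum_i\lambda_i$. In Russian convention its Young diagram is identified with the set of box centres $\{(j-i,\,i+j-1):1\le i\le\ell(\lambda),\,1\le j\le\lambda_i\}$; each box is a square of area $2$ with sides parallel to the lines $y=\pm x$. The upper boundary of the diagram is the graph of a $1$-Lipschitz function $\omega_\lambda:\mathbb R\to\mathbb R$, with $\omega_\lambda(x)=|x|$ for $|x|$ large. The interlacing coordinates $a_0<b_1<a_1<\dots<b_m<a_m$ are the integers such that the $a_i$ are the local minima and the $b_i$ the local maxima of $\omega_\lambda$; one has $a_0=-\ell(\lambda)$, $a_m=\lambda_1$, $\sum_{i=0}^m a_i=\sum_{i=1}^m b_i$. Put $\eta=1/\sqrt{|\lambda^0|}$. **Limiting height function.** A Poissonized Young tableau of shape $\lambda$ is a function $T:\lambda\to[0,1]$ with distinct values, increasing along rows and columns; a uniform random one is sampled from normalized Lebesgue measure on the set of such functions in $[0,1]^\lambda$. Its height function is $H_{\lambda,T}(x,t)=\#\{y:(x,y)\in\lambda,\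 T(x,y)\le t\}$. For an integer $n\ge1$ let $N=n^2|\lambda^0|$, let $\lambda_N$ be the diagram obtained from $\lambda^0$ by replacing each box by an $n\times n$ square of boxes, and let $T_N$ be a uniform random Poissonized Young tableau of shape $\lambda_N$. It is known that there is a deterministic function $H^\infty:[\eta a_0,\eta a_m]\times[0,1]\to\mathbb R$ such that, as $n\to\infty$, $\frac1{\sqrt N}H_{\lambda_N,T_N}(\lfloor x\sqrt N\rfloor,t)\to H^\infty(x,t)$ in probability, uniformly in $(x,t)$. **Limiting surface.** Let $\omega_{\eta\lambda^0}(x)=\eta\,\omega_{\lambda^0}(x/\eta)$ and $D_{\lambda^0}=\{(x,y)\in\mathbb R^2:|x|<y<\omega_{\eta\lambda^0}(x)\}$. For $(x,y)\in D_{\lambda^0}$ set $$T^\infty_+(x,y)=\sup\{t\in[0,1]:H^\infty(x,t)\le\tfrac12(y-|x|)\},\qquad T^\infty_-(x,y)=\inf\{t\in[0,1]:H^\infty(x,t)\ge\tfrac12(y-|x|)\}.$$ Let $D^{\mathrm{reg}}_{\lambda^0}$ be the set of $(x,y)\in D_{\lambda^0}$ with $T^\infty_-(x,y)=T^\infty_+(x,y)$; on it $T^\infty(x,y)$ denotes this common value. ''$T^\infty$ is continuous in the whole domain $D_{\lambda^0}$'' means that $T^\infty$ is defined on all of $D_{\lambda^0}$ (i.e. $D^{\mathrm{reg}}_{\lambda^0}=D_{\lambda^0}$) and continuous there. *)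

(* Defs.v *)
From HB Require Import structures.
From mathcomp Require Import all_boot all_order all_algebra.
From mathcomp Require Import all_classical all_reals all_analysis.
Set Implicit Arguments.
Unset Strict Implicit.
Unset Printing Implicit Defensive.
Import Order.TTheory GRing.Theory Num.Theory.
Import numFieldNormedType.Exports.
Local Open Scope classical_set_scope.
Local Open Scope ring_scope.

Definition is_partition (lam : seq nat) : bool :=
  sorted geq lam && all (ltn 0) lam.

(* Box centres in Russian convention: the box in row i and column j
   (both counted from 1) is (j - i, i + j - 1). *)
Definition boxes (lam : seq nat) : seq (int * int) :=
  [seq (j%:Z - i%:Z, (i + j)%N%:Z - 1)
     | i <- iota 1 (size lam), j <- iota 1 (nth 0%N lam i.-1)].

(* Each box is replaced by an n x n square of boxes. *)
Definition dilate (n : nat) (lam : seq nat) : seq nat :=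
  flatten [seq nseq n (n * p)%N | p <- lam].

(* The box with centre (u, v) is the square |x - u| + |y - v| <= 1, so its
   upper boundary is v + 1 - |x - u| over [u - 1, u + 1]. Outside this interval
   that expression stays below the upper boundary of the diagram, because the
   latter is 1-Lipschitz. *)
Definition upper_boundary (R : realType) (lam : seq nat) (x : R) : R :=
  \big[Num.max/`|x|]_(c <- boxes lam) (c.2%:~R + 1 - `|x - c.1%:~R|).

Definition local_minimum (R : realType) (f : R -> R) (x : R) : Prop :=
  \forall z \near x, f x <= f z.

Definition local_maximum (R : realType) (f : R -> R) (x : R) : Prop :=
  \forall z \near x, f z <= f x.

(* a_0 < b_1 < a_1 < ... < b_m < a_m; only a 0, ..., a m and b 1, ..., b m
   are meaningful. *)
Definition interlacing_coordinates (R : realType) (lam : seq nat)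
    (m : nat) (a b : nat -> int) : Prop :=
  [/\ forall i, (1 <= i <= m)%N -> a i.-1 < b i /\ b i < a i,
      forall x : R, local_minimum (upper_boundary lam) x <->
        exists2 i, (i <= m)%N & x = (a i)%:~R
    & forall x : R, local_maximum (upper_boundary lam) x <->
        exists2 i, (1 <= i <= m)%N & x = (b i)%:~R].

(* A function boxes lam -> R is the tuple of its values along the enumeration
   of the boxes. *)
Definition filling (R : realType) (lam : seq nat) : Type :=
  (size (boxes lam)).-tuple (measurableTypeR R).

Definition entry (R : realType) (lam : seq nat) (T : filling R lam)
    (c : int * int) : R :=
  nth 0 (T : seq R) (index c (boxes lam)).

(* From the box (u, v), the next box in the same row is (u + 1, v + 1) and the
   next box in the same column is (u - 1, v + 1). *)
Definition poissonized_tableau (R : realType) (lam : seq nat) :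
    set (filling R lam) :=
  [set T | [/\ forall c, c \in boxes lam -> 0 <= entry T c <= 1,
      {in boxes lam &, injective (entry T)},
      forall u v : int, (u, v) \in boxes lam ->
        (u + 1, v + 1) \in boxes lam -> entry T (u, v) < entry T (u + 1, v + 1)
    & forall u v : int, (u, v) \in boxes lam ->
        (u - 1, v + 1) \in boxes lam ->
        entry T (u, v) < entry T (u - 1, v + 1)]].

Section tuple_cons.
Context (R : realType) (n : nat).

Definition tuple_cons (p : measurableTypeR R * n.-tuple (measurableTypeR R)) :
    n.+1.-tuple (measurableTypeR R) := [tuple of p.1 :: p.2].

Lemma measurable_tuple_cons : measurable_fun [set: _] tuple_cons.
Proof.
by apply: measurable_cons; [exact: measurable_fst|exact: measurable_snd].
Qed.

HB.instance Definition _ :=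
  isMeasurableFun.Build _ _ _ _ tuple_cons measurable_tuple_cons.

End tuple_cons.

(* Lebesgue measure on [0,1]^n, as the n-fold product of the uniform
   distribution on [0,1]. *)
Fixpoint lebesgue_cube (R : realType) (n : nat) :
    probability (n.-tuple (measurableTypeR R)) R :=
  match n with
  | 0%N => \d_[tuple]
  | k.+1 => distribution (uniform_prob (@ltr01 R) \x lebesgue_cube R k)%E
              (@tuple_cons R k)
  end.

(* Lebesgue measure on the set of Poissonized tableaux, normalized to total
   mass 1. *)
Definition tableau_law (R : realType) (lam : seq nat)
    (A : set (filling R lam)) : R :=
  fine (lebesgue_cube R _ (A `&` @poissonized_tableau R lam)) /
  fine (lebesgue_cube R _ (@poissonized_tableau R lam)).

Definition height (R : realType) (lam : seq nat) (T : filling R lam)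
    (x : int) (t : R) : nat :=
  count (fun c => (c.1 == x) && (entry T c <= t)) (boxes lam).

Definition eta (R : realType) (lam : seq nat) : R :=
  (Num.sqrt (sumn lam)%:R)^-1.

(* The event that the rescaled height function of a filling of the n-fold
   dilation of lam is not within eps of H, uniformly on
   [eta a0, eta am] x [0, 1]. *)
Definition height_deviation (R : realType) (lam : seq nat) (a0 am : int)
    (H : R -> R -> R) (n : nat) (eps : R) : set (filling R (dilate n lam)) :=
  let N : R := (n ^ 2 * sumn lam)%N%:R in
  [set T | exists x t : R,
    [/\ eta R lam * a0%:~R <= x <= eta R lam * am%:~R, 0 <= t <= 1
      & eps < `|(Num.sqrt N)^-1 *
                  (height T (Num.floor (x * Num.sqrt N)) t)%:R - H x t|]].
Arguments height_deviation {R} lam a0 am H n eps.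

(* Uniform convergence in probability. The deviation event involves an
   uncountable union over (x, t), so its probability is understood as an outer
   probability, through a measurable event A n that contains it. *)
Definition limiting_height (R : realType) (lam : seq nat) (a0 am : int)
    (H : R -> R -> R) : Prop :=
  forall eps : R, 0 < eps ->
    exists A : forall n, set (filling R (dilate n lam)),
      (forall n, measurable (A n) /\
        height_deviation lam a0 am H n eps `<=` A n) /\
      tableau_law (A n) @[n --> \oo] --> (0 : R).

Definition scaled_boundary (R : realType) (lam : seq nat) (x : R) : R :=
  eta R lam * upper_boundary lam (x / eta R lam).

Definition surface_domain (R : realType) (lam : seq nat) : set (R * R) :=
  [set p | `|p.1| < p.2 < scaled_boundary lam p.1].

Definition surface_sup (R : realType) (H : R -> R -> R) (p : R * R) : R :=
  sup [set t | 0 <= t <= 1 /\ H p.1 t <= (p.2 - `|p.1|) / 2].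

Definition surface_inf (R : realType) (H : R -> R -> R) (p : R * R) : R :=
  inf [set t | 0 <= t <= 1 /\ (p.2 - `|p.1|) / 2 <= H p.1 t].

Definition regular_domain (R : realType) (lam : seq nat) (H : R -> R -> R) :
    set (R * R) :=
  [set p | surface_domain lam p /\ surface_inf H p = surface_sup H p].

(* On the regular domain the limiting surface is surface_sup H, which equals
   surface_inf H there. *)
Definition surface_continuous (R : realType) (lam : seq nat)
    (H : R -> R -> R) : Prop :=
  regular_domain lam H = surface_domain lam /\
  {within surface_domain lam, continuous (surface_sup H)}.

(* Main.v *)
(* Frobenius' formula for the number of standard tableaux, in partial fraction
   form, says that under a uniform linear extension the mean of
   1/(z - c_k), c_k being the content of the k-th box, equals the mean of
   (z - W_k(z))/k, where W_k = z prod_(i <= k) (1 - (z - c_i)^-2). In the limit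
   J_t(z) = int H(x,t)/(z - x) dx satisfies dJ/dt = (z - W_t)/t with
   W_t = z exp(dJ_t/dz), so that v = W_t/t solves the Burgers equation
   dv/dt + v dv/dz = 0. By characteristics u = z + (1 - t) v_t(z) satisfies
   v_1(u) = v_t(z), where v_1(u) = u - sum_j p_j/(u - b_j) with p_j > 0 is the
   rational function with zeros a_i and poles b_i. With s = 1 - t, H(x,.) is
   locally constant at t exactly when X_s(u) = u - s v_1(u) = x has a real
   solution with X_s'(u) >= 0 ("frozen"). Discontinuities of the surface are the
   intervals where H(x,.) is constant with a value strictly between 0 and H(x,1).
   If v_1''(a_i) = 0 for the inner a_i, a frozen point persists until t = 1 or
   back to t = 0, hence no such interval exists. If v_1''(a_i) <> 0, the inflection
   point c of v_1 near a_i differs from a_i, and the point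
   x = X_s(c), s slightly below 1/v_1'(c), is frozen for s, but neither for a
   slightly larger nor for a slightly smaller parameter. *)
Require Import Defs.
From HB Require Import structures.
From mathcomp Require Import all_boot all_order all_algebra fingroup perm.
From mathcomp Require Import all_classical all_reals all_analysis measurable_realfun.
From mathcomp Require Import complex ring lra zify.
Set Implicit Arguments.
Unset Strict Implicit.
Unset Printing Implicit Defensive.
Import Order.TTheory GRing.Theory Num.Theory.
Import numFieldNormedType.Exports.
Local Open Scope classical_set_scope.
Local Open Scope ring_scope.

(** * Partial fractions *)

(** Neither z- nor t-derivatives of the limit are taken. All that is known is J_t2(z) - J_t1(z) =
    (t2 - t1)/t1 (z - W_t1(z)) + O((t2 - t1)^2), while W contains dJ/dz. The estimate is used at z
    and at z + h with time step h^2: dividing the difference by h leaves an error O(h^3) per step,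
    and the (1 - t)/h^2 steps along the line of slope v_t(z) add up to O(h). So v is constant on
    characteristics by a discrete Gronwall argument. The passage to real z rests on one inequality.
    The complex points u on characteristics satisfy s(1 + sum_j p_j/|u - b_j|^2) <= 1, the analogue
    of X_s' >= 0, and for such a u and a real frozen w one has |X_s(u) - X_s(w)| >= c |u - w|^3. The
    exponent 3 is what an inflection point with X_s' = 0 allows, so nothing degenerates at critical
    points. This gives uniqueness of frozen points, convergence of u to them as Im z tends to 0, and
    the failure of freezing near the inflection point c. Statement 2 enters as v_1''(a_i) = 0, by
    comparing the partial fractions of v_1 with its product form near a_i. *)

Section PartialFractions.
Variables (F : fieldType) (x0 : F) (a b : nat -> F).

Definition ratf n (u : F) := (u - x0) * \prod_(0 <= k < n) ((u - a k) / (u - b k)).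

(** Minus the residue of [ratf] at [b j]: with this sign it is positive when zeros and poles
    interlace, and it serves both as a probability and as a weight p_j. *)
Definition residue n j := (b j - x0) * (a j - b j) *
  \prod_(0 <= k < n | k != j) ((b j - a k) / (b j - b k)).

Lemma residueS n j : (j < n)%N ->
  residue n.+1 j = residue n j * ((b j - a n) / (b j - b n)).
Proof.
move=> jn; rewrite /residue big_mkcond big_nat_recr //= -big_mkcond.
by rewrite (gtn_eqF jn) /= mulrA.
Qed.

Lemma residue_last n : residue n.+1 n = (a n - b n) * ratf n (b n).
Proof.
rewrite /residue /ratf big_mkcond big_nat_recr //= -big_mkcond eqxx /= mulr1.
rewrite [in LHS](mulrC (b n - x0)) -mulrA; congr (_ * (_ * _)).
rewrite big_nat_cond [RHS]big_nat_cond; apply: eq_bigl => k.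
by case: ltngtP => //=; rewrite ?andbT ?andbF //; lia.
Qed.

(** Induction on the number of factors: multiplying by (u - a n)/(u - b n) = 1 - (a n - b n)/(u - b
    n) creates the pole [b n], whose coefficient is the old function at [b n], known from the
    induction hypothesis. *)
Lemma ratf_partial_fractions n u :
  (forall j k, (j < n)%N -> (k < n)%N -> j != k -> b j != b k) ->
  (forall j, (j < n)%N -> u != b j) ->
  ratf n u = u - x0 - \sum_(0 <= k < n) (a k - b k)
             - \sum_(0 <= j < n) residue n j / (u - b j).
Proof.
elim: n u => [|n IH] u bI ub.
  by rewrite /ratf !big_nil mulr1; ring.
have bI' j k : (j < n)%N -> (k < n)%N -> j != k -> b j != b k.
  by move=> jn kn; apply: bI; lia.
have ub0 k : (k < n.+1)%N -> u - b k != 0 by move=> kn; rewrite subr_eq0 ub.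
have bb0 k : (k < n)%N -> b k - b n != 0.
  by move=> kn; rewrite subr_eq0 bI //; lia.
rewrite /ratf big_nat_recr //= mulrA -/(ratf n u) IH // => [|j jn]; last by apply: ub; lia.
rewrite [in RHS]big_nat_recr //= [\sum_(0 <= j < n.+1) residue _ _ / _]big_nat_recr //=.
rewrite residue_last IH //; last by move=> j jn; rewrite bI //; lia.
(* For the old poles, 1/((u - b i)(u - b n)) is split into simple fractions; the part at [b n]
   cancels against the sum hidden in [residue_last]. *)
have -> : \sum_(0 <= i < n) residue n.+1 i / (u - b i) =
  \sum_(0 <= i < n) residue n i / (u - b i)
  - (a n - b n) / (u - b n) * (\sum_(0 <= i < n) residue n i / (u - b i)
      - \sum_(0 <= i < n) residue n i / (b n - b i)).
  rewrite -sumrB mulr_sumr -sumrB; apply: eq_big_nat => i /andP[_ iN].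
  have un := ub0 n (leqnn _); have ui := ub0 i (leqW iN); have bin := bb0 i iN.
  have bni : b n - b i != 0 by rewrite -opprB oppr_eq0.
  by rewrite residueS //; field; rewrite un ui bin bni.
have un := ub0 n (leqnn _).
by field.
Qed.

(** Up to sign, the coefficient of 1/u at infinity. For shifted parts it is the size of the diagram,
    which normalises the cotransition probabilities. *)
Lemma residue_sum n :
  (forall j k, (j < n)%N -> (k < n)%N -> j != k -> b j != b k) ->
  \sum_(0 <= j < n) residue n j =
  \sum_(0 <= j < n) (a j - b j) * (b j - x0 - \sum_(0 <= k < j) (a k - b k)).
Proof.
elim: n => [|n IH] bI; first by rewrite !big_nil.
have bI' j k : (j < n)%N -> (k < n)%N -> j != k -> b j != b k.
  by move=> jn kn; apply: bI; lia.
rewrite !big_nat_recr //= -IH //.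
have bb0 k : (k < n)%N -> b k - b n != 0.
  by move=> kn; rewrite subr_eq0 bI //; lia.
rewrite residue_last ratf_partial_fractions //; last by move=> j jn; rewrite bI //; lia.
have -> : \sum_(0 <= i < n) residue n.+1 i = \sum_(0 <= i < n) residue n i
   + (a n - b n) * (\sum_(0 <= i < n) residue n i / (b n - b i)).
  rewrite mulr_sumr -big_split /=; apply: eq_big_nat => i /andP[_ iN].
  have bin := bb0 i iN.
  have bni : b n - b i != 0 by rewrite -opprB oppr_eq0.
  by rewrite residueS //; field; rewrite bni bin.
by ring.
Qed.

End PartialFractions.

(** * Frobenius' product formula under removal of a box *)

Section Vandermonde.
Variable K : numFieldType.
Implicit Type l : nat -> nat.

(** For distinct shifted parts [l i], Frobenius' formula: the number of standard tableaux divided by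
    the factorial of the size. *)
Definition frobenius n l : K := \prod_(0 <= i < n)
  ((\prod_(0 <= j < i) ((l j)%:R - (l i)%:R)) / (l i)`!%:R).

Definition decr l i : nat -> nat := fun k => if k == i then (l k).-1 else l k.

(** Zeros at 0 and at the shifted parts plus one, poles at the shifted parts. The value is the size
    of the diagram times the probability that the last box of a uniform linear extension lies in row
    [j]. *)
Definition cotrans n l j : K :=
  residue 0 (fun k => (l k)%:R + 1) (fun k => (l k)%:R) n j.

Lemma cotransE n l j :
  cotrans n l j = (l j)%:R * \prod_(0 <= k < n | k != j)
    (((l j)%:R - 1 - (l k)%:R) / ((l j)%:R - (l k)%:R)).
Proof.
rewrite /cotrans /residue subr0 addrAC subrr add0r mulr1; congr (_ * _).
by apply: eq_bigr => k _; congr (_ / _); ring.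
Qed.

Lemma frobenius_neq0 n l :
  (forall j k, (j < n)%N -> (k < n)%N -> j != k -> l j != l k) ->
  frobenius n l != 0.
Proof.
move=> lI; rewrite prodf_seq_neq0; apply/allP => i.
rewrite mem_index_iota /= => iN.
rewrite mulf_neq0 ?invr_eq0 ?pnatr_eq0 -?lt0n ?fact_gt0 //.
rewrite prodf_seq_neq0; apply/allP => j; rewrite mem_index_iota /= => ji.
by rewrite subr_eq0 eqr_nat lI //; lia.
Qed.

(** Induction on [n]. If the last index is the decreased one, the whole quotient comes from its own
    factors; otherwise the last index contributes the single factor (l i - 1 - l n)/(l i - l n). *)
Lemma frobenius_decr n l i : (i < n)%N -> (0 < l i)%N ->
  (forall j k, (j < n)%N -> (k < n)%N -> j != k -> l j != l k) ->
  frobenius n (decr l i) = frobenius n l * cotrans n l i.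
Proof.
move=> iN li0; elim: n iN => [//|n IH] iN lI.
have lI' j k : (j < n)%N -> (k < n)%N -> j != k -> l j != l k.
  by move=> jn kn; apply: lI; lia.
rewrite /frobenius !big_nat_recr //= -!/(frobenius n _).
move: iN; rewrite ltnS leq_eqVlt => /orP[/eqP iN|iN].
  move=> {IH}; subst n.
  have -> : frobenius i (decr l i) = frobenius i l.
    apply: eq_big_nat => k /andP[_ kn]; rewrite /decr.
    have -> : (k == i) = false by lia.
    congr (_ / _); apply: eq_big_nat => j /andP[_ jk].
    by have -> : (j == i) = false by lia.
  rewrite -mulrA; congr (_ * _); rewrite cotransE.
  have -> : \prod_(0 <= k < i.+1 | k != i)
     (((l i)%:R - 1 - (l k)%:R) / ((l i)%:R - (l k)%:R)) =
     \prod_(0 <= k < i) (((l k)%:R - ((l i)%:R - 1)) / ((l k)%:R - (l i)%:R)) :> K.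
    rewrite big_mkcond big_nat_recr //= eqxx mulr1 -big_mkcond.
    rewrite big_nat_cond [RHS]big_nat_cond; apply: eq_big => k; first by lia.
    by rewrite -mulrNN -invrN !opprB.
  have -> : \prod_(0 <= j < i) ((decr l i j)%:R - (decr l i i)%:R) =
    \prod_(0 <= j < i) ((l j)%:R - ((l i)%:R - 1)) :> K.
    apply: eq_big_nat => j /andP[_ ji]; rewrite /decr eqxx.
    have -> : (j == i) = false by lia.
    by rewrite -subn1 natrB.
  rewrite big_split /= prodfV /decr eqxx.
  set P := \prod_(0 <= k < i) ((l k)%:R - (l i)%:R).
  have P0 : P != 0.
    rewrite prodf_seq_neq0; apply/allP => j; rewrite mem_index_iota /= => ji.
    by rewrite subr_eq0 eqr_nat lI //; lia.
  have -> : (l i)`! = (l i * (l i).-1`!)%N by rewrite -{1 2}(prednK li0) factS.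
  rewrite natrM; field.
  by rewrite P0 !pnatr_eq0 -!lt0n fact_gt0 li0.
rewrite IH //; have nE : (n == i) = false by lia.
rewrite [decr l i n]/decr nE.
have lin : (l i)%:R - (l n)%:R != 0 :> K.
  by rewrite subr_eq0 eqr_nat lI //; lia.
have -> : cotrans n.+1 l i = cotrans n l i *
     (((l i)%:R - 1 - (l n)%:R) / ((l i)%:R - (l n)%:R)).
  rewrite /cotrans residueS //; congr (_ * (_ / _)); ring.
have -> : \prod_(0 <= j < n) ((decr l i j)%:R - (l n)%:R) =
   \prod_(0 <= j < n) ((l j)%:R - (l n)%:R) *
     (((l i)%:R - 1 - (l n)%:R) / ((l i)%:R - (l n)%:R)) :> K.
  transitivity (\prod_(0 <= j < n) (((l j)%:R - (l n)%:R) *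
     (if j == i then ((l i)%:R - 1 - (l n)%:R) / ((l i)%:R - (l n)%:R) else 1)) : K).
    apply: eq_bigr => j _; rewrite /decr.
    case: eqP => [->|_]; last by rewrite mulr1.
    by rewrite mulrCA divff // mulr1 -subn1 natrB.
  by rewrite big_split /= -big_mkcond big_nat1_eq leq0n iN.
by ring.
Qed.

End Vandermonde.

(** * Linear extensions of a Young diagram *)

Section Boxes.
Implicit Types (lam : seq nat) (c : int * int) (s : seq (int * int)).

(** Rows are counted from 0 and columns from 1, so that membership reads [0 < j <= nth 0 lam i]. *)
Definition box (i j : nat) : int * int := (j%:Z - i.+1%:Z, (i.+1 + j)%N%:Z - 1).

Lemma box_inj i j i' j' : box i j = box i' j' -> i = i' /\ j = j'.
Proof. by case; lia. Qed.

Lemma boxes_mem lam c : (c \in boxes lam) <->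
  exists i j, (0 < j <= nth 0%N lam i)%N /\ c = box i j.
Proof.
split.
  case/allpairsPdep => i [j []]; rewrite !mem_iota => iH jH ->.
  exists i.-1, j; split; first by lia.
  by rewrite /box prednK //; lia.
case=> i [j [jH ->]]; apply/allpairsPdep; exists i.+1, j; rewrite !mem_iota.
have iN : (i < size lam)%N.
  by rewrite ltnNge; apply/negP => /(nth_default 0%N) E; move: jH; rewrite E; lia.
by split => //; lia.
Qed.

Lemma box_in lam i j : (box i j \in boxes lam) = (0 < j <= nth 0%N lam i)%N.
Proof.
apply/idP/idP => [/boxes_mem[i' [j' [jH /box_inj[-> ->]]]]//|jH].
by apply/boxes_mem; exists i, j.
Qed.

Lemma boxes_uniq lam : uniq (boxes lam).
Proof.
apply: allpairs_uniq_dep; first exact: iota_uniq.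
  by move=> i _; exact: iota_uniq.
move=> [i j] [i' j'] /allpairsPdep[x [y [xH yH [-> ->]]]]
  /allpairsPdep[x' [y' [xH' yH' [-> ->]]]] /= [].
move: xH yH xH' yH'; rewrite !mem_iota => *.
have -> : x = x' by lia.
by have -> : y = y' by lia.
Qed.

Lemma size_boxes lam : size (boxes lam) = sumn lam.
Proof.
rewrite size_allpairs_dep; congr sumn; apply: (@eq_from_nth _ 0%N).
  by rewrite size_map size_iota.
move=> i; rewrite size_map size_iota => iN.
by rewrite (nth_map 0%N) ?size_iota // nth_iota.
Qed.

Lemma box_succ i j :
  ((box i j).1 + 1, (box i j).2 + 1) = box i j.+1 /\
  ((box i j).1 - 1, (box i j).2 + 1) = box i.+1 j.
Proof. by rewrite /box /=; split; congr (_, _); lia. Qed.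

(** A row emptied by the removal stays as a part 0. The number of rows, and with it the shift in
    [shifted], is then constant along a chain of removals; for this reason the lemmas assume
    [sorted geq] instead of [is_partition]. *)
Definition remove_box lam i := set_nth 0%N lam i (nth 0%N lam i).-1.

Definition removable lam i :=
  (i < size lam)%N && (nth 0%N lam i.+1 < nth 0%N lam i)%N.

Definition corner lam i := box i (nth 0%N lam i).

Lemma nth_remove_box lam i k :
  nth 0%N (remove_box lam i) k = if k == i then (nth 0%N lam i).-1 else nth 0%N lam k.
Proof. by rewrite nth_set_nth. Qed.

Lemma size_remove_box lam i : (i < size lam)%N -> size (remove_box lam i) = size lam.
Proof. by move=> iN; rewrite size_set_nth; apply/maxn_idPr. Qed.

Lemma nth_sorted lam i j : sorted geq lam -> (i <= j)%N ->
  (nth 0%N lam j <= nth 0%N lam i)%N.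
Proof.
move=> sl ij; case: (ltnP j (size lam)) => jN; last by rewrite (nth_default _ jN).
apply: (sorted_leq_nth (leT := geq)) => //.
- by move=> a b c; rewrite /geq /= => *; lia.
- by move=> a; exact: leqnn.
- by rewrite inE; apply: leq_ltn_trans ij jN.
Qed.

Lemma sorted_remove_box lam i : sorted geq lam -> removable lam i ->
  sorted geq (remove_box lam i).
Proof.
move=> sl /andP[iN rm].
apply/(sortedP 0%N) => k; rewrite size_remove_box // => kN.
rewrite /geq /= !nth_remove_box.
have := nth_sorted sl (leqnSn k).
case: (altP (k.+1 =P i)) => [E|_]; case: (altP (k =P i)) => [E'|_] //=; try lia.
- by rewrite E; lia.
- by subst k; lia.
Qed.

Lemma boxes_remove_box lam i c : sorted geq lam -> removable lam i ->
  (c \in boxes lam) = (c == corner lam i) || (c \in boxes (remove_box lam i)).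
Proof.
move=> sl /andP[iN rm]; apply/idP/idP.
  case/boxes_mem => i' [j' [jH ->]].
  have [E|nE] := eqVneq i' i; last first.
    by apply/orP; right; rewrite box_in nth_remove_box (negbTE nE).
  subst i'; have [->|nE] := eqVneq j' (nth 0%N lam i).
    by rewrite /corner eqxx.
  by apply/orP; right; rewrite box_in nth_remove_box eqxx; lia.
case/orP => [/eqP->|]; first by rewrite box_in; lia.
case/boxes_mem => i' [j' [jH ->]]; rewrite box_in.
by move: jH; rewrite nth_remove_box; case: (altP (i' =P i)) => [->|_]; lia.
Qed.

Lemma corner_notin lam i : corner lam i \notin boxes (remove_box lam i) \/
  nth 0%N lam i = 0%N.
Proof.
rewrite box_in nth_remove_box eqxx.
by case: (nth 0%N lam i) => [|k]; [right|left; lia].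
Qed.

Lemma perm_boxes_remove_box lam i : sorted geq lam -> removable lam i ->
  perm_eq (boxes lam) (rcons (boxes (remove_box lam i)) (corner lam i)).
Proof.
move=> sl rm; apply: uniq_perm; first exact: boxes_uniq.
  rewrite rcons_uniq boxes_uniq andbT.
  case: (corner_notin lam i) => // E.
  by move: rm; rewrite /removable E ltn0 andbF.
by move=> c; rewrite mem_rcons inE (boxes_remove_box _ sl rm).
Qed.

Lemma sumn_remove_box lam i : sorted geq lam -> removable lam i ->
  sumn lam = (sumn (remove_box lam i)).+1.
Proof.
move=> sl rm; rewrite -!size_boxes (perm_size (perm_boxes_remove_box sl rm)).
by rewrite size_rcons.
Qed.

Definition covers c c' :=
  (c' == (c.1 + 1, c.2 + 1)) || (c' == (c.1 - 1, c.2 + 1)).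

Definition order_compatible s :=
  all (fun c => all (fun c' => covers c c' ==> (index c s < index c' s)%N) s) s.

(** A standard tableau is encoded by the list of its boxes in order of insertion, so that prefixes
    are the growing diagrams. *)
Definition linear_extensions lam :=
  [seq s <- permutations (boxes lam) | order_compatible s].

Lemma mem_linear_extensions lam s :
  (s \in linear_extensions lam) = perm_eq s (boxes lam) && order_compatible s.
Proof. by rewrite mem_filter mem_permutations andbC. Qed.

Lemma covers_box i j c' :
  covers (box i j) c' = (c' == box i j.+1) || (c' == box i.+1 j).
Proof. by rewrite /covers; have [-> ->] := box_succ i j. Qed.

Lemma order_compatible_rcons s c : uniq (rcons s c) ->
  order_compatible (rcons s c) =
  order_compatible s && all (fun c' => ~~ covers c c') s.
Proof.
rewrite rcons_uniq => /andP[cs us].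
have idx c' : c' \in s -> index c' (rcons s c) = index c' s.
  by move=> c's; rewrite -cats1 index_cat c's.
have idc : index c (rcons s c) = size s.
  by rewrite -cats1 index_cat (negbTE cs) /= eqxx addn0.
have covcc : covers c c = false.
  by case: c {cs idx idc} => u v; rewrite /covers /= !xpair_eqE; lia.
apply/idP/andP.
  move=> /allP H; split.
    apply/allP => x xs; apply/allP => y ys.
    have := H x; rewrite mem_rcons inE xs orbT => /(_ isT)/allP/(_ y).
    by rewrite mem_rcons inE ys orbT => /(_ isT); rewrite !idx.
  apply/allP => y ys; apply/negP => cy.
  have := H c; rewrite mem_rcons inE eqxx => /(_ isT)/allP/(_ y).
  rewrite mem_rcons inE ys orbT => /(_ isT); rewrite cy idc idx //=.
  by rewrite ltnNge index_size.
case=> /allP H1 /allP H2; apply/allP => x; rewrite mem_rcons inE => xH.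
apply/allP => y; rewrite mem_rcons inE => yH; apply/implyP => xy.
case/orP: yH => [/eqP E|ys].
  subst y; rewrite idc; case/orP: xH => [/eqP E|xs].
    by move: xy; rewrite E covcc.
  by rewrite idx // index_mem.
case/orP: xH => [/eqP E|xs].
  by subst x; move: (H2 _ ys); rewrite xy.
by rewrite !idx //; have /allP/(_ y ys) := H1 x xs; rewrite xy.
Qed.

(** No box covering the last one can be in the diagram, which forces the last box to end a removable
    row. *)
Lemma linear_extensions_rcons lam s c : sorted geq lam ->
  (rcons s c \in linear_extensions lam) <->
  exists i, [/\ removable lam i, c = corner lam i &
    s \in linear_extensions (remove_box lam i)].
Proof.
move=> sl; rewrite mem_linear_extensions; split.
  case/andP => pe; have us : uniq (rcons s c).
    by rewrite (perm_uniq pe) boxes_uniq.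
  rewrite order_compatible_rcons // => /andP[oc /allP mx].
  have : c \in boxes lam by rewrite -(perm_mem pe) mem_rcons inE eqxx.
  case/boxes_mem => i [j [jH cE]].
  have nin c' : covers c c' -> c' \notin boxes lam.
    move=> cc'; rewrite -(perm_mem pe) mem_rcons inE negb_or.
    apply/andP; split.
      apply/eqP => E; move: cc'; rewrite E cE covers_box.
      by case/orP => /eqP/box_inj[]; lia.
    by apply/negP => /mx; rewrite cc'.
  have n1 : box i j.+1 \notin boxes lam by apply: nin; rewrite cE covers_box eqxx.
  have n2 : box i.+1 j \notin boxes lam.
    by apply: nin; rewrite cE covers_box eqxx orbT.
  have jE : j = nth 0%N lam i by move: n1; rewrite box_in; lia.
  have iN : (i < size lam)%N.
    rewrite ltnNge; apply/negP => /(nth_default 0%N) E.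
    by move: jH; rewrite E; lia.
  have rm : removable lam i.
    by rewrite /removable iN; move: n2; rewrite box_in jE; lia.
  have cE' : c = corner lam i by rewrite cE jE.
  exists i; split=> //; rewrite mem_linear_extensions oc andbT.
  have := perm_trans pe (perm_boxes_remove_box sl rm).
  by rewrite cE' !(perm_rcons (corner lam i)) perm_sym !(perm_rcons (corner lam i)) perm_cons perm_sym.
case=> i [rm cE]; rewrite mem_linear_extensions => /andP[pe oc].
have pe' : perm_eq (rcons s c) (boxes lam).
  rewrite perm_sym; apply: (perm_trans (perm_boxes_remove_box sl rm)).
  by rewrite cE perm_sym -!cats1 perm_cat2r.
rewrite pe' /= order_compatible_rcons ?oc /=; last by rewrite (perm_uniq pe') boxes_uniq.
apply/allP => c' c's; rewrite cE covers_box; apply/negP.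
have : c' \in boxes lam by rewrite -(perm_mem pe') mem_rcons inE c's orbT.
move=> c'l H; move: rm => /andP[_ rm].
case/orP: H => /eqP E; move: c'l; rewrite E box_in.
  by rewrite ltnn andbF.
by lia.
Qed.

Lemma sum_linear_extensions (V : nmodType) lam (F : seq (int * int) -> V) :
  sorted geq lam -> (0 < sumn lam)%N ->
  \sum_(s <- linear_extensions lam) F s =
  \sum_(0 <= i < size lam | removable lam i)
    \sum_(s <- linear_extensions (remove_box lam i)) F (rcons s (corner lam i)).
Proof.
move=> sl l0.
pose L := [seq rcons s (corner lam i) | i <- [seq i <- index_iota 0 (size lam) | removable lam i],
   s <- linear_extensions (remove_box lam i)].
have pL : perm_eq (linear_extensions lam) L.
  apply: uniq_perm.
  - by rewrite filter_uniq // permutations_uniq.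
  - apply: allpairs_uniq_dep => [|i _|].
    + by rewrite filter_uniq // iota_uniq.
    + by rewrite filter_uniq // permutations_uniq.
    move=> [i s] [i' s'] /= _ _ /rcons_inj E.
    have /= ss' := congr1 fst E; have /box_inj[ii' _] := congr1 snd E.
    by subst.
  move=> s; apply/idP/idP.
    case/lastP: s => [|s c].
      rewrite mem_linear_extensions => /andP[/perm_size].
      by rewrite size_boxes /= => E; move: l0; rewrite -E.
    case/(linear_extensions_rcons _ _ sl) => i [rm -> sL].
    apply/allpairsPdep; exists i, s; split=> //.
    rewrite mem_filter rm mem_index_iota /=.
    by case/andP: rm.
  case/allpairsPdep => i [s' []]; rewrite mem_filter => /andP[rm _] s'L ->.
  by apply/(linear_extensions_rcons _ _ sl); exists i.
by rewrite (perm_big _ pL) /= /L big_allpairs_dep big_filter.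
Qed.

End Boxes.

Lemma sumr_const_seq (V : nmodType) (I : Type) (r : seq I) (x : V) :
  \sum_(i <- r) x = x *+ size r.
Proof. by rewrite big_const_seq count_predT iter_addr_0. Qed.

(** * Cotransition probabilities and the mean increment identity *)

Section Cotransition.
Variable K : numFieldType.
Implicit Types (lam : seq nat) (s : seq (int * int)).

Definition shifted lam j := (nth 0%N lam j + (size lam - j.+1))%N.

Lemma shifted_neq lam j k : sorted geq lam ->
  (j < size lam)%N -> (k < size lam)%N -> j != k -> shifted lam j != shifted lam k.
Proof.
move=> sl; wlog jk : j k / (j < k)%N => [H jN kN jk|jN kN _].
  have [E|E|E] := ltngtP j k; first exact: H.
    by rewrite eq_sym; apply: H => //; rewrite eq_sym.
  by move: jk; rewrite E eqxx.
have := nth_sorted sl (ltnW jk); rewrite /shifted; lia.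
Qed.

Lemma shifted_remove_box lam i : removable lam i ->
  shifted (remove_box lam i) =1 decr (shifted lam) i.
Proof.
move=> /andP[iN rm] k; rewrite /shifted /decr size_remove_box // nth_remove_box.
by case: eqP => // ->; lia.
Qed.

(** If rows [i] and [i.+1] have equal length, the factor with k = i + 1 vanishes; an empty last row
    has shifted part 0. *)
Lemma cotrans_not_removable lam i : sorted geq lam -> (i < size lam)%N ->
  ~~ removable lam i -> cotrans K (size lam) (shifted lam) i = 0.
Proof.
move=> sl iN; rewrite /removable iN /= -leqNgt => nr; rewrite cotransE.
have nE : nth 0%N lam i.+1 = nth 0%N lam i.
  by have := nth_sorted sl (leqnSn i); lia.
case: (ltnP i.+1 (size lam)) => iN'; last first.
  move: nE; rewrite (nth_default _ iN') => E.
  have -> : shifted lam i = 0%N by rewrite /shifted -E; lia.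
  by rewrite mul0r.
rewrite big_mkcond (bigD1_seq i.+1) /= ?mem_index_iota ?iota_uniq //.
have -> : i.+1 != i by lia.
have -> : shifted lam i = (shifted lam i.+1).+1 by rewrite /shifted nE; lia.
by rewrite -natr1 addrK subrr !(mul0r, mulr0).
Qed.

Lemma frobenius_ext n (l l' : nat -> nat) :
  (forall k, (k < n)%N -> l k = l' k) -> frobenius K n l = frobenius K n l'.
Proof.
move=> E; apply: eq_big_nat => i /andP[_ iN]; rewrite E //; congr (_ / _).
by apply: eq_big_nat => j /andP[_ ji]; rewrite E //; lia.
Qed.

Lemma sum_cotrans lam : sorted geq lam ->
  \sum_(0 <= i < size lam) cotrans K (size lam) (shifted lam) i = (sumn lam)%:R.
Proof.
move=> sl; rewrite residue_sum; last first.
  by move=> j k jN kN jk; rewrite eqr_nat shifted_neq.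
transitivity (\sum_(0 <= j < size lam) ((shifted lam j)%:R - j%:R) : K).
  apply: eq_bigr => j _; rewrite addrAC subrr add0r mul1r subr0; congr (_ - _).
  rewrite (eq_bigr (fun=> 1)) ?sumr_const_nat ?subn0 // => k _.
  by rewrite addrAC subrr add0r.
rewrite sumrB [in X in _ - X]big_nat_rev /= add0n -sumrB.
rewrite sumnE (big_nth 0%N) natr_sum.
by apply: eq_bigr => j _; rewrite /shifted natrD addrK.
Qed.

Lemma linear_extensions0 lam : sumn lam = 0%N -> linear_extensions lam = [:: [::]].
Proof.
move=> l0; have : size (boxes lam) = 0%N by rewrite size_boxes.
by move/size0nil => E; rewrite /linear_extensions E.
Qed.

(** Both sides satisfy the recursion over the last box, the right one because the [cotrans] values
    add up to the size. Only ratios of dimensions are taken later, so the factor of the empty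
    diagram with the same number of rows is left unevaluated. *)
Lemma dim_frobenius lam : sorted geq lam ->
  (size (linear_extensions lam))%:R * frobenius K (size lam) (shifted (nseq (size lam) 0%N))
  = (sumn lam)`!%:R * frobenius K (size lam) (shifted lam).
Proof.
move En : (sumn lam) => n; elim: n lam En => [|n IH] lam En sl.
  rewrite linear_extensions0 // fact0 /=; congr (_ * _).
  apply: frobenius_ext => k kN; rewrite /shifted size_nseq nth_nseq kN.
  have : (nth 0%N lam k <= sumn lam)%N.
    rewrite sumnE (big_rem (nth 0%N lam k)) /=; last by rewrite mem_nth.
    exact: leq_addr.
  by rewrite En leqn0 => /eqP ->.
have := @sum_linear_extensions nat lam (fun=> 1%N) sl.
rewrite En => /(_ isT); rewrite !sum1_size => ->.
rewrite natr_sum mulr_suml factS natrM -[X in X%:R * _]En -sum_cotrans // mulrAC mulr_suml mulr_suml.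
rewrite [RHS](bigID (removable lam)) /= [X in _ = _ + X]big1_seq ?addr0; last first.
  move=> i /andP[nr]; rewrite mem_index_iota /= => iN.
  by rewrite cotrans_not_removable // !mul0r.
rewrite big_nat_cond [RHS]big_nat_cond; apply: eq_bigr => i /andP[/andP[_ iN] rm].
rewrite sum1_size.
have iN' : (i < size lam)%N by case/andP: rm.
have n1 : sumn (remove_box lam i) = n.
  by move: En; rewrite (sumn_remove_box sl rm) => -[].
have := IH _ n1 (sorted_remove_box sl rm); rewrite size_remove_box // => ->.
rewrite (frobenius_ext (l := shifted (remove_box lam i)) (l' := decr (shifted lam) i)); last first.
  by move=> k _; exact: shifted_remove_box.
rewrite frobenius_decr //; first ring.
  by case/andP: rm => _ rm; rewrite /shifted; lia.
by move=> j k; exact: shifted_neq.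
Qed.

Lemma size_linear_extensions_gt0 lam : sorted geq lam ->
  (0 < size (linear_extensions lam))%N.
Proof.
move=> sl; have := dim_frobenius sl.
rewrite lt0n; case: eqP => // ->; rewrite mul0r => /esym/eqP.
rewrite mulf_eq0 (negbTE (frobenius_neq0 _ _)) ?orbF; last first.
  by move=> j k; exact: shifted_neq.
by rewrite pnatr_eq0 gtn_eqF ?fact_gt0.
Qed.

Lemma dim_remove_box lam i : sorted geq lam -> removable lam i ->
  (size (linear_extensions (remove_box lam i)))%:R =
  (size (linear_extensions lam))%:R / (sumn lam)%:R *
    cotrans K (size lam) (shifted lam) i.
Proof.
move=> sl rm; have iN : (i < size lam)%N by case/andP: rm.
have := dim_frobenius (sorted_remove_box sl rm); rewrite size_remove_box //.
rewrite (frobenius_ext (l := shifted (remove_box lam i)) (l' := decr (shifted lam) i)); last first.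
  by move=> k _; exact: shifted_remove_box.
have li0 : (0 < shifted lam i)%N by case/andP: rm => _ rm; rewrite /shifted; lia.
rewrite frobenius_decr //; last by move=> j k; exact: shifted_neq.
have := dim_frobenius sl; rewrite (sumn_remove_box sl rm) factS natrM.
set f := frobenius _ _ (shifted (nseq _ _)); set g := frobenius _ _ _.
have f0 : f != 0.
  apply: frobenius_neq0 => j k jN kN jk; apply: shifted_neq; rewrite ?size_nseq //.
  by elim: (size lam) => //= -[|m] //=; rewrite /geq /= leqnn.
move: (sumn _) => m E1 E2.
have m0 : m.+1%:R != 0 :> K by rewrite pnatr_eq0.
apply: (mulIf f0); rewrite E2.
apply: (mulIf m0).
set d := (size _)%:R in E1 *; set c := cotrans _ _ _ _.
have -> : d / m.+1%:R * c * f * m.+1%:R = d * f * c by field.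
by rewrite E1; ring.
Qed.

(** W of the overview in lattice units. Its partial fractions carry the law of the last box of a
    prefix given the shape of the prefix. *)
Definition kerov s (z : K) := z * \prod_(c <- s) (1 - ((z - c.1%:~R) ^+ 2)^-1).

(** 1 - 1/x^2 = (x - 1)(x + 1)/x^2, so the product along a row telescopes. *)
Lemma kerov_row (y : K) n : (forall m : int, y != m%:~R) ->
  \prod_(j <- iota 1 n) (1 - ((y - j%:R) ^+ 2)^-1) =
  (y - n%:R - 1) / (y - n%:R) * (y / (y - 1)).
Proof.
move=> yn; have y0 (m : int) : y - m%:~R != 0 by rewrite subr_eq0 yn.
elim: n => [|n IH].
  by rewrite big_nil; have := y0 0; have := y0 1; rewrite !subr0 => *; field; apply/andP.
rewrite -[n.+1]addn1 iotaD big_cat /= IH big_seq1.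
have := y0 1; have := y0 n%:Z; have := y0 (n.+1)%:Z.
rewrite -!pmulrn add1n -natr1 => h1 h2 h3.
rewrite natrD; field.
by rewrite h1 h2 h3.
Qed.

Lemma kerov_boxes lam z : (forall m : int, z != m%:~R) ->
  kerov (boxes lam) z = ratf 0 (fun k => (shifted lam k)%:R + 1)
    (fun k => (shifted lam k)%:R) (size lam) (z + (size lam)%:R).
Proof.
move=> zn; rewrite /kerov /boxes big_allpairs_dep /= /ratf subr0.
have zi i : forall m : int, z + i%:R != m%:~R.
  move=> m; rewrite -subr_eq0; have := zn (m - i%:Z).
  by rewrite -subr_eq0 intrB -pmulrn opprB addrA addrAC.
(* The factors (z + i + 1)/(z + i) left over by the rows telescope to (z + size)/z and turn the
   prefactor z into that of [ratf]. *)
transitivity (z * \prod_(0 <= i < size lam)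
  ((z + (size lam)%:R - ((shifted lam i)%:R + 1)) / (z + (size lam)%:R - (shifted lam i)%:R)
    * ((z + i.+1%:R) / (z + i%:R)))).
  congr (_ * _); rewrite -[1%N]addn0 iotaDl big_map /index_iota subn0.
  rewrite big_seq [RHS]big_seq; apply: eq_bigr => i; rewrite mem_iota /= => iN.
  rewrite add1n /=.
  transitivity (\prod_(j <- iota 1 (nth 0%N lam i)) (1 - ((z + i.+1%:R - j%:R) ^+ 2)^-1)).
    apply: eq_bigr => j _; rewrite intrB -!pmulrn; congr (1 - (_ ^+ 2)^-1); ring.
  rewrite kerov_row; last exact: zi.
  have E : (size lam)%:R = (size lam - i.+1)%:R + i.+1%:R :> K.
    by rewrite -natrD subnK.
  rewrite /shifted !natrD E; congr (_ / _ * (_ / _)).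
  - ring.
  - ring.
  - by rewrite -natr1; ring.
rewrite big_split /= mulrCA [RHS]mulrC; congr (_ * _).
have z0 i : z + i%:R != 0 by have := zi i 0.
elim: (size lam) => [|n IH]; first by rewrite big_nil mulr1 addr0.
by rewrite big_nat_recr //= mulrA IH mulrC divfK.
Qed.

Lemma kerov_cotrans lam z : sorted geq lam -> (forall m : int, z != m%:~R) ->
  kerov (boxes lam) z = z -
   \sum_(0 <= i < size lam) cotrans K (size lam) (shifted lam) i
     / (z - (nth 0%N lam i)%:R + i.+1%:R).
Proof.
move=> sl zn; rewrite kerov_boxes // ratf_partial_fractions.
- rewrite subr0 (eq_bigr (fun=> 1)); last by move=> k _; rewrite addrAC subrr add0r.
  rewrite sumr_const_nat subn0 addrK; congr (_ - _).
  apply: eq_big_nat => i /andP[_ iN]; congr (_ / _).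
  have E : (size lam)%:R = (size lam - i.+1)%:R + i.+1%:R :> K.
    by rewrite -natrD subnK.
  by rewrite /shifted natrD E; ring.
- by move=> j k jN kN jk; rewrite eqr_nat shifted_neq.
- move=> j jN; rewrite -subr_eq0; have := zn ((shifted lam j)%:Z - (size lam)%:Z).
  by rewrite -subr_eq0 intrB -!pmulrn opprB addrA addrAC.
Qed.

Lemma kerov_perm s s' z : perm_eq s s' -> kerov s z = kerov s' z.
Proof. by move=> p; rewrite /kerov (perm_big _ p). Qed.

(** Given the shape of the first k boxes, the k-th one is the corner of row i with probability
    cotrans/k, and [kerov_cotrans] says that (z - W_k)/k is the mean of 1/(z - c) under this law.
    For k below the size, summing over the last box reduces the claim to the smaller diagrams. *)
Lemma mean_increment lam k z : sorted geq lam -> (0 < k <= sumn lam)%N ->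
  (forall m : int, z != m%:~R) ->
  \sum_(s <- linear_extensions lam)
    ((z - (nth (0, 0) s k.-1).1%:~R)^-1 - (z - kerov (take k s) z) / k%:R) = 0.
Proof.
move=> sl /andP[k0 kN] zn; move En : (sumn lam) => n.
elim: n lam sl kN En => [|n IH] lam sl kN En; first by move: kN k0; rewrite En; lia.
move: kN; rewrite leq_eqVlt => /orP[/eqP kE|kN].
  rewrite sumrB.
  have -> : \sum_(s <- linear_extensions lam) ((z - kerov (take k s) z) / k%:R) =
    (size (linear_extensions lam))%:R * ((z - kerov (boxes lam) z) / k%:R).
    rewrite mulr_natl -sumr_const_seq big_seq [RHS]big_seq; apply: eq_bigr => s.
    rewrite mem_linear_extensions => /andP[pe _].
    rewrite take_oversize ?(kerov_perm _ pe) //.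
    by rewrite (perm_size pe) size_boxes kE.
  rewrite kerov_cotrans // subKr sum_linear_extensions; last by rewrite En.
    rewrite mulrCA mulr_suml.
    apply/eqP; rewrite subr_eq0; apply/eqP.
    rewrite [RHS](bigID (removable lam)) /= [X in _ = _ + X]big1_seq ?addr0; last first.
      move=> i /andP[nr]; rewrite mem_index_iota /= => iN.
      by rewrite cotrans_not_removable // !mul0r.
    rewrite big_nat_cond [RHS]big_nat_cond; apply: eq_bigr => i /andP[/andP[_ iN] rm].
    transitivity (\sum_(s <- linear_extensions (remove_box lam i))
       (z - (nth 0%N lam i)%:R + i.+1%:R)^-1).
      rewrite big_seq [RHS]big_seq; apply: eq_bigr => s.
      rewrite mem_linear_extensions => /andP[pe _].
      rewrite nth_rcons (perm_size pe) size_boxes kE (sumn_remove_box sl rm) /= ltnn eqxx /=.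
      rewrite intrB -!pmulrn; congr _^-1; ring.
    rewrite sumr_const_seq -[LHS]mulr_natl dim_remove_box // kE; ring.
  done.
rewrite sum_linear_extensions //; last by rewrite En.
rewrite big1 // => i rm.
have n1 := sumn_remove_box sl rm.
have kN' : (k <= sumn (remove_box lam i))%N by move: kN; rewrite n1.
rewrite -[RHS](IH (remove_box lam i)) //; last 2 first.
- exact: sorted_remove_box.
- by move: n1; rewrite En => -[].
rewrite big_seq [RHS]big_seq; apply: eq_bigr => s.
rewrite mem_linear_extensions => /andP[pe _].
have ss : size s = sumn (remove_box lam i) by rewrite (perm_size pe) size_boxes.
rewrite nth_rcons ss; have -> : (k.-1 < sumn (remove_box lam i))%N by lia.
by rewrite -cats1 takel_cat // ss.
Qed.

End Cotransition.

(** * Interlacing coordinates *)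

Section Boundary.
Variable R : realType.
Implicit Types (lam : seq nat) (x : R) (k : int).

(** Content of the last box of row [i]; the boundary descends over the unit interval starting
    there. *)
Definition row_end lam i : int := (nth 0%N lam i)%:Z - i.+1%:Z.

Lemma row_end_lt lam i j : sorted geq lam -> (i < j)%N -> row_end lam j < row_end lam i.
Proof. by move=> sl ij; have := nth_sorted sl (ltnW ij); rewrite /row_end; lia. Qed.

Lemma split_rows lam x : sorted geq lam -> exists i, [/\ (i <= size lam)%N,
  forall j, (j < i)%N -> x <= (row_end lam j)%:~R &
  forall j, (i <= j < size lam)%N -> (row_end lam j)%:~R < x].
Proof.
move=> sl; pose P j := (j < size lam)%N ==> ((row_end lam j)%:~R < x).
have exP : exists j, P j by exists (size lam); rewrite /P ltnn.
exists (ex_minn exP); case: ex_minnP => i Pi mini; split.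
- by apply: mini; rewrite /P ltnn.
- move=> j ji; rewrite leNgt; apply/negP => H.
  by have := mini j; rewrite /P H implybT => /(_ isT); lia.
- move=> j /andP[ij jN]; have iN : (i < size lam)%N by lia.
  move: Pi; rewrite /P iN /= => H; move: ij; rewrite leq_eqVlt => /orP[/eqP<-//|ij].
  by apply: lt_trans H; rewrite ltr_int row_end_lt.
Qed.

(** A tent is the minimum of an ascending line depending on the row only and a descending line
    depending on the column only. *)
Lemma tent_box i j x :
  let t := (box i j).2%:~R + 1 - `|x - (box i j).1%:~R| in
  t = Num.min (2 * j%:R - x) (2 * i.+1%:R + x).
Proof.
rewrite /=.
have -> : (box i j).2%:~R = i%:R + j%:R :> R.
  by rewrite /box [snd _]/= intrB -pmulrn natrD -natr1; ring.
have -> : (box i j).1%:~R = j%:R - i%:R - 1 :> R.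
  by rewrite /box [fst _]/= intrB -!pmulrn -natr1; ring.
rewrite -natr1; have [h|h] := ler0P (x - (j%:R - i%:R - 1)).
  by rewrite min_r; lra.
by rewrite min_l; lra.
Qed.

Lemma tent_le_upper_boundary lam i j x : box i j \in boxes lam ->
  Num.min (2 * j%:R - x) (2 * i.+1%:R + x) <= upper_boundary lam x.
Proof.
move=> cB; rewrite -tent_box.
exact: (@le_bigmax_seq _ _ _ _ _ (box i j) xpredT
  (fun c : int * int => c.2%:~R + 1 - `|x - c.1%:~R| : R) cB isT).
Qed.

Lemma norm_le_upper_boundary lam x : `|x| <= upper_boundary lam x.
Proof. exact: bigmax_ge_id. Qed.

Lemma partition_nth_gt0 lam i : is_partition lam -> (i < size lam)%N -> (0 < nth 0%N lam i)%N.
Proof. by case/andP => _ /all_nthP; apply. Qed.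

(** Among the rows reaching x the last has the highest ascending line, among the others the first
    has the highest descending line. At i = 0 or i = [size lam] the missing row leaves x or -x,
    which is covered by |x|. *)
Lemma upper_boundary_split lam x i : is_partition lam -> (i <= size lam)%N ->
  (forall j, (j < i)%N -> x <= (row_end lam j)%:~R) ->
  (forall j, (i <= j < size lam)%N -> (row_end lam j)%:~R < x) ->
  upper_boundary lam x = Num.max (2 * i%:R + x) (2 * (nth 0%N lam i)%:R - x).
Proof.
move=> pl iN lo hi; have sl : sorted geq lam by case/andP: pl.
have i0 : 0 <= i%:R :> R by [].
have l0 : 0 <= (nth 0%N lam i)%:R :> R by [].
apply/eqP; rewrite eq_le; apply/andP; split.
  rewrite /upper_boundary big_seq; apply: bigmax_le => [|c].
    rewrite le_max; apply/orP; have [h|h] := lerP 0 x.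
      by left; rewrite ger0_norm //; lra.
    by right; rewrite ltr0_norm //; lra.
  move=> /boxes_mem[i' [j [jH ->]]]; rewrite tent_box.
  have [ii'|ii'] := ltnP i' i.
    rewrite le_max; apply/orP; left;
    rewrite ge_min; apply/orP; right; rewrite lerD2r ler_pM2l // ler_nat //.
  rewrite le_max; apply/orP; right; rewrite ge_min; apply/orP; left.
  rewrite lerD2r ler_pM2l // ler_nat; have := nth_sorted sl ii'; lia.
rewrite ge_max; apply/andP; split.
  case: i iN lo {hi i0 l0} => [_ _|i iN lo].
    by rewrite mulr0 add0r; apply: le_trans (norm_le_upper_boundary _ _); exact: ler_norm.
  have li := partition_nth_gt0 pl iN.
  have cB : box i (nth 0%N lam i) \in boxes lam by rewrite box_in li leqnn.
  apply: le_trans (tent_le_upper_boundary _ cB); rewrite le_min lexx andbT.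
  by have := lo i (ltnSn _); rewrite /row_end intrB -!pmulrn; lra.
have [iN'|iN'] := ltnP i (size lam); last first.
  rewrite nth_default // mulr0 add0r; apply: le_trans (norm_le_upper_boundary _ _).
  by rewrite -normrN ler_norm.
have li := partition_nth_gt0 pl iN'.
have cB : box i (nth 0%N lam i) \in boxes lam by rewrite box_in li leqnn.
apply: le_trans (tent_le_upper_boundary _ cB); rewrite le_min lexx /=.
have := hi i; rewrite leqnn iN' => /(_ isT); rewrite /row_end intrB -!pmulrn; lra.
Qed.

(** Slope -1 on [k, k + 1]: either k ends a row, or the interval lies to the left of the diagram,
    where the boundary is |x|. *)
Definition descending lam k :=
  (k \in [seq row_end lam i | i <- iota 0 (size lam)]) || (k < - (size lam)%:Z).

Lemma upper_boundary_step lam k x : is_partition lam ->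
  k%:~R <= x <= k%:~R + 1 ->
  upper_boundary lam x = upper_boundary lam k%:~R +
    (if descending lam k then k%:~R - x else x - k%:~R).
Proof.
move=> pl /andP[kx xk]; have sl : sorted geq lam by case/andP: pl.
have [i [iN lo hi]] := split_rows (k%:~R + 1) sl.
have lo' j : (j < i)%N -> k + 1 <= row_end lam j.
  by move=> /lo; rewrite -(ler_int R) intrD.
have hi' j : (i <= j < size lam)%N -> row_end lam j <= k.
  by move=> /hi H; rewrite -ltzD1 -(ltr_int R) intrD.
have kE : k%:~R = (k + 1)%:~R - 1 :> R by rewrite intrD addrK.
case: (boolP ((i < size lam)%N && (row_end lam i == k))) => [/andP[iN' /eqP ik]|nk].
  have -> : descending lam k.
    by apply/orP; left; apply/mapP; exists i; rewrite ?mem_iota.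
  have dk : (k%:~R : R) = (nth 0%N lam i)%:R - i%:R - 1.
    by rewrite -ik /row_end intrB -!pmulrn -natr1; ring.
  have ko : upper_boundary lam k%:~R = 2 * i%:R + 2 + k%:~R :> R.
    rewrite (@upper_boundary_split _ _ i.+1) //.
    - have iS : i.+1%:R = i%:R + 1 :> R by rewrite -natr1.
      rewrite max_l iS; first by ring.
      have [iN2|iN2] := ltnP i.+1 (size lam).
        have : row_end lam i.+1 < k by rewrite -ik row_end_lt.
        move=> h; have : (row_end lam i.+1)%:~R + 1 <= k%:~R :> R.
          by rewrite -[1]/(1%:~R) -intrD ler_int; lia.
        by rewrite /row_end intrB -!pmulrn -!natr1; lra.
      rewrite nth_default // mulr0 add0r dk.
      have := partition_nth_gt0 pl iN'; rewrite -(ler_nat R); lra.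
    - move=> j; rewrite ltnS leq_eqVlt => /orP[/eqP->|/lo']; first by rewrite ik.
      by rewrite ler_int; lia.
    - by move=> j /andP[ij jN]; rewrite ltr_int -ik row_end_lt.
  have [->|xk'] := eqVneq x k%:~R; first by rewrite subrr addr0.
  have kx' : k%:~R < x by rewrite lt_neqAle eq_sym xk'.
  rewrite (@upper_boundary_split _ x i) //.
  - by rewrite ko max_r; lra.
  - by move=> j /lo; lra.
  - move=> j /andP[ij jN]; apply: le_lt_trans kx'; rewrite ler_int hi' //; lia.
have hi2 j : (i <= j < size lam)%N -> row_end lam j < k.
  move=> ijN; rewrite lt_neqAle hi' // andbT; apply/eqP => E.
  move/negP: nk; apply; have iN' : (i < size lam)%N by lia.
  rewrite iN' /=; case/andP: ijN; rewrite leq_eqVlt => /orP[/eqP->|ij] _; first exact/eqP.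
  have := row_end_lt sl ij; have := hi' i; rewrite leqnn iN' => /(_ isT); lia.
have ndA : k \notin [seq row_end lam i | i <- iota 0 (size lam)].
  apply/mapP => -[j]; rewrite mem_iota /= add0n => jN E.
  have [ji|ij] := ltnP j i; first by have := lo' _ ji; lia.
  by have := hi2 j; rewrite ij jN => /(_ isT); lia.
have F (y : R) : k%:~R <= y <= k%:~R + 1 ->
    upper_boundary lam y = Num.max (2 * i%:R + y) (2 * (nth 0%N lam i)%:R - y).
  move=> /andP[ky yk]; apply: upper_boundary_split => //.
  - by move=> j /lo; lra.
  - by move=> j /hi2; rewrite -(ltr_int R); lra.
rewrite !F; [|lra|lra].
rewrite /descending (negbTE ndA) /=.
case: ltP => kl.
  have iE : i = size lam.
    apply/eqP; rewrite eqn_leq iN /= leqNgt; apply/negP => iN'.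
    have := hi2 i; rewrite leqnn iN' => /(_ isT); rewrite /row_end; lia.
  have kl' : k%:~R + 1 <= - i%:R :> R.
    by rewrite iE -[1]/(1%:~R) -intrD pmulrn -mulrNz ler_int; lia.
  have i0 : 0 <= i%:R :> R by [].
  rewrite iE nth_default // -iE mulr0 !add0r !max_r; lra.
rewrite !max_l; first lra.
  have [iN'|iN'] := ltnP i (size lam).
    have : (row_end lam i)%:~R + 1 <= k%:~R :> R.
      rewrite -[1]/(1%:~R) -intrD ler_int.
      by have := hi2 i; rewrite leqnn iN' => /(_ isT); lia.
    by rewrite /row_end intrB -!pmulrn -!natr1; lra.
  have iE : i = size lam by lia.
  have : - i%:R <= k%:~R :> R by rewrite iE pmulrn -mulrNz ler_int.
  rewrite nth_default // mulr0; lra.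
have [iN'|iN'] := ltnP i (size lam).
  have : (row_end lam i)%:~R + 1 <= k%:~R :> R.
    rewrite -[1]/(1%:~R) -intrD ler_int.
    by have := hi2 i; rewrite leqnn iN' => /(_ isT); lia.
  by rewrite /row_end intrB -!pmulrn -!natr1; lra.
have iE : i = size lam by lia.
have : - i%:R <= k%:~R :> R by rewrite iE pmulrn -mulrNz ler_int.
rewrite nth_default // mulr0; lra.
Qed.

End Boundary.

(** * Local extrema of the boundary as surviving zeros and poles *)

Section Interlacing.
Variable R : realType.
Implicit Types (lam : seq nat) (k : int).

Lemma row_end_gt lam i : is_partition lam -> (i < size lam)%N ->
  - (size lam)%:Z < row_end lam i.
Proof. by move=> pl iN; have := partition_nth_gt0 pl iN; rewrite /row_end; lia. Qed.

Lemma upper_boundary_right lam k (d : R) : is_partition lam -> 0 <= d <= 1 ->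
  upper_boundary lam (k%:~R + d) = upper_boundary lam k%:~R +
    (if descending lam k then - d else d).
Proof.
move=> pl d01; rewrite (@upper_boundary_step R lam k) //; last lra.
by case: ifP => _; congr (_ + _); ring.
Qed.

Lemma upper_boundary_left lam k (d : R) : is_partition lam -> 0 <= d <= 1 ->
  upper_boundary lam (k%:~R - d) = upper_boundary lam k%:~R +
    (if descending lam (k - 1) then d else - d).
Proof.
move=> pl d01.
have E : (k - 1)%:~R = k%:~R - 1 :> R by rewrite intrB.
rewrite (@upper_boundary_step R lam (k - 1) (k%:~R - d)) //; last by rewrite E; lra.
rewrite (@upper_boundary_step R lam (k - 1) k%:~R) //; last by rewrite E; lra.
by rewrite E; case: ifP => _; ring.
Qed.

Lemma near_int (P : R -> Prop) (k : int) :
  (\forall z \near (k%:~R : R), P z) <->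
  exists2 e : R, 0 < e <= 1 & forall d, 0 <= d < e -> P (k%:~R + d) /\ P (k%:~R - d).
Proof.
split.
  move=> /nbhs_ballP[e /= e0 H]; exists (Num.min e 1).
    by rewrite lt_min e0 ltr01 ge_min lexx orbT.
  move=> d; rewrite lt_min => /andP[d0 /andP[de _]]; split; apply: H; rewrite /ball /=.
    by rewrite opprD addNKr normrN ger0_norm.
  by rewrite opprB addrC subrK ger0_norm.
case=> e /andP[e0 e1] H; apply/nbhs_ballP; exists e => //= z; rewrite /ball /= => ze.
case: (lerP 0 (z - k%:~R)) => h.
  have zd : 0 <= z - k%:~R < e by rewrite h -[ltLHS]ger0_norm // distrC.
  by have [+ _] := H _ zd; rewrite addrC subrK.
have zd : 0 <= k%:~R - z < e by move: ze h; rewrite ltr_norml; lra.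
by have [_] := H _ zd; rewrite subKr.
Qed.

Lemma local_minimum_int lam k : is_partition lam ->
  local_minimum (upper_boundary lam) (k%:~R : R) <->
  descending lam (k - 1) && ~~ descending lam k.
Proof.
move=> pl; rewrite /local_minimum near_int; split.
  case=> e /andP[e0 e1] H; have [] := H (e / 2); first by lra.
  rewrite upper_boundary_right //; last lra.
  rewrite upper_boundary_left //; last lra.
  by case: ifP => _; case: ifP => _ //; lra.
case/andP => d1 d2; exists 1; first by rewrite ltr01 lexx.
move=> d d01; rewrite upper_boundary_right; [|by []|lra].
rewrite upper_boundary_left; [|by []|lra].
by rewrite d1 (negbTE d2); split; lra.
Qed.

Lemma local_maximum_int lam k : is_partition lam ->
  local_maximum (upper_boundary lam) (k%:~R : R) <->
  ~~ descending lam (k - 1) && descending lam k.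
Proof.
move=> pl; rewrite /local_maximum near_int; split.
  case=> e /andP[e0 e1] H; have [] := H (e / 2); first by lra.
  rewrite upper_boundary_right //; last lra.
  rewrite upper_boundary_left //; last lra.
  by case: ifP => _; case: ifP => _ //; lra.
case/andP => d1 d2; exists 1; first by rewrite ltr01 lexx.
move=> d d01; rewrite upper_boundary_right; [|by []|lra].
rewrite upper_boundary_left; [|by []|lra].
by rewrite (negbTE d1) d2; split; lra.
Qed.

(** [row_ends] holds the poles and [row_ends1] the zeros of W before cancellation. After removal of
    the common elements there remain the local maxima, respectively the local minima, of the
    boundary. *)
Definition row_ends lam := [seq row_end lam i | i <- iota 0 (size lam)].

Definition row_ends1 lam := - (size lam)%:Z :: [seq k + 1 | k <- row_ends lam].

Lemma mem_row_ends lam k : is_partition lam -> k \in row_ends lam -> - (size lam)%:Z < k.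
Proof. by move=> pl; case/mapP => i; rewrite mem_iota /= => iN ->; exact: row_end_gt. Qed.

Lemma mem_row_ends1 lam k : (k \in row_ends1 lam) =
  (k == - (size lam)%:Z) || (k - 1 \in row_ends lam).
Proof.
rewrite inE; congr (_ || _); apply/mapP/idP => [[j jr ->]|kr].
  by rewrite addrK.
by exists (k - 1) => //; rewrite subrK.
Qed.

Lemma row_ends_uniq lam : sorted geq lam -> uniq (row_ends lam).
Proof.
move=> sl; rewrite map_inj_in_uniq ?iota_uniq // => i j _ _ E.
by have [ij|ij|//] := ltngtP i j; have := row_end_lt sl ij; rewrite E ltxx.
Qed.

Lemma row_ends1_uniq lam : is_partition lam -> uniq (row_ends1 lam).
Proof.
move=> pl; rewrite /row_ends1 /= map_inj_uniq ?row_ends_uniq ?andbT; last 2 first.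
- by case/andP: pl.
- exact: addIr.
by apply/mapP => -[k /(mem_row_ends pl)]; lia.
Qed.

Lemma minima_row_ends lam k : is_partition lam ->
  (k \in row_ends1 lam) && (k \notin row_ends lam) =
  descending lam (k - 1) && ~~ descending lam k.
Proof.
move=> pl; rewrite mem_row_ends1 /descending -!/(row_ends lam).
have H1 := @mem_row_ends lam k pl; have H2 := @mem_row_ends lam (k - 1) pl.
by case E1: (k \in _) => /=; case E2: (k - 1 \in _) => /=;
  try have h1 := H1 E1; try have h2 := H2 E2; lia.
Qed.

Lemma maxima_row_ends lam k : is_partition lam ->
  (k \in row_ends lam) && (k \notin row_ends1 lam) =
  ~~ descending lam (k - 1) && descending lam k.
Proof.
move=> pl; rewrite mem_row_ends1 /descending -!/(row_ends lam).
have H1 := @mem_row_ends lam k pl; have H2 := @mem_row_ends lam (k - 1) pl.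
by case E1: (k \in _) => /=; case E2: (k - 1 \in _) => /=;
  try have h1 := H1 E1; try have h2 := H2 E2; lia.
Qed.

Section Coordinates.
Variables (lam : seq nat) (m : nat) (a b : nat -> int).
Hypotheses (pl : is_partition lam) (ic : interlacing_coordinates R lam m a b).

Lemma interlacing_ab i j : (i < j <= m)%N -> a i < b j.
Proof.
case: ic => lt _ _; elim: j => [//|j IH] /andP[ij jm].
have [h1 h2] := lt j.+1 jm; move: ij; rewrite ltnS leq_eqVlt => /orP[/eqP->//|ij].
have [|h3 h4] := lt j; first lia.
have := IH; rewrite ij => /(_ (ltnW jm)) /= h5; move: h1 => /= h1.
by apply: lt_trans h1; apply: lt_trans h4.
Qed.

Lemma interlacing_ba i j : (0 < i <= j)%N -> (j <= m)%N -> b i < a j.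
Proof.
move=> /andP[i0 ij] jm; case: ic => lt _ _.
move: ij; rewrite leq_eqVlt => /orP[/eqP E|ij].
  by subst; have [] := lt j; rewrite ?i0.
have [|h1 h2] := lt j; first lia.
have [|h3 h4] := lt i; first lia.
by apply: lt_trans h4 _; apply: lt_trans (interlacing_ab _) h2; lia.
Qed.

Lemma interlacing_aa i j : (i < j <= m)%N -> a i < a j.
Proof. by move=> h; apply: lt_trans (interlacing_ab h) (interlacing_ba _ _); lia. Qed.

Lemma interlacing_bb i j : (0 < i < j)%N -> (j <= m)%N -> b i < b j.
Proof.
by move=> h jm; apply: lt_trans (@interlacing_ba i j.-1 _ _) (interlacing_ab _); lia.
Qed.

Lemma perm_minima :
  perm_eq [seq k <- row_ends1 lam | k \notin row_ends lam] [seq a i | i <- index_iota 0 m.+1].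
Proof.
apply: uniq_perm; first by rewrite filter_uniq // row_ends1_uniq.
  rewrite map_inj_in_uniq ?iota_uniq // => i j; rewrite !mem_index_iota => iN jN E.
  by have [ij|ij|//] := ltngtP i j; have := @interlacing_aa _ _ _;
     [move=> /(_ i j)|move=> /(_ j i)]; rewrite ij E ltxx; lia.
move=> k; rewrite mem_filter andbC minima_row_ends //.
case: ic => _ mn _; apply/idP/mapP.
  move=> /(local_minimum_int _ pl)/mn[i im /intr_inj->].
  by exists i => //; rewrite mem_index_iota.
case=> i; rewrite mem_index_iota => im ->.
by apply/(local_minimum_int _ pl)/mn; exists i.
Qed.

Lemma perm_maxima :
  perm_eq [seq k <- row_ends lam | k \notin row_ends1 lam] [seq b i.+1 | i <- index_iota 0 m].
Proof.
apply: uniq_perm; first by rewrite filter_uniq // row_ends_uniq //; case/andP: pl.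
  rewrite map_inj_in_uniq ?iota_uniq // => i j; rewrite !mem_index_iota => iN jN E.
  by have [ij|ij|//] := ltngtP i j; have := @interlacing_bb _ _ _;
     [move=> /(_ i.+1 j.+1)|move=> /(_ j.+1 i.+1)]; rewrite E ltxx; lia.
move=> k; rewrite mem_filter andbC maxima_row_ends //.
case: ic => _ _ mx; apply/idP/mapP.
  move=> /(local_maximum_int _ pl)/mx[i im /intr_inj->].
  by exists i.-1; rewrite ?mem_index_iota ?prednK //; lia.
case=> i; rewrite mem_index_iota => im ->.
by apply/(local_maximum_int _ pl)/mx; exists i.+1.
Qed.

Lemma interlacing_first : a 0%N = - (size lam)%:Z.
Proof.
have mem := perm_mem perm_minima.
have : - (size lam)%:Z \in [seq a i | i <- index_iota 0 m.+1].
  rewrite -mem mem_filter inE eqxx /= andbT; apply/negP => /(mem_row_ends pl).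
  by rewrite ltxx.
case/mapP => i; rewrite mem_index_iota => im E.
have : a 0%N \in [seq a i | i <- index_iota 0 m.+1].
  by apply/mapP; exists 0%N => //; rewrite mem_index_iota.
rewrite -mem mem_filter mem_row_ends1 => /andP[_ h].
have lb : - (size lam)%:Z <= a 0%N.
  case/orP: h => [/eqP->//|/(mem_row_ends pl)]; lia.
case: i im E => [_ ->//|i im E].
have := @interlacing_aa 0 i.+1 im; rewrite -E; lia.
Qed.

Lemma interlacing_last : lam != [::] -> a m = (nth 0%N lam 0)%:Z.
Proof.
move=> l0; have sl0 : (0 < size lam)%N by case: (lam) l0.
have sl : sorted geq lam by case/andP: pl.
have mem := perm_mem perm_minima.
have rub k : k \in row_ends lam -> k < (nth 0%N lam 0)%:Z.
  by case/mapP => i _ ->; have := nth_sorted sl (leq0n i); rewrite /row_end; lia.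
have : (nth 0%N lam 0)%:Z \in [seq a i | i <- index_iota 0 m.+1].
  rewrite -mem mem_filter mem_row_ends1; apply/andP; split.
    by apply/negP => /rub; rewrite ltxx.
  apply/orP; right; apply/mapP; exists 0%N; first by rewrite mem_iota.
  by rewrite /row_end.
case/mapP => i; rewrite mem_index_iota => im E.
have : a m \in [seq a i | i <- index_iota 0 m.+1].
  by apply/mapP; exists m => //; rewrite mem_index_iota ltnSn.
rewrite -mem mem_filter mem_row_ends1 => /andP[_ h].
have ub : a m <= (nth 0%N lam 0)%:Z.
  case/orP: h => [/eqP->|/rub]; lia.
move: im; rewrite /= ltnS leq_eqVlt => /orP[/eqP<-//|im].
by have := @interlacing_aa i m; rewrite im leqnn -E => /(_ isT); lia.
Qed.

Lemma perm_common :
  perm_eq [seq k <- row_ends1 lam | k \in row_ends lam]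
          [seq k <- row_ends lam | k \in row_ends1 lam].
Proof.
apply: uniq_perm; rewrite ?filter_uniq ?row_ends1_uniq ?row_ends_uniq //.
  by case/andP: pl.
by move=> k; rewrite !mem_filter andbC.
Qed.

Lemma kerov_interlacing (K : numFieldType) (z : K) : (forall k : int, z != k%:~R) ->
  kerov (boxes lam) z =
  ratf (a 0%N)%:~R (fun i => (a i.+1)%:~R) (fun i => (b i.+1)%:~R) m z.
Proof.
move=> zn; have z0 k : z - k%:~R != 0 by rewrite subr_eq0 zn.
rewrite kerov_boxes // /ratf !prodf_div subr0.
have -> : (z + (size lam)%:R) * ((\prod_(0 <= k < size lam)
    (z + (size lam)%:R - ((shifted lam k)%:R + 1))) /
    (\prod_(0 <= k < size lam) (z + (size lam)%:R - (shifted lam k)%:R))) =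
  (\prod_(k <- row_ends1 lam) (z - k%:~R)) / (\prod_(k <- row_ends lam) (z - k%:~R)).
  rewrite mulrA big_cons !big_map mulrNz opprK -pmulrn.
  have E i : (i < size lam)%N ->
      z + (size lam)%:R - (shifted lam i)%:R = z - (row_end lam i)%:~R.
    move=> iN; have F : (size lam)%:R = (size lam - i.+1)%:R + i.+1%:R :> K.
      by rewrite -natrD subnK.
    by rewrite /shifted /row_end natrD intrB -!pmulrn F; ring.
  rewrite /index_iota subn0; congr (_ * _ / _); rewrite big_seq [RHS]big_seq;
    apply: eq_bigr => i; rewrite mem_iota /= => /E h; last by [].
  by rewrite opprD addrA h intrD opprD addrA.
have split2 (s s' : seq int) : \prod_(k <- s) (z - k%:~R) =
    \prod_(k <- [seq k <- s | k \in s']) (z - k%:~R) *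
    \prod_(k <- [seq k <- s | k \notin s']) (z - k%:~R).
  by rewrite (bigID (fun k => k \in s')) /= !big_filter.
rewrite (split2 (row_ends1 lam) (row_ends lam)) (split2 (row_ends lam) (row_ends1 lam)).
rewrite (perm_big _ perm_minima) (perm_big _ perm_maxima) (perm_big _ perm_common).
rewrite -mulf_div divff ?mul1r; last first.
  by rewrite prodf_seq_neq0; apply/allP => k _; rewrite z0.
by rewrite !big_map big_nat_recl //= mulrA.
Qed.

(** The two lists have equal sums, since moving each of the [size lam] row ends by 1 compensates the
    extra element; the common part is then cancelled. *)
Lemma sum_interlacing : \sum_(0 <= i < m) (a i.+1 - b i.+1) = - a 0%N.
Proof.
have E : \sum_(k <- row_ends1 lam) k = \sum_(k <- row_ends lam) k.
  rewrite big_cons big_map big_split /= addrCA -[RHS]addr0; congr (_ + _).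
  by rewrite sumr_const_seq size_map size_iota natz addNr.
have split2 (s s' : seq int) : \sum_(k <- s) k =
    \sum_(k <- [seq k <- s | k \in s']) k + \sum_(k <- [seq k <- s | k \notin s']) k.
  by rewrite (bigID (fun k => k \in s')) /= !big_filter.
move: E; rewrite (split2 (row_ends1 lam) (row_ends lam)) (split2 (row_ends lam) (row_ends1 lam)).
rewrite (perm_big _ perm_minima) (perm_big _ perm_maxima) (perm_big _ perm_common).
move=> /addrI; rewrite !big_map big_nat_recl //= => E.
by rewrite sumrB -E; ring.
Qed.

End Coordinates.
End Interlacing.

Lemma big_nat_block (T : Type) (idx : T) (op : Monoid.law idx) (F : nat -> T) n m :
  \big[op/idx]_(0 <= j < n * m) F j =
  \big[op/idx]_(0 <= q < m) \big[op/idx]_(0 <= r < n) F (n * q + r)%N.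
Proof.
elim: m => [|m IH]; first by rewrite muln0 !big_geq.
rewrite big_nat_recr //= -IH mulnS addnC (@big_cat_nat _ _ _ (n * m)) ?leq_addr //=.
congr (op _ _); rewrite -[X in \big[_/_]_(X <= _ < _) _]add0n big_addn addKn.
by apply: eq_bigr => r _; rewrite addnC.
Qed.

(** * Dilated diagrams *)

Section Dilation.
Variable R : realType.
Implicit Types (lam : seq nat).

Definition column lam (k : int) := count (fun c : int * int => c.1 == k) (boxes lam).

Lemma sum_interval n p q : (q <= n)%N ->
  (\sum_(0 <= i < n) (p <= i < q : nat) = q - p)%N.
Proof.
elim: n q => [|n IH] q qn; first by rewrite big_geq //; lia.
rewrite big_nat_recr //=; have [qn'|qn'] := leqP q n.
  by rewrite IH //; lia.
have -> : q = n.+1 by lia.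
rewrite (eq_big_nat _ _ (F2 := fun i => (p <= i < n : nat))); last by move=> i; lia.
by rewrite IH //; lia.
Qed.

Lemma column_rows lam k : column lam k =
  (\sum_(0 <= i < size lam) ((0 < k + i.+1%:Z <= (nth 0%N lam i)%:Z)%R : nat))%N.
Proof.
rewrite /column -sum1_count big_mkcond big_allpairs_dep /=.
rewrite -[1%N]addn0 iotaDl big_map /index_iota subn0; apply: eq_bigr => i _.
rewrite /= add0n -big_mkcond /= add1n.
rewrite (eq_bigl (fun j : nat => (j : int) == k + i.+1%:Z)); last by move=> j; lia.
case: (k + i.+1%:Z) => p /=; last by rewrite big_pred0 // => j; lia.
rewrite (eq_bigl (pred1 p)) // sum1_count count_uniq_mem ?iota_uniq // mem_iota.
by congr nat_of_bool; lia.
Qed.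

(** Links a box count, which is the height at time 1, to the boundary; this identifies H(x, 1). *)
Lemma upper_boundary_int lam k : is_partition lam ->
  upper_boundary lam k%:~R = `|k|%:~R + 2 * (column lam k)%:R :> R.
Proof.
move=> pl; have sl : sorted geq lam by case/andP: pl.
have [i [iN lo hi]] := split_rows (k%:~R : R) sl.
have lo' j : (j < i)%N -> k <= row_end lam j by move=> /lo; rewrite ler_int.
have hi' j : (i <= j < size lam)%N -> row_end lam j < k by move=> /hi; rewrite ltr_int.
rewrite (upper_boundary_split pl iN lo hi).
(* Row j meets the diagonal k exactly when j >= -k and its end is at least k, that is, j < i. *)
have colE : column lam k = (\sum_(0 <= j < size lam) (`|Num.max 0%R (- k)%R| <= j < i : nat))%N.
  rewrite column_rows; apply: eq_big_nat => j /andP[_ jN].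
  have [ji|ij] := ltnP j i.
    by have := lo' _ ji; rewrite /row_end; lia.
  by have := hi' j; rewrite ij jN /row_end => /(_ isT); lia.
rewrite colE sum_interval //.
have nx : (nth 0%N lam i)%:Z <= i%:Z + k \/ (nth 0%N lam i = 0%N /\ i = size lam).
  have [iN'|iN'] := ltnP i (size lam).
    by left; have := hi' i; rewrite leqnn iN' /row_end => /(_ isT); lia.
  by right; rewrite nth_default //; lia.
have ki : - k <= i%:Z \/ i = size lam.
  have [iN'|iN'] := ltnP i (size lam); last by right; lia.
  left; have := hi' i; rewrite leqnn iN' /row_end => /(_ isT).
  have := partition_nth_gt0 pl iN'; lia.
have -> : (2 * i%:R + k%:~R : R) = (2 * i%:Z + k)%:~R by rewrite intrD intrM -pmulrn.
have -> : (2 * (nth 0%N lam i)%:R - k%:~R : R) = (2 * (nth 0%N lam i)%:Z - k)%:~R.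
  by rewrite intrB intrM -pmulrn.
have -> : (2 * (i - `|Num.max 0%R (- k)%R|)%:R : R) = (2 * (i - `|Num.max 0%R (- k)%R|)%N%:Z)%:~R.
  by rewrite intrM -pmulrn.
rewrite -intrD.
have [h|h] := lerP (2 * (nth 0%N lam i)%:Z - k) (2 * i%:Z + k).
  rewrite max_l ?ler_int //; congr (_%:~R); case: nx => nx; case: ki => ki; lia.
rewrite max_r ?ler_int ?(ltW h) //; congr (_%:~R); case: nx => nx; lia.
Qed.

Lemma upper_boundary_ge_row lam x q : is_partition lam -> (q < size lam)%N ->
  Num.min (2 * (nth 0%N lam q)%:R - x) (2 * q.+1%:R + x) <= upper_boundary lam x :> R.
Proof.
move=> pl qN; apply: tent_le_upper_boundary.
by rewrite box_in leqnn andbT; exact: partition_nth_gt0.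
Qed.

Lemma upper_boundary_lipschitz lam (x y : R) :
  `|upper_boundary lam x - upper_boundary lam y| <= `|x - y|.
Proof.
suff H (u v : R) : upper_boundary lam u <= upper_boundary lam v + `|u - v|.
  rewrite ler_norml; have := H x y; have := H y x; rewrite [`|y - x|]distrC; lra.
rewrite {1}/upper_boundary big_seq; apply: bigmax_le => [|c].
  have := norm_le_upper_boundary lam v; have := ler_normD v (u - v).
  by rewrite addrC subrK; lra.
move=> /boxes_mem[i [j [jH ->]]].
have cB : box i j \in boxes lam by rewrite box_in.
have := tent_le_upper_boundary v cB; rewrite -tent_box.
set w := (box i j).1%:~R.
have := ler_normD (u - v) (v - u + (u - w)); have := ler_normD (v - u) (u - w).
rewrite addrA subrK [`|v - u|]distrC; lra.
Qed.

Lemma nth_dilate n lam i : (0 < n)%N ->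
  nth 0%N (dilate n lam) i = (n * nth 0%N lam (i %/ n))%N.
Proof.
move=> n0; elim: lam i => [|p lam IH] i; first by rewrite /dilate /= !nth_nil muln0.
rewrite /dilate /= nth_cat size_nseq; case: ltnP => h.
  by rewrite nth_nseq h divn_small.
rewrite -/(dilate n lam) IH; congr (_ * _)%N.
by rewrite -{2}(subnK h) divnDr ?dvdnn // divnn n0 addn1.
Qed.

Lemma size_dilate n lam : size (dilate n lam) = (n * size lam)%N.
Proof.
by elim: lam => [|p lam IH]; rewrite /dilate /= ?muln0 // size_cat size_nseq -/(dilate n lam) IH mulnS.
Qed.

Lemma dilate_partition n lam : (0 < n)%N -> is_partition lam -> is_partition (dilate n lam).
Proof.
move=> n0 pl; have sl : sorted geq lam by case/andP: pl.
apply/andP; split.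
  apply/(sortedP 0%N) => i _; rewrite /geq /= !nth_dilate // leq_pmul2l //.
  by apply: nth_sorted => //; exact: leq_div2r.
apply/(all_nthP 0%N) => i; rewrite size_dilate => iN; rewrite nth_dilate //= muln_gt0 n0 /=.
by apply: partition_nth_gt0; rewrite // ltn_divLR // mulnC.
Qed.

Lemma sumn_dilate n lam : sumn (dilate n lam) = (n ^ 2 * sumn lam)%N.
Proof.
elim: lam => [|p lam IH]; rewrite /dilate /= ?muln0 // sumn_cat sumn_nseq -/(dilate n lam) IH.
by rewrite mulnDr expnS expn1 mulnC mulnA.
Qed.

(** A tent of the dilated diagram lies under the scaled tent of the last box of the original row.
    Conversely the scaled tent of a box is exactly the tent of the outermost box of its n x n
    block. *)
Lemma upper_boundary_dilate n lam (x : R) : (0 < n)%N -> is_partition lam ->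
  upper_boundary (dilate n lam) (n%:R * x) = n%:R * upper_boundary lam x.
Proof.
move=> n0 pl; have n0' : 0 < n%:R :> R by rewrite ltr0n.
apply/eqP; rewrite eq_le; apply/andP; split.
  rewrite {1}/upper_boundary big_seq; apply: bigmax_le => [|c].
    by rewrite normrM (gtr0_norm n0') ler_pM2l // norm_le_upper_boundary.
  move=> /boxes_mem[i [j [jH ->]]]; rewrite tent_box.
  move: jH; rewrite nth_dilate // => /andP[j0 jH].
  have iq : (i.+1 <= n * (i %/ n).+1)%N.
    by rewrite mulnC mulSn {1}(divn_eq i n); have := ltn_pmod i n0; lia.
  have qN : (i %/ n < size lam)%N.
    rewrite ltnNge; apply/negP => /(nth_default 0%N) E; move: jH; rewrite E; lia.
  have := upper_boundary_ge_row x pl qN; rewrite -(ler_pM2l n0').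
  apply: le_trans; rewrite minr_pMr ?(ltW n0') // le_min !ge_min; apply/andP; split.
    apply/orP; left; by rewrite mulrBr lerD2r -!natrM ler_nat mulnCA leq_pmul2l.
  apply/orP; right; by rewrite mulrDr lerD2r -!natrM ler_nat mulnCA leq_pmul2l.
rewrite {1}/upper_boundary big_seq.
elim/big_rec: _ => [|c y /boxes_mem[i [j [jH ->]]] IH].
  by have := norm_le_upper_boundary (dilate n lam) (n%:R * x); rewrite normrM (gtr0_norm n0').
rewrite maxr_pMr ?(ltW n0') // ge_max IH andbT tent_box.
have cB : box (n * i + n.-1) (n * j) \in boxes (dilate n lam).
  rewrite box_in nth_dilate // leq_pmul2l // muln_gt0 n0 /=.
  rewrite mulnC divnMDl // divn_small ?addn0 //; lia.
apply: le_trans (tent_le_upper_boundary _ cB).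
rewrite minr_pMr ?(ltW n0') // mulrBr mulrDr -!natrM.
rewrite [(n * (2 * j))%N]mulnCA [(n * (2 * i.+1))%N]mulnCA.
by have -> : (n * i.+1 = (n * i + n.-1).+1)%N by rewrite mulnS; lia.
Qed.

(** The n rows cut out of one original row give a telescoping product equal to a single factor at
    z/n. Hence the rescaled W of the full diagram is the same for all n. *)
Lemma kerov_dilate (K : numFieldType) n lam (z : K) : (0 < n)%N ->
  (forall m : int, z != m%:~R) -> (forall m : int, z / n%:R != m%:~R) ->
  kerov (boxes (dilate n lam)) z = n%:R * kerov (boxes lam) (z / n%:R).
Proof.
move=> n0 zn zn'; have nz : n%:R != 0 :> K by rewrite pnatr_eq0 -lt0n.
rewrite !kerov_boxes // /ratf !subr0 size_dilate big_nat_block.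
have -> : z + (n * size lam)%N%:R = n%:R * (z / n%:R + (size lam)%:R).
  by rewrite natrM; field.
rewrite -!mulrA; congr (_ * (_ * _)); apply: eq_big_nat => q /andP[_ qN].
pose f r : K := z - n%:R * (nth 0%N lam q)%:R + n%:R * q%:R + r%:R.
have f0 r : f r != 0.
  have -> : f r = z - (n%:Z * (nth 0%N lam q)%:Z - n%:Z * q%:Z - r%:Z)%:~R.
    by rewrite !intrB !intrM -!pmulrn /f; ring.
  by rewrite subr_eq0.
transitivity (\prod_(0 <= r < n) (f r / f r.+1)).
  apply: eq_big_nat => r /andP[_ rN].
  have iN : (n * q + r < n * size lam)%N.
    by have : (n * q.+1 <= n * size lam)%N; [rewrite leq_mul2l qN orbT|rewrite mulnS; lia].
  have E : n%:R * (z / n%:R + (size lam)%:R) - (shifted (dilate n lam) (n * q + r))%:R = f r.+1.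
    have dq : ((n * q + r) %/ n = q)%N by rewrite mulnC divnMDl // divn_small // addn0.
    rewrite /shifted size_dilate nth_dilate // dq.
    have F : (n * size lam)%:R = (n * size lam - (n * q + r).+1)%:R + (n * q + r).+1%:R :> K.
      by rewrite -natrD subnK.
    rewrite mulrDr [n%:R * (z / _)]mulrC divfK // -natrM F natrD natrM /f.
    by rewrite -[r.+1]addn1 -[(_ + r).+1]addn1 !natrD !natrM; ring.
  rewrite -E; congr (_ / _); rewrite opprD addrA E /f -natr1; ring.
have -> : \prod_(0 <= r < n) (f r / f r.+1) = f 0%N / f n.
  elim: (n) => [|k IH]; first by rewrite big_nil divff.
  rewrite big_nat_recr //= IH; field; by rewrite !f0.
have F : (size lam)%:R = (size lam - q.+1)%:R + q.+1%:R :> K.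
  by rewrite -natrD subnK.
have g1 : z / n%:R + (size lam)%:R - (shifted lam q)%:R = f n / n%:R.
  rewrite /shifted natrD F /f -natr1; field; exact: nz.
have g0 : z / n%:R + (size lam)%:R - ((shifted lam q)%:R + 1) = f 0%N / n%:R.
  rewrite opprD addrA g1 /f; field; exact: nz.
by rewrite g0 g1; field; rewrite nz f0.
Qed.

End Dilation.

(** * Uniform random tableaux *)

Section Cube.
Variable R : realType.
Local Notation U := (uniform_prob (@ltr01 R)).
Local Notation M := (measurableTypeR R).

Lemma uniform01E (A : set M) : measurable A ->
  U A = lebesgue_measure (A `&` `[0%R, 1%R]%classic).
Proof.
move=> mA; rewrite /uniform_prob integral_uniform_pdf.
rewrite (eq_integral (fun=> 1%:E)); last first.
  by move=> x; rewrite inE /= => -[_]; rewrite in_itv /uniform_pdf /= => ->; rewrite subr0 invr1.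
by rewrite integral_cst ?mul1e //; apply: measurableI.
Qed.

Lemma uniform01_itv (c d : R) : 0 <= c <= d -> d <= 1 -> U `[c, d]%classic = (d - c)%:E.
Proof.
move=> /andP[c0 cd] d1; rewrite uniform01E // (_ : _ `&` _ = `[c, d]%classic).
  rewrite lebesgue_measure_itv /= lte_fin; case: ltP => // dc.
  by have -> : c = d; [apply/eqP; rewrite eq_le cd dc|rewrite subrr].
apply/seteqP; split => x /=; rewrite !in_itv /=; first by case.
by move=> /andP[cx xd]; split; apply/andP; split; lra.
Qed.

Lemma uniform01_le (t : R) : 0 <= t <= 1 -> U `]-oo, t]%classic = t%:E.
Proof.
move=> t01; rewrite uniform01E // (_ : _ `&` _ = `[0, t]%classic).
  rewrite lebesgue_measure_itv /= lte_fin; case: ltP => [_|t0]; first by rewrite oppr0 adde0.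
  by have -> : t = 0; [lra|].
apply/seteqP; split => x /=; rewrite !in_itv /=; first by case; lra.
by move=> /andP[cx xd]; split; lra.
Qed.

Lemma uniform01_setC : U (~` `[0%R, 1%R]%classic) = 0%E.
Proof.
rewrite uniform01E; last exact: measurableC.
by rewrite setIC setICr measure0.
Qed.

Definition rect n (A : 'I_n -> set M) : set (n.-tuple M) :=
  [set T | forall i, A i (tnth T i)].

Lemma measurable_rect n (A : 'I_n -> set M) : (forall i, measurable (A i)) ->
  measurable (rect A).
Proof.
move=> mA; rewrite (_ : rect A = \bigcap_(i in [set: 'I_n]) ((@tnth n M)^~ i @^-1` A i)).
  apply: fin_bigcap_measurable => [|i _]; first exact: finite_finset.
  by rewrite -[X in measurable X]setTI; exact: measurable_tnth.
by apply/seteqP; split => T /= TA i; [move=> _; exact: TA|exact: TA].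
Qed.

Lemma cube_rect n (A : 'I_n -> set M) : (forall i, measurable (A i)) ->
  fine (lebesgue_cube R n (rect A)) = \prod_(i < n) fine (U (A i)).
Proof.
elim: n A => [|n IH] A mA.
  rewrite big_ord0 (_ : lebesgue_cube R 0 (rect A) = \d_([tuple] : 0.-tuple M) (rect A)) //.
  by rewrite diracE mem_set // => -[].
rewrite big_ord_recl /= /distribution /pushforward /=.
have -> : @tuple_cons R n @^-1` rect A = A ord0 `*` rect (fun i => A (lift ord0 i)).
  apply/seteqP; split => -[x T] /=.
    move=> H; split => /=; first by have := H ord0; rewrite tnth0.
    by move=> i; have := H (lift ord0 i); rewrite tnthS.
  move=> [H1 H2] i; case: (unliftP ord0 i) => [j ->|->].
    by rewrite tnthS; exact: H2.
  by rewrite tnth0.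
rewrite product_measure1E //; last exact: measurable_rect.
by rewrite fineM ?IH //; apply: fin_num_measure => //; exact: measurable_rect.
Qed.

Definition permute n (s : 'S_n) (T : n.-tuple M) : n.-tuple M := [tuple tnth T (s i) | i < n].

Lemma measurable_permute n (s : 'S_n) : measurable_fun [set: n.-tuple M] (permute s).
Proof.
apply/measurable_fun_tnthP => i.
rewrite (_ : _ \o _ = (@tnth n M)^~ (s i)); first exact: measurable_tnth.
by apply/funext => T /=; rewrite tnth_mktuple.
Qed.

HB.instance Definition _ n (s : 'S_n) :=
  isMeasurableFun.Build _ _ _ _ (permute s) (measurable_permute s).

(** Probabilities that agree on rectangles, a generating family stable under intersection, are
    equal; on a rectangle a permutation only reorders the factors. *)
Lemma cube_permute n (s : 'S_n) (A : set (n.-tuple M)) : measurable A ->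
  lebesgue_cube R n (permute s @^-1` A) = lebesgue_cube R n A.
Proof.
move=> mA.
pose G := [set rect B | B in [set B : 'I_n -> set M | forall i, measurable (B i)]].
have -> : lebesgue_cube R n (permute s @^-1` A) =
  distribution (lebesgue_cube R n) (permute s) A by [].
apply: (measure_unique G (fun=> setT)) => //.
- apply/seteqP; split.
    apply: smallest_sub; first exact: smallest_sigma_algebra.
    elim/big_ind: _ => [|X Y XG YG|i _]; first exact: sub0set.
      by rewrite subUset; split.
    move=> _ [C mC <-]; apply: sub_sigma_algebra.
    exists (fun j => if j == i then C else setT).
      by move=> j /=; case: ifP.
    rewrite setTI; apply/seteqP; split => T /=.
      by move=> /(_ i); rewrite eqxx.
    by move=> H j; case: eqP => [->|].
  apply: smallest_sub; first exact: sigma_algebra_measurable.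
  by move=> _ [B mB <-]; exact: measurable_rect.
- move=> _ _ [B mB <-] [C mC <-]; exists (fun i => B i `&` C i).
    by move=> i; apply: measurableI; [exact: mB|exact: mC].
  apply/seteqP; split => T /=; first by move=> H; split => i; have [] := H i.
  by move=> [H1 H2] i; split; [exact: H1|exact: H2].
- move=> _; exists (fun=> setT) => //.
  by apply/seteqP; split.
- by rewrite bigcup_const //; exists 0%N.
- move=> _ [B mB <-]; rewrite /= /distribution /pushforward.
  have E : permute s @^-1` rect B = rect (fun i => B ((s^-1)%g i)).
    apply/seteqP; split => T /= H i.
      by have := H ((s^-1)%g i); rewrite tnth_mktuple permKV.
    by rewrite tnth_mktuple; have := H (s i); rewrite permK.
  have mB' : forall i, measurable (B ((s^-1)%g i)) by move=> i; exact: mB.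
  have m1 : measurable (rect B) by exact: measurable_rect.
  have m2 : measurable (permute s @^-1` rect B) by rewrite E; exact: measurable_rect.
  rewrite -[LHS]fineK ?fin_num_measure // -[RHS]fineK ?fin_num_measure //; congr EFin.
  rewrite E !cube_rect // (reindex_inj (@perm_inj _ s)) /=.
  by apply: eq_bigr => i _; rewrite permK.
- by move=> _; rewrite ltey_eq fin_num_measure.
Qed.

End Cube.

(** * Simplices of fillings with a prescribed order of entries *)

Section Cells.
Variables (R : realType) (lam : seq nat).
Local Notation M := (measurableTypeR R).
Local Notation L := (boxes lam).
Local Notation filling := (filling R lam).
Local Notation mu := (lebesgue_cube R (size L)).
Implicit Types (T : filling) (s : seq (int * int)) (A B : set filling).

Definition volume A : R := fine (mu A).

Lemma volume_ge0 A : 0 <= volume A.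
Proof. by rewrite fine_ge0. Qed.

Lemma volumeE A : measurable A -> mu A = (volume A)%:E.
Proof. by move=> mA; rewrite fineK // fin_num_measure. Qed.

Lemma volume_le A B : measurable A -> measurable B -> A `<=` B -> volume A <= volume B.
Proof.
move=> mA mB AB; rewrite -lee_fin -!volumeE //.
by apply: le_measure; rewrite ?inE.
Qed.

Lemma volume_bigcup (I : choiceType) (r : seq I) (F : I -> set filling) :
  uniq r -> (forall i, i \in r -> measurable (F i)) ->
  (forall i j T, i \in r -> j \in r -> F i T -> F j T -> i = j) ->
  volume (\bigcup_(i in [set` r]) F i) = \sum_(i <- r) volume (F i).
Proof.
move=> ur mF dF; rewrite /volume measure_fin_bigcup //.
- rewrite -fsbig_seq //.
  transitivity (fine (\sum_(i <- r) (volume (F i))%:E)); last by rewrite sumEFin.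
  by congr fine; rewrite big_seq [RHS]big_seq; apply: eq_bigr => i ir; exact: volumeE (mF _ ir).
- by apply/trivIsetP => i j ir jr ij; apply/seteqP; split=> [T [Fi Fj]|//];
    move/eqP: ij; apply; exact: dF Fi Fj.
Qed.

Lemma entry_tnth T (i : 'I_(size L)) c0 : entry T (nth c0 L i) = tnth T i.
Proof. by rewrite /entry index_uniq ?boxes_uniq // (tnth_nth 0). Qed.

Lemma index_box c : c \in L -> (index c L < size L)%N.
Proof. by rewrite index_mem. Qed.

Lemma entry_in T c (cL : c \in L) :
  entry T c = tnth T (Ordinal (index_box cL)).
Proof. by rewrite (tnth_nth 0). Qed.

(** One simplex per listing of the boxes. All have the same volume and together they cover the cube
    up to ties; the tableaux are the points in the simplices of linear extensions. This turns the
    continuous law into the uniform one on linear extensions. *)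
Definition cell s : set filling :=
  [set T | (forall i, 0 <= tnth T i <= 1) /\ sorted <%R [seq entry T c | c <- s]].

Definition below c (t : R) : set filling := [set T | entry T c <= t].

Lemma measurable_entry c : c \in L -> measurable_fun [set: filling] (fun T => entry T c : M).
Proof.
move=> cL; rewrite (_ : (fun T => _) = (fun T : filling => tnth T (Ordinal (index_box cL)))).
  exact: measurable_tnth.
by apply/funext => T; rewrite (entry_in _ cL).
Qed.

Lemma measurable_below c t : c \in L -> measurable (below c t).
Proof.
move=> cL; have /(_ measurableT [set true]) := measurable_fun_ler (measurable_entry cL) (@measurable_cst _ _ _ _ setT t).
by rewrite setTI; apply.
Qed.

Lemma measurable_entry_lt c c' : c \in L -> c' \in L ->
  measurable [set T : filling | entry T c < entry T c'].
Proof.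
move=> cL cL'; have /(_ measurableT [set true]) := measurable_fun_ltr (measurable_entry cL) (measurable_entry cL').
by rewrite setTI; apply.
Qed.

Lemma measurable_cell s : {subset s <= L} -> measurable (cell s).
Proof.
move=> sL.
have -> : cell s = rect (fun=> `[0%R, 1%R]%classic) `&`
    \bigcap_(i in `I_(size s).-1)
      [set T : filling | entry T (nth (0, 0) s i) < entry T (nth (0, 0) s i.+1)].
  apply/seteqP; split => T /=.
    move=> [T01 sT]; split=> [i|i /=]; first by rewrite /= in_itv /= T01.
    move=> iN; have i1 : (i < size s)%N by lia.
    have i2 : (i.+1 < size s)%N by lia.
    by have := (sortedP 0 sT) i; rewrite size_map !(nth_map (0, 0)) //; apply.
  move=> [T01 sT]; split=> [i|]; first by have := T01 i; rewrite /= in_itv.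
  apply/(sortedP 0) => i; rewrite size_map => iN.
  have i1 : (i < size s)%N by lia.
  by rewrite !(nth_map (0, 0)) //; apply: sT => /=; lia.
apply: measurableI; first by apply: measurable_rect => i; exact: measurable_itv.
apply: fin_bigcap_measurable; first exact: finite_II.
suff H (k : nat) : (k < (size s).-1)%N ->
    measurable [set T : filling | entry T (nth (0, 0) s k) < entry T (nth (0, 0) s k.+1)].
  exact: H.
move=> kN; apply: measurable_entry_lt; apply: sL; apply: mem_nth.
  exact: leq_trans kN (leq_pred _).
by rewrite -ltn_predRL.
Qed.

Lemma cell_inj s s' T : perm_eq s L -> perm_eq s' L -> cell s T -> cell s' T -> s = s'.
Proof.
move=> sL sL' [_ h] [_ h'].
have E : [seq entry T c | c <- s] = [seq entry T c | c <- s'].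
  apply: (irr_sorted_eq lt_trans ltxx h h').
  by apply: perm_mem; apply: perm_map; apply: perm_trans sL _; rewrite perm_sym.
have us : uniq [seq entry T c | c <- s].
  exact: (sorted_uniq lt_trans ltxx h).
have ss : size s = size s' by rewrite (perm_size sL) (perm_size sL').
apply: (@eq_from_nth _ (0, 0)) => // i iN.
have c's : nth (0, 0) s' i \in s.
  by rewrite (perm_mem sL) -(perm_mem sL') mem_nth // -ss.
rewrite -(nth_index (0, 0) c's); congr nth; apply/eqP.
rewrite -(nth_uniq 0 _ _ us) ?size_map ?index_mem // !(nth_map (0, 0)) ?index_mem //.
rewrite nth_index // -(nth_map (0, 0) 0) // E (nth_map (0, 0)) // -ss //.
Qed.

End Cells.

Section CellVolumes.
Variables (R : realType) (lam : seq nat).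
Local Notation M := (measurableTypeR R).
Local Notation L := (boxes lam).
Local Notation filling := (filling R lam).
Local Notation vol := (@volume R lam).
Local Notation cel := (@cell R lam).
Local Notation bel := (@below R lam).
Local Notation mu := (lebesgue_cube R (size L)).
Implicit Types (T : filling) (s : seq (int * int)) (A B : set filling).

Lemma listing_perm s : perm_eq s L -> exists p : 'S_(size L), forall T i,
  tnth (permute p T) i = entry T (nth (0, 0) s i).
Proof.
move=> sL; have sz := perm_size sL.
have us : uniq s by rewrite (perm_uniq sL) boxes_uniq.
have inL (i : 'I_(size L)) : nth (0, 0) s i \in L.
  by rewrite -(perm_mem sL) mem_nth // sz.
have finj : injective (fun i => Ordinal (index_box (inL i))).
  move=> i j /(congr1 val) /= E; apply/val_inj => /=; apply/eqP.
  rewrite -(nth_uniq (0, 0) _ _ us) ?sz //; apply/eqP.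
  by rewrite -(nth_index (0, 0) (inL i)) E nth_index.
exists (perm finj) => T i.
by rewrite tnth_mktuple permE (entry_in _ (inL i)).
Qed.

Lemma preimage_cell s (p : 'S_(size L)) : perm_eq s L ->
  (forall T i, tnth (permute p T) i = entry T (nth (0, 0) s i)) ->
  permute (R := R) p @^-1` cel L = cel s.
Proof.
move=> sL pE; have sz := perm_size sL.
have mapE T : [seq entry (permute p T) c | c <- L] = [seq entry T c | c <- s].
  apply: (@eq_from_nth _ 0); rewrite !size_map // => i iN.
  rewrite !(nth_map (0, 0)) ?sz //.
  have := entry_tnth (permute p T) (Ordinal iN) (0, 0).
  by rewrite pE => <-.
apply/seteqP; split => T /= [h1 h2]; split; [move=> i| |move=> i|].
- by have := h1 ((p^-1)%g i); rewrite tnth_mktuple permKV.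
- by rewrite -mapE.
- by rewrite tnth_mktuple.
- by rewrite mapE.
Qed.

Lemma volume_cell s : perm_eq s L -> vol (cel s) = vol (cel L).
Proof.
move=> sL; have [p pE] := listing_perm sL.
rewrite -(preimage_cell sL pE) /volume cube_permute //.
exact: measurable_cell.
Qed.

(** The law of the i-th smallest entry inside a simplex does not depend on the listing. *)
Lemma volume_cell_below s i t : perm_eq s L -> (i < size L)%N ->
  vol (cel s `&` bel (nth (0, 0) s i) t) =
  vol (cel L `&` bel (nth (0, 0) L i) t).
Proof.
move=> sL iN; have [p pE] := listing_perm sL.
rewrite /volume -[in RHS](cube_permute p); last first.
  by apply: measurableI; [exact: measurable_cell|apply: measurable_below; exact: mem_nth].
rewrite preimage_setI (preimage_cell sL pE); congr (fine (mu (_ `&` _))).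
have E T : entry (permute p T) (nth (0, 0) L i) = entry T (nth (0, 0) s i).
  by have := entry_tnth (permute p T) (Ordinal iN) (0, 0); rewrite pE.
by apply/seteqP; split => T; rewrite /below /= E.
Qed.

Lemma volume_below c t : c \in L -> 0 <= t <= 1 -> vol (bel c t) = t.
Proof.
move=> cL t01; pose A (i : 'I_(size L)) : set M :=
  if i == Ordinal (index_box cL) then `]-oo, t]%classic else setT.
have mA i : measurable (A i) by rewrite /A; case: ifP => _; [exact: measurable_itv|].
have -> : bel c t = rect A.
  apply/seteqP; split => T; rewrite /below /= (entry_in _ cL).
    by move=> h i; rewrite /A; case: eqP => [->|//]; rewrite /= in_itv.
  by move=> /(_ (Ordinal (index_box cL))); rewrite /A eqxx /= in_itv.
rewrite /volume cube_rect // (bigD1 (Ordinal (index_box cL))) //= big1 => [|i /negbTE ni].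
  by rewrite /A eqxx uniform01_le // mulr1.
by rewrite /A ni probability_setT.
Qed.

Lemma negligible_outside (i : 'I_(size L)) :
  mu.-negligible [set T : filling | ~ (0 <= tnth T i <= 1)].
Proof.
pose A (j : 'I_(size L)) : set M := if j == i then ~` `[0%R, 1%R]%classic else setT.
have mA j : measurable (A j).
  by rewrite /A; case: ifP => _ //; apply: measurableC; exact: measurable_itv.
have mr : measurable (rect A) by exact: measurable_rect.
have v0 : fine (mu (rect A)) = 0.
  by rewrite cube_rect // (bigD1 i) //= /A eqxx uniform01_setC mul0r.
exists (rect A); split => //; first by rewrite -[LHS]fineK ?fin_num_measure // v0.
by move=> T h j; rewrite /A; case: eqP => [->|_ //] /=; rewrite in_itv; exact: h.
Qed.

(** For each K the diagonal is covered by K + 1 squares of side 1/(K + 1), of total area 1/(K +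
    1). *)
Lemma negligible_diagonal (i j : 'I_(size L)) : i != j ->
  mu.-negligible [set T : filling | tnth T i = tnth T j /\ 0 <= tnth T i <= 1].
Proof.
move=> ij.
pose A K (l : nat) (k : 'I_(size L)) : set M :=
  if (k == i) || (k == j) then `[l%:R / K.+1%:R, l.+1%:R / K.+1%:R]%classic else setT.
have mA K l k : measurable (A K l k) by rewrite /A; case: ifP => _ //; exact: measurable_itv.
pose E K := \big[setU/set0]_(l < K.+1) rect (A K l).
have mE K : measurable (E K) by apply: bigsetU_measurable => l _; exact: measurable_rect.
have vE K : vol (E K) <= K.+1%:R^-1.
  have K0 : 0 < K.+1%:R :> R by rewrite ltr0n.
  rewrite -lee_fin -volumeE //.
  apply: (@le_trans _ _ (\sum_(l < K.+1) mu (rect (A K l)))%E).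
    apply: (@content_subadditive _ _ _ mu (E K) (fun l => rect (A K l)) K.+1) => //.
    by move=> l _; exact: measurable_rect.
  have vr l : (l < K.+1)%N -> mu (rect (A K l)) = (K.+1%:R ^- 2)%:E.
    move=> lK; have mr : measurable (rect (A K l)) by exact: measurable_rect.
    rewrite volumeE //; congr EFin; rewrite /volume cube_rect // (bigD1 i) //= (bigD1 j) /=; last by rewrite eq_sym.
    rewrite big1 => [|k /andP[/negbTE ki /negbTE kj]]; last first.
      by rewrite /A ki kj probability_setT.
    have uE : uniform_prob (@ltr01 R) `[l%:R / K.+1%:R, l.+1%:R / K.+1%:R]%classic = (K.+1%:R^-1)%:E.
      rewrite uniform01_itv.
      - by congr EFin; rewrite -natr1; field; rewrite gt_eqF // natr1.
      - by rewrite divr_ge0 ?ler_pM2r ?invr_gt0 ?ler_nat //=.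
      - by rewrite ler_pdivrMr // mul1r ler_nat.
    by rewrite /A !eqxx orbT /= uE /= mulr1 expr2 invfM.
  have -> : (\sum_(l < K.+1) mu (rect (A K l)) = (\sum_(l < K.+1) K.+1%:R ^- 2)%:E :> \bar R)%E.
    by rewrite -sumEFin; apply: eq_bigr => l _; exact: vr.
  rewrite lee_fin sumr_const card_ord -[leLHS]mulr_natr expr2 invfM -mulrA mulVf ?mulr1 //.
exists (\bigcap_K E K); split.
- exact: bigcapT_measurable.
- have mI : measurable (\bigcap_K E K) by exact: bigcapT_measurable.
  rewrite volumeE //; congr EFin.
  apply/eqP; rewrite eq_le volume_ge0 andbT leNgt; apply/negP => v0.
  pose K := Num.truncn (vol (\bigcap_K E K))^-1.
  have : vol (\bigcap_K E K) <= K.+1%:R^-1.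
    by apply: le_trans (vE K); apply: volume_le => //; exact: bigcap_inf.
  rewrite leNgt => /negP; apply.
  by rewrite invf_plt ?posrE ?ltr0n // truncnS_gt.
move=> T /= [Tij /andP[T0 T1]] K _.
have K0 : 0 < K.+1%:R :> R by rewrite ltr0n.
(* The minimum puts the value 1 into the last square. *)
pose l := minn (Num.truncn (tnth T i * K.+1%:R)) K.
have lK : (l < K.+1)%N by rewrite ltnS geq_minr.
have x0 : 0 <= tnth T i * K.+1%:R by rewrite mulr_ge0 // ltW.
have hl : tnth T i \in `[l%:R / K.+1%:R, l.+1%:R / K.+1%:R].
  rewrite in_itv /= ler_pdivrMr // ler_pdivlMr //.
  have /andP[h1 h2] := truncn_itv x0.
  rewrite /l; case: (leqP (Num.truncn (tnth T i * K.+1%:R)) K) => h.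
    by rewrite h1 ltW.
  apply/andP; split; last by rewrite -[leRHS]mul1r ler_wpM2r // ltW.
  by apply: le_trans h1; rewrite ler_nat ltnW.
rewrite /E -(bigcup_mkord K.+1 (fun l => rect (A K l))); exists l => //= k.
by rewrite /A; case: ifP => // /orP[/eqP->|/eqP->] //=; rewrite -Tij.
Qed.

End CellVolumes.

(** * The uniform law on tableaux through linear extensions *)

Section Tableaux.
Variables (R : realType) (lam : seq nat).
Local Notation L := (boxes lam).
Local Notation filling := (filling R lam).
Local Notation vol := (@volume R lam).
Local Notation cel := (@cell R lam).
Local Notation bel := (@below R lam).
Local Notation mu := (lebesgue_cube R (size L)).
Local Notation tableau := (@poissonized_tableau R lam).
Implicit Types (T : filling) (s : seq (int * int)) (A B : set filling).

Definition sort_boxes T := sort (fun c c' => entry T c <= entry T c') L.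

Lemma sort_boxes_cell T : (forall i, 0 <= tnth T i <= 1) ->
  {in L &, injective (entry T)} -> perm_eq (sort_boxes T) L /\ cel (sort_boxes T) T.
Proof.
move=> T01 inj; have pe : perm_eq (sort_boxes T) L by rewrite perm_sort.
split=> //; split=> //; rewrite lt_sorted_uniq_le map_inj_in_uniq; last first.
  by move=> c c'; rewrite !(perm_mem pe); exact: inj.
rewrite (perm_uniq pe) boxes_uniq /= sorted_map; apply: sort_sorted.
by move=> c c'; exact: le_total.
Qed.

Lemma negligible_no_cell :
  mu.-negligible (~` \bigcup_(s in [set` permutations L]) cel s).
Proof.
pose F (i : nat) : set filling := [set T | exists h : (i < size L)%N, ~ (0 <= tnth T (Ordinal h) <= 1)].
pose G (i j : nat) : set filling := [set T | exists (h : (i < size L)%N) (h' : (j < size L)%N),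
  [/\ i != j, tnth T (Ordinal h) = tnth T (Ordinal h') & 0 <= tnth T (Ordinal h) <= 1]].
have Fn i : mu.-negligible (F i).
  case: (ltnP i (size L)) => h.
    apply: negligibleS (negligible_outside _ (Ordinal h)) => T [h'] /=.
    by rewrite (bool_irrelevance h' h).
  by apply: negligibleS (negligible_set0 _) => T [h']; move: h; rewrite leqNgt h'.
have Gn i j : mu.-negligible (G i j).
  case: (ltnP i (size L)) => h; last first.
    by apply: negligibleS (negligible_set0 _) => T [h']; move: h; rewrite leqNgt h'.
  case: (ltnP j (size L)) => h2; last first.
    by apply: negligibleS (negligible_set0 _) => T [h3 [h']]; move: h2; rewrite leqNgt h'.
  have [ij|ij] := eqVneq i j.
    by apply: negligibleS (negligible_set0 _) => T [h3 [h4 [/eqP/(_ ij)]]].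
  have ij' : Ordinal h != Ordinal h2 by [].
  apply: negligibleS (negligible_diagonal R ij') => T [h' [h2' []]] /=.
  by rewrite (bool_irrelevance h' h) (bool_irrelevance h2' h2).
apply: (@negligibleS _ _ _ _ ((\bigcup_i F i) `|` \bigcup_i \bigcup_j G i j)).
  move=> T Tn; apply: contrapT => /not_orP[TF TG]; apply: Tn.
  have T01 i : 0 <= tnth T i <= 1.
    apply: contrapT => h; apply: TF; exists (val i) => //; exists (ltn_ord i).
    by have -> : Ordinal (ltn_ord i) = i by exact/val_inj.
  have inj : {in L &, injective (entry T)}.
    move=> c c' cL cL'; rewrite (entry_in _ cL) (entry_in _ cL') => E.
    apply/eqP; apply: contrapT => /negP cc'; apply: TG.
    exists (index c L) => //; exists (index c' L) => //.
    exists (index_box cL), (index_box cL'); split => //.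
    apply: contra cc' => /eqP Ei; rewrite -(nth_index c cL) -(nth_index c cL') Ei //.
  have [pe ce] := sort_boxes_cell T01 inj.
  by exists (sort_boxes T) => //=; rewrite mem_permutations.
apply: negligibleU; first by apply: negligible_bigcup; exact: Fn.
by apply: negligible_bigcup => i; apply: negligible_bigcup; exact: Gn.
Qed.

Lemma permutations_perm s : s \in permutations L -> perm_eq s L.
Proof. by rewrite mem_permutations. Qed.

Lemma measurable_cell_perm s : perm_eq s L -> measurable (cel s).
Proof. by move=> sL; apply: measurable_cell => c; rewrite (perm_mem sL). Qed.

Lemma volumeDI A B : measurable A -> measurable B ->
  vol A = vol (A `\` B) + vol (A `&` B).
Proof.
move=> mA mB; rewrite /volume [in LHS](measureDI mu mA mB) fineD //; apply: fin_num_measure.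
  exact: measurableD.
exact: measurableI.
Qed.

Lemma volume_negligible A : measurable A -> mu.-negligible A -> vol A = 0.
Proof. by move=> mA /(negligibleP _ mA) A0; rewrite /volume A0. Qed.

Lemma volume_cells A : measurable A ->
  \sum_(s <- permutations L) vol (cel s `&` A) = vol A.
Proof.
move=> mA.
have mC : measurable (\bigcup_(s in [set` permutations L]) cel s).
  apply: fin_bigcup_measurable; first exact: finite_seq.
  by move=> s /permutations_perm; exact: measurable_cell_perm.
rewrite -(volume_bigcup (permutations_uniq _)); first last.
- move=> s s' T /permutations_perm sL /permutations_perm sL' [h _] [h' _].
  exact: cell_inj h h'.
- by move=> s /permutations_perm sL; apply: measurableI => //; exact: measurable_cell_perm.
rewrite -setI_bigcupl setIC [RHS](volumeDI mA mC) [X in _ = X + _]volume_negligible ?add0r //.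
  exact: measurableD.
by apply: negligibleS negligible_no_cell => T [].
Qed.

Lemma volume_cell_fact : (size L)`!%:R * vol (cel L) = 1.
Proof.
have := volume_cells measurableT.
rewrite {2}/volume probability_setT /= => H; rewrite -[RHS]H mulr_natl -(size_permutations (boxes_uniq lam)) -sumr_const_seq big_seq [RHS]big_seq.
apply: eq_bigr => s /permutations_perm sL; rewrite setIT.
by rewrite volume_cell.
Qed.

Lemma volume_cell_gt0 : 0 < vol (cel L).
Proof.
rewrite lt_def volume_ge0 andbT; apply/eqP => v0.
by have := volume_cell_fact; rewrite v0 mulr0 => /eqP; rewrite eq_sym oner_eq0.
Qed.

(** The mean number of entries at most t is N t. It is computed over all N! simplices at once, where
    every single box is below t on a set of volume t. *)
Lemma sum_cell_below t : 0 <= t <= 1 ->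
  \sum_(0 <= i < size L) vol (cel L `&` bel (nth (0, 0) L i) t) =
  (size L)%:R * t * vol (cel L).
Proof.
move=> t01; have F0 : (size L)`!%:R != 0 :> R by rewrite pnatr_eq0 -lt0n fact_gt0.
apply: (mulfI F0); rewrite [RHS]mulrCA volume_cell_fact mulr1.
transitivity (\sum_(s <- permutations L) \sum_(c <- L) vol (cel s `&` bel c t)).
  rewrite mulr_natl -(size_permutations (boxes_uniq lam)) -sumr_const_seq big_seq [RHS]big_seq.
  apply: eq_bigr => s /permutations_perm sL.
  rewrite -(perm_big _ sL) (big_nth (0, 0)) (perm_size sL).
  by apply: eq_big_nat => i /andP[_ iN]; rewrite -(volume_cell_below t sL).
rewrite exchange_big /= mulr_natl -sumr_const_seq big_seq [RHS]big_seq.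
apply: eq_bigr => c cL; rewrite volume_cells; last exact: measurable_below.
exact: volume_below.
Qed.

Lemma cell_sorted_index s T c c' : cel s T -> c \in s -> c' \in s ->
  (entry T c < entry T c') = (index c s < index c' s)%N.
Proof.
move=> [_ sT] cs cs'.
have i1 : index c s \in [pred n | (n < size [seq entry T c | c <- s])%N].
  by rewrite inE size_map index_mem.
have i2 : index c' s \in [pred n | (n < size [seq entry T c | c <- s])%N].
  by rewrite inE size_map index_mem.
have := lt_sorted_ltn_nth 0 sT i1 i2.
by rewrite !(nth_map c) ?index_mem // !nth_index.
Qed.

Lemma tableau_cells T : tableau T <-> exists2 s, s \in linear_extensions lam & cel s T.
Proof.
split.
  move=> [T01 inj Tr Tc].
  have T01' i : 0 <= tnth T i <= 1.
    by rewrite -(entry_tnth T i (0, 0)); apply: T01; exact: mem_nth.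
  have [pe ce] := sort_boxes_cell T01' inj.
  exists (sort_boxes T) => //; rewrite mem_linear_extensions pe /=.
  apply/allP => -[u v] cs; apply/allP => c' cs'; apply/implyP => cc'.
  rewrite -(cell_sorted_index ce) //.
  have cL : (u, v) \in L by rewrite -(perm_mem pe).
  move: cs'; rewrite (perm_mem pe).
  by case/orP: cc' => /eqP -> /= ?; [exact: Tr|exact: Tc].
move=> [s]; rewrite mem_linear_extensions => /andP[pe oc] ce.
have T01 c : c \in L -> 0 <= entry T c <= 1.
  by move=> cL; rewrite (entry_in _ cL); case: ce.
have mono u v c' : (u, v) \in L -> c' \in L -> covers (u, v) c' -> entry T (u, v) < entry T c'.
  rewrite -!(perm_mem pe) => cs cs' cc'; rewrite (cell_sorted_index ce) //.
  by have /allP/(_ _ cs)/allP/(_ _ cs') := oc; rewrite cc'.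
split => //.
- move=> c c'; rewrite -!(perm_mem pe) => cs cs' E; apply/eqP.
  have h1 : (entry T c < entry T c') = false by rewrite E ltxx.
  have h2 : (entry T c' < entry T c) = false by rewrite E ltxx.
  move: h1 h2; rewrite !(cell_sorted_index ce) // => h1 h2.
  have Ei : index c s = index c' s by lia.
  by rewrite -(nth_index c cs) Ei nth_index.
- by move=> u v h h'; apply: mono => //; rewrite /covers eqxx.
- by move=> u v h h'; apply: mono => //; rewrite /covers eqxx orbT.
Qed.

Lemma linear_extension_perm s : s \in linear_extensions lam -> perm_eq s L.
Proof. by rewrite mem_linear_extensions => /andP[]. Qed.

Lemma volume_tableau A : measurable A ->
  vol (A `&` tableau) = \sum_(s <- linear_extensions lam) vol (cel s `&` A).
Proof.
move=> mA; rewrite -volume_bigcup.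
- rewrite -setI_bigcupl; congr vol; rewrite setIC; congr (_ `&` _).
  by apply/seteqP; split => T; [move=> /tableau_cells[s]; exists s|move=> [s h1 h2]; apply/tableau_cells; exists s].
- by rewrite filter_uniq // permutations_uniq.
- by move=> s /linear_extension_perm sL; apply: measurableI => //; exact: measurable_cell_perm.
- move=> s s' T /linear_extension_perm sL /linear_extension_perm sL' [h _] [h' _].
  exact: cell_inj h h'.
Qed.

Local Notation dim := (size (linear_extensions lam)).

Lemma volume_tableauT : vol tableau = dim%:R * vol (cel L).
Proof.
rewrite -[X in vol X]setTI volume_tableau // mulr_natl -sumr_const_seq big_seq [RHS]big_seq.
by apply: eq_bigr => s /linear_extension_perm sL; rewrite setIT volume_cell.
Qed.

Lemma tableau_lawE A : measurable A -> sorted geq lam ->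
  tableau_law A * (dim%:R * vol (cel L)) = \sum_(s <- linear_extensions lam) vol (cel s `&` A).
Proof.
move=> mA sl; rewrite /tableau_law -/(vol _) -/(vol _) volume_tableau // volume_tableauT divfK //.
by rewrite mulf_neq0 ?gt_eqF ?volume_cell_gt0 // ltr0n (size_linear_extensions_gt0 R).
Qed.

(** Converts the probability of an event into a bound on the number of linear extensions whose whole
    simplex lies in it. *)
Lemma count_cells_in A : measurable A -> sorted geq lam ->
  (count (fun s => `[< cel s `<=` A >]) (linear_extensions lam))%:R <= tableau_law A * dim%:R.
Proof.
move=> mA sl; rewrite -(ler_pM2r volume_cell_gt0) -mulrA tableau_lawE //.
rewrite mulr_natl -sum1_count -sumrMnr big_mkcond /= big_seq [leRHS]big_seq.
apply: ler_sum => s /linear_extension_perm sL; case: asboolP => [/setIidl ->|_].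
  by rewrite volume_cell.
exact: volume_ge0.
Qed.

Lemma nb_le_ge0 (x : R) n : \sum_(0 <= i < n) (i.+1%:R <= x)%R%:R <= Num.max 0 x.
Proof.
elim: n => [|n IH]; first by rewrite big_geq // le_max lexx.
rewrite big_nat_recr //=; case: (lerP n.+1%:R x) => h; last by rewrite addr0.
apply: (@le_trans _ _ (\sum_(0 <= i < n.+1) 1)).
  rewrite [leRHS]big_nat_recr //= lerD2r; apply: ler_sum => i _.
  by rewrite -[leRHS]/(true%:R) ler_nat leq_b1.
by rewrite sumr_const_nat subn0 le_max h orbT.
Qed.

Lemma nb_gt_ge0 (x : R) n : \sum_(0 <= i < n) (x < i.+1%:R)%R%:R <= Num.max 0 (n%:R - x + 1).
Proof.
elim: n => [|n IH]; first by rewrite big_geq // le_max lexx.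
rewrite big_nat_recr //=; case: (ltP x n.+1%:R) => h.
  apply: (le_trans (lerD IH (lexx _))); move: h; rewrite -natr1 => h.
  by rewrite max_r ?max_r //=; lra.
rewrite addr0; apply: (le_trans IH); rewrite ge_max !le_max lexx /=; apply/orP; right.
by rewrite -natr1; lra.
Qed.

Definition rank T t := count (fun c => entry T c <= t) L.

Lemma cell_below s T i t : perm_eq s L -> cel s T -> (i < size L)%N ->
  (entry T (nth (0, 0) s i) <= t) = (i < rank T t)%N.
Proof.
move=> sL [_ sT]; rewrite /rank -(seq.permP sL) -(perm_size sL) => iN.
have -> : count (fun c => entry T c <= t) s = count (fun x => x <= t) [seq entry T c | c <- s].
  by rewrite count_map.
rewrite -(nth_map (0, 0) 0) //.
have : (i < size [seq entry T c | c <- s])%N by rewrite size_map.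
elim: [seq _ | _ <- s] i sT {iN} => [//|x e IH] i /= sT iN.
have srt := path_sorted sT.
have xe : {in e, forall y, x < y} by apply/allP; exact: order_path_min lt_trans sT.
case: (lerP x t) => xt.
  case: i iN => [|i] iN /=; first by rewrite xt add1n.
  by rewrite add1n ltnS; exact: IH.
have -> : count (fun x0 => x0 <= t) e = 0%N.
  apply/eqP; rewrite -leqn0 leqNgt -has_count; apply/hasPn => y /xe xy.
  by rewrite -ltNge (lt_trans xt).
case: i iN => [|i] iN /=; first by rewrite leNgt xt.
by apply/negbTE; rewrite -ltNge (lt_trans xt) // xe // mem_nth.
Qed.

(** If the proportion of entries at most t is nearly a constant [a] off an unlikely event, then [a]
    is close to t. Here [g i] is the distribution function at t of the i-th smallest entry; these
    values sum to N t, and the assumption makes them nearly 0 beyond N(a + e) and nearly 1 before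
    N(a - e). *)
Lemma rank_concentration B t (a e d : R) : measurable B -> sorted geq lam ->
  0 <= t <= 1 -> (0 < size L)%N -> tableau_law B <= d -> d < 1 ->
  (forall T, tableau T -> ~ B T -> `|(rank T t)%:R / (size L)%:R - a| <= e) ->
  `|a - t| <= e + d + (size L)%:R^-1.
Proof.
move=> mB sl t01 N0 lB d1 HB; set N : R := (size L)%:R.
have N0' : 0 < N by rewrite ltr0n.
have q0 := volume_cell_gt0; set q := vol (cel L) in q0 *.
have D0 : 0 < dim%:R :> R by rewrite ltr0n (size_linear_extensions_gt0 R).
pose g i := vol (cel L `&` bel (nth (0, 0) L i) t) / q.
have sumg : \sum_(0 <= i < size L) g i = N * t.
  by rewrite -mulr_suml sum_cell_below // mulfK // gt_eqF.
have gE s i : perm_eq s L -> (i < size L)%N ->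
    vol (cel s `&` bel (nth (0, 0) s i) t) = g i * q.
  by move=> sL iN; rewrite volume_cell_below // divfK // gt_eqF.
have mcb s i : perm_eq s L -> (i < size L)%N -> measurable (cel s `&` bel (nth (0, 0) s i) t).
  move=> sL iN; apply: measurableI; first exact: measurable_cell_perm.
  by apply: measurable_below; rewrite -(perm_mem sL) mem_nth // (perm_size sL).
have mcB s : perm_eq s L -> measurable (cel s `&` B).
  by move=> sL; apply: measurableI => //; exact: measurable_cell_perm.
have tab s T : s \in linear_extensions lam -> cel s T -> tableau T.
  by move=> sE ce; apply/tableau_cells; exists s.
have gup i : (i < size L)%N -> g i <= (i.+1%:R <= N * (a + e))%R%:R + d.
  move=> iN; case: (lerP i.+1%:R (N * (a + e))) => h /=.
    have g1 : g i <= 1.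
      rewrite /g ler_pdivrMr // mul1r.
      by apply: volume_le; [exact: mcb|exact: measurable_cell_perm|exact: subIsetl].
    have d0 : 0 <= d by apply: le_trans lB; rewrite divr_ge0 ?volume_ge0.
    by apply: (le_trans g1); rewrite lerDl.
  (* The entry with index i can be at most t only when the rank exceeds N(a + e), which happens
     inside [B] alone. *)
  rewrite add0r; apply: le_trans lB.
  rewrite -(ler_pM2r (mulr_gt0 D0 q0)) tableau_lawE //.
  rewrite mulrCA mulr_natl -sumr_const_seq big_seq [leRHS]big_seq; apply: ler_sum => s sE.
  have sL := linear_extension_perm sE; rewrite -(gE s) //.
  apply: volume_le; [exact: mcb|exact: mcB|move=> T [ce]].
  rewrite /below /= (cell_below _ sL) // => ir; split=> //.
  apply: contrapT => nB; have := HB T (tab _ _ sE ce) nB; rewrite ler_norml => /andP[_].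
  rewrite lerBlDr ler_pdivrMr // => h2.
  have : i.+1%:R <= (rank T t)%:R :> R by rewrite ler_nat.
  move: h; rewrite -/N mulrC [a + e]addrC; lra.
have glo i : (i < size L)%N -> 1 - g i <= (N * (a - e) < i.+1%:R)%R%:R + d.
  move=> iN; case: (ltP (N * (a - e)) i.+1%:R) => h /=.
    have : 0 <= g i by rewrite divr_ge0 ?volume_ge0 // ltW.
    have d0 : 0 <= d by apply: le_trans lB; rewrite divr_ge0 ?volume_ge0.
    lra.
  rewrite add0r; apply: le_trans lB.
  rewrite -(ler_pM2r (mulr_gt0 D0 q0)) tableau_lawE //.
  rewrite mulrCA mulr_natl -sumr_const_seq big_seq [leRHS]big_seq; apply: ler_sum => s sE.
  have sL := linear_extension_perm sE.
  have mS := measurable_cell_perm sL.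
  have mb : measurable (bel (nth (0, 0) s i) t).
    by apply: measurable_below; rewrite -(perm_mem sL) mem_nth // (perm_size sL).
  have -> : (1 - g i) * q = vol (cel s `\` bel (nth (0, 0) s i) t).
    by rewrite mulrBl mul1r -(gE s) // /q -(volume_cell R sL) (volumeDI mS mb) addrK.
  apply: volume_le; [exact: measurableD|exact: mcB|move=> T [ce]].
  rewrite /below /= (cell_below _ sL) // => /negP; rewrite -leqNgt => ir; split=> //.
  apply: contrapT => nB; have := HB T (tab _ _ sE ce) nB; rewrite ler_norml => /andP[+ _].
  rewrite lerBrDr ler_pdivlMr // => h2.
  have : (rank T t)%:R + 1 <= i.+1%:R :> R by rewrite -natr1 lerD2r ler_nat.
  move: h; rewrite -/N mulrC [- e + a]addrC in h2 *; lra.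
(* The law of [B] is below 1, so some tableau avoids it; since its rank lies between 0 and N, it
   gives 0 <= a + e and a - e <= 1. *)
have /existsNP[T /not_implyP[tT nBT]] : ~ (forall T, tableau T -> B T).
  move=> H; have BT : B `&` tableau = tableau by apply/setIidr => T; exact: H.
  have := lB; rewrite /tableau_law -/(vol _) -/(vol _) BT divff; first lra.
  by rewrite volume_tableauT mulf_neq0 // gt_eqF.
have rN : (rank T t)%:R / N <= 1.
  by rewrite ler_pdivrMr // mul1r ler_nat count_size.
have r0 : 0 <= (rank T t)%:R / N by rewrite divr_ge0 // ltW.
have := HB T tT nBT; rewrite -/N ler_norml => /andP[b1 b2].
move: rN r0 b1 b2; set r := _ / N => rN r0 b1 b2.
have ae0 : 0 <= a + e by lra.
have ae1 : a - e <= 1 by lra.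
have U : N * t <= N * (a + e) + N * d.
  rewrite -sumg; apply: (@le_trans _ _ (\sum_(0 <= i < size L) ((i.+1%:R <= N * (a + e))%R%:R + d))).
    by rewrite big_nat [leRHS]big_nat; apply: ler_sum => i /andP[_ iN]; exact: gup.
  rewrite big_split /= sumr_const_nat subn0 -[d *+ _]mulr_natl lerD2r.
  apply: (le_trans (nb_le_ge0 _ _)); by rewrite max_r // mulr_ge0 // ltW.
have V : N - N * t <= N - N * (a - e) + 1 + N * d.
  rewrite -sumg -[X in X - _ <= _]mulr1 mulr_natl -[X in _ *+ X]subn0 -sumr_const_nat -sumrB.
  apply: (@le_trans _ _ (\sum_(0 <= i < size L) ((N * (a - e) < i.+1%:R)%R%:R + d))).
    by rewrite big_nat [leRHS]big_nat; apply: ler_sum => i /andP[_ iN]; exact: glo.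
  rewrite big_split /= sumr_const_nat subn0 -[d *+ _]mulr_natl lerD2r.
  apply: (le_trans (nb_gt_ge0 _ _)); rewrite max_r //.
  have : N * (a - e) <= N * 1 by rewrite ler_pM2l.
  lra.
have E : e + d + N^-1 = (N * e + N * d + 1) / N by field; rewrite gt_eqF.
rewrite E ler_pdivlMr // mulrC -{1}(gtr0_norm N0') -normrM ler_norml.
by apply/andP; split; lra.
Qed.

End Tableaux.

(** * Complex moduli and Riemann sums *)

Local Notation "x %:C" := (real_complex _ x) : ring_scope.

Section ComplexNorm.
Variable R : realType.
Implicit Types (z w : R[i]) (x y : R).

Definition cabs z : R := Normc.normc z.

Lemma ReD z w : complex.Re (z + w) = complex.Re z + complex.Re w. Proof. by case: z w => [? ?] []. Qed.
Lemma ImD z w : complex.Im (z + w) = complex.Im z + complex.Im w. Proof. by case: z w => [? ?] []. Qed.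
Lemma ReN z : complex.Re (- z) = - complex.Re z. Proof. by case: z. Qed.
Lemma ImN z : complex.Im (- z) = - complex.Im z. Proof. by case: z. Qed.
Lemma ReB z w : complex.Re (z - w) = complex.Re z - complex.Re w. Proof. by rewrite ReD ReN. Qed.
Lemma ImB z w : complex.Im (z - w) = complex.Im z - complex.Im w. Proof. by rewrite ImD ImN. Qed.
Lemma ReM z w : complex.Re (z * w) = complex.Re z * complex.Re w - complex.Im z * complex.Im w.
Proof. by case: z w => [? ?] []. Qed.
Lemma ImM z w : complex.Im (z * w) = complex.Re z * complex.Im w + complex.Im z * complex.Re w.
Proof. by case: z w => [? ?] []. Qed.
Lemma ReC x : complex.Re x%:C = x. Proof. by []. Qed.
Lemma ImC x : complex.Im x%:C = 0. Proof. by []. Qed.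

Lemma Re_sum I (r : seq I) (F : I -> R[i]) :
  complex.Re (\sum_(i <- r) F i) = \sum_(i <- r) complex.Re (F i).
Proof. by elim: r => [|i r IH]; rewrite ?big_nil // !big_cons ReD IH. Qed.

Lemma Im_sum I (r : seq I) (F : I -> R[i]) :
  complex.Im (\sum_(i <- r) F i) = \sum_(i <- r) complex.Im (F i).
Proof. by elim: r => [|i r IH]; rewrite ?big_nil // !big_cons ImD IH. Qed.

Lemma complex_ext z w : complex.Re z = complex.Re w -> complex.Im z = complex.Im w -> z = w.
Proof. by case: z w => [? ?] [? ?] /= -> ->. Qed.

Lemma cabs_sqr z : cabs z ^+ 2 = complex.Re z ^+ 2 + complex.Im z ^+ 2.
Proof. by case: z => x y; rewrite /cabs /= sqr_sqrtr // addr_ge0 ?sqr_ge0. Qed.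

Lemma cabs_ge0 z : 0 <= cabs z. Proof. by case: z => *; exact: sqrtr_ge0. Qed.

Lemma cabsM z w : cabs (z * w) = cabs z * cabs w. Proof. exact: Normc.normcM. Qed.
Lemma cabsV z : cabs z^-1 = (cabs z)^-1. Proof. exact: Normc.normcV. Qed.
Lemma cabsD z w : cabs (z + w) <= cabs z + cabs w. Proof. exact: le_normcD. Qed.
Lemma cabsN z : cabs (- z) = cabs z. Proof. exact: normcN. Qed.
Lemma cabs0 : cabs 0 = 0 :> R. Proof. exact: Normc.normc0. Qed.
Lemma cabs1 : cabs 1 = 1 :> R. Proof. exact: Normc.normc1. Qed.
Lemma cabsB z w : cabs (z - w) <= cabs z + cabs w.
Proof. by rewrite -[cabs w]cabsN cabsD. Qed.
Lemma cabsBC z w : cabs (z - w) = cabs (w - z). Proof. by rewrite -cabsN opprB. Qed.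
Lemma cabs_real x : cabs x%:C = `|x|.
Proof. by rewrite /cabs /= expr0n /= addr0 sqrtr_sqr. Qed.
Lemma cabs_eq0 z : cabs z = 0 -> z = 0. Proof. exact: Normc.eq0_normc. Qed.
Lemma cabsX z n : cabs (z ^+ n) = cabs z ^+ n.
Proof. by elim: n => [|n IH]; rewrite ?cabs1 // !exprS cabsM IH. Qed.

Lemma cabs_gt0 z : z != 0 -> 0 < cabs z.
Proof. by move=> z0; rewrite lt_def cabs_ge0 andbT; apply: contra z0 => /eqP/cabs_eq0->. Qed.

Lemma abs_Re z : `|complex.Re z| <= cabs z.
Proof.
rewrite -(@ler_pXn2r _ 2) ?nnegrE ?cabs_ge0 // cabs_sqr real_normK ?num_real //.
by rewrite lerDl sqr_ge0.
Qed.

Lemma abs_Im z : `|complex.Im z| <= cabs z.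
Proof.
rewrite -(@ler_pXn2r _ 2) ?nnegrE ?cabs_ge0 // cabs_sqr real_normK ?num_real //.
by rewrite lerDr sqr_ge0.
Qed.

Lemma cabs_le_ReIm z : cabs z <= `|complex.Re z| + `|complex.Im z|.
Proof.
rewrite -(@ler_pXn2r _ 2) ?nnegrE ?cabs_ge0 ?addr_ge0 // cabs_sqr sqrrD.
by rewrite !real_normK ?num_real // addrAC lerDl mulrn_wge0 // mulr_ge0.
Qed.

Lemma cabs_sum I (r : seq I) (F : I -> R[i]) :
  cabs (\sum_(i <- r) F i) <= \sum_(i <- r) cabs (F i).
Proof.
elim: r => [|i r IH]; first by rewrite !big_nil cabs0.
by rewrite !big_cons (le_trans (cabsD _ _)) // lerD2l.
Qed.

Lemma cabs_inv_le z (e : R) : 0 < e -> e <= cabs z -> cabs z^-1 <= e^-1.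
Proof. by move=> e0 ez; rewrite cabsV lef_pV2 ?posrE ?(lt_le_trans e0). Qed.

End ComplexNorm.

(** * Riemann sums with an explicit rate *)

Section RiemannSums.
Variables (R : realType) (al w : R) (W : nat).
Hypothesis w0 : 0 < w.
Implicit Types (g h : R -> R[i]) (f : R -> R).

(** With al = eta a_0 and w = eta the grid of step w/n consists of the rescaled diagonals of the
    n-fold dilation, so sums over columns of the dilated diagram are of this form exactly. *)
Definition rsum n g : R[i] :=
  (w / n%:R)%:C * \sum_(0 <= k < n * W) g (al + k%:R * (w / n%:R)).

(** The rate 1/n makes limits unique and lets inequalities pass to the limit through [small_eq0] and
    [le_limit]. *)
Definition is_riemann g (I : R[i]) :=
  exists B : R, forall n, (0 < n)%N -> cabs (rsum n g - I) <= B / n%:R.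

Definition in_range (x : R) := al <= x <= al + w * W%:R.

Lemma grid_in_range n k : (0 < n)%N -> (k <= n * W)%N ->
  in_range (al + k%:R * (w / n%:R)).
Proof.
move=> n0 kn; have n0' : 0 < n%:R :> R by rewrite ltr0n.
rewrite /in_range lerDl lerD2l mulr_ge0 ?divr_ge0 ?(ltW w0) //=.
rewrite mulrCA ler_pM2l // ler_pdivrMr // -natrM ler_nat mulnC; lia.
Qed.

Lemma small_eq0 (x B : R) : 0 <= x -> (forall n, (0 < n)%N -> x <= B / n%:R) -> x = 0.
Proof.
move=> x0 H; apply/eqP; rewrite eq_le x0 andbT leNgt; apply/negP => xp.
pose n := Num.truncn (B / x).
have := H n.+1 isT; rewrite ler_pdivlMr ?ltr0n // mulrC -ler_pdivlMr //.
by rewrite leNgt truncnS_gt.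
Qed.

Lemma is_riemann_unique g I J : is_riemann g I -> is_riemann g J -> I = J.
Proof.
move=> [B HB] [B' HB']; apply/eqP; rewrite -subr_eq0; apply/eqP/cabs_eq0.
apply: (@small_eq0 _ (B + B')) => [|n n0]; first exact: cabs_ge0.
rewrite mulrDl (le_trans _ (lerD (HB n n0) (HB' n n0))) //.
have := cabsD (I - rsum n g) (rsum n g - J).
by rewrite addrA subrK [cabs (I - _)]cabsBC.
Qed.

Lemma is_riemannD g h I J : is_riemann g I -> is_riemann h J ->
  is_riemann (fun x => g x + h x) (I + J).
Proof.
move=> [B HB] [B' HB']; exists (B + B') => n n0.
rewrite mulrDl (le_trans _ (lerD (HB n n0) (HB' n n0))) //.
apply: le_trans (cabsD _ _); rewrite /rsum big_split /= mulrDr.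
by rewrite opprD addrACA.
Qed.

Lemma is_riemannZ c g I : is_riemann g I -> is_riemann (fun x => c * g x) (c * I).
Proof.
move=> [B HB]; exists (cabs c * B) => n n0.
rewrite -mulrA; apply: le_trans (ler_wpM2l (cabs_ge0 _) (HB n n0)).
by rewrite -cabsM /rsum -mulr_sumr mulrCA mulrBr.
Qed.

Lemma is_riemann_ext g h I : (forall x, in_range x -> g x = h x) ->
  is_riemann g I -> is_riemann h I.
Proof.
move=> E [B HB]; exists B => n n0; have := HB n n0.
rewrite /rsum big_nat (eq_bigr (fun k => h (al + k%:R * (w / n%:R)))).
  by rewrite -big_nat.
by move=> k /andP[_ kn]; rewrite E //; apply: grid_in_range => //; exact: ltnW.
Qed.

Lemma is_riemannB g h I J : is_riemann g I -> is_riemann h J ->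
  is_riemann (fun x => g x - h x) (I - J).
Proof.
move=> gI /(is_riemannZ (-1)) hJ; rewrite -[- J]mulN1r.
by apply: is_riemann_ext (is_riemannD gI hJ) => x _; rewrite mulN1r.
Qed.

Lemma is_riemann_cst c : is_riemann (fun=> c) (c * (w * W%:R)%:C).
Proof.
exists 0 => n n0; rewrite /rsum sumr_const_nat subn0 -[c *+ _]mulr_natl.
have E : (w / n%:R)%:C * ((n * W)%:R * c) = c * (w * W%:R)%:C.
  rewrite mulrA mulrC; congr (_ * _).
  have -> : (n * W)%:R = ((n * W)%:R : R)%:C :> R[i] by rewrite rmorph_nat.
  rewrite -rmorphM natrM; congr (_%:C); field.
  by rewrite pnatr_eq0 -lt0n.
by rewrite E subrr cabs0 mul0r.
Qed.

Lemma le_limit (x y B : R) : (forall n, (0 < n)%N -> x <= y + B / n%:R) -> x <= y.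
Proof.
move=> H; rewrite leNgt; apply/negP => yx.
have : x - y = 0.
  apply: (@small_eq0 _ B); first by rewrite subr_ge0 ltW.
  by move=> n n0; rewrite lerBlDl H.
by move=> /eqP; rewrite subr_eq0 => /eqP E; rewrite E ltxx in yx.
Qed.

Lemma is_riemann_bound g h I J : is_riemann g I -> is_riemann h J ->
  (forall x, in_range x -> cabs (g x) <= complex.Re (h x)) -> cabs I <= complex.Re J.
Proof.
move=> [B HB] [B' HB'] gh; apply: (@le_limit _ _ (B + B')) => n n0.
have n0' : 0 < n%:R :> R by rewrite ltr0n.
have h1 : cabs I <= cabs (rsum n g) + B / n%:R.
  by apply: le_trans (lerD (lexx _) (HB n n0)); rewrite cabsBC; have := cabsD (rsum n g) (I - rsum n g); rewrite addrC subrK.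
have h2 : complex.Re (rsum n h) <= complex.Re J + B' / n%:R.
  rewrite -lerBlDl -ReB; apply: le_trans (HB' n n0); apply: le_trans (abs_Re _); exact: ler_norm.
suff h3 : cabs (rsum n g) <= complex.Re (rsum n h) by rewrite mulrDl; lra.
have wn : 0 <= w / n%:R by rewrite divr_ge0 // ltW.
rewrite /rsum cabsM cabs_real ger0_norm // ReM ImC mul0r subr0 ReC ler_wpM2l //.
rewrite Re_sum (le_trans (cabs_sum _ _)) // big_nat [leRHS]big_nat.
apply: ler_sum => k /andP[_ kn]; apply: gh; apply: grid_in_range => //; exact: ltnW.
Qed.

Lemma is_riemann_le g h I J : is_riemann g I -> is_riemann h J ->
  (forall x, in_range x -> complex.Im (g x) <= complex.Im (h x)) -> complex.Im I <= complex.Im J.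
Proof.
move=> [B HB] [B' HB'] gh; apply: (@le_limit _ _ (B + B')) => n n0.
have n0' : 0 < n%:R :> R by rewrite ltr0n.
have h1 : complex.Im I <= complex.Im (rsum n g) + B / n%:R.
  rewrite -lerBlDl -ImB; apply: le_trans (HB n n0); rewrite cabsBC; apply: le_trans (abs_Im _); exact: ler_norm.
have h2 : complex.Im (rsum n h) <= complex.Im J + B' / n%:R.
  rewrite -lerBlDl -ImB; apply: le_trans (HB' n n0); apply: le_trans (abs_Im _); exact: ler_norm.
suff h3 : complex.Im (rsum n g) <= complex.Im (rsum n h) by rewrite mulrDl; lra.
have wn : 0 <= w / n%:R by rewrite divr_ge0 // ltW.
rewrite /rsum !ImM ImC !mul0r !addr0 ReC ler_wpM2l //.
rewrite !Im_sum big_nat [leRHS]big_nat.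
apply: ler_sum => k /andP[_ kn]; apply: gh; apply: grid_in_range => //; exact: ltnW.
Qed.

Definition lipschitz_range g (C : R) := forall x y, in_range x -> in_range y ->
  cabs (g x - g y) <= C * `|x - y|.

Definition rsumr n f : R := (w / n%:R) * \sum_(0 <= k < n * W) f (al + k%:R * (w / n%:R)).

Lemma rsumr_refine f (C : R) n p : (0 < n)%N -> (0 < p)%N ->
  (forall x y, in_range x -> in_range y -> `|f x - f y| <= C * `|x - y|) -> 0 <= C ->
  `|rsumr n f - rsumr (p * n) f| <= C * w * (w * W%:R) / n%:R.
Proof.
move=> n0 p0 Lf C0; have n0' : 0 < n%:R :> R by rewrite ltr0n.
have p0' : 0 < p%:R :> R by rewrite ltr0n.
have wn : 0 <= w / n%:R by rewrite divr_ge0 // ltW.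
have -> : rsumr n f - rsumr (p * n) f = (w / (p * n)%N%:R) *
    \sum_(0 <= k < n * W) \sum_(0 <= r < p)
      (f (al + k%:R * (w / n%:R)) - f (al + (p * k + r)%N%:R * (w / (p * n)%N%:R))).
  have -> : rsumr n f = (w / (p * n)%N%:R) * \sum_(0 <= k < n * W) \sum_(0 <= r < p) f (al + k%:R * (w / n%:R)).
    rewrite /rsumr [in RHS](eq_bigr (fun k => p%:R * f (al + k%:R * (w / n%:R)))); last first.
      by move=> k _; rewrite sumr_const_nat subn0 -[LHS]mulr_natl.
    rewrite -mulr_sumr mulrA natrM; congr (_ * _); field.
    by rewrite !gt_eqF.
  have -> : rsumr (p * n) f = (w / (p * n)%N%:R) * \sum_(0 <= k < n * W) \sum_(0 <= r < p)
      f (al + (p * k + r)%N%:R * (w / (p * n)%N%:R)).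
    by rewrite /rsumr -mulnA big_nat_block.
  rewrite -mulrBr -sumrB; congr (_ * _).
  by apply: eq_bigr => k _; rewrite sumrB.
have pn0 : 0 < (p * n)%N%:R :> R by rewrite ltr0n muln_gt0 p0.
rewrite normrM ger0_norm; last by rewrite divr_ge0 // ltW.
have B : `|\sum_(0 <= k < n * W) \sum_(0 <= r < p)
      (f (al + k%:R * (w / n%:R)) - f (al + (p * k + r)%N%:R * (w / (p * n)%N%:R)))| <=
    \sum_(0 <= k < n * W) \sum_(0 <= r < p) (C * (w / n%:R)).
  apply: (le_trans (ler_norm_sum _ _ _)); rewrite big_nat [leRHS]big_nat; apply: ler_sum => k /andP[_ kn].
  apply: (le_trans (ler_norm_sum _ _ _)); rewrite big_nat [leRHS]big_nat; apply: ler_sum => r /andP[_ rp].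
  apply: (le_trans (Lf _ _ _ _)).
  - by apply: grid_in_range => //; exact: ltnW.
  - apply: grid_in_range; first by rewrite muln_gt0 p0.
    rewrite -mulnA; apply: (@leq_trans (p * k.+1)%N); first by rewrite mulnS; lia.
    by rewrite leq_mul2l kn orbT.
  apply: ler_wpM2l => //.
  have -> : al + k%:R * (w / n%:R) - (al + (p * k + r)%N%:R * (w / (p * n)%N%:R)) = - (r%:R * (w / (p * n)%N%:R)).
    rewrite natrD !natrM; field; by rewrite !gt_eqF.
  rewrite normrN ger0_norm; last by rewrite mulr_ge0 // divr_ge0 // ltW.
  have -> : r%:R * (w / (p * n)%N%:R) = (r%:R / p%:R) * (w / n%:R).
    by rewrite natrM; field; rewrite !gt_eqF.
  by rewrite -[leRHS]mul1r ler_wpM2r // ler_pdivrMr // mul1r ler_nat ltnW.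
apply: (le_trans (ler_wpM2l _ B)); first by rewrite divr_ge0 // ltW.
rewrite !sumr_const_nat !subn0 -mulrnA -[X in _ * X <= _]mulr_natl !natrM.
rewrite le_eqVlt; apply/orP; left; apply/eqP; field.
by rewrite !gt_eqF.
Qed.

(** Scales n and m are compared through the common refinement n m, so every lower bound is below
    every upper bound; the limit is the supremum of the lower bounds. *)
Lemma rsumr_limit f (C : R) :
  (forall x y, in_range x -> in_range y -> `|f x - f y| <= C * `|x - y|) -> 0 <= C ->
  exists I, forall n, (0 < n)%N -> `|rsumr n f - I| <= C * w * (w * W%:R) / n%:R.
Proof.
move=> Lf C0; set B := C * w * (w * W%:R).
have cross n m : (0 < n)%N -> (0 < m)%N -> rsumr n f - B / n%:R <= rsumr m f + B / m%:R.
  move=> n0 m0; have := rsumr_refine n0 m0 Lf C0; have := rsumr_refine m0 n0 Lf C0.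
  rewrite mulnC -/B !ler_norml; lra.
pose S := [set x | exists2 n, (0 < n)%N & x = rsumr n f - B / n%:R].
have hs : has_sup S.
  split; first by exists (rsumr 1 f - B / 1); exists 1%N.
  by exists (rsumr 1 f + B / 1) => x [n n0 ->]; exact: cross.
exists (sup S) => n n0; rewrite ler_norml; apply/andP; split.
  have : sup S <= rsumr n f + B / n%:R.
    by apply: ge_sup; [exact: hs.1|move=> x [m m0 ->]; exact: cross].
  lra.
have : rsumr n f - B / n%:R <= sup S by apply: sup_upper_bound => //; exists n.
lra.
Qed.

Lemma is_riemann_exists g (C : R) : lipschitz_range g C -> 0 <= C -> exists I, is_riemann g I.
Proof.
move=> Lg C0.
have [I1 H1] : exists I, forall n, (0 < n)%N ->
    `|rsumr n (fun x => complex.Re (g x)) - I| <= C * w * (w * W%:R) / n%:R.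
  apply: rsumr_limit => // x y xr yr; rewrite -ReB; apply: le_trans (abs_Re _) _; exact: Lg.
have [I2 H2] : exists I, forall n, (0 < n)%N ->
    `|rsumr n (fun x => complex.Im (g x)) - I| <= C * w * (w * W%:R) / n%:R.
  apply: rsumr_limit => // x y xr yr; rewrite -ImB; apply: le_trans (abs_Im _) _; exact: Lg.
exists (Complex I1 I2); exists (C * w * (w * W%:R) + C * w * (w * W%:R)) => n n0.
apply: (le_trans (cabs_le_ReIm _)); rewrite mulrDl; apply: lerD.
  by have := H1 n n0; rewrite /rsumr -Re_sum ReB /rsum ReM ImC mul0r subr0.
by have := H2 n n0; rewrite /rsumr -Im_sum ImB /rsum ImM ImC mul0r addr0.
Qed.

(** The default 0 is never reached for Lipschitz integrands, by [riemannP]. *)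
Definition riemann g : R[i] := xget 0 [set I | is_riemann g I].

Lemma riemannP g (C : R) : lipschitz_range g C -> 0 <= C -> is_riemann g (riemann g).
Proof.
by move=> Lg C0; have [I HI] := is_riemann_exists Lg C0; apply: (@xgetPex _ 0 [set I | is_riemann g I]); exists I.
Qed.

End RiemannSums.

(** * The limiting height function *)

Section Columns.
Variables (R : realType) (lam : seq nat).
Hypothesis sl : sorted geq lam.
Local Notation L := (boxes lam).
Local Notation tableau := (@poissonized_tableau R lam).
Implicit Types (T : filling R lam) (t : R).

Lemma height_le T (j : int) t t' : t <= t' -> (height T j t <= height T j t')%N.
Proof.
move=> tt'; apply: sub_count => c /andP[-> ct]; exact: le_trans tt'.
Qed.

Let shift (e : int) (c : int * int) := (c.1 + e, c.2 - 1).

Let shift_uniq e (p : pred (int * int)) : uniq [seq shift e c | c <- L & p c].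
Proof.
rewrite map_inj_uniq ?filter_uniq ?boxes_uniq // => -[u v] [u' v'] [] e1 e2.
by congr (_, _); lia.
Qed.

(** Moving a box of diagonal j one row up gives a box of diagonal j + 1 with a smaller entry. Only a
    box of the first row leaves the diagram; its image (j + 1, j) is added by hand, whence the
    successor. *)
Lemma height_step_up T j t : tableau T -> (height T j t <= (height T (j + 1) t).+1)%N.
Proof.
move=> [_ _ _ Tc].
rewrite /height -!size_filter -(size_map (shift 1)) -[X in (_ <= X)%N]/(size ((j + 1, j) :: _)).
apply: uniq_leq_size; first exact: shift_uniq.
move=> c' /mapP[c]; rewrite mem_filter => /andP[/andP[/eqP cj ct] cL] ->.
have [i [k [kH cE]]] := (boxes_mem lam c).1 cL.
case: i kH cE => [|i] kH cE; rewrite inE; apply/orP; [left|right].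
  by move: cj; rewrite cE /shift /box /= => cj; apply/eqP; congr (_, _); lia.
have fE : shift 1 c = box i k by rewrite cE /shift /box /=; congr (_, _); lia.
have bL : box i k \in L.
  by rewrite box_in; have := nth_sorted sl (leqnSn i); lia.
rewrite fE mem_filter bL andbT; apply/andP; split.
  by move: cj; rewrite cE /box /= => cj; apply/eqP; lia.
have [_ E2] := box_succ i k.
apply: ltW; apply: lt_le_trans ct; have := Tc (box i k).1 (box i k).2.
by rewrite E2 -cE -surjective_pairing; apply.
Qed.

(** The same argument with boxes moved one column to the left; the exception is a box of the first
    column. *)
Lemma height_step_down T j t : tableau T -> (height T (j + 1) t <= (height T j t).+1)%N.
Proof.
move=> [_ _ Tr _].
rewrite /height -!size_filter -(size_map (shift (-1))) -[X in (_ <= X)%N]/(size ((j, - (j + 1)) :: _)).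
apply: uniq_leq_size; first exact: shift_uniq.
move=> c' /mapP[c]; rewrite mem_filter => /andP[/andP[/eqP cj ct] cL] ->.
have [i [k [kH cE]]] := (boxes_mem lam c).1 cL.
case: k kH cE => [|[|k]] // kH cE; rewrite inE; apply/orP; [left|right].
  by move: cj; rewrite cE /shift /box /= => cj; apply/eqP; congr (_, _); lia.
have fE : shift (-1) c = box i k.+1 by rewrite cE /shift /box /=; congr (_, _); lia.
have bL : box i k.+1 \in L by rewrite box_in; lia.
rewrite fE mem_filter bL andbT; apply/andP; split.
  by move: cj; rewrite cE /box /= => cj; apply/eqP; lia.
have [E1 _] := box_succ i k.+1.
apply: ltW; apply: lt_le_trans ct; have := Tr (box i k.+1).1 (box i k.+1).2.
by rewrite E1 -cE -surjective_pairing; apply.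
Qed.

Lemma height_lipschitz T (i j : int) t : tableau T -> i <= j ->
  `|(height T i t)%:R - (height T j t)%:R| <= (j - i)%:~R :> R.
Proof.
move=> tT ij; have -> : j = i + `|j - i|%N by lia.
move: (`|j - i|%N) => n {ij}; rewrite [i + _]addrC addrK -pmulrn.
elim: n => [|n IH]; first by rewrite add0r subrr normr0.
have -> : n.+1%:Z + i = (n%:Z + i) + 1 by lia.
have h1 := height_step_up (n%:Z + i) t tT; have h2 := height_step_down (n%:Z + i) t tT.
move: h1 h2; rewrite -!(ler_nat R) -!natr1 => h1 h2.
by move: IH; rewrite !ler_norml => /andP[h3 h4]; apply/andP; split; lra.
Qed.

Lemma height_at1 T j : tableau T -> height T j 1 = column lam j.
Proof.
move=> [T01 _ _ _]; apply: eq_in_count => c cL.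
by have /andP[_ ->] := T01 c cL; rewrite andbT.
Qed.

Lemma height_at0 T j : tableau T -> (height T j 0 <= 1)%N.
Proof.
move=> [T01 inj _ _]; rewrite /height -size_filter.
case E: [seq _ <- _ | _] => [|c [|c' s]] //.
have u : uniq ([seq c <- L | (c.1 == j) && (entry T c <= 0)]).
  by rewrite filter_uniq // boxes_uniq.
have cm : c \in [seq c <- L | (c.1 == j) && (entry T c <= 0)] by rewrite E inE eqxx.
have cm' : c' \in [seq c <- L | (c.1 == j) && (entry T c <= 0)] by rewrite E !inE eqxx orbT.
move: cm cm'; rewrite !mem_filter => /andP[/andP[_ c0] cL] /andP[/andP[_ c0'] cL'].
have e0 : entry T c = 0 by apply/eqP; rewrite eq_le c0; have /andP[->] := T01 c cL.
have e0' : entry T c' = 0 by apply/eqP; rewrite eq_le c0'; have /andP[->] := T01 c' cL'.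
have cc' : c = c' by apply: inj; rewrite ?e0.
by move: u; rewrite E cc' /= inE eqxx.
Qed.

Lemma sorted_count_take (s : seq (int * int)) T t (p : pred (int * int)) :
  sorted <%R [seq entry T c | c <- s] ->
  count (fun c => p c && (entry T c <= t)) s = count p (take (count (fun c => entry T c <= t) s) s).
Proof.
elim: s => [//|c s IH] /= srt.
have xe : {in s, forall y, entry T c < entry T y}.
  move=> y ys; have /allP := order_path_min lt_trans srt; apply; exact: map_f.
case: (lerP (entry T c) t) => ct.
  by rewrite andbT add1n /= IH //; exact: path_sorted srt.
rewrite andbF add0n.
have z : {in s, forall y, (entry T y <= t) = false}.
  by move=> y /xe h; apply/negbTE; rewrite -ltNge (lt_trans ct).
have -> : count (fun c0 => entry T c0 <= t) s = 0%N.
  by apply/eqP; rewrite -leqn0 leqNgt -has_count; apply/hasPn => y /z ->.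
by apply/eqP; rewrite -leqn0 leqNgt -has_count; apply/hasPn => y /z ->; rewrite andbF.
Qed.

End Columns.

(** * First properties of the limiting height function *)

Section Limit.
Variables (R : realType) (lam : seq nat) (m : nat) (a b : nat -> int) (H : R -> R -> R).
Hypotheses (pl : is_partition lam) (l0 : lam != [::]).
Hypothesis ic : interlacing_coordinates R lam m a b.
Hypothesis lim : limiting_height lam (a 0%N) (a m) H.

Local Notation et := (Defs.eta R lam).
(** Width of the diagram in lattice units: [al, al + et W] is the interval on which H is
    considered. *)
Let W := (size lam + nth 0%N lam 0)%N.
Let al := et * (a 0%N)%:~R.
Let inr := in_range al et W.
Let sl : sorted geq lam. Proof. by case/andP: pl. Qed.

Lemma sumn_gt0 : (0 < sumn lam)%N.
Proof.
have s0 : (0 < size lam)%N by case: (lam) l0.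
by have := partition_nth_gt0 pl s0; case: (lam) l0 => //= p s _; lia.
Qed.

Lemma eta_gt0 : 0 < et.
Proof. by rewrite invr_gt0 sqrtr_gt0 ltr0n sumn_gt0. Qed.

Lemma eta_neq0 : et != 0. Proof. by rewrite gt_eqF // eta_gt0. Qed.

Lemma sqrt_size n : Num.sqrt ((n ^ 2 * sumn lam)%N%:R : R) = n%:R / et.
Proof. by rewrite invrK natrM natrX sqrtrM ?sqr_ge0 // sqrtr_sqr ger0_norm. Qed.

Lemma cells_eta n : ((n ^ 2 * sumn lam)%N%:R : R) = (n%:R / et) ^+ 2.
Proof. by rewrite -sqrt_size sqr_sqrtr. Qed.

Lemma range_end : et * (a m)%:~R = al + et * W%:R.
Proof.
rewrite /al (interlacing_first pl ic) (interlacing_last pl ic l0) mulrNz -!pmulrn natrD.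
ring.
Qed.

Definition good n eps (T : filling R (dilate n lam)) :=
  @poissonized_tableau R (dilate n lam) T /\ ~ height_deviation lam (a 0%N) (a m) H n eps T.

Arguments good : clear implicits.

Lemma good_height n eps T x t : (0 < n)%N -> good n eps T -> inr x -> 0 <= t <= 1 ->
  `|et / n%:R * (height T (Num.floor (x * (n%:R / et))) t)%:R - H x t| <= eps.
Proof.
move=> n0 [_ nd] xr t01; rewrite leNgt; apply/negP => h; apply: nd.
by exists x, t; rewrite sqrt_size invf_div range_end; split.
Qed.

Definition node n k : R := al + k%:R * (et / n%:R).

Lemma good_node n eps T k t : (0 < n)%N -> good n eps T -> (k <= n * W)%N -> 0 <= t <= 1 ->
  `|et / n%:R * (height T (n%:Z * a 0%N + k%:Z) t)%:R - H (node n k) t| <= eps.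
Proof.
move=> n0 gT kn t01.
have := good_height n0 gT (grid_in_range al eta_gt0 n0 kn) t01.
have -> : (al + k%:R * (et / n%:R)) * (n%:R / et) = (n%:Z * a 0%N + k%:Z)%:~R.
  rewrite intrD intrM -!pmulrn /al; field.
  by rewrite eta_neq0 pnatr_eq0 -lt0n n0.
by rewrite intrKfloor.
Qed.

Lemma lim_good (eps : R) : 0 < eps -> exists n0, forall n, (n0 <= n)%N -> (0 < n)%N ->
  exists A : set (filling R (dilate n lam)), [/\ measurable A, tableau_law A <= eps &
   forall T, poissonized_tableau T -> ~ A T -> good n eps T].
Proof.
move=> e0; have [A [HA cA]] := lim e0.
have /cvgrPdist_le/(_ eps e0) [n0 _ Hn0] := cA.
exists n0 => n n0n n1; exists (A n); split; first by have [] := HA n.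
  have := Hn0 n n0n; rewrite sub0r normrN; exact: le_trans (ler_norm _).
move=> T tT nA; split=> // dT; apply: nA; have [_] := HA n; exact.
Qed.

Lemma good_exists (eps : R) : 0 < eps -> exists n0, forall n, (n0 <= n)%N -> (0 < n)%N ->
  exists T : filling R (dilate n lam), good n eps T.
Proof.
move=> e0; pose e := Num.min eps (1 / 2).
have e0' : 0 < e by rewrite lt_min e0 /= divr_gt0.
have [n0 Hn0] := lim_good e0'; exists n0 => n n0n n1.
have [A [mA lA HA]] := Hn0 n n0n n1.
have : ~ (forall T, poissonized_tableau T -> A T).
  move=> HT; have AT : A `&` @poissonized_tableau R (dilate n lam) = @poissonized_tableau R (dilate n lam).
    by apply/setIidr => T; exact: HT.
  move: lA; rewrite /tableau_law AT divff.
    by rewrite le_min => /andP[_]; lra.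
  rewrite -/(volume _) volume_tableauT mulf_neq0 // ?gt_eqF ?volume_cell_gt0 //.
  rewrite ltr0n (size_linear_extensions_gt0 R) //.
  by case/andP: (dilate_partition n1 pl).
move=> /existsNP[T /not_implyP[tT nT]]; exists T.
have [_ nd] := HA T tT nT; split=> // -[x [t [h1 h2 h3]]]; apply: nd; exists x, t; split=> //.
by apply: le_lt_trans h3; rewrite ge_min lexx.
Qed.

Lemma eventually_small (c eps : R) : 0 < eps -> exists n0, forall n, (n0 <= n)%N ->
  (0 < n)%N -> c / n%:R <= eps.
Proof.
move=> e0; exists (Num.truncn (c / eps)).+1 => n n0 n1.
rewrite ler_pdivrMr ?ltr0n // mulrC -ler_pdivrMr //.
by apply: le_trans (ltW (truncnS_gt _)) _; rewrite ler_nat.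
Qed.

Lemma good_large (c eps : R) : 0 < eps -> exists n, (0 < n)%N /\ c / n%:R <= eps /\
  exists T : filling R (dilate n lam), good n eps T.
Proof.
move=> e0; have [n1 H1] := good_exists e0; have [n2 H2] := eventually_small c e0.
exists (n1 + n2).+1; split=> //; split; first by apply: H2 => //; lia.
by apply: H1 => //; lia.
Qed.

Lemma eps_le (x y c : R) : (forall eps, 0 < eps -> x <= y + c * eps) -> x <= y.
Proof.
move=> h; rewrite leNgt; apply/negP => yx.
have c1 : 0 < `|c| + 1 by rewrite ltr_wpDl.
have e0 : 0 < (x - y) / (2 * (`|c| + 1)) by rewrite divr_gt0 ?subr_gt0 ?mulr_gt0.
have := h _ e0; set e := (X in c * X) => hx.
have E : (`|c| + 1) * e = (x - y) / 2 by rewrite /e; field; rewrite gt_eqF.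
have ce : c * e <= (`|c| + 1) * e.
  by rewrite ler_wpM2r ?(ltW e0) //; have := ler_norm c; lra.
rewrite E in ce; lra.
Qed.

(** This and the next properties of H are read off one good tableau at a fine scale, whose height
    function has them up to an error that tends to 0. *)
Lemma H_ge0 x t : inr x -> 0 <= t <= 1 -> 0 <= H x t.
Proof.
move=> xr t01; apply: (@eps_le _ _ 1) => eps e0.
have [n [n0 [_ [T gT]]]] := good_large 0 e0.
have := good_height n0 gT xr t01; rewrite ler_norml => /andP[_].
have : 0 <= et / n%:R * (height T (Num.floor (x * (n%:R / et))) t)%:R.
  by rewrite mulr_ge0 // divr_ge0 // ltW // eta_gt0.
lra.
Qed.

Lemma H_mono x t t' : inr x -> 0 <= t -> t <= t' -> t' <= 1 -> H x t <= H x t'.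
Proof.
move=> xr t0 tt' t1; apply: (@eps_le _ _ 2) => eps e0.
have [n [n0 [_ [T gT]]]] := good_large 0 e0.
have t01 : 0 <= t <= 1 by rewrite t0 (le_trans tt').
have t01' : 0 <= t' <= 1 by rewrite t1 (le_trans t0).
have := good_height n0 gT xr t01; have := good_height n0 gT xr t01'.
have : et / n%:R * (height T (Num.floor (x * (n%:R / et))) t)%:R <=
       et / n%:R * (height T (Num.floor (x * (n%:R / et))) t')%:R.
  by apply: ler_wpM2l; [rewrite divr_ge0 // ltW // eta_gt0|rewrite ler_nat height_le].
rewrite !ler_norml; lra.
Qed.

Lemma H_lipschitz x y t : inr x -> inr y -> 0 <= t <= 1 -> `|H x t - H y t| <= `|x - y|.
Proof.
wlog xy : x y / x <= y => [wl xr yr t01|].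
  have [xy|yx] := leP x y; first exact: wl.
  by rewrite distrC [`|x - y|]distrC; apply: wl => //; exact: ltW.
move=> xr yr t01; apply: (@eps_le _ _ 3) => eps e0.
have [n [n0 [en [T gT]]]] := good_large et e0.
have n0' : 0 < n%:R / et by rewrite divr_gt0 ?ltr0n // eta_gt0.
have fxy : Num.floor (x * (n%:R / et)) <= Num.floor (y * (n%:R / et)).
  by apply: le_floor; rewrite ler_pM2r.
have sl' : sorted geq (dilate n lam) by case/andP: (dilate_partition n0 pl).
have := height_lipschitz sl' t gT.1 fxy.
have := good_height n0 gT xr t01; have := good_height n0 gT yr t01.
set u := (height _ _ _)%:R; set v := (height _ _ _)%:R => h1 h2 h3.
have enp : 0 < et / n%:R by rewrite divr_gt0 ?ltr0n // eta_gt0.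
have h4 : et / n%:R * `|v - u| <= et / n%:R * ((y - x) * (n%:R / et) + 1).
  rewrite ler_pM2l //; apply: (le_trans h3); rewrite intrB.
  have := floor_le (y * (n%:R / et)); have := floorD1_gt (x * (n%:R / et)).
  by rewrite intrD; lra.
have E : et / n%:R * ((y - x) * (n%:R / et) + 1) = (y - x) + et / n%:R.
  by field; rewrite eta_neq0 pnatr_eq0 -lt0n n0.
have h5 : `|et / n%:R * v - et / n%:R * u| <= (y - x) + et / n%:R.
  by rewrite -mulrBr normrM (gtr0_norm enp) -E.
rewrite distrC [`|x - y|]distrC [`|y - x|]ger0_norm ?subr_ge0 //.
move: h1 h2 h5; move: (et / n%:R * v) (et / n%:R * u) => p1 p2.
by rewrite !ler_norml => /andP[h11 h12] /andP[h21 h22] /andP[h51 h52]; apply/andP; split; lra.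
Qed.

Lemma H_zero x : inr x -> H x 0 = 0.
Proof.
move=> xr; have t01 : 0 <= (0 : R) <= 1 by rewrite ?lexx ?ler01.
apply/eqP; rewrite eq_le (H_ge0 xr t01) andbT; apply: (@eps_le _ _ 2) => eps e0.
have [n [n0 [en [T gT]]]] := good_large et e0.
have := good_height n0 gT xr t01; rewrite ler_norml => /andP[h1 _].
have h2 : et / n%:R * (height T (Num.floor (x * (n%:R / et))) 0)%:R <= et / n%:R * 1.
  rewrite ler_wpM2l ?divr_ge0 ?(ltW eta_gt0) // -[1]/(1%:R) ler_nat.
  by apply: height_at0; have [] := gT.
lra.
Qed.

Lemma H_one x : inr x -> H x 1 = (scaled_boundary lam x - `|x|) / 2.
Proof.
move=> xr; have t01 : 0 <= (1 : R) <= 1 by rewrite ?lexx ?ler01.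
apply/eqP; rewrite -subr_eq0 -normr_le0; apply: (@eps_le _ _ 2) => eps e0.
have [n [n0 [en [T gT]]]] := good_large et e0.
have := good_height n0 gT xr t01; set j := Num.floor _.
have enp : 0 < et / n%:R by rewrite divr_gt0 ?ltr0n // eta_gt0.
have n0' : 0 < n%:R :> R by rewrite ltr0n.
have sl' : sorted geq (dilate n lam) by case/andP: (dilate_partition n0 pl).
rewrite (height_at1 _ gT.1).
have := upper_boundary_int R j (dilate_partition n0 pl).
have -> : j%:~R = n%:R * (j%:~R / n%:R) :> R by field; rewrite gt_eqF.
rewrite upper_boundary_dilate // => cE.
have -> : (column (dilate n lam) j)%:R = (n%:R * @upper_boundary R lam (j%:~R / n%:R) - `|j|%:~R) / 2.
  by rewrite cE; field.
have jx : `|x / et - j%:~R / n%:R| <= n%:R^-1.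
  have E : x / et - j%:~R / n%:R = (x * (n%:R / et) - j%:~R) / n%:R.
    by field; rewrite eta_neq0 gt_eqF.
  have d1 : `|x * (n%:R / et) - j%:~R| <= 1.
    have := floor_le (x * (n%:R / et)); have := floorD1_gt (x * (n%:R / et)).
    by rewrite -/j intrD ler_norml; lra.
  rewrite E normrM [`|n%:R^-1|]gtr0_norm ?invr_gt0 //.
  by rewrite -[leRHS]mul1r ler_wpM2r // invr_ge0 ltW.
have h1 := le_trans (upper_boundary_lipschitz lam (x / et) (j%:~R / n%:R)) jx.
have h2 : `| `|x / et| - `|j%:~R / n%:R| | <= n%:R^-1 by apply: le_trans jx; exact: ler_dist_dist.
move=> h3.
have E1 : et / n%:R * ((n%:R * upper_boundary lam (j%:~R / n%:R) - `|j|%:~R) / 2) =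
   (et * upper_boundary lam (j%:~R / n%:R) - et * `|j%:~R / n%:R|) / 2.
  by rewrite normrM [`|n%:R^-1|]gtr0_norm ?invr_gt0 // -intr_norm; field; rewrite gt_eqF.
have E2 : scaled_boundary lam x - `|x| = et * upper_boundary lam (x / et) - et * `|x / et|.
  have -> : et * `|x / et| = `|x|.
    have ei : 0 < et^-1 by rewrite invr_gt0 eta_gt0.
    by rewrite normrM (gtr0_norm ei) mulrCA divff ?mulr1 // eta_neq0.
  by [].
have ep := eta_gt0.
rewrite E1 in h3; rewrite E2.
set u := upper_boundary lam _ in h1 h3 *; set v := upper_boundary lam _ in h1 *.
set y := `|x / et| in h2 *; set z := `|_ / n%:R| in h2 h3.
have k1 : `|et * u - et * v| <= et / n%:R.
  by rewrite -mulrBr normrM gtr0_norm // ler_pM2l // distrC.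
have k2 : `|et * y - et * z| <= et / n%:R by rewrite -mulrBr normrM gtr0_norm // ler_pM2l.
move: k1 k2 h3; rewrite !ler_norml; move: (et * u) (et * v) (et * y) (et * z) => p1 p2 p3 p4.
by lra.
Qed.

End Limit.

Arguments good R lam m a H n eps T : clear implicits.

Lemma sum_by_column (K : pzRingType) (s : seq (int * int)) (lo : int) n (F : int -> K) :
  (forall c, c \in s -> lo <= c.1 < lo + n%:Z) ->
  \sum_(c <- s) F c.1 =
  \sum_(0 <= k < n) (count (fun c => c.1 == (lo + k%:Z)%R) s)%:R * F (lo + k%:Z).
Proof.
elim: s => [|[v v'] s IH] H; first by rewrite big_nil big1 // => k _; rewrite mul0r.
rewrite big_cons IH; last by move=> c' c's; apply: H; rewrite inE c's orbT.
have := H (v, v') (mem_head _ _); rewrite /= => /andP[c1 c2].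
rewrite [RHS](eq_bigr (fun k : nat => (if k == `|v - lo|%N then F (lo + k%:Z) else 0) +
   (count (fun c0 => c0.1 == (lo + k%:Z)%R) s)%:R * F (lo + k%:Z))); last first.
  move=> k _ /=; rewrite natrD mulrDl; congr (_ + _).
  have -> : (v == lo + k%:Z) = (k == `|v - lo|%N) by lia.
  by case: ifP => _; rewrite ?mul1r ?mul0r.
rewrite big_split /= -big_mkcond big_nat1_eq; congr (_ + _).
have -> : (0 <= `|(v - lo)%R| < n)%N by lia.
by congr F; lia.
Qed.

Lemma boxes_dilate_range n lam c : (0 < n)%N -> sorted geq lam -> c \in boxes (dilate n lam) ->
  - (n * size lam)%N%:Z < c.1 < (n * nth 0%N lam 0)%N%:Z.
Proof.
move=> n0 sl /boxes_mem[i [j [jH ->]]]; rewrite /box /=.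
have iN : (i < n * size lam)%N.
  rewrite -size_dilate ltnNge; apply/negP => /(nth_default 0%N) E; move: jH; rewrite E; lia.
move: jH; rewrite nth_dilate // => /andP[j0 jH].
have : (n * nth 0%N lam (i %/ n) <= n * nth 0%N lam 0)%N by rewrite leq_mul2l nth_sorted ?orbT.
lia.
Qed.

Lemma leq_sum3 n1 n2 n3 : [/\ n1 <= (n1 + n2 + n3).+1, n2 <= (n1 + n2 + n3).+1 &
  n3 <= (n1 + n2 + n3).+1]%N.
Proof. by split; lia. Qed.

(** * The area under H at time t, and typical listings *)

Section Area.
Variables (R : realType) (lam : seq nat) (m : nat) (a b : nat -> int) (H : R -> R -> R).
Hypotheses (pl : is_partition lam) (l0 : lam != [::]).
Hypothesis ic : interlacing_coordinates R lam m a b.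
Hypothesis lim : limiting_height lam (a 0%N) (a m) H.

Local Notation et := (Defs.eta R lam).
Local Notation W := (size lam + nth 0%N lam 0)%N.
Local Notation al := (et * (a 0%N)%:~R).
Local Notation inr := (in_range al et W).
Local Notation good := (@good R lam m a H).
Local Notation node := (@node R lam a).

Let sl : sorted geq lam. Proof. by case/andP: pl. Qed.
Let et0 : 0 < et := eta_gt0 R pl l0.

Lemma boxes_dilate_column n c : (0 < n)%N -> c \in boxes (dilate n lam) ->
  n%:Z * a 0%N <= c.1 < n%:Z * a 0%N + (n * W)%N%:Z.
Proof.
move=> n0 /(boxes_dilate_range n0 sl); rewrite (interlacing_first pl ic); lia.
Qed.

Lemma size_boxes_dilate n : ((size (boxes (dilate n lam)))%:R : R) = (n%:R / et) ^+ 2.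
Proof. by rewrite size_boxes sumn_dilate cells_eta. Qed.

Lemma rank_heights n (T : filling R (dilate n lam)) t : (0 < n)%N ->
  (rank T t)%:R / (size (boxes (dilate n lam)))%:R =
  et / n%:R * \sum_(0 <= k < n * W) et / n%:R * (height T (n%:Z * a 0%N + k%:Z) t)%:R.
Proof.
move=> n0; have n0' : n%:R != 0 :> R by rewrite pnatr_eq0 -lt0n.
rewrite size_boxes_dilate -mulr_sumr.
have -> : (rank T t)%:R = \sum_(0 <= k < n * W) (height T (n%:Z * a 0%N + k%:Z) t)%:R :> R.
  pose s := [seq c <- boxes (dilate n lam) | entry T c <= t].
  have -> : (rank T t)%:R = \sum_(c <- s) (1 : R).
    by rewrite sumr_const_seq size_filter.
  rewrite (@sum_by_column R s (n%:Z * a 0%N) (n * W) (fun=> 1)).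
    by apply: eq_bigr => k _; rewrite mulr1 count_filter.
  by move=> c; rewrite mem_filter => /andP[_ cL]; exact: boxes_dilate_column.
by field; rewrite n0' gt_eqF.
Qed.

Lemma rank_deviation n eps (T : filling R (dilate n lam)) t : (0 < n)%N ->
  good n eps T -> 0 <= t <= 1 ->
  `|(rank T t)%:R / (size (boxes (dilate n lam)))%:R - rsumr al et W n (fun x => H x t)|
    <= et * W%:R * eps.
Proof.
move=> n0 gT t01; have n0' : 0 < n%:R :> R by rewrite ltr0n.
rewrite rank_heights // /rsumr -mulrBr -sumrB normrM gtr0_norm ?divr_gt0 //.
have -> : et * W%:R * eps = et / n%:R * \sum_(0 <= k < n * W) eps.
  by rewrite sumr_const_nat subn0 -[eps *+ _]mulr_natl natrM; field; rewrite gt_eqF.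
rewrite ler_pM2l ?divr_gt0 //; apply: (le_trans (ler_norm_sum _ _ _)).
rewrite big_nat [leRHS]big_nat; apply: ler_sum => k /andP[_ kn].
exact: (good_node pl l0 ic n0 gT (ltnW kn) t01).
Qed.

Let B := 1 * et * (et * W%:R).

(** The scaled rank of a good tableau is nearly a Riemann sum of H(., t), hence nearly constant, and
    [rank_concentration] identifies the constant with t. This matches the time of Poissonized
    tableaux with the proportion of inserted boxes. *)
Lemma rsumr_H_limit t : 0 <= t <= 1 ->
  forall n, (0 < n)%N -> `|rsumr al et W n (fun x => H x t) - t| <= B / n%:R.
Proof.
move=> t01.
have LH x y : inr x -> inr y -> `|H x t - H y t| <= 1 * `|x - y|.
  by rewrite mul1r => xr yr; exact: (H_lipschitz pl l0 ic lim).
have [I HI] := rsumr_limit et0 LH ler01; rewrite -/B in HI.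
suff It : I = t by move=> n n0; rewrite -[X in _ - X]It; exact: HI.
apply/eqP; rewrite -subr_eq0 -normr_le0; apply: (@eps_le _ _ _ (et * W%:R + 3)) => eps e0.
pose e := Num.min eps (1 / 2).
have e1 : 0 < e by rewrite lt_min e0 /= divr_gt0.
have e2 : e <= eps by rewrite ge_min lexx.
have e3 : e <= 1 / 2 by rewrite ge_min lexx orbT.
have [n1 H1] := lim_good lim e1; have [n2 H2] := eventually_small B e1.
have [n3 H3] := eventually_small 1 e1.
have [nn1 nn2 nn3] := leq_sum3 n1 n2 n3; have n0 : (0 < (n1 + n2 + n3).+1)%N by [].
move: (n1 + n2 + n3).+1 nn1 nn2 nn3 n0 => n nn1 nn2 nn3 n0.
have [A [mA lA HA]] := H1 n nn1 n0.
have N0 : (0 < size (boxes (dilate n lam)))%N.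
  by rewrite size_boxes sumn_dilate muln_gt0 expn_gt0 n0 (sumn_gt0 pl l0).
have [sl' _] := andP (dilate_partition n0 pl).
have d1 : e < 1 by lra.
have := @rank_concentration R (dilate n lam) A t I (et * W%:R * e + e) e mA sl' t01 N0 lA d1.
have hyp : forall T, poissonized_tableau T -> ~ A T ->
    `|(rank T t)%:R / (size (boxes (dilate n lam)))%:R - I| <= et * W%:R * e + e.
  move=> T tT nA; have gT := HA T tT nA.
  have h1 := rank_deviation n0 gT t01.
  have h2 : `|rsumr al et W n (fun x => H x t) - I| <= e.
    exact: le_trans (HI n n0) (H2 _ nn2 n0).
  apply: le_trans (lerD h1 h2); apply: le_trans (ler_normD _ _).
  by rewrite addrA subrK.
move=> /(_ hyp) => h; apply: (le_trans h).
have h3 : (size (boxes (dilate n lam)))%:R^-1 <= e.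
  apply: le_trans (H3 n nn3 n0).
  rewrite mul1r lef_pV2 ?posrE ?ltr0n // ler_nat size_boxes sumn_dilate expnS expn1 -mulnA.
  by rewrite leq_pmulr // muln_gt0 n0 (sumn_gt0 pl l0).
have w0 : 0 <= et * W%:R by rewrite mulr_ge0 // ltW.
have : et * W%:R * e <= et * W%:R * eps by rewrite ler_wpM2l.
rewrite mulrDl; lra.
Qed.

Lemma area_H t : 0 <= t <= 1 -> is_riemann al et W (fun x => (H x t)%:C) t%:C.
Proof.
move=> t01; exists B => n n0.
have -> : rsum al et W n (fun x => (H x t)%:C) = (rsumr al et W n (fun x => H x t))%:C.
  by rewrite /rsum /rsumr [RHS]rmorphM rmorph_sum.
by rewrite -rmorphB cabs_real; exact: rsumr_H_limit.
Qed.

(** The listing follows H at all times: [K] boxes, a proportion close to t, are inserted by time t,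
    and their column counts are close to H. Entries no longer occur, so averages over linear
    extensions apply. *)
Definition ok_listing n eps (s : seq (int * int)) := forall t, 0 <= t <= 1 ->
  exists K, [/\ (K <= size s)%N,
    `|K%:R / (n%:R / et) ^+ 2 - t| <= eps &
    forall k, (k < n * W)%N ->
      `|et / n%:R * (count (fun c => c.1 == (n%:Z * a 0%N + k%:Z)%R) (take K s))%:R
        - H (node n k) t| <= eps].

(** A tableau outside the bad event certifies its listing, so the simplex of a listing that is not
    ok lies in the bad event; [count_cells_in] counts such listings. *)
Lemma good_listing eps : 0 < eps -> exists n0, forall n, (n0 <= n)%N -> (0 < n)%N ->
  (count (fun s => ~~ `[< ok_listing n eps s >]) (linear_extensions (dilate n lam)))%:R
    <= eps * (size (linear_extensions (dilate n lam)))%:R.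
Proof.
move=> ep; have w0 : 0 <= et * W%:R by rewrite mulr_ge0 // ltW.
pose e := Num.min eps (eps / (2 * (et * W%:R + 1))).
have e1 : 0 < e by rewrite lt_min ep /= divr_gt0 // mulr_gt0 // ltr_wpDl.
have e2 : e <= eps by rewrite ge_min lexx.
have e3 : et * W%:R * e <= eps / 2.
  have : e <= eps / (2 * (et * W%:R + 1)) by rewrite ge_min lexx orbT.
  rewrite ler_pdivlMr; last by rewrite mulr_gt0 // ltr_wpDl.
  by nra.
have eh : 0 < eps / 2 by rewrite divr_gt0.
have [n1 H1] := lim_good lim e1; have [n2 H2] := eventually_small B eh.
exists (n1 + n2)%N => n n12 n0.
have nn1 : (n1 <= n)%N by apply: leq_trans n12; exact: leq_addr.
have nn2 : (n2 <= n)%N by apply: leq_trans n12; exact: leq_addl.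
have [A [mA lA HA]] := H1 n nn1 n0.
have [sl' _] := andP (dilate_partition n0 pl).
have := @count_cells_in R (dilate n lam) A mA sl' => h.
apply: le_trans (le_trans h _); last by rewrite ler_wpM2r // (le_trans lA).
rewrite ler_nat -!size_filter; apply: uniq_leq_size; first by rewrite !filter_uniq // permutations_uniq.
move=> s; rewrite !mem_filter => /andP[/negP nok sE]; rewrite sE andbT.
apply/asboolP => T cT; apply: contrapT => nA; apply: nok; apply/asboolP => t t01.
have sE' : s \in linear_extensions (dilate n lam) by rewrite mem_filter.
have sL := linear_extension_perm sE'.
have tT : poissonized_tableau T by apply/tableau_cells; exists s.
have gT := HA T tT nA.
have srt : sorted <%R [seq entry T c | c <- s] by case: cT.
have rk : rank T t = count (fun c => entry T c <= t) s by rewrite /rank -(seq.permP sL).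
exists (rank T t); split.
- by rewrite rk count_size.
- rewrite -size_boxes_dilate.
  have h1 := rank_deviation n0 gT t01.
  have h2 : `|rsumr al et W n (fun x => H x t) - t| <= eps / 2.
    exact: le_trans (rsumr_H_limit t01 n0) (H2 _ nn2 n0).
  have := ler_normD ((rank T t)%:R / (size (boxes (dilate n lam)))%:R - rsumr al et W n (fun x => H x t)) (rsumr al et W n (fun x => H x t) - t).
  by rewrite addrA subrK; lra.
move=> k kn; rewrite rk -(sorted_count_take _ _ srt).
have := good_node pl l0 ic n0 gT (ltnW kn) t01.
by rewrite /height -(seq.permP sL); lra.
Qed.

End Area.

(** * Evolution of the Cauchy transform *)

Section ComplexExp.
Variable R : realType.
Implicit Types (x a b : R) (z w : R[i]).

Lemma abs_sin_le x : `|sin x| <= `|x|.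
Proof.
wlog x0 : x / 0 <= x => [wl|].
  have [/wl//|x0] := leP 0 x; have := wl (- x); rewrite sinN !normrN; apply; lra.
have [c _] := @MVT_segment R sin cos 0 x x0 (fun y _ => is_derive_sin y) (continuous_subspaceT (@continuous_sin R)).
rewrite sin0 !subr0 => ->; rewrite normrM ler_piMl // cos_max //.
Qed.

Lemma abs_cos_le x : `|cos x - 1| <= x ^+ 2.
Proof.
wlog x0 : x / 0 <= x => [wl|].
  have [/wl//|x0] := leP 0 x; have := wl (- x); rewrite cosN sqrrN; apply; lra.
have [c] := @MVT_segment R cos (fun y => - sin y) 0 x x0 (fun y _ => is_derive_cos y) (continuous_subspaceT (@continuous_cos R)).
rewrite in_itv /= => /andP[c0 cx]; rewrite cos0 subr0 => ->.
rewrite normrM normrN expr2 (ger0_norm x0) ler_wpM2r //.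
by apply: le_trans (abs_sin_le _) _; rewrite ger0_norm.
Qed.

Lemma abs_sin_sub_le x : `|x| <= 1 -> `|sin x - x| <= x ^+ 2.
Proof.
wlog x0 : x / 0 <= x => [wl|].
  have [/wl//|x0] := leP 0 x; have := wl (- x); rewrite sinN sqrrN -opprD !normrN; apply; lra.
rewrite ger0_norm // => x1.
have d (y : R) : is_derive y 1 (fun u : R => sin u - u) (cos y - 1).
  exact: is_deriveB.
have cf : continuous (fun u : R => sin u - u).
  by move=> y; apply: differentiable_continuous; apply/derivable1_diffP; case: (d y).
have [c] := @MVT_segment R (fun y => sin y - y) (fun y => cos y - 1) 0 x x0 (fun y _ => d y) (continuous_subspaceT cf).
rewrite in_itv /= => /andP[c0 cx]; rewrite sin0 !subr0 => ->.
rewrite normrM (ger0_norm x0); apply: (@le_trans _ _ (c ^+ 2 * x)).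
  by rewrite ler_wpM2r // abs_cos_le.
by nra.
Qed.

Lemma expR_taylor a : `|a| <= 1 / 2 -> `|expR a - 1 - a| <= 2 * a ^+ 2.
Proof.
rewrite ler_norml => /andP[a1 a2].
have h1 := expR_ge1Dx a; have h2 := expR_ge1Dx (- a).
have e0 := expR_gt0 a.
have h3 : expR a * (1 - a) <= 1.
  by rewrite -[leRHS](expRxMexpNx_1 a) ler_pM2l.
have h4 : expR a <= 1 + a + 2 * a ^+ 2 by nra.
by rewrite ler_norml; nra.
Qed.

Definition cexp z : R[i] := Complex (expR (complex.Re z) * cos (complex.Im z)) (expR (complex.Re z) * sin (complex.Im z)).

Lemma cexp0 : cexp 0 = 1.
Proof. by apply: complex_ext; rewrite /cexp /= expR0 ?cos0 ?sin0 ?mul1r. Qed.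

Lemma cexpD z w : cexp (z + w) = cexp z * cexp w.
Proof.
apply: complex_ext; rewrite ?ReM ?ImM /cexp /= ReD ImD expRD ?cosD ?sinD; ring.
Qed.

Lemma cabs_cexp z : cabs (cexp z) = expR (complex.Re z).
Proof.
apply: (@pexpIrn _ 2) => //; rewrite ?nnegrE ?cabs_ge0 ?expR_ge0 // cabs_sqr /cexp /=.
by rewrite !exprMn -mulrDr cos2Dsin2 mulr1.
Qed.

Lemma cabs_cexp_le z : cabs (cexp z) <= expR (cabs z).
Proof. by rewrite cabs_cexp ler_expR (le_trans (ler_norm _) (abs_Re _)). Qed.

Lemma cexp_taylor z : cabs z <= 1 / 2 -> cabs (cexp z - 1 - z) <= 4 * cabs z ^+ 2.
Proof.
move=> z2; rewrite cabs_sqr; have ha := le_trans (abs_Re z) z2; have hb := le_trans (abs_Im z) z2.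
apply: le_trans (cabs_le_ReIm _) _; rewrite !ReB !ImB /cexp /=.
move: (complex.Re z) (complex.Im z) ha hb => x y ha hb.
have e1 := expR_taylor ha; have c1 := abs_cos_le y; have s1 := abs_sin_le y.
have hb' : `|y| <= 1 by lra.
have s2 := abs_sin_sub_le hb'.
have e0 := expR_gt0 x.
have x2 : x ^+ 2 = `|x| * `|x| by rewrite -expr2 real_normK // num_real.
have y2 : y ^+ 2 = `|y| * `|y| by rewrite -expr2 real_normK // num_real.
have nx := normr_ge0 x; have ny := normr_ge0 y.
have e2 : `|expR x - 1| <= 2 * `|x|.
  have -> : expR x - 1 = (expR x - 1 - x) + x by ring.
  apply: le_trans (ler_normD _ _) _; rewrite x2 in e1; nra.
have e3 : expR x <= 2.
  have := ler_norm (expR x - 1); lra.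
have r1 : `|expR x * cos y - 1 - x| <= 2 * x ^+ 2 + 2 * y ^+ 2.
  have -> : expR x * cos y - 1 - x = (expR x - 1 - x) + expR x * (cos y - 1) by ring.
  apply: le_trans (ler_normD _ _) _; rewrite normrM gtr0_norm //.
  apply: lerD => //; apply: ler_pM => //; exact: ltW.
have r2 : `|expR x * sin y - 0 - y| <= 2 * `|x| * `|y| + y ^+ 2.
  have -> : expR x * sin y - 0 - y = (expR x - 1) * sin y + (sin y - y) by ring.
  apply: le_trans (ler_normD _ _) _; rewrite normrM.
  by apply: lerD => //; apply: ler_pM.
by rewrite x2 y2 in r1 r2 *; nra.
Qed.

Lemma cexp_lipschitz z w : cabs (z - w) <= 1 / 2 ->
  cabs (cexp z - cexp w) <= 3 * expR (cabs w) * cabs (z - w).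
Proof.
move=> zw; have -> : cexp z - cexp w = cexp w * (cexp (z - w) - 1).
  by rewrite mulrBr mulr1 -cexpD [w + _]addrC subrK.
rewrite cabsM mulrAC mulrC; apply: ler_pM; rewrite ?cabs_ge0 //; last exact: cabs_cexp_le.
have -> : cexp (z - w) - 1 = (cexp (z - w) - 1 - (z - w)) + (z - w) by rewrite subrK.
apply: le_trans (cabsD _ _) _; have := cexp_taylor zw; have := cabs_ge0 (z - w); nra.
Qed.

(** Each factor differs from exp(-q) by at most 4 d^2 and the others are bounded by exp(d). With
    about N factors and d of order 1/N the total error is of order 1/N. *)
Lemma prod_cexp (s : seq R[i]) (d : R) : d <= 1 / 2 -> (forall q, q \in s -> cabs q <= d) ->
  cabs (\prod_(q <- s) (1 - q) - cexp (- \sum_(q <- s) q)) <=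
  (size s)%:R * (4 * d ^+ 2) * expR ((size s)%:R * d).
Proof.
move=> d2; elim: s => [|q s IH] H.
  by rewrite !big_nil oppr0 cexp0 subrr cabs0 !mul0r.
have qd : cabs q <= d by apply: H; rewrite mem_head.
have d0 : 0 <= d by apply: le_trans qd; exact: cabs_ge0.
have Hs : forall q, q \in s -> cabs q <= d by move=> q' q's; apply: H; rewrite inE q's orbT.
have {IH} IH := IH Hs; rewrite !big_cons opprD cexpD.
set P := \prod_(_ <- _) _ in IH *; set S := \sum_(_ <- _) _ in IH *.
have -> : (1 - q) * P - cexp (- q) * cexp (- S) =
   (1 - q) * (P - cexp (- S)) - (cexp (- q) - 1 - (- q)) * cexp (- S) by ring.
apply: le_trans (cabsB _ _) _; rewrite !cabsM.
have b1 : cabs (1 - q) <= expR d.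
  apply: le_trans (cabsB _ _) _; rewrite cabs1.
  by apply: le_trans (expR_ge1Dx d); rewrite lerD2l.
have b2 : cabs (cexp (- q) - 1 - - q) <= 4 * d ^+ 2.
  apply: le_trans (cexp_taylor _) _; first by rewrite cabsN (le_trans qd).
  by rewrite cabsN ler_pM2l // ler_pXn2r ?nnegrE ?cabs_ge0.
have b3 : cabs (cexp (- S)) <= expR ((size s)%:R * d).
  apply: le_trans (cabs_cexp_le _) _; rewrite cabsN ler_expR.
  apply: le_trans (cabs_sum _ _) _; rewrite mulr_natl -sumr_const_seq big_seq [leRHS]big_seq.
  by apply: ler_sum => q' q's; exact: Hs.
rewrite /= -natr1; move: (size s)%:R (ler0n R (size s)) IH b3 => n n0 IH b3.
have -> : (n + 1) * d = d + n * d by ring.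
rewrite expRD; have e1 : 1 <= expR d by apply: le_trans (expR_ge1Dx d); rewrite lerDl.
have e2 : 0 < expR (n * d) := expR_gt0 _.
have e0 : 0 <= expR d := expR_ge0 _.
have k1 : cabs (1 - q) * cabs (P - cexp (- S)) <= expR d * (n * (4 * d ^+ 2) * expR (n * d)).
  by apply: ler_pM; rewrite ?cabs_ge0.
have k2 : cabs (cexp (- q) - 1 - - q) * cabs (cexp (- S)) <= (4 * d ^+ 2) * expR (n * d).
  by apply: ler_pM; rewrite ?cabs_ge0.
have k3 : (4 * d ^+ 2) * expR (n * d) <= expR d * ((4 * d ^+ 2) * expR (n * d)).
  have p1 : 0 <= 4 * d ^+ 2 by have := sqr_ge0 d; lra.
  by apply: ler_peMl => //; apply: mulr_ge0 => //; exact: ltW.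
apply: le_trans (lerD k1 (le_trans k2 k3)) _.
by rewrite le_eqVlt; apply/orP; left; apply/eqP; ring.
Qed.

Lemma cabs_prod_le (s : seq R[i]) (d : R) : (forall q, q \in s -> cabs q <= d) ->
  cabs (\prod_(q <- s) (1 - q)) <= expR ((size s)%:R * d).
Proof.
elim: s => [|q s IH] H; first by rewrite big_nil cabs1 mul0r expR0.
have qd : cabs q <= d by apply: H; rewrite mem_head.
rewrite big_cons cabsM /= -natr1 mulrDl mul1r [(size s)%:R * d + d]addrC expRD.
apply: ler_pM; rewrite ?cabs_ge0 //; last by apply: IH => q' q's; apply: H; rewrite inE q's orbT.
apply: le_trans (cabsB _ _) _; rewrite cabs1.
by apply: le_trans (expR_ge1Dx d); rewrite lerD2l.
Qed.

End ComplexExp.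

(** * Resolvents and averaging estimates *)

Section Kernels.
Variable R : realType.
Implicit Types (z : R[i]) (x y : R) (s : seq (int * int)).

Definition resolvent z x : R[i] := (z - x%:C)^-1.

Lemma Im_sub z x : complex.Im (z - x%:C) = complex.Im z.
Proof. by rewrite ImB ImC subr0. Qed.

Lemma resolvent_neq0 z x : 0 < complex.Im z -> z - x%:C != 0.
Proof. by move=> y0; apply: contraTneq y0 => E; rewrite -(Im_sub z x) E ltxx. Qed.

Lemma cabs_resolvent z x e : 0 < e -> e <= complex.Im z -> cabs (resolvent z x) <= e^-1.
Proof.
move=> e0 ez; apply: cabs_inv_le => //; apply: le_trans ez _.
by rewrite -(Im_sub z x) (le_trans (ler_norm _) (abs_Im _)).
Qed.

Lemma resolventB z z' x x' : 0 < complex.Im z -> 0 < complex.Im z' ->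
  resolvent z x - resolvent z' x' =
  ((z' - z) + (x - x')%:C) * (resolvent z x * resolvent z' x').
Proof.
move=> y0 y0'; rewrite /resolvent rmorphB; field.
by rewrite !resolvent_neq0.
Qed.

Lemma resolvent_lipschitz z x x' e : 0 < e -> e <= complex.Im z ->
  cabs (resolvent z x - resolvent z x') <= e ^- 2 * `|x - x'|.
Proof.
move=> e0 ez; have y0 := lt_le_trans e0 ez.
rewrite resolventB // subrr add0r !cabsM cabs_real mulrC expr2 invfM.
by apply: ler_wpM2r => //; apply: ler_pM; rewrite ?cabs_ge0 // cabs_resolvent.
Qed.

Lemma sum_take_diff s (f : int * int -> R[i]) (M : R) k K :
  (forall c, c \in s -> cabs (f c) <= M) -> (k <= size s)%N -> (K <= size s)%N ->
  cabs (\sum_(c <- take k s) f c - \sum_(c <- take K s) f c) <= M * `|k%:R - K%:R|.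
Proof.
move=> fM; wlog kK : k K / (k <= K)%N => [wl kN KN|kN KN].
  have [/wl|/ltnW/wl h] := leqP k K; first exact.
  by rewrite cabsBC distrC; exact: h.
have -> : take K s = take k s ++ drop k (take K s).
  by rewrite -{1}(cat_take_drop k (take K s)) -take_min (minn_idPl kK).
rewrite big_cat /= opprD addrA subrr add0r cabsN.
have sz : size (drop k (take K s)) = (K - k)%N by rewrite size_drop size_takel.
apply: le_trans (cabs_sum _ _) _.
rewrite distrC ger0_norm ?subr_ge0 ?ler_nat // -natrB // -sz mulr_natr -sumr_const_seq.
rewrite big_seq [leRHS]big_seq; apply: ler_sum => c cs; apply: fM.
by apply: mem_take; apply: mem_drop cs.
Qed.

(** Typical listings give the bound [e]; the exceptional ones have proportion at most [d] and the
    crude bound [M]. *)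
Lemma mean_close (T : eqType) (S : seq T) (P : pred T) (f : T -> R[i]) (L : R[i]) (e M d : R) :
  (0 < size S)%N -> 0 <= e -> 0 <= M ->
  (forall u, u \in S -> P u -> cabs (f u - L) <= e) ->
  (forall u, u \in S -> cabs (f u - L) <= M) ->
  (count (predC P) S)%:R <= d * (size S)%:R ->
  cabs ((size S)%:R^-1 * \sum_(u <- S) f u - L) <= e + M * d.
Proof.
move=> S0 e0 M0 Pe PM cd; have S0' : 0 < (size S)%:R :> R by rewrite ltr0n.
have nC : (size S)%:R = ((size S)%:R : R)%:C :> R[i] by rewrite rmorph_nat.
have S1 : (size S)%:R != 0 :> R[i] by rewrite pnatr_eq0 -lt0n.
have -> : (size S)%:R^-1 * \sum_(u <- S) f u - L = (size S)%:R^-1 * \sum_(u <- S) (f u - L).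
  by rewrite sumrB sumr_const_seq -[L *+ _]mulr_natl mulrBr mulrA mulVf // mul1r.
rewrite cabsM cabsV nC cabs_real gtr0_norm // mulrC ler_pdivrMr //.
apply: le_trans (cabs_sum _ _) _.
apply: (@le_trans _ _ (\sum_(u <- S) (e + M * (~~ P u)%:R))).
  rewrite big_seq [leRHS]big_seq; apply: ler_sum => u uS.
  case: (boolP (P u)) => ps; first by rewrite mulr0 addr0 Pe.
  by rewrite mulr1; apply: le_trans (PM u uS) _; rewrite lerDr.
rewrite big_split /= sumr_const_seq -mulr_sumr -[e *+ _]mulr_natr mulrDl lerD2l -mulrA.
apply: ler_wpM2l => //; apply: le_trans cd.
by rewrite -sum1_count natr_sum [leRHS]big_mkcond /=; apply: ler_sum => u _; case: (P u).
Qed.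

Lemma harmonic_estimate (k1 k2 : nat) : (0 < k1)%N -> (k1 <= k2)%N ->
  `|\sum_(k1 <= k < k2) k.+1%:R^-1 - (k2 - k1)%N%:R / k1%:R| <= ((k2 - k1)%N%:R / k1%:R) ^+ 2 :> R.
Proof.
move=> k10 k12; have k1p : 0 < k1%:R :> R by rewrite ltr0n.
have -> : (k2 - k1)%N%:R / k1%:R = \sum_(k1 <= k < k2) k1%:R^-1 :> R.
  by rewrite sumr_const_nat -[RHS]mulr_natl.
rewrite -sumrB; apply: le_trans (ler_norm_sum _ _ _) _.
rewrite [X in X ^+ 2]sumr_const_nat -[X in X ^+ 2]mulr_natl.
have -> : ((k2 - k1)%N%:R * k1%:R^-1) ^+ 2 = \sum_(k1 <= k < k2) ((k2 - k1)%N%:R / k1%:R ^+ 2) :> R.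
  by rewrite sumr_const_nat -[RHS]mulr_natl; field; rewrite gt_eqF.
rewrite big_nat [leRHS]big_nat; apply: ler_sum => k /andP[kk1 kk2].
have kp : 0 < k.+1%:R :> R by rewrite ltr0n.
have -> : k.+1%:R^-1 - k1%:R^-1 = - ((k.+1%:R - k1%:R) / (k.+1%:R * k1%:R)) :> R.
  by field; rewrite !gt_eqF.
have kk : k1%:R <= k.+1%:R :> R by rewrite ler_nat leqW.
have pp : 0 < k.+1%:R * k1%:R :> R by rewrite mulr_gt0.
rewrite normrN ger0_norm; last by rewrite divr_ge0 ?subr_ge0 // ltW.
have h1 : k.+1%:R - k1%:R <= (k2 - k1)%N%:R :> R.
  by rewrite natrB // lerD2r ler_nat.
have h2 : (k.+1%:R * k1%:R)^-1 <= (k1%:R ^+ 2)^-1 :> R.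
  by rewrite lef_pV2 ?posrE ?exprn_gt0 // expr2 ler_wpM2r // ltW.
by apply: ler_pM; rewrite ?subr_ge0 // invr_ge0 ltW.
Qed.

End Kernels.

(** * Integrals of kernels against H as limits of sums over prefixes *)

Section KernelLimit.
Variables (R : realType) (lam : seq nat) (m : nat) (a b : nat -> int) (H : R -> R -> R).
Hypotheses (pl : is_partition lam) (l0 : lam != [::]).
Hypothesis ic : interlacing_coordinates R lam m a b.
Hypothesis lim : limiting_height lam (a 0%N) (a m) H.

Local Notation et := (Defs.eta R lam).
Local Notation W := (size lam + nth 0%N lam 0)%N.
Local Notation al := (et * (a 0%N)%:~R).
Local Notation inr := (in_range al et W).
Local Notation node := (@node R lam a).
Local Notation ok n := (@ok_listing R lam a H n).
Local Notation LE n := (linear_extensions (dilate n lam)).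

Let sl : sorted geq lam. Proof. by case/andP: pl. Qed.
Let et0 : 0 < et := eta_gt0 R pl l0.

Definition transform (t : R) (g : R -> R[i]) : R[i] :=
  riemann al et W (fun x => (H x t)%:C * g x).

Definition kernel (g : R -> R[i]) (M C : R) :=
  (forall x, cabs (g x) <= M) /\ (forall x x', cabs (g x - g x') <= C * `|x - x'|).

Lemma kernel_ge0 g M C : kernel g M C -> 0 <= M /\ 0 <= C.
Proof.
move=> [h1 h2]; split; first exact: le_trans (cabs_ge0 _) (h1 0).
have := le_trans (cabs_ge0 _) (h2 1 0); by rewrite subr0 normr1 mulr1.
Qed.

Lemma range_left : inr al.
Proof. by rewrite /in_range lexx lerDl mulr_ge0 // ltW. Qed.

Lemma H_bounded : exists2 B, 0 <= B & forall x t, inr x -> 0 <= t <= 1 -> `|H x t| <= B.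
Proof.
exists (`|H al 1| + et * W%:R); first by rewrite addr_ge0 // mulr_ge0 // ltW.
move=> x t xr t01; have t1 : 0 <= (1 : R) <= 1 by rewrite ler01 lexx.
have h0 := H_ge0 pl l0 ic lim xr t01; rewrite ger0_norm //.
have h1 : H x t <= H x 1 by case/andP: t01 => *; exact: (H_mono pl l0 ic lim).
have h2 := H_lipschitz pl l0 ic lim xr range_left t1.
have h3 : `|x - al| <= et * W%:R by case/andP: xr => *; rewrite ger0_norm; lra.
have := ler_norm (H x 1 - H al 1); have := ler_norm (H al 1); lra.
Qed.

Lemma kernel_transform t g M C : 0 <= t <= 1 -> kernel g M C ->
  is_riemann al et W (fun x => (H x t)%:C * g x) (transform t g).
Proof.
move=> t01 kg; have [M0 C0] := kernel_ge0 kg; have [gM gC] := kg.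
have [B B0 HB] := H_bounded.
apply: (riemannP et0 (C := B * C + M)); last by rewrite addr_ge0 // mulr_ge0.
move=> x y xr yr.
have -> : (H x t)%:C * g x - (H y t)%:C * g y =
  (H x t)%:C * (g x - g y) + (H x t - H y t)%:C * g y by rewrite rmorphB; ring.
apply: le_trans (cabsD _ _) _; rewrite !cabsM !cabs_real mulrDl; apply: lerD.
  by rewrite -mulrA; apply: ler_pM; rewrite ?cabs_ge0 // HB.
by rewrite mulrC; apply: ler_pM; rewrite ?cabs_ge0 // (H_lipschitz pl l0 ic lim).
Qed.

Lemma transform_ext t g h : (forall x, g x = h x) -> transform t g = transform t h.
Proof. by move=> E; congr riemann; apply/funext => x; rewrite E. Qed.

(** Three errors: the prefix of length [k] against the length [K] attached to t, the column counts
    against H, and the Riemann sum against its limit. *)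
Lemma transform_limit t g M C : 0 <= t <= 1 -> kernel g M C ->
  exists2 B, 0 <= B & forall n eps s k, (0 < n)%N -> 0 <= eps -> s \in LE n -> ok n eps s -> (k <= size s)%N ->
  cabs (((n%:R / et) ^- 2)%:C * \sum_(c <- take k s) g (et / n%:R * c.1%:~R) - transform t g) <=
  B / n%:R + et * W%:R * M * eps + M * (`|k%:R / (n%:R / et) ^+ 2 - t| + eps).
Proof.
move=> t01 kg; have [M0 C0] := kernel_ge0 kg; have [gM gC] := kg.
have [B HB] := kernel_transform t01 kg.
exists `|B| => // n eps s k n0 e0 sE okE kN.
have n0' : 0 < n%:R :> R by rewrite ltr0n.
have dn : 0 < et / n%:R by rewrite divr_gt0.
have N0 : 0 < (n%:R / et) ^+ 2 by rewrite exprn_gt0 // divr_gt0.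
have [K [KN Kt Kh]] := okE t t01.
have sL := linear_extension_perm sE.
pose S j := \sum_(c <- take j s) g (et / n%:R * c.1%:~R).
rewrite -/(S k).
have h1 : cabs (((n%:R / et) ^- 2)%:C * S k - ((n%:R / et) ^- 2)%:C * S K) <=
    M * (`|k%:R / (n%:R / et) ^+ 2 - t| + eps).
  rewrite -mulrBr cabsM cabs_real gtr0_norm ?invr_gt0 // mulrC ler_pdivrMr //.
  have := @sum_take_diff R s (fun c => g (et / n%:R * c.1%:~R)) M k K (fun c _ => gM _) kN KN.
  move=> /le_trans; apply; rewrite -mulrA; apply: ler_wpM2l => //.
  have -> : `|k%:R - K%:R| = `|k%:R / (n%:R / et) ^+ 2 - K%:R / (n%:R / et) ^+ 2| * (n%:R / et) ^+ 2.
    by rewrite -mulrBl normrM [`|_^-1|]gtr0_norm ?invr_gt0 // divfK // gt_eqF.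
  rewrite ler_pM2r //.
  have := ler_normB (k%:R / (n%:R / et) ^+ 2 - t) (K%:R / (n%:R / et) ^+ 2 - t).
  by rewrite opprB addrA subrK; lra.
have h2 : cabs (((n%:R / et) ^- 2)%:C * S K - rsum al et W n (fun x => (H x t)%:C * g x)) <=
    et * W%:R * M * eps.
  have -> : S K = \sum_(0 <= j < n * W) (count (fun c => c.1 == (n%:Z * a 0%N + j%:Z)%R) (take K s))%:R * g (node n j).
    rewrite /S (@sum_by_column _ (take K s) (n%:Z * a 0%N) (n * W) (fun u => g (et / n%:R * u%:~R))).
      apply: eq_bigr => j _; congr (_ * g _).
      by rewrite /node intrD intrM -!pmulrn; field; rewrite gt_eqF.
    move=> c /mem_take; rewrite (perm_mem sL).
    exact: (boxes_dilate_column pl l0 ic n0).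
  rewrite /rsum.
  have -> : ((n%:R / et) ^- 2)%:C = (et / n%:R)%:C * (et / n%:R)%:C.
    by rewrite -rmorphM; congr (_%:C); field; rewrite !gt_eqF.
  rewrite -mulrA -mulrBr cabsM cabs_real gtr0_norm // mulr_sumr -sumrB.
  have -> : et * W%:R * M * eps = et / n%:R * \sum_(0 <= j < n * W) (eps * M).
    by rewrite sumr_const_nat subn0 -[_ *+ (n * W)]mulr_natl natrM; field; rewrite gt_eqF.
  rewrite ler_pM2l //; apply: le_trans (cabs_sum _ _) _.
  rewrite big_nat [leRHS]big_nat; apply: ler_sum => j /andP[_ jN].
  have hj := Kh j jN.
  rewrite mulrA -mulrBl cabsM; apply: ler_pM; rewrite ?cabs_ge0 //.
  have -> : (count (fun c => c.1 == (n%:Z * a 0%N + j%:Z)%R) (take K s))%:R =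
     ((count (fun c => c.1 == (n%:Z * a 0%N + j%:Z)%R) (take K s))%:R : R)%:C :> R[i] by rewrite rmorph_nat.
  by rewrite -rmorphM -rmorphB cabs_real.
have h3 : cabs (rsum al et W n (fun x => (H x t)%:C * g x) - transform t g) <= `|B| / n%:R.
  by apply: le_trans (HB n n0) _; rewrite ler_pM2r ?invr_gt0 // ler_norm.
have := cabsD (((n%:R / et) ^- 2)%:C * S k - ((n%:R / et) ^- 2)%:C * S K)
  (((n%:R / et) ^- 2)%:C * S K - rsum al et W n (fun x => (H x t)%:C * g x) + (rsum al et W n (fun x => (H x t)%:C * g x) - transform t g)).
have := cabsD (((n%:R / et) ^- 2)%:C * S K - rsum al et W n (fun x => (H x t)%:C * g x)) (rsum al et W n (fun x => (H x t)%:C * g x) - transform t g).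
rewrite !addrA !subrK; lra.
Qed.

Lemma transform_bound t g M C : 0 <= t <= 1 -> kernel g M C -> cabs (transform t g) <= t * M.
Proof.
move=> t01 kg; have [M0 C0] := kernel_ge0 kg; have [gM gC] := kg.
have h := kernel_transform t01 kg.
have h2 := is_riemannZ M%:C (area_H pl l0 ic lim t01).
have -> : t * M = complex.Re (M%:C * t%:C) by rewrite -rmorphM ReC mulrC.
apply: (is_riemann_bound et0 h h2) => x xr.
have h0 := H_ge0 pl l0 ic lim xr t01.
by rewrite cabsM cabs_real -rmorphM ReC mulrC ger0_norm // ler_wpM2r.
Qed.

(** H increases in t, so the growth t' - t of the area is the integral of |H(x, t') - H(x, t)|. *)
Lemma transform_diff_bound t t' g M C : 0 <= t -> t <= t' -> t' <= 1 -> kernel g M C ->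
  cabs (transform t' g - transform t g) <= (t' - t) * M.
Proof.
move=> t0 tt' t1 kg; have [M0 C0] := kernel_ge0 kg; have [gM gC] := kg.
have t01 : 0 <= t <= 1 by rewrite t0 (le_trans tt').
have t01' : 0 <= t' <= 1 by rewrite t1 (le_trans t0).
have h := is_riemannB et0 (kernel_transform t01' kg) (kernel_transform t01 kg).
have h2 := is_riemannZ M%:C (is_riemannB et0 (area_H pl l0 ic lim t01') (area_H pl l0 ic lim t01)).
have -> : (t' - t) * M = complex.Re (M%:C * (t'%:C - t%:C)) by rewrite -rmorphB -rmorphM ReC mulrC.
apply: (is_riemann_bound et0 h h2) => x xr.
rewrite -mulrBl -rmorphB -rmorphM ReC cabsM cabs_real mulrC.
have hm := H_mono pl l0 ic lim xr t0 tt' t1.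
by rewrite ger0_norm ?subr_ge0 // ler_wpM2r // subr_ge0.
Qed.

Lemma transformD t g h M C M' C' : 0 <= t <= 1 -> kernel g M C -> kernel h M' C' ->
  transform t (fun x => g x + h x) = transform t g + transform t h.
Proof.
move=> t01 kg kh; have [gM gC] := kg; have [hM hC] := kh.
have k : kernel (fun x => g x + h x) (M + M') (C + C').
  split=> [x|x x']; first by apply: le_trans (cabsD _ _) _; exact: lerD.
  by rewrite opprD addrACA mulrDl; apply: le_trans (cabsD _ _) _; exact: lerD.
apply: (is_riemann_unique (kernel_transform t01 k)).
apply: (is_riemann_ext et0 _ (is_riemannD (kernel_transform t01 kg) (kernel_transform t01 kh))).
by move=> x _ /=; rewrite mulrDr.
Qed.

Lemma transformZ t c g M C : 0 <= t <= 1 -> kernel g M C ->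
  transform t (fun x => c * g x) = c * transform t g.
Proof.
move=> t01 kg; have [gM gC] := kg.
have k : kernel (fun x => c * g x) (cabs c * M) (cabs c * C).
  split=> [x|x x']; first by rewrite cabsM ler_wpM2l // cabs_ge0.
  by rewrite -mulrBr cabsM -mulrA ler_wpM2l // cabs_ge0.
apply: (is_riemann_unique (kernel_transform t01 k)).
apply: (is_riemann_ext et0 _ (is_riemannZ c (kernel_transform t01 kg))).
by move=> x _ /=; rewrite mulrCA.
Qed.

Lemma kernelM g h M C M' C' : kernel g M C -> kernel h M' C' ->
  kernel (fun x => g x * h x) (M * M') (C * M' + M * C').
Proof.
move=> kg kh; have [M0 C0] := kernel_ge0 kg; have [gM gC] := kg; have [hM hC] := kh.
split=> [x|x x']; first by rewrite cabsM; apply: ler_pM; rewrite ?cabs_ge0.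
have -> : g x * h x - g x' * h x' = (g x - g x') * h x + g x' * (h x - h x') by ring.
apply: le_trans (cabsD _ _) _; rewrite !cabsM mulrDl; apply: lerD.
  by rewrite mulrAC; apply: ler_pM; rewrite ?cabs_ge0.
by rewrite -mulrA; apply: ler_pM; rewrite ?cabs_ge0.
Qed.

Lemma kernel_resolvent z e : 0 < e -> e <= complex.Im z -> kernel (resolvent z) e^-1 (e ^- 2).
Proof.
by move=> e0 ez; split=> [x|x x']; [exact: cabs_resolvent|exact: resolvent_lipschitz].
Qed.

Lemma kernel_resolvent2 z e : 0 < e -> e <= complex.Im z ->
  kernel (fun x => resolvent z x ^+ 2) (e ^- 2) (2 * e ^- 3).
Proof.
move=> e0 ez; have := kernelM (kernel_resolvent e0 ez) (kernel_resolvent e0 ez).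
have -> : e^-1 * e^-1 = e ^- 2 by rewrite expr2 invfM.
have -> : e ^- 2 * e^-1 + e^-1 * e ^- 2 = 2 * e ^- 3 by field; rewrite gt_eqF.
exact.
Qed.

(** J_t of the overview; [Kt] stands for -dJ_t/dz, written as an integral of its own so that nothing
    has to be differentiated. *)
Definition Jt t z := transform t (resolvent z).
Definition Kt t z := transform t (fun x => resolvent z x ^+ 2).
Definition Wt t z := z * cexp (- Kt t z).

End KernelLimit.

(** * Cauchy transforms of prefixes of a linear extension *)

Section Increment.
Variables (R : realType) (lam : seq nat) (m : nat) (a b : nat -> int) (H : R -> R -> R).
Hypotheses (pl : is_partition lam) (l0 : lam != [::]).
Hypothesis ic : interlacing_coordinates R lam m a b.
Hypothesis lim : limiting_height lam (a 0%N) (a m) H.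

Local Notation et := (Defs.eta R lam).
Local Notation W := (size lam + nth 0%N lam 0)%N.
Local Notation LE n := (linear_extensions (dilate n lam)).
Local Notation ok n := (@ok_listing R lam a H n).
Local Notation N n := ((n%:R / et) ^+ 2).
Local Notation Jt := (@Jt R lam a H).
Local Notation Kt := (@Kt R lam a H).
Local Notation Wt := (@Wt R lam a H).

Let et0 : 0 < et := eta_gt0 R pl l0.

Definition step_kernel n z (c : int * int) : R[i] := resolvent z (et / n%:R * c.1%:~R).

(** [Jn] and [Wn] are the counterparts of [Jt] and [Wt] for the first [k] boxes; the product in [Wn]
    is [kerov] in rescaled coordinates, which becomes an exponential only in the limit. *)
Definition Jn n z k s : R[i] := ((N n)^-1)%:C * \sum_(c <- take k s) step_kernel n z c.

Definition Wn n z k s : R[i] :=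
  z * \prod_(q <- [seq ((N n)^-1)%:C * step_kernel n z c ^+ 2 | c <- take k s]) (1 - q).

Lemma size_listing n s : s \in LE n -> (size s)%:R = N n :> R.
Proof. by move=> /linear_extension_perm /perm_size ->; exact: size_boxes_dilate. Qed.

Lemma size_listing_nat n s : s \in LE n -> size s = sumn (dilate n lam).
Proof. by move=> /linear_extension_perm /perm_size ->; rewrite size_boxes. Qed.

Lemma scale_neq0 n : (0 < n)%N -> (n%:R / et)%:C != 0 :> R[i].
Proof.
by move=> n0; rewrite -[0]/(0%:C) (inj_eq (@complexI _)) gt_eqF // divr_gt0 // ltr0n.
Qed.

Lemma scaled_notint (r : R) z p : 0 < r -> 0 < complex.Im z -> r%:C * z != p%:~R.
Proof.
move=> r0 y0; apply/eqP => E; have : complex.Im (r%:C * z) = complex.Im (p%:~R : R[i]) by rewrite E.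
rewrite -[p%:~R](rmorph_int (real_complex R)) ImC ImM ReC ImC mul0r addr0 => /eqP.
by rewrite mulf_eq0 !gt_eqF.
Qed.

Lemma step_kernelE n z c : (0 < n)%N -> 0 < complex.Im z ->
  step_kernel n z c = (n%:R / et)%:C * ((n%:R / et)%:C * z - c.1%:~R)^-1.
Proof.
move=> n0 y0; have rC := scale_neq0 n0; have n0' : 0 < n%:R :> R by rewrite ltr0n.
have cE : c.1%:~R = (n%:R / et)%:C * (et / n%:R * c.1%:~R)%:C.
  rewrite -rmorphM -(rmorph_int (real_complex R)); congr (_%:C).
  by field; rewrite !gt_eqF.
have h : z - (et / n%:R * c.1%:~R)%:C != 0 by exact: resolvent_neq0.
by rewrite /step_kernel /resolvent cE -mulrBr invfM mulrA mulfV // mul1r.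
Qed.

Lemma kerov_Wn n z k s : (0 < n)%N -> 0 < complex.Im z ->
  kerov (take k s) ((n%:R / et)%:C * z) = (n%:R / et)%:C * Wn n z k s.
Proof.
move=> n0 y0; have rC := scale_neq0 n0.
rewrite /kerov /Wn -mulrA; congr (_ * (_ * _)); rewrite big_map; apply: eq_bigr => c _.
rewrite step_kernelE // fmorphV rmorphXn; congr (1 - _).
by rewrite exprMn mulrA mulVf ?mul1r ?exprVn // expf_neq0.
Qed.

Lemma mean_increment_scaled n z k : (0 < n)%N -> 0 < complex.Im z ->
  (0 < k <= sumn (dilate n lam))%N ->
  \sum_(s <- LE n) (Jn n z k s - Jn n z k.-1 s - (z - Wn n z k s) / k%:R) = 0.
Proof.
move=> n0 y0 kN; have [sl' _] := andP (dilate_partition n0 pl).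
have r0 : 0 < n%:R / et by rewrite divr_gt0 // ltr0n.
have rC := scale_neq0 n0.
have EN : ((N n)^-1)%:C = ((n%:R / et)%:C ^+ 2)^-1 :> R[i] by rewrite fmorphV rmorphXn.
set r := (n%:R / et)%:C in rC EN *; pose Z := r * z.
have hZ p : Z != p%:~R by exact: scaled_notint.
have MI : \sum_(s <- LE n) ((Z - (nth (0, 0) s k.-1).1%:~R)^-1 - (Z - kerov (take k s) Z) / k%:R) = 0.
  exact: (mean_increment sl' kN hZ).
apply: (@etrans _ _ ((r ^+ 2)^-1 * r * (\sum_(s <- LE n)
  ((Z - (nth (0, 0) s k.-1).1%:~R)^-1 - (Z - kerov (take k s) Z) / k%:R)))); last by rewrite MI mulr0.
rewrite mulr_sumr big_seq [RHS]big_seq; apply: eq_bigr => s sE.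
have sz := size_listing_nat sE.
move: kN; clear MI; case: k => // k /= kN.
rewrite kerov_Wn // /Jn (take_nth (0, 0)); last by rewrite sz.
rewrite -cats1 big_cat big_seq1 /= step_kernelE // EN -/r /Z.
have k0 : k.+1%:R != 0 :> R[i] by rewrite pnatr_eq0.
have hz : r * z - (nth (0, 0) s k).1%:~R != 0 by rewrite subr_eq0.
move: k0 hz rC; clear EN hZ Z; move: (k.+1%:R : R[i]) r => K r k0 hz rC.
by field; rewrite k0 hz rC.
Qed.

Lemma mean_increment_range n z k1 k2 : (0 < n)%N -> 0 < complex.Im z ->
  (k1 <= k2 <= sumn (dilate n lam))%N ->
  \sum_(s <- LE n) (Jn n z k2 s - Jn n z k1 s -
     \sum_(k1 <= k < k2) (z - Wn n z k.+1 s) / k.+1%:R) = 0.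
Proof.
move=> n0 y0 /andP[k12 k2N].
transitivity (\sum_(k1 <= k < k2) \sum_(s <- LE n)
    (Jn n z k.+1 s - Jn n z k s - (z - Wn n z k.+1 s) / k.+1%:R)).
  rewrite exchange_big /=; apply: eq_bigr => s _.
  by rewrite sumrB telescope_sumr.
rewrite big_nat big1 // => k /andP[kk1 kk2].
by have := @mean_increment_scaled n z k.+1 n0 y0 (leq_trans kk2 k2N).
Qed.

Section Bounds.
Variables (z : R[i]) (e : R).
Hypotheses (e0 : 0 < e) (ez : e <= complex.Im z).

Let Mw := cabs z * expR (e ^- 2).

Let y0 : 0 < complex.Im z. Proof. exact: lt_le_trans ez. Qed.
Let e20 : 0 < e ^- 2. Proof. by rewrite invr_gt0 exprn_gt0. Qed.
Let Mw0 : 0 <= Mw. Proof. by rewrite mulr_ge0 ?cabs_ge0 ?expR_ge0. Qed.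

Lemma cabs_step n c : cabs (step_kernel n z c) <= e^-1.
Proof. exact: cabs_resolvent. Qed.

Lemma N_gt0 n : (0 < n)%N -> 0 < N n :> R.
Proof. by move=> n0; rewrite exprn_gt0 // divr_gt0 // ltr0n. Qed.

Lemma cabs_factor n (s : seq (int * int)) : (0 < n)%N ->
  forall q, q \in [seq ((N n)^-1)%:C * step_kernel n z c ^+ 2 | c <- s] -> cabs q <= (N n)^-1 * e ^- 2.
Proof.
move=> n0 q /mapP[c _ ->]; have N0 := N_gt0 n0.
rewrite cabsM cabs_real gtr0_norm ?invr_gt0 // ler_pM2l ?invr_gt0 // cabsX -exprVn.
by apply: ler_pM; rewrite ?cabs_ge0 // cabs_step.
Qed.

Lemma take_fraction n s k : (0 < n)%N -> s \in LE n -> (size (take k s))%:R * ((N n)^-1 * e ^- 2) <= e ^- 2.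
Proof.
move=> n0 sE; have N0 := N_gt0 n0; rewrite mulrA; apply: ler_piMl; first exact: ltW.
rewrite ler_pdivrMr // mul1r -(size_listing sE) ler_nat size_take.
by case: ltnP => // /ltnW.
Qed.

Lemma cabs_Wn n s k : (0 < n)%N -> s \in LE n -> cabs (Wn n z k s) <= Mw.
Proof.
move=> n0 sE; rewrite cabsM; apply: ler_wpM2l; first exact: cabs_ge0.
apply: le_trans (cabs_prod_le (cabs_factor (s := take k s) n0)) _.
by rewrite ler_expR size_map take_fraction.
Qed.

Lemma Wn_step n s k : (0 < n)%N -> s \in LE n ->
  cabs (Wn n z k.+1 s - Wn n z k s) <= Mw * ((N n)^-1 * e ^- 2).
Proof.
move=> n0 sE; have N0 := N_gt0 n0.
have [ks|ks] := leqP (size s) k.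
  rewrite /Wn !take_oversize ?leqW // subrr cabs0; apply: mulr_ge0 => //.
  by rewrite ltW // mulr_gt0 // invr_gt0.
have -> : Wn n z k.+1 s - Wn n z k s = - (Wn n z k s * (((N n)^-1)%:C * step_kernel n z (nth (0, 0) s k) ^+ 2)).
  by rewrite /Wn (take_nth (0, 0)) // map_rcons -cats1 big_cat big_seq1 /=; ring.
rewrite cabsN cabsM; apply: ler_pM; rewrite ?cabs_ge0 ?cabs_Wn //.
by apply: (cabs_factor (s := [:: nth (0, 0) s k]) n0); rewrite mem_seq1.
Qed.

Lemma Wn_diff n s k1 k2 : (0 < n)%N -> s \in LE n -> (k1 <= k2)%N ->
  cabs (Wn n z k2 s - Wn n z k1 s) <= (k2 - k1)%N%:R * (Mw * ((N n)^-1 * e ^- 2)).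
Proof.
move=> n0 sE k12; rewrite -(telescope_sumr (fun k => Wn n z k s) k12).
apply: le_trans (cabs_sum _ _) _; rewrite mulr_natl -sumr_const_nat.
by apply: ler_sum => k _; exact: Wn_step.
Qed.

Lemma cabs_Jn n s k : (0 < n)%N -> s \in LE n -> cabs (Jn n z k s) <= e^-1.
Proof.
move=> n0 sE; have N0 := N_gt0 n0; rewrite cabsM cabs_real gtr0_norm ?invr_gt0 //.
rewrite mulrC ler_pdivrMr //; apply: le_trans (cabs_sum _ _) _.
apply: (@le_trans _ _ (\sum_(c <- take k s) e^-1)); first by apply: ler_sum => c _; exact: cabs_step.
rewrite sumr_const_seq -[_ *+ _]mulr_natr ler_pM2l ?invr_gt0 // -(size_listing sE) ler_nat size_take.
by case: ltnP => // /ltnW.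
Qed.

Lemma cabs_Jt t : 0 <= t <= 1 -> cabs (Jt t z) <= e^-1.
Proof.
move=> t01; apply: le_trans (transform_bound pl l0 ic lim t01 (kernel_resolvent e0 ez)) _.
by apply: ler_piMl; [rewrite invr_ge0 ltW|case/andP: t01].
Qed.

Lemma cabs_Kt t : 0 <= t <= 1 -> cabs (Kt t z) <= e ^- 2.
Proof.
move=> t01; apply: le_trans (transform_bound pl l0 ic lim t01 (kernel_resolvent2 e0 ez)) _.
by apply: ler_piMl; [rewrite ltW|case/andP: t01].
Qed.

Lemma cabs_Wt t : 0 <= t <= 1 -> cabs (Wt t z) <= Mw.
Proof.
move=> t01; rewrite cabsM; apply: ler_wpM2l; first exact: cabs_ge0.
by apply: le_trans (cabs_cexp_le _) _; rewrite ler_expR cabsN cabs_Kt.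
Qed.

Lemma Jn_limit t : 0 <= t <= 1 -> exists2 B, 0 <= B & forall n eps s k, (0 < n)%N -> 0 <= eps ->
  n%:R^-1 <= eps -> s \in LE n -> ok n eps s -> (k <= size s)%N -> `|k%:R / N n - t| <= eps ->
  cabs (Jn n z k s - Jt t z) <= B * eps.
Proof.
move=> t01; have [B B0 HB] := transform_limit pl l0 ic lim t01 (kernel_resolvent e0 ez).
exists (B + et * W%:R * e^-1 + e^-1 * 2).
  by rewrite !addr_ge0 // !mulr_ge0 ?invr_ge0 // ltW.
move=> n eps s k n0 ep ne sE okE kN kt.
apply: le_trans (HB n eps s k n0 ep sE okE kN) _.
have h1 : B / n%:R <= B * eps by rewrite ler_wpM2l.
have h2 : e^-1 * (`|k%:R / N n - t| + eps) <= e^-1 * (2 * eps) by rewrite ler_pM2l ?invr_gt0 //; lra.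
rewrite !mulrDl; lra.
Qed.

Lemma Wn_limit t : 0 <= t <= 1 -> exists2 B, 0 <= B & exists2 d, 0 < d &
  forall n eps s k, (0 < n)%N -> 0 <= eps -> eps <= d ->
  n%:R^-1 <= eps -> (N n)^-1 <= eps -> s \in LE n -> ok n eps s -> (k <= size s)%N -> `|k%:R / N n - t| <= eps ->
  cabs (Wn n z k s - Wt t z) <= B * eps.
Proof.
move=> t01; have [B B0 HB] := transform_limit pl l0 ic lim t01 (kernel_resolvent2 e0 ez).
pose c1 := B + et * W%:R * e ^- 2 + e ^- 2 * 2.
have c10 : 0 <= c1 by rewrite !addr_ge0 // !mulr_ge0 // ltW.
pose ex := expR (e ^- 2).
exists (cabs z * (4 * (e ^- 2) ^+ 2 * ex + 3 * ex * c1)).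
  have x0 : 0 <= ex by exact: expR_ge0.
  have x1 : 0 <= (e ^- 2) ^+ 2 by exact: sqr_ge0.
  apply: mulr_ge0; first exact: cabs_ge0.
  by apply: addr_ge0; do ?[apply: mulr_ge0 => //].
(* The two bounds keep the exponents in [cexp_lipschitz] and [prod_cexp] at most 1/2. *)
exists (Num.min (1 / (2 * (c1 + 1))) (1 / (2 * e ^- 2))).
  have x0 : 0 < c1 + 1 by rewrite ltr_wpDl.
  have x1 : 0 < 2 * (c1 + 1) by rewrite mulr_gt0.
  have x2 : 0 < 2 * e ^- 2 by rewrite mulr_gt0.
  by rewrite lt_min; apply/andP; split; apply: divr_gt0.
move=> n eps s k n0 ep; rewrite le_min => /andP[ed1 ed2] ne Ne sE okE kN kt.
have N0 := N_gt0 n0.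
pose q := [seq ((N n)^-1)%:C * step_kernel n z c ^+ 2 | c <- take k s].
have hq : cabs (\sum_(x <- q) x - Kt t z) <= c1 * eps.
  have := HB n eps s k n0 ep sE okE kN.
  rewrite /q big_map -mulr_sumr => /le_trans; apply.
  have h1 : B / n%:R <= B * eps by rewrite ler_wpM2l.
  have h2 : e ^- 2 * (`|k%:R / N n - t| + eps) <= e ^- 2 * (2 * eps) by rewrite ler_pM2l //; lra.
  rewrite /c1 !mulrDl; lra.
have hq2 : c1 * eps <= 1 / 2.
  apply: (@le_trans _ _ (c1 * (1 / (2 * (c1 + 1))))); first by rewrite ler_wpM2l.
  rewrite mul1r invfM mulrCA div1r; apply: ler_piMr; first by rewrite invr_ge0.
  by rewrite ler_pdivrMr ?mul1r ?lerDl // ltr_wpDl.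
have dq : (N n)^-1 * e ^- 2 <= 1 / 2.
  have : eps * e ^- 2 <= 1 / (2 * e ^- 2) * e ^- 2 by rewrite ler_pM2r.
  have -> : 1 / (2 * e ^- 2) * e ^- 2 = 1 / 2 by field; rewrite gt_eqF.
  by apply: le_trans; rewrite ler_pM2r.
have h1 := prod_cexp dq (cabs_factor (s := take k s) n0).
rewrite -/q in h1.
have h1' : cabs (\prod_(x <- q) (1 - x) - cexp (- \sum_(x <- q) x)) <= 4 * (e ^- 2) ^+ 2 * ex * eps.
  apply: le_trans h1 _; rewrite [size q]size_map.
  have tf := take_fraction k n0 sE.
  set p := (size _)%:R in tf *.
  have p0 : 0 <= p by [].
  set x := (N n)^-1 * e ^- 2 in tf *.
  have x0 : 0 < x by rewrite mulr_gt0 // invr_gt0.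
  have xe : x <= eps * e ^- 2 by rewrite ler_pM2r.
  have px : 0 <= p * x by rewrite mulr_ge0 // ltW.
  have -> : p * (4 * x ^+ 2) = 4 * ((p * x) * x) by ring.
  have -> : 4 * (e ^- 2) ^+ 2 * ex * eps = 4 * (e ^- 2 * (eps * e ^- 2)) * ex by ring.
  apply: ler_pM; rewrite ?expR_ge0 ?ler_expR //.
    by apply: mulr_ge0 => //; apply: mulr_ge0 => //; exact: ltW.
  by rewrite ler_pM2l //; apply: ler_pM => //; exact: ltW.
have h2 : cabs (cexp (- \sum_(x <- q) x) - cexp (- Kt t z)) <= 3 * ex * c1 * eps.
  apply: le_trans (cexp_lipschitz _) _; first by rewrite opprK addrC cabsBC (le_trans hq).
  rewrite opprK addrC cabsBC -[leRHS]mulrA; apply: ler_pM; rewrite ?cabs_ge0 ?mulr_ge0 ?expR_ge0 //.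
  by rewrite ler_pM2l // ler_expR cabsN cabs_Kt.
rewrite /Wn /Wt -mulrBr cabsM -[leRHS]mulrA; apply: ler_wpM2l; first exact: cabs_ge0.
rewrite -/q mulrDl; apply: le_trans (lerD h1' h2).
have := cabsD (\prod_(x <- q) (1 - x) - cexp (- \sum_(x <- q) x)) (cexp (- \sum_(x <- q) x) - cexp (- Kt t z)).
by rewrite addrA subrK.
Qed.

(** Replaces W_(k+1) by W_k1 and 1/(k + 1) by 1/k1; both replacements cost an error quadratic in the
    length of the range. *)
Lemma increment_listing n s k1 k2 : (0 < n)%N -> s \in LE n -> (0 < k1)%N -> (k1 <= k2)%N ->
  cabs (\sum_(k1 <= k < k2) (z - Wn n z k.+1 s) / k.+1%:R -
     ((k2 - k1)%N%:R / k1%:R)%:C * (z - Wn n z k1 s)) <=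
  ((k2 - k1)%N%:R / k1%:R) * ((k2 - k1)%N%:R * (Mw * ((N n)^-1 * e ^- 2))) +
  (cabs z + Mw) * ((k2 - k1)%N%:R / k1%:R) ^+ 2.
Proof.
move=> n0 sE k10 k12.
set S : R := \sum_(k1 <= k < k2) k.+1%:R^-1.
have -> : \sum_(k1 <= k < k2) (z - Wn n z k.+1 s) / k.+1%:R -
     ((k2 - k1)%N%:R / k1%:R)%:C * (z - Wn n z k1 s) =
  \sum_(k1 <= k < k2) (Wn n z k1 s - Wn n z k.+1 s) / k.+1%:R +
  (S - (k2 - k1)%N%:R / k1%:R)%:C * (z - Wn n z k1 s).
  have -> : \sum_(k1 <= k < k2) (z - Wn n z k.+1 s) / k.+1%:R =
     \sum_(k1 <= k < k2) (Wn n z k1 s - Wn n z k.+1 s) / k.+1%:R + S%:C * (z - Wn n z k1 s).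
    rewrite /S rmorph_sum mulr_suml -big_split /=; apply: eq_bigr => k _.
    have k0 : k.+1%:R != 0 :> R[i] by rewrite pnatr_eq0.
    rewrite fmorphV rmorph_nat; move: k0; move: (k.+1%:R : R[i]) => K k0.
    by field.
  by rewrite -addrA -mulrBl -rmorphB.
apply: le_trans (cabsD _ _) _; apply: lerD.
  apply: le_trans (cabs_sum _ _) _.
  have -> : (k2 - k1)%N%:R / k1%:R * ((k2 - k1)%N%:R * (Mw * ((N n)^-1 * e ^- 2))) =
    \sum_(k1 <= k < k2) ((k2 - k1)%N%:R * (Mw * ((N n)^-1 * e ^- 2)) / k1%:R).
    by rewrite sumr_const_nat -[RHS]mulr_natl; ring.
  rewrite big_nat [leRHS]big_nat; apply: ler_sum => k /andP[kk1 kk2].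
  rewrite cabsM; apply: ler_pM; rewrite ?cabs_ge0 //.
    rewrite cabsBC; apply: le_trans (Wn_diff n0 sE (leqW kk1)) _.
    apply: ler_wpM2r; last by rewrite ler_nat leq_sub2r.
    by apply: mulr_ge0 => //; rewrite ltW // mulr_gt0 // invr_gt0 N_gt0.
  rewrite -(rmorph_nat (real_complex R)) cabsV cabs_real ger0_norm //.
  by rewrite lef_pV2 ?posrE ?ltr0n // ler_nat leqW.
rewrite cabsM cabs_real mulrC; apply: ler_pM; rewrite ?cabs_ge0 //; last exact: harmonic_estimate.
by apply: le_trans (cabsB _ _) _; rewrite lerD2l cabs_Wn.
Qed.

End Bounds.

End Increment.

(** * Time increments of J in the limit *)

Section IncrementJ.
Variables (R : realType) (lam : seq nat) (m : nat) (a b : nat -> int) (H : R -> R -> R).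
Hypotheses (pl : is_partition lam) (l0 : lam != [::]).
Hypothesis ic : interlacing_coordinates R lam m a b.
Hypothesis lim : limiting_height lam (a 0%N) (a m) H.

Local Notation et := (Defs.eta R lam).
Local Notation LE n := (linear_extensions (dilate n lam)).
Local Notation ok n := (@ok_listing R lam a H n).
Local Notation N n := ((n%:R / et) ^+ 2).
Local Notation Jt := (@Jt R lam a H).
Local Notation Kt := (@Kt R lam a H).
Local Notation Wt := (@Wt R lam a H).
Local Notation Jn := (@Jn R lam).
Local Notation Wn := (@Wn R lam).

Let et0 : 0 < et := eta_gt0 R pl l0.

Lemma cell_count n : (sumn (dilate n lam))%:R = N n :> R.
Proof. by rewrite sumn_dilate cells_eta. Qed.

Lemma LE_gt0 n : (0 < n)%N -> (0 < size (LE n))%N.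
Proof. by move=> n0; case/andP: (dilate_partition n0 pl) => sl' _; exact: (size_linear_extensions_gt0 rat). Qed.

Lemma good_n (d : R) : 0 < d -> exists n, [/\ (0 < n)%N, n%:R^-1 <= d, (N n)^-1 <= d &
  (count (fun s => ~~ `[< ok n d s >]) (LE n))%:R <= d * (size (LE n))%:R].
Proof.
move=> d0; have [n1 H1] := good_listing pl l0 ic lim d0.
have [n2 H2] := @eventually_small R 1 d d0; have [n3 H3] := @eventually_small R (et ^+ 2) d d0.
have [nn1 nn2 nn3] := leq_sum3 n1 n2 n3; have n0 : (0 < (n1 + n2 + n3).+1)%N by [].
exists (n1 + n2 + n3).+1; move: (n1 + n2 + n3).+1 nn1 nn2 nn3 n0 => n nn1 nn2 nn3 n0.
have n0' : 0 < n%:R :> R by rewrite ltr0n.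
split; [exact: n0| |  |exact: H1].
  by have := H2 n nn2 n0; rewrite div1r.
apply: le_trans (H3 n nn3 n0); rewrite exprMn exprVn invfM invrK mulrC ler_pM2l ?exprn_gt0 //.
by rewrite lef_pV2 ?posrE ?exprn_gt0 // ler_eXnr // ler1n.
Qed.

Lemma level (n : nat) (t : R) : (0 < n)%N -> 0 <= t <= 1 ->
  (Num.truncn (t * N n) <= sumn (dilate n lam))%N /\
  `|(Num.truncn (t * N n))%:R / N n - t| <= (N n)^-1.
Proof.
move=> n0 /andP[t0 t1]; have N0 : 0 < N n := N_gt0 R pl l0 n0.
have tN : 0 <= t * N n by rewrite mulr_ge0 // ltW.
have /andP[h1 h2] := truncn_itv tN; split.
  rewrite -(ler_nat R) cell_count; apply: le_trans h1 _; exact: ler_piMl (ltW N0) t1.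
have -> : (Num.truncn (t * N n))%:R / N n - t = ((Num.truncn (t * N n))%:R - t * N n) / N n.
  by rewrite mulrBl mulfK // gt_eqF.
rewrite normrM [`|_^-1|]gtr0_norm ?invr_gt0 // -[leRHS]mul1r ler_pM2r ?invr_gt0 //.
by rewrite ler_norml; move: h2; rewrite -natr1; lra.
Qed.

Section Increment.
Variables (z : R[i]) (e t1 t2 : R).
Hypotheses (e0 : 0 < e) (ez : e <= complex.Im z) (t10 : 0 < t1) (t12 : t1 < t2) (t21 : t2 <= 1).

Let Mw := cabs z * expR (e ^- 2).
Let y0 : 0 < complex.Im z. Proof. exact: lt_le_trans ez. Qed.

(** At scale n the mean of the discrete increments over all linear extensions is known from
    [mean_increment_range], up to an error quadratic in t2 - t1 uniformly in n. Typical listings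
    have discrete quantities close to those of H, and n tends to infinity with t1 and t2 fixed. *)
Lemma increment_J :
  cabs (Jt t2 z - Jt t1 z - ((t2 - t1) / t1)%:C * (z - Wt t1 z)) <=
  (8 * (Mw * e ^- 2) / t1 + 16 * (cabs z + Mw) / t1 ^+ 2) * (t2 - t1) ^+ 2.
Proof.
set L := (X in cabs X).
pose dl := t2 - t1; pose sg := dl / t1; pose Mz := cabs z + Mw.
have dl0 : 0 < dl by rewrite subr_gt0.
have sg0 : 0 < sg by rewrite divr_gt0.
have Mw0 : 0 <= Mw by rewrite mulr_ge0 ?cabs_ge0 ?expR_ge0.
have Mz0 : 0 <= Mz by rewrite addr_ge0 ?cabs_ge0.
have e20 : 0 < e ^- 2 by rewrite invr_gt0 exprn_gt0.
have t01 : 0 <= t1 <= 1 by rewrite ltW //= ltW // (lt_le_trans t12).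
have t02 : 0 <= t2 <= 1 by rewrite t21 ltW // (lt_trans t10).
have [B1 B10 HB1] := Jn_limit pl l0 ic lim e0 ez t01.
have [B2 B20 HB2] := Jn_limit pl l0 ic lim e0 ez t02.
have [B3 B30 [d d0 HB3]] := Wn_limit pl l0 ic lim e0 ez t01.
pose c0 := B2 + B1 + (4 / t1 ^+ 2 * Mz + sg * B3).
pose M' := 4 * e^-1 + (4 * sg + sg) * Mz.
have c00 : 0 <= c0.
  rewrite /c0 !addr_ge0 //; apply: mulr_ge0 => //; last exact: ltW.
  by rewrite divr_ge0 // exprn_ge0 // ltW.
have M'0 : 0 <= M'.
  apply: addr_ge0; first by rewrite mulr_ge0 // invr_ge0 ltW.
  by apply: mulr_ge0 => //; lra.
apply: (@eps_le _ _ _ (c0 + M')) => eps eps0.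
(* [ep <= dl / 2] gives x1 <= x2, [ep <= t1 / 2] gives x1 >= t1 / 2, and [ep <= d] is required by
   [Wn_limit]. *)
pose ep := Num.min (Num.min eps d) (Num.min (dl / 2) (t1 / 2)).
have ep0 : 0 < ep by rewrite !lt_min eps0 d0 !divr_gt0.
have ep1 : ep <= eps by rewrite !ge_min lexx.
have ep2 : ep <= d by rewrite !ge_min lexx orbT.
have ep3 : ep <= dl / 2 by rewrite !ge_min lexx !orbT.
have ep4 : ep <= t1 / 2 by rewrite !ge_min lexx !orbT.
have [n [n0 nE NE cE]] := good_n ep0.
have N0 : 0 < N n := N_gt0 R pl l0 n0.
have [k1N k1t] := level n0 t01; have [k2N k2t] := level n0 t02.
have k12 : (Num.truncn (t1 * N n) <= Num.truncn (t2 * N n))%N.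
  by apply: le_truncn; rewrite ler_pM2r // ltW.
move: (Num.truncn (t1 * N n)) (Num.truncn (t2 * N n)) k1N k1t k2N k2t k12 => k1 k2 k1N k1t k2N k2t k12.
have {}k1t := le_trans k1t NE; have {}k2t := le_trans k2t NE.
pose x1 := k1%:R / N n; pose x2 := k2%:R / N n.
have h1 : t1 - ep <= x1 <= t1 + ep by move: k1t; rewrite -/x1 ler_norml; lra.
have h2 : t2 - ep <= x2 <= t2 + ep by move: k2t; rewrite -/x2 ler_norml; lra.
have x10 : t1 / 2 <= x1 by lra.
have x1p : 0 < x1 by apply: lt_le_trans x10; rewrite divr_gt0.
have k10 : (0 < k1)%N by rewrite -(ltr0n R); move: x1p; rewrite pmulr_lgt0 // invr_gt0.
have k10' : 0 < k1%:R :> R by rewrite ltr0n.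
pose rho : R := (k2 - k1)%N%:R / k1%:R.
have kx : (k2 - k1)%N%:R / N n = x2 - x1 by rewrite natrB // mulrBl.
have rhoE : rho = (x2 - x1) / x1.
  have gen (A k NN : R) : k != 0 -> NN != 0 -> A / k = A / NN / (k / NN).
    by move=> k0 NN0; field; rewrite k0 NN0.
  by rewrite -kx; apply: gen; rewrite gt_eqF.
have dx : x2 - x1 <= 2 * dl by rewrite /dl in dl0 ep3 *; lra.
have dx0 : 0 <= x2 - x1 by rewrite /dl in ep3; lra.
have rho0 : 0 <= rho by rewrite rhoE divr_ge0 // ltW.
have rho1 : rho <= 4 * sg.
  rewrite rhoE ler_pdivrMr // /sg.
  have : dl / t1 * (t1 / 2) <= dl / t1 * x1 by rewrite ler_pM2l.
  have -> : dl / t1 * (t1 / 2) = dl / 2 by field; rewrite gt_eqF.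
  lra.
have rs : `|rho - sg| <= 4 / t1 ^+ 2 * ep.
  have -> : rho - sg = ((x2 - t2) * t1 - t2 * (x1 - t1)) / (x1 * t1).
    by rewrite rhoE /sg /dl; field; rewrite !gt_eqF.
  have p0 : 0 < x1 * t1 by rewrite mulr_gt0.
  rewrite normrM [`|_^-1|]gtr0_norm ?invr_gt0 // ler_pdivrMr //.
  apply: (@le_trans _ _ (2 * ep)).
    apply: le_trans (ler_normB _ _) _; rewrite !normrM (gtr0_norm t10) (gtr0_norm (lt_trans t10 t12)).
    have : `|x2 - t2| * t1 <= ep * 1.
      by apply: ler_pM => //; [exact: ltW | case/andP: t01].
    have : t2 * `|x1 - t1| <= 1 * ep by apply: ler_pM => //; case/andP: t02.
    lra.
  have -> : 4 / t1 ^+ 2 * ep * (x1 * t1) = 4 * ep / t1 * x1 by field; rewrite gt_eqF.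
  have -> : 2 * ep = 4 * ep / t1 * (t1 / 2) by field; rewrite gt_eqF.
  by rewrite ler_pM2l // divr_gt0 // mulr_gt0.
pose f s := Jn n z k2 s - Jn n z k1 s - rho%:C * (z - Wn n z k1 s).
pose X s := \sum_(k1 <= k < k2) (z - Wn n z k.+1 s) / k.+1%:R - rho%:C * (z - Wn n z k1 s).
pose E := (8 * (Mw * e ^- 2) / t1 + 16 * (cabs z + Mw) / t1 ^+ 2) * dl ^+ 2.
have E0 : 0 <= E.
  apply: mulr_ge0; last exact: sqr_ge0.
  have w0 : 0 <= Mw * e ^- 2 by rewrite mulr_ge0 // ltW.
  by apply: addr_ge0; apply: divr_ge0; [rewrite mulr_ge0|exact: ltW|rewrite mulr_ge0|exact: sqr_ge0].
have XE s : s \in LE n -> cabs (X s) <= E.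
  move=> sE; apply: le_trans (increment_listing pl l0 e0 ez n0 sE k10 k12) _.
  rewrite -/rho -/Mw.
  have -> : (k2 - k1)%N%:R * (Mw * ((N n)^-1 * e ^- 2)) = (x2 - x1) * (Mw * e ^- 2) by rewrite -kx; ring.
  rewrite /E [leRHS]mulrDl; apply: lerD.
    have -> : 8 * (Mw * e ^- 2) / t1 * dl ^+ 2 = (4 * sg) * ((2 * dl) * (Mw * e ^- 2)).
      by rewrite /sg; field; rewrite !gt_eqF.
    have w0 : 0 <= Mw * e ^- 2 by rewrite mulr_ge0 // ltW.
    by apply: ler_pM => //; [rewrite mulr_ge0 | rewrite ler_wpM2r].
  have -> : 16 * (cabs z + Mw) / t1 ^+ 2 * dl ^+ 2 = Mz * (4 * sg) ^+ 2.
    by rewrite /sg /Mz; field; rewrite gt_eqF.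
  by apply: ler_wpM2l => //; rewrite !expr2; apply: ler_pM.
(* [f] and [X] have the same mean; [X] is at most [E] for every listing, while [f] is close to the
   constant [L] for typical ones. *)
have fX : \sum_(s <- LE n) f s = \sum_(s <- LE n) X s.
  apply/eqP; rewrite -subr_eq0 -sumrB; apply/eqP.
  have k12N : (k1 <= k2 <= sumn (dilate n lam))%N by rewrite k12.
  rewrite -[RHS](mean_increment_range pl l0 n0 y0 k12N).
  by apply: eq_bigr => s _; rewrite /f /X; ring.
have mX : cabs ((size (LE n))%:R^-1 * \sum_(s <- LE n) f s - 0) <= E + E * 0.
  rewrite fX; apply: (@mean_close _ _ _ predT) => //; first exact: LE_gt0.
  - by move=> s sE _; rewrite subr0 XE.
  - by move=> s sE; rewrite subr0 XE.
  - by rewrite mul0r (@eq_count _ _ pred0) ?count_pred0.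
have Wb s : s \in LE n -> cabs (z - Wn n z k1 s) <= Mz.
  by move=> sE; apply: le_trans (cabsB _ _) _; rewrite lerD2l (cabs_Wn pl l0 e0 ez).
have Wtb : cabs (z - Wt t1 z) <= Mz.
  by apply: le_trans (cabsB _ _) _; rewrite lerD2l (cabs_Wt pl l0 ic lim e0 ez).
have mf : cabs ((size (LE n))%:R^-1 * \sum_(s <- LE n) f s - L) <= c0 * ep + M' * ep.
  apply: (@mean_close _ _ _ (fun s => `[< ok n ep s >])) => //; first exact: LE_gt0.
  - by rewrite mulr_ge0 // ltW.
  - move=> s sE /asboolP okE; rewrite /f /L.
    have k1s : (k1 <= size s)%N by rewrite (size_listing_nat sE).
    have k2s : (k2 <= size s)%N by rewrite (size_listing_nat sE).
    have g1 := HB1 n ep s k1 n0 (ltW ep0) nE sE okE k1s k1t.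
    have g2 := HB2 n ep s k2 n0 (ltW ep0) nE sE okE k2s k2t.
    have g3 := HB3 n ep s k1 n0 (ltW ep0) ep2 nE NE sE okE k1s k1t.
    have -> : Jn n z k2 s - Jn n z k1 s - rho%:C * (z - Wn n z k1 s) -
        (Jt t2 z - Jt t1 z - ((t2 - t1) / t1)%:C * (z - Wt t1 z)) =
      (Jn n z k2 s - Jt t2 z) - (Jn n z k1 s - Jt t1 z) -
      ((rho - sg)%:C * (z - Wn n z k1 s) - sg%:C * (Wn n z k1 s - Wt t1 z)).
      by rewrite rmorphB /sg /dl; ring.
    apply: le_trans (cabsB _ _) _; rewrite /c0 mulrDl; apply: lerD.
      by apply: le_trans (cabsB _ _) _; rewrite mulrDl lerD.
    apply: le_trans (cabsB _ _) _; rewrite mulrDl !cabsM !cabs_real; apply: lerD.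
      by rewrite [4 / _ * _]mulrC -mulrA [leRHS]mulrC; apply: ler_pM; rewrite ?cabs_ge0 ?Wb // mulrC.
    by rewrite (gtr0_norm sg0) -[leRHS]mulrA ler_pM2l.
  move=> s sE; rewrite /f /L.
  have j1 := cabs_Jn pl l0 e0 ez k1 n0 sE; have j2 := cabs_Jn pl l0 e0 ez k2 n0 sE.
  have j3 := cabs_Jt pl l0 ic lim e0 ez t01; have j4 := cabs_Jt pl l0 ic lim e0 ez t02.
  apply: (@le_trans _ _ (((e^-1 + e^-1) + 4 * sg * Mz) + ((e^-1 + e^-1) + sg * Mz))); last by rewrite /M'; lra.
  apply: le_trans (cabsB _ _) _; apply: lerD; apply: le_trans (cabsB _ _) _; apply: lerD.
  - by apply: le_trans (cabsB _ _) _; exact: lerD.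
  - by rewrite cabsM cabs_real ger0_norm //; apply: ler_pM; rewrite ?cabs_ge0 ?Wb.
  - by apply: le_trans (cabsB _ _) _; exact: lerD.
  - by rewrite cabsM cabs_real -/dl -/sg gtr0_norm // ler_pM2l.
rewrite -/E; rewrite mulr0 addr0 subr0 in mX.
set mean := _ * _ in mX mf.
have := cabsB mean (mean - L); rewrite subKr.
have : (c0 + M') * ep <= (c0 + M') * eps by rewrite ler_wpM2l // addr_ge0.
rewrite [X in X <= _ -> _]mulrDl; lra.
Qed.

End Increment.

End IncrementJ.

Lemma residue_morph (F K : fieldType) (f : {rmorphism F -> K}) x0 (a b : nat -> F) n j :
  f (residue x0 a b n j) = residue (f x0) (f \o a) (f \o b) n j.
Proof.
rewrite /residue !rmorphM rmorph_prod !rmorphB; congr (_ * _); apply: eq_bigr => k _.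
by rewrite fmorph_div !rmorphB.
Qed.

Lemma ratf_scale (F : fieldType) (c x0 : F) (a b : nat -> F) n u : c != 0 ->
  c * ratf x0 a b n (u / c) = ratf (c * x0) (fun i => c * a i) (fun i => c * b i) n u.
Proof.
move=> c0; have h v : u / c - v = (u - c * v) / c by field.
rewrite /ratf mulrA h [c * _]mulrC divfK //; congr (_ * _); apply: eq_bigr => k _.
by rewrite !h invfM invrK mulrACA mulVf ?mulr1.
Qed.

(** * The function v_1 and the limit at time 1 *)

Section EndPoint.
Variables (R : realType) (lam : seq nat) (m : nat) (a b : nat -> int) (H : R -> R -> R).
Hypotheses (pl : is_partition lam) (l0 : lam != [::]).
Hypothesis ic : interlacing_coordinates R lam m a b.
Hypothesis lim : limiting_height lam (a 0%N) (a m) H.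

Local Notation et := (Defs.eta R lam).
Local Notation LE n := (linear_extensions (dilate n lam)).
Local Notation ok n := (@ok_listing R lam a H n).
Local Notation N n := ((n%:R / et) ^+ 2).
Local Notation Wt := (@Wt R lam a H).
Local Notation Wn := (@Wn R lam).

Let et0 : 0 < et := eta_gt0 R pl l0.

(** Rescaled minima and maxima. The index of [hi] is shifted: poles are counted from 0, whereas the
    b_i start at 1. *)
Definition lo i : R := et * (a i)%:~R.
Definition hi j : R := et * (b j.+1)%:~R.
Definition weight j : R := residue (lo 0) (fun i => lo i.+1) hi m j.

Lemma lo_hi i j : (i <= j < m)%N -> lo i < hi j.
Proof. by move=> h; rewrite ltr_pM2l // ltr_int (interlacing_ab pl ic) //; lia. Qed.

Lemma hi_lo i j : (i < j <= m)%N -> hi i < lo j.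
Proof. by move=> h; rewrite ltr_pM2l // ltr_int (interlacing_ba pl ic) //; lia. Qed.

Lemma hi_hi i j : (i < j < m)%N -> hi i < hi j.
Proof. by move=> h; rewrite ltr_pM2l // ltr_int (interlacing_bb pl ic) //; lia. Qed.

Lemma hi_neq i j : (i < m)%N -> (j < m)%N -> i != j -> hi i != hi j.
Proof.
move=> im jm; rewrite neq_ltn => /orP[] ij; first by rewrite lt_eqF // hi_hi // ij.
by rewrite gt_eqF // hi_hi // ij.
Qed.

Lemma weight_gt0 j : (j < m)%N -> 0 < weight j.
Proof.
move=> jm; rewrite /weight /residue.
have h1 : 0 < hi j - lo 0 by rewrite subr_gt0 lo_hi.
have h2 : 0 < lo j.+1 - hi j by rewrite subr_gt0 hi_lo // leqnn.
rewrite !mulr_gt0 // big_nat_cond; apply: prodr_gt0 => k /andP[/andP[_ km]].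
rewrite neq_ltn => /orP[kj|jk].
  by rewrite divr_gt0 // subr_gt0 ?lo_hi ?hi_hi //; lia.
by rewrite -mulrNN -invrN !opprB divr_gt0 // subr_gt0 ?hi_lo ?hi_hi //; lia.
Qed.

Definition vreal (u : R) : R := u - \sum_(0 <= j < m) weight j / (u - hi j).
Definition vcomplex (u : R[i]) : R[i] := u - \sum_(0 <= j < m) (weight j)%:C / (u - (hi j)%:C).

(** The a_i and the b_i have equal sums, so v_1(u) - u vanishes at infinity. *)
Lemma sum_lo_hi : lo 0 + \sum_(0 <= k < m) (lo k.+1 - hi k) = 0.
Proof.
have -> : \sum_(0 <= k < m) (lo k.+1 - hi k) = et * (\sum_(0 <= i < m) (a i.+1 - b i.+1))%:~R.
  rewrite (big_morph (fun i : int => i%:~R : R) (fun i j => intrD R i j) erefl) mulr_sumr; apply: eq_bigr => k _.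
  by rewrite rmorphB mulrBr.
by rewrite (sum_interlacing pl ic) rmorphN mulrN subrr.
Qed.

Lemma vreal_ratf u : (forall j, (j < m)%N -> u != hi j) ->
  vreal u = ratf (lo 0) (fun i => lo i.+1) hi m u.
Proof.
move=> hu; rewrite ratf_partial_fractions //; last exact: hi_neq.
by rewrite -[u - lo 0 - _]addrA -opprD sum_lo_hi oppr0 addr0.
Qed.

Lemma vcomplex_ratf u : 0 < complex.Im u ->
  vcomplex u = ratf (lo 0)%:C (fun i => (lo i.+1)%:C) (fun j => (hi j)%:C) m u.
Proof.
move=> y0; rewrite ratf_partial_fractions; last 2 first.
- by move=> i j im jm ij; rewrite (inj_eq (@complexI _)) hi_neq.
- by move=> j jm; rewrite -subr_eq0 resolvent_neq0.
have -> : u - (lo 0)%:C - \sum_(0 <= k < m) ((lo k.+1)%:C - (hi k)%:C) = u.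
  rewrite -[RHS]subr0 -[0 in RHS]/(0%:C) -sum_lo_hi rmorphD rmorph_sum opprD addrA; congr (_ - _).
  by apply: eq_bigr => k _; rewrite rmorphB.
congr (_ - _); apply: eq_bigr => j _; congr (_ / _).
exact: (residue_morph (real_complex R)).
Qed.

Lemma Wn_end n (z : R[i]) s : (0 < n)%N -> 0 < complex.Im z -> s \in LE n ->
  Wn n z (size s) s = vcomplex z.
Proof.
move=> n0 y0 sE; have r0 : 0 < n%:R / et by rewrite divr_gt0 // ltr0n.
have rC := scale_neq0 R pl l0 n0.
apply: (mulfI rC); rewrite -(kerov_Wn pl l0) // take_size (kerov_perm _ (linear_extension_perm sE)).
have nC : n%:R != 0 :> R[i] by rewrite pnatr_eq0 -lt0n.
have eC : et%:C != 0 by rewrite -[0]/(0%:C) (inj_eq (@complexI _)) gt_eqF.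
have E : (n%:R / et)%:C * z / n%:R = z / et%:C.
  by rewrite fmorph_div rmorph_nat; field; rewrite nC eC.
have E2 : z / et%:C = (et^-1)%:C * z.
  by rewrite [LHS]mulrC; congr (_ * _); rewrite [RHS]fmorphV.
have ei0 : 0 < et^-1 by rewrite invr_gt0.
have z1 p : (n%:R / et)%:C * z != p%:~R by exact: scaled_notint.
have z2 p : (n%:R / et)%:C * z / n%:R != p%:~R by rewrite E E2; exact: scaled_notint.
rewrite (kerov_dilate _ n0 z1 z2) E.
have z3 p : z / et%:C != p%:~R by rewrite E2; exact: scaled_notint.
rewrite (kerov_interlacing pl ic z3).
apply: (mulfI eC); rewrite mulrCA ratf_scale // vcomplex_ratf // mulrA.
have -> : et%:C * (n%:R / et)%:C = n%:R by rewrite fmorph_div rmorph_nat; field.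
congr (_ * _); rewrite /ratf /lo /hi rmorphM rmorph_int; congr (_ * _).
by apply: eq_bigr => k _; rewrite !rmorphM !rmorph_int.
Qed.

(** For the full listing [Wn] is [vcomplex] for every n, so one typical listing per scale suffices
    to pass to the limit. *)
Lemma Wt_end z : 0 < complex.Im z -> Wt 1 z = vcomplex z.
Proof.
move=> y0; have t01 : 0 <= (1 : R) <= 1 by rewrite ler01 lexx.
have [B B0 [d d0 HB]] := Wn_limit pl l0 ic lim y0 (lexx _) t01.
apply/eqP; rewrite eq_sym -subr_eq0; apply/eqP; apply: cabs_eq0; apply/eqP.
rewrite eq_le cabs_ge0 andbT; apply: (@eps_le _ _ _ B) => eps eps0; rewrite add0r.
pose ep := Num.min (Num.min eps d) (1 / 2).
have ep0 : 0 < ep by rewrite !lt_min eps0 d0 divr_gt0.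
have ep1 : ep <= eps by rewrite !ge_min lexx.
have ep2 : ep <= d by rewrite !ge_min lexx orbT.
have ep3 : ep <= 1 / 2 by rewrite !ge_min lexx !orbT.
have [n [n0 nE NE cE]] := good_n pl l0 ic lim ep0.
have [s sE okE] : exists2 s, s \in LE n & ok n ep s.
  apply: contrapT => no; move: cE; apply/negP; rewrite -ltNge.
  have -> : count (fun s => ~~ `[< ok n ep s >]) (LE n) = size (LE n).
    apply/eqP; rewrite -all_count; apply/allP => s sE; apply/asboolP => okE; apply: no.
    by exists s.
  by rewrite gtr_pMl ?ltr0n ?LE_gt0 //; lra.
have := HB n ep s (size s) n0 (ltW ep0) ep2 nE NE sE okE (leqnn _).
rewrite Wn_end // (size_listing R sE) divff ?subrr ?normr0; last by rewrite gt_eqF // (N_gt0 R pl l0).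
by move=> /(_ (ltW ep0)) /le_trans; apply; rewrite ler_wpM2l.
Qed.

End EndPoint.

(** * The Burgers equation *)

(** Multiplication of expansions to first order in h^2 with remainder O(h^3); [velocity_step]
    composes three factors with it. *)
Lemma product_expansion (R : realType) (X Y x y : R[i]) (h x0 y0 Cx Cy : R) : 0 <= h <= 1 ->
  cabs x <= x0 -> cabs y <= y0 ->
  cabs (X - 1 - (h ^+ 2)%:C * x) <= Cx * h ^+ 3 -> cabs (Y - 1 - (h ^+ 2)%:C * y) <= Cy * h ^+ 3 ->
  cabs (X * Y - 1 - (h ^+ 2)%:C * (x + y)) <= (Cx + Cy + x0 * y0 + x0 * Cy + Cx * y0 + Cx * Cy) * h ^+ 3.
Proof.
move=> /andP[h0 h1] hx hy; set rx := X - 1 - _; set ry := Y - 1 - _ => hX hY.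
have x00 := le_trans (cabs_ge0 _) hx; have y00 := le_trans (cabs_ge0 _) hy.
have h3 : 0 <= h ^+ 3 by rewrite exprn_ge0.
have -> : X * Y - 1 - (h ^+ 2)%:C * (x + y) =
  rx + ry + (h ^+ 4)%:C * (x * y) + (h ^+ 2)%:C * (x * ry) + (h ^+ 2)%:C * (rx * y) + rx * ry.
  by rewrite /rx /ry !rmorphXn /=; ring.
have h2 : h ^+ 2 <= 1 by rewrite exprn_ile1.
have h20 : 0 <= h ^+ 2 by rewrite exprn_ge0.
have h31 : h ^+ 3 <= 1 by rewrite exprn_ile1.
have p1 (u : R[i]) c : cabs u <= c * h ^+ 3 -> cabs ((h ^+ 2)%:C * u) <= c * h ^+ 3.
  move=> uc; rewrite cabsM cabs_real ger0_norm //; apply: le_trans uc.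
  by rewrite ler_piMl ?cabs_ge0.
have q1 : cabs ((h ^+ 4)%:C * (x * y)) <= x0 * y0 * h ^+ 3.
  rewrite cabsM cabs_real ger0_norm ?exprn_ge0 // mulrC cabsM; apply: ler_pM; rewrite ?mulr_ge0 ?cabs_ge0 ?exprn_ge0 //.
    by apply: ler_pM; rewrite ?cabs_ge0.
  by rewrite [h ^+ 4]exprS ler_piMl.
have q2 : cabs (x * ry) <= x0 * Cy * h ^+ 3.
  by rewrite cabsM -mulrA; apply: ler_pM; rewrite ?cabs_ge0.
have q3 : cabs (rx * y) <= Cx * y0 * h ^+ 3.
  by rewrite cabsM mulrAC; apply: ler_pM; rewrite ?cabs_ge0.
have q4 : cabs (rx * ry) <= Cx * Cy * h ^+ 3.
  have c0 : 0 <= Cx * h ^+ 3 := le_trans (cabs_ge0 _) hX.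
  have c1 : 0 <= Cy * h ^+ 3 := le_trans (cabs_ge0 _) hY.
  rewrite cabsM; apply: (@le_trans _ _ ((Cx * h ^+ 3) * (Cy * h ^+ 3))).
    by apply: ler_pM; rewrite ?cabs_ge0.
  have [h00|hn0] := eqVneq h 0; first by rewrite h00 expr0n /= !mulr0.
  have hp : 0 < h ^+ 3 by rewrite exprn_gt0 // lt0r hn0.
  have d0 : 0 <= Cx * Cy.
    by move: c0 c1; rewrite (pmulr_lge0 Cx hp) (pmulr_lge0 Cy hp); exact: mulr_ge0.
  by rewrite mulrACA mulrA ler_wpM2r // ler_piMr.
clearbody rx ry; rewrite !mulrDl.
apply: le_trans (cabsD _ _) _; apply: lerD => //.
apply: le_trans (cabsD _ _) _; apply: lerD; last exact: p1.
apply: le_trans (cabsD _ _) _; apply: lerD; last exact: p1.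
apply: le_trans (cabsD _ _) _; apply: lerD => //.
by apply: le_trans (cabsD _ _) _; apply: lerD.
Qed.

Section Burgers.
Variables (R : realType) (lam : seq nat) (m : nat) (a b : nat -> int) (H : R -> R -> R).
Hypotheses (pl : is_partition lam) (l0 : lam != [::]).
Hypothesis ic : interlacing_coordinates R lam m a b.
Hypothesis lim : limiting_height lam (a 0%N) (a m) H.

Local Notation et := (Defs.eta R lam).
Local Notation transform := (@transform R lam a H).
Local Notation Jt := (@Jt R lam a H).
Local Notation Kt := (@Kt R lam a H).
Local Notation Wt := (@Wt R lam a H).

(** The z-derivative of [Kt] is -2 [Lt]. *)
Definition Lt t z := transform t (fun x => resolvent z x ^+ 3).

Lemma kernelD (g h : R -> R[i]) M C M' C' : kernel g M C -> kernel h M' C' ->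
  kernel (fun x => g x + h x) (M + M') (C + C').
Proof.
move=> [gM gC] [hM hC]; split=> [x|x x']; first by apply: le_trans (cabsD _ _) _; exact: lerD.
by rewrite opprD addrACA mulrDl; apply: le_trans (cabsD _ _) _; exact: lerD.
Qed.

Lemma kernelZ c (g : R -> R[i]) M C : kernel g M C -> kernel (fun x => c * g x) (cabs c * M) (cabs c * C).
Proof.
move=> [gM gC]; split=> [x|x x']; first by rewrite cabsM ler_wpM2l // cabs_ge0.
by rewrite -mulrBr cabsM -mulrA ler_wpM2l // cabs_ge0.
Qed.

Section Shift.
Variables (z w : R[i]) (e : R).
Hypotheses (e0 : 0 < e) (ez : e <= complex.Im z) (w0 : 0 <= complex.Im w).

Let ezw : e <= complex.Im (z + w). Proof. by rewrite ImD ler_wpDr. Qed.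
Let r x := resolvent z x.
Let r' x := resolvent (z + w) x.
Let k1 : kernel r e^-1 (e ^- 2) := kernel_resolvent e0 ez.
Let k1' : kernel r' e^-1 (e ^- 2) := kernel_resolvent e0 ezw.

Let rr x : r' x = r x - w * (r x * r' x).
Proof.
have := @resolventB R (z + w) z x x (lt_le_trans e0 ezw) (lt_le_trans e0 ez).
rewrite subrr addr0 -/(r x) -/(r' x) => /eqP; rewrite subr_eq => /eqP {1}->.
by rewrite opprD addNKr; ring.
Qed.

Lemma kernel_shift2 : exists C, kernel (fun x => r x * r x * r' x) (e ^- 3) C.
Proof.
have := kernelM (kernelM k1 k1) k1'.
have -> : e^-1 * e^-1 * e^-1 = e ^- 3 by field; rewrite gt_eqF.
by move=> k; eexists; exact: k.
Qed.

(** The resolvent identity applied twice: r' = r - w r^2 + w^2 r^2 r'. *)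
Lemma J_shift t : 0 <= t <= 1 ->
  Jt t (z + w) = Jt t z - w * Kt t z + w ^+ 2 * transform t (fun x => r x * r x * r' x).
Proof.
move=> t01; have [C kC] := kernel_shift2; have k2 := kernelM k1 k1.
rewrite -(transformZ pl l0 ic lim (w ^+ 2) t01 kC).
have -> : Kt t z = transform t (fun x => r x * r x) by apply: transform_ext => x; rewrite expr2.
rewrite -mulNr -(transformZ pl l0 ic lim (- w) t01 k2).
rewrite -(transformD pl l0 ic lim t01 k1 (kernelZ (- w) k2)).
rewrite -(transformD pl l0 ic lim t01 (kernelD k1 (kernelZ (- w) k2)) (kernelZ (w ^+ 2) kC)).
apply: transform_ext => x; rewrite -/(r' x) {1}rr {1}rr; ring.
Qed.

(** The remainder of [J_shift] is itself an integral against H, so its time increment carries a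
    factor t' - t. With w = h and t' - t = h^2 it is O(h^4). *)
Lemma J_shift_diff t t' : 0 <= t -> t <= t' -> t' <= 1 ->
  cabs ((Jt t' (z + w) - Jt t (z + w)) - (Jt t' z - Jt t z) + w * (Kt t' z - Kt t z)) <=
  cabs w ^+ 2 * ((t' - t) * e ^- 3).
Proof.
move=> t0 tt' t1; have t01 : 0 <= t <= 1 by rewrite t0 (le_trans tt').
have t01' : 0 <= t' <= 1 by rewrite t1 (le_trans t0).
have [C kC] := kernel_shift2; rewrite !J_shift //.
set Q := transform _ _; set Q' := transform _ _.
have -> : forall j k j' k' : R[i], j - w * k + w ^+ 2 * Q - (j' - w * k' + w ^+ 2 * Q') - (j - j') + w * (k - k')
  = w ^+ 2 * (Q - Q') by move=> *; ring.
rewrite cabsM cabsX; apply: ler_wpM2l; first by rewrite exprn_ge0 // cabs_ge0.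
exact: (transform_diff_bound pl l0 ic lim t0 tt' t1 kC).
Qed.

Lemma kernel_resolvent3 : exists C, kernel (fun x => r x ^+ 3) (e ^- 3) C.
Proof.
have k := kernelM k1 (kernelM k1 k1); eexists; move: k.
have -> : e^-1 * (e^-1 * e^-1) = e ^- 3 by field; rewrite gt_eqF.
exact.
Qed.

Lemma cabs_Lt t : 0 <= t <= 1 -> cabs (Lt t z) <= e ^- 3.
Proof.
move=> t01; have [C kC] := kernel_resolvent3.
apply: le_trans (transform_bound pl l0 ic lim t01 kC) _.
by apply: ler_piMl; [rewrite invr_ge0 exprn_ge0 // ltW|case/andP: t01].
Qed.

Lemma Lt_diff t t' : 0 <= t -> t <= t' -> t' <= 1 -> cabs (Lt t' z - Lt t z) <= (t' - t) * e ^- 3.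
Proof.
by move=> t0 tt' t1; have [C kC] := kernel_resolvent3; exact: (transform_diff_bound pl l0 ic lim t0 tt' t1 kC).
Qed.

Lemma K_shift t : 0 <= t <= 1 ->
  cabs (Kt t (z + w) - Kt t z + 2 * w * Lt t z) <= 3 * e ^- 4 * cabs w ^+ 2.
Proof.
move=> t01; have [C kC] := kernel_resolvent3; have k2 := kernel_resolvent2 e0 ez.
have kS := kernelM (kernelM k1 k1) (kernelM k1' (kernelD k1' (kernelD k1 k1))).
set g := (fun x => _ * _) in kS.
have E : Kt t (z + w) = Kt t z + - (2 * w) * Lt t z + w ^+ 2 * transform t g.
  rewrite -(transformZ pl l0 ic lim (w ^+ 2) t01 kS) -(transformZ pl l0 ic lim (- (2 * w)) t01 kC).
  rewrite -(transformD pl l0 ic lim t01 k2 (kernelZ (- (2 * w)) kC)).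
  rewrite -(transformD pl l0 ic lim t01 (kernelD k2 (kernelZ (- (2 * w)) kC)) (kernelZ (w ^+ 2) kS)).
  apply: transform_ext => x; rewrite -/(r x) -/(r' x) /g.
  have := rr x; move: (r x) (r' x) => p q h; symmetry.
  have -> : p ^+ 2 + - (2 * w) * p ^+ 3 + w ^+ 2 * (p * p * (q * (q + (p + p)))) =
    p ^+ 2 - 2 * w * p ^+ 2 * (p - w * (p * q)) + (w * (p * q)) ^+ 2 by ring.
  by rewrite -h [in RHS]h; ring.
rewrite E mulNr.
have -> : forall k l s : R[i], k - l + s - k + l = s by move=> *; ring.
rewrite cabsM cabsX mulrC; apply: ler_wpM2r; first by rewrite exprn_ge0 // cabs_ge0.
apply: le_trans (transform_bound pl l0 ic lim t01 kS) _.
have -> : e^-1 * e^-1 * (e^-1 * (e^-1 + (e^-1 + e^-1))) = 3 * e ^- 4 by field; rewrite gt_eqF.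
by apply: ler_piMl; [rewrite mulr_ge0 // invr_ge0 exprn_ge0 // ltW|case/andP: t01].
Qed.

End Shift.

End Burgers.

Ltac nonneg := repeat first [ done | assumption | (apply: ltW; assumption) | exact: cabs_ge0 |
  exact: expR_ge0 | apply: addr_ge0 | apply: mulr_ge0 | apply: exprn_ge0 | rewrite invr_ge0 ].

(** * One step along a characteristic *)

Section Characteristics.
Variables (R : realType) (lam : seq nat) (m : nat) (a b : nat -> int) (H : R -> R -> R).
Hypotheses (pl : is_partition lam) (l0 : lam != [::]).
Hypothesis ic : interlacing_coordinates R lam m a b.
Hypothesis lim : limiting_height lam (a 0%N) (a m) H.

Local Notation et := (Defs.eta R lam).
Local Notation Jt := (@Jt R lam a H).
Local Notation Kt := (@Kt R lam a H).
Local Notation Lt := (@Lt R lam a H).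
Local Notation Wt := (@Wt R lam a H).
Local Notation vcomplex := (@vcomplex R lam m a b).

Let et0 : 0 < et := eta_gt0 R pl l0.

Section Uniform.
Variables (e M t0 : R).
Hypotheses (e0 : 0 < e) (M0 : 0 <= M) (t00 : 0 < t0).

Let Mw := M * expR (e ^- 2).
Let Mw0 : 0 <= Mw. Proof. by rewrite mulr_ge0 ?expR_ge0. Qed.
Let e20 : 0 < e ^- 2. Proof. by rewrite invr_gt0 exprn_gt0. Qed.
Let e30 : 0 < e ^- 3. Proof. by rewrite invr_gt0 exprn_gt0. Qed.
Let e40 : 0 < e ^- 4. Proof. by rewrite invr_gt0 exprn_gt0. Qed.
Let e10 : 0 < e^-1. Proof. by rewrite invr_gt0. Qed.

Let inv_t t : t0 <= t -> t^-1 <= t0^-1.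
Proof. by move=> tt; rewrite lef_pV2 ?posrE // (lt_le_trans t00). Qed.

Lemma increment_J_uniform : exists2 C, 0 <= C & forall z t1 t2, e <= complex.Im z -> cabs z <= M ->
  t0 <= t1 -> t1 < t2 -> t2 <= 1 ->
  cabs (Jt t2 z - Jt t1 z - ((t2 - t1) / t1)%:C * (z - Wt t1 z)) <= C * (t2 - t1) ^+ 2.
Proof.
exists (8 * (Mw * e ^- 2) * t0^-1 + 16 * (M + Mw) * (t0^-1) ^+ 2).
  by nonneg.
move=> z t1 t2 ez zM tt t12 t21.
have t10 := lt_le_trans t00 tt.
apply: le_trans (increment_J pl l0 ic lim e0 ez t10 t12 t21) _.
apply: ler_wpM2r; first exact: sqr_ge0.
have hw : cabs z * expR (e ^- 2) <= Mw by rewrite ler_wpM2r ?expR_ge0.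
have w0 : 0 <= cabs z * expR (e ^- 2) by rewrite mulr_ge0 ?cabs_ge0 ?expR_ge0.
have hi := inv_t tt; have i0 : 0 <= t1^-1 by rewrite invr_ge0 ltW.
apply: lerD.
  apply: ler_pM => //; first by nonneg.
  by rewrite ler_pM2l // ler_pM2r.
rewrite -(exprVn t1); apply: ler_pM => //; rewrite ?exprn_ge0 //.
- by nonneg.
- by rewrite ler_pM2l // lerD.
by rewrite lerXn2r ?nnegrE ?invr_ge0 // ltW.
Qed.

Let c1 := 2 * e ^- 3 + 3 * e ^- 4.
Let c10 : 0 < c1. Proof. by rewrite addr_gt0 // mulr_gt0. Qed.

(** dW/dz = W/z - W dK/dz, and dK/dz = -2L. *)
Lemma W_shift : exists2 C, 0 <= C & forall z t h, e <= complex.Im z -> cabs z <= M ->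
  0 <= t <= 1 -> 0 < h <= 1 -> c1 * h <= 1 / 2 ->
  cabs (Wt t (z + h%:C) - Wt t z - h%:C * (Wt t z / z + 2 * Lt t z * Wt t z)) <= C * h ^+ 2.
Proof.
exists (expR (e ^- 2) * (2 * e ^- 3 + (M + 1) * (3 * e ^- 4 + 4 * c1 ^+ 2))).
  by nonneg.
move=> z t h ez zM t01 /andP[h0 h1] ch.
have y0 := lt_le_trans e0 ez.
have z0 : z != 0 by have := resolvent_neq0 0 y0; rewrite subr0.
have w0 : 0 <= complex.Im h%:C by rewrite ImC.
have hK := K_shift pl l0 ic lim e0 ez w0 t01.
have hL := cabs_Lt pl l0 ic lim e0 ez t01.
have hKt := cabs_Kt pl l0 ic lim e0 ez t01.
set K := Kt t z in hK hKt *; set K' := Kt t (z + h%:C) in hK *; set L := Lt t z in hK hL *.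
pose rho := K' - K + 2 * h%:C * L.
have hrho : cabs rho <= 3 * e ^- 4 * h ^+ 2 by move: hK; rewrite cabs_real gtr0_norm.
pose u := 2 * h%:C * L - rho.
have hu : cabs u <= c1 * h.
  apply: le_trans (cabsB _ _) _; rewrite /c1 [leRHS]mulrDl; apply: lerD.
    rewrite -[2]/(2%:R) -(rmorph_nat (real_complex R)) -rmorphM cabsM cabs_real ger0_norm; last by rewrite mulr_ge0 // ltW.
    by rewrite mulrAC ler_pM2r // ler_pM2l.
  apply: le_trans hrho _; apply: ler_wpM2l; first by nonneg.
  by rewrite expr2 ler_piMl // ltW.
have ht := cexp_taylor (le_trans hu ch).
set tau := cexp u - 1 - u in ht.
have htau : cabs tau <= 4 * c1 ^+ 2 * h ^+ 2.
  apply: le_trans ht _; rewrite -mulrA ler_pM2l // -exprMn lerXn2r ?nnegrE ?cabs_ge0 //.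
  by rewrite mulr_ge0 // ltW.
have eK : cexp (- K') = cexp (- K) * (1 + u + tau).
  have -> : 1 + u + tau = cexp u by rewrite /tau; ring.
  by rewrite -cexpD /u /rho; congr cexp; ring.
rewrite /Wt -/K -/K' eK.
have -> : (z + h%:C) * (cexp (- K) * (1 + u + tau)) - z * cexp (- K) -
     h%:C * (z * cexp (- K) / z + 2 * L * (z * cexp (- K))) =
   cexp (- K) * ((h ^+ 2)%:C * (2 * L) + (z + h%:C) * (tau - rho)).
  by rewrite /u rmorphXn /=; field.
rewrite cabsM -mulrA; apply: ler_pM; rewrite ?cabs_ge0 //.
  by apply: le_trans (cabs_cexp_le _) _; rewrite cabsN ler_expR.
rewrite [leRHS]mulrDl; apply: le_trans (cabsD _ _) _; apply: lerD.
  rewrite cabsM cabs_real ger0_norm ?exprn_ge0 // ?(ltW h0) // mulrC ler_pM2r ?exprn_gt0 //.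
  by rewrite cabsM -[2]/(2%:R) -(rmorph_nat (real_complex R)) cabs_real ger0_norm // ler_pM2l.
rewrite cabsM -mulrA; apply: ler_pM; rewrite ?cabs_ge0 //.
  by apply: le_trans (cabsD _ _) _; rewrite cabs_real gtr0_norm // lerD.
by apply: le_trans (cabsB _ _) _; rewrite [leRHS]mulrDl addrC lerD.
Qed.

End Uniform.

Section Step.
Variables (e M t0 : R).
Hypotheses (e0 : 0 < e) (M0 : 0 <= M) (t00 : 0 < t0).

(** K is minus a z-derivative of J, so its time increment is a difference quotient of J increments
    at z and z + h. With time step h^2 their errors are O(h^4), and division by h leaves O(h^3); the
    main term is minus the difference quotient of (z - W)/t. *)
Lemma K_increment : exists C h0, [/\ 0 <= C, 0 < h0 <= 1 & forall z t h, e <= complex.Im z -> cabs z <= M ->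
  t0 <= t -> 0 < h <= h0 -> t + h ^+ 2 <= 1 ->
  cabs (Kt (t + h ^+ 2) z - Kt t z - (h ^+ 2 / t)%:C * (Wt t z / z + 2 * Lt t z * Wt t z - 1)) <= C * h ^+ 3].
Proof.
have M1 : 0 <= M + 1 by rewrite addr_ge0.
have [C1 C10 HJ] := increment_J_uniform e0 M1 t00.
have [C2 C20 HW] := W_shift e0 M0.
set c1 := 2 * e ^- 3 + 3 * e ^- 4 in HW.
have c10 : 0 < c1 by rewrite addr_gt0 // mulr_gt0 // invr_gt0 exprn_gt0.
have e30 : 0 < e ^- 3 by rewrite invr_gt0 exprn_gt0.
exists (e ^- 3 + C1 + C1 + C2 / t0), (Num.min 1 (1 / (2 * c1))); split.
- by nonneg.
- by rewrite lt_min ltr01 divr_gt0 ?mulr_gt0 //= ge_min lexx.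
move=> z t h ez zM tt /andP[h0]; rewrite le_min => /andP[h1 hc] th1.
have t0' := lt_le_trans t00 tt.
have h20 : 0 < h ^+ 2 by rewrite exprn_gt0.
have tlt : t < t + h ^+ 2 by rewrite ltrDl.
have t01 : 0 <= t <= 1 by rewrite ltW //= ltW // (lt_le_trans tlt).
have ch : c1 * h <= 1 / 2.
  move: hc; rewrite ler_pdivlMr ?mulr_gt0 //; lra.
have hh : 0 < h <= 1 by rewrite h0.
have w0 : 0 <= complex.Im h%:C by rewrite ImC.
have zM1 : cabs z <= M + 1 by rewrite (le_trans zM) // lerDl.
have zM2 : cabs (z + h%:C) <= M + 1.
  by apply: le_trans (cabsD _ _) _; rewrite cabs_real gtr0_norm // lerD.
have ez2 : e <= complex.Im (z + h%:C) by rewrite ImD ImC addr0.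
have g1 := HJ z t (t + h ^+ 2) ez zM1 tt tlt th1.
have g2 := HJ (z + h%:C) t (t + h ^+ 2) ez2 zM2 tt tlt th1.
have g3 := HW z t h ez zM t01 hh ch.
have g4 := J_shift_diff pl l0 ic lim e0 ez w0 (ltW t0') (ltW tlt) th1.
have dt : t + h ^+ 2 - t = h ^+ 2 by rewrite addrAC subrr add0r.
rewrite !dt in g1 g2 g4.
rewrite cabs_real gtr0_norm // in g4.
set D := Wt t z / z + 2 * Lt t z * Wt t z in g3 *.
suff : h * cabs (Kt (t + h ^+ 2) z - Kt t z - (h ^+ 2 / t)%:C * (D - 1)) <=
    h * ((e ^- 3 + C1 + C1 + C2 / t0) * h ^+ 3) by rewrite ler_pM2l.
rewrite -{1}(gtr0_norm h0) -cabs_real -cabsM.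
clearbody D; move: g1 g2 g3 g4; move: (Jt t z) (Jt (t + h ^+ 2) z) (Jt t (z + h%:C)) (Jt (t + h ^+ 2) (z + h%:C))
  (Wt t z) (Wt t (z + h%:C)) (Kt t z) (Kt (t + h ^+ 2) z)
  => J1 J2 J3 J4 W1 W2 K1 K2 g1 g2 g3 g4.
(* The four groups are the shift estimate, the J increments at z + h and at z, and [W_shift]. *)
have -> : h%:C * (K2 - K1 - (h ^+ 2 / t)%:C * (D - 1)) =
  (J4 - J3 - (J2 - J1) + h%:C * (K2 - K1)) - (J4 - J3 - (h ^+ 2 / t)%:C * (z + h%:C - W2)) +
  (J2 - J1 - (h ^+ 2 / t)%:C * (z - W1)) + (h ^+ 2 / t)%:C * (W2 - W1 - h%:C * D) by ring.
have -> : h * ((e ^- 3 + C1 + C1 + C2 / t0) * h ^+ 3) =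
  h ^+ 2 * (h ^+ 2 * e ^- 3) + C1 * (h ^+ 2) ^+ 2 + C1 * (h ^+ 2) ^+ 2 + h ^+ 2 / t0 * (C2 * h ^+ 2) by ring.
apply: le_trans (cabsD _ _) _; apply: lerD; last first.
  rewrite cabsM cabs_real gtr0_norm ?divr_gt0 //; apply: ler_pM => //; [by rewrite divr_ge0 // ltW|exact: cabs_ge0|].
  by rewrite ler_pM2l // lef_pV2 ?posrE.
apply: le_trans (cabsD _ _) _; apply: lerD => //.
by apply: le_trans (cabsB _ _) _; apply: lerD.
Qed.

Definition velocity t z : R[i] := (t^-1)%:C * Wt t z.

Let V := (M * expR (e ^- 2)) / t0.
Let V0 : 0 <= V. Proof. by rewrite divr_ge0 ?mulr_ge0 ?expR_ge0 // ltW. Qed.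

Lemma cabs_velocity z t : e <= complex.Im z -> cabs z <= M -> t0 <= t <= 1 -> cabs (velocity t z) <= V.
Proof.
move=> ez zM /andP[tt t1]; have t0' := lt_le_trans t00 tt.
have t01 : 0 <= t <= 1 by rewrite ltW.
rewrite cabsM cabs_real gtr0_norm ?invr_gt0 // mulrC; apply: ler_pM; rewrite ?cabs_ge0 ?invr_ge0 ?(ltW t0') //.
  apply: le_trans (cabs_Wt pl l0 ic lim e0 ez t01) _.
  by rewrite ler_wpM2r ?expR_ge0.
by rewrite lef_pV2 ?posrE.
Qed.

(** The line of slope [c] is a characteristic when the velocity on it is [c]; the deviation of the
    velocity from [c] obeys a discrete Gronwall inequality. The condition Im c >= 0 keeps the line
    in the half-plane where the estimates are uniform. *)
Lemma velocity_step : exists C L h0, [/\ 0 <= C, 0 <= L, 0 < h0 <= 1 &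
  forall z t h c, e <= complex.Im z -> cabs z <= M -> 0 <= complex.Im c -> cabs c <= V ->
  t0 <= t -> 0 < h <= h0 -> t + h ^+ 2 <= 1 ->
  cabs (velocity (t + h ^+ 2) (z + (h ^+ 2)%:C * c) - c) <=
    cabs (velocity t z - c) * (1 + L * h ^+ 2) + C * h ^+ 3].
Proof.
have [C [h0 [C0 /andP[h00 h01] HK]]] := K_increment.
have e10 : 0 < e^-1 by rewrite invr_gt0.
have e30 : 0 < e ^- 3 by rewrite invr_gt0 exprn_gt0.
have e40 : 0 < e ^- 4 by rewrite invr_gt0 exprn_gt0.
have ti0 : 0 < t0^-1 by rewrite invr_gt0.
pose C3 := 3 * e ^- 4 * V ^+ 2 + 2 * V * e ^- 3 + C.
have C30 : 0 <= C3 by rewrite /C3; nonneg.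
pose D0 := V * e^-1 + t0^-1 + 2 * e ^- 3 * (V + V).
have D00 : 0 <= D0 by rewrite /D0; nonneg.
pose x0 := V * e^-1; pose C4 := 4 * (D0 + C3) ^+ 2 + C3; pose y0 := t0^-1.
pose Cxy := 0 + y0 ^+ 2 + x0 * y0 + x0 * y0 ^+ 2 + 0 * y0 + 0 * y0 ^+ 2.
pose C5 := Cxy + C4 + (x0 + y0) * D0 + (x0 + y0) * C4 + Cxy * D0 + Cxy * C4.
have x00 : 0 <= x0 by rewrite /x0; nonneg.
have y00 : 0 <= y0 by exact: ltW.
have C40 : 0 <= C4 by rewrite /C4; nonneg.
have Cxy0 : 0 <= Cxy by rewrite /Cxy; nonneg.
have C50 : 0 <= C5 by rewrite /C5; nonneg.
pose h1 := Num.min h0 (1 / (2 * (D0 + C3 + 1))).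
have dc : 0 < 2 * (D0 + C3 + 1) by rewrite mulr_gt0 // ltr_wpDl // addr_ge0.
exists (V * C5), (V * (e^-1 + 2 * e ^- 3)), h1; split.
- exact: mulr_ge0.
- by nonneg.
- by rewrite lt_min h00 divr_gt0 //= ge_min h01.
move=> z t h c ez zM c0 cV tt /andP[hp]; rewrite le_min => /andP[hh0 hh1] th1.
have hle1 : h <= 1 := le_trans hh0 h01.
have h01' : 0 <= h <= 1 by rewrite ltW.
have h20 : 0 < h ^+ 2 by rewrite exprn_gt0.
have h21 : h ^+ 2 <= 1 by rewrite exprn_ile1 // ltW.
have h30 : 0 < h ^+ 3 by rewrite exprn_gt0.
have h43 : h ^+ 4 <= h ^+ 3 by rewrite [h ^+ 4]exprS ler_piMl // ltW.
have h23 : h ^+ 3 <= h ^+ 2 by rewrite exprS ler_piMl // ltW.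
have tp := lt_le_trans t00 tt.
have tlt : t < t + h ^+ 2 by rewrite ltrDl.
have t01 : 0 <= t <= 1 by rewrite ltW //= ltW // (lt_le_trans tlt).
have t02 : 0 <= t + h ^+ 2 <= 1 by rewrite th1 andbT addr_ge0 // ltW.
have tt1 : t0 <= t <= 1 by rewrite tt; case/andP: t01.
have yz := lt_le_trans e0 ez.
have z0 : z != 0 by have := resolvent_neq0 0 yz; rewrite subr0.
have hz : cabs z^-1 <= e^-1.
  by apply: cabs_inv_le => //; apply: le_trans (abs_Im z); apply: le_trans ez _; exact: ler_norm.
have hv := cabs_velocity ez zM tt1.
have hL := cabs_Lt pl l0 ic lim e0 ez t01.
set v := velocity t z in hv *; set L := Lt t z in hL *.
pose w := (h ^+ 2)%:C * c.
have w0 : 0 <= complex.Im w by rewrite ImM ReC ImC mul0r addr0 mulr_ge0 // ltW.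
have hw : cabs w <= h ^+ 2 * V by rewrite cabsM cabs_real gtr0_norm // ler_pM2l.
(* The new velocity is v times three factors coming from z, 1/t and exp(-K). Their first-order terms
   c/z, -1/t and -D add up to -(v - c)(1/z + 2L), which is proportional to the deviation. *)
pose D := v / z - (t^-1)%:C + 2 * L * (v - c).
have two u : cabs (2 * u) = 2 * cabs u :> R.
  by rewrite cabsM -[2 in LHS]/(2%:R) -(rmorph_nat (real_complex R)) cabs_real ger0_norm.
have tiC : cabs (t^-1)%:C <= t0^-1 by rewrite cabs_real gtr0_norm ?invr_gt0 // lef_pV2 ?posrE.
have hD : cabs D <= D0.
  apply: le_trans (cabsD _ _) _; apply: lerD.
    apply: le_trans (cabsB _ _) _; apply: lerD => //.
    by rewrite cabsM; apply: ler_pM; rewrite ?cabs_ge0.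
  rewrite -mulrA two -mulrA ler_pM2l // cabsM; apply: ler_pM; rewrite ?cabs_ge0 //.
  by apply: le_trans (cabsB _ _) _; apply: lerD.
pose dK := Kt (t + h ^+ 2) (z + w) - Kt t z.
have tC : t%:C != 0 by rewrite -[0]/(0%:C) (inj_eq (@complexI _)) gt_eqF.
have WE : Wt t z = t%:C * v by rewrite /v /velocity mulrA -rmorphM mulfV ?mul1r // gt_eqF.
have hdK : cabs (dK - (h ^+ 2)%:C * D) <= C3 * h ^+ 3.
  have g1 := HK z t h ez zM tt (introT andP (conj hp hh0)) th1.
  have g2 := K_shift pl l0 ic lim e0 ez w0 t02.
  have g3 := Lt_diff pl l0 ic lim e0 ez (ltW tp) (ltW tlt) th1.
  have -> : dK - (h ^+ 2)%:C * D = (Kt (t + h ^+ 2) (z + w) - Kt (t + h ^+ 2) z + 2 * w * Lt (t + h ^+ 2) z)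
     - 2 * (w * (Lt (t + h ^+ 2) z - Lt t z)) +
     (Kt (t + h ^+ 2) z - Kt t z - (h ^+ 2 / t)%:C * (Wt t z / z + 2 * Lt t z * Wt t z - 1)).
    by rewrite /dK /D WE -/L fmorph_div fmorphV /w; field; rewrite z0 tC.
  rewrite /C3 [leRHS]mulrDl [X in _ <= X + _]mulrDl; apply: le_trans (cabsD _ _) _; apply: lerD => //.
  apply: le_trans (cabsB _ _) _; apply: lerD.
    apply: le_trans g2 _; rewrite -[leRHS]mulrA ler_pM2l ?mulr_gt0 //.
    apply: (@le_trans _ _ ((h ^+ 2 * V) ^+ 2)).
      by rewrite lerXn2r ?nnegrE ?cabs_ge0 // mulr_ge0 // ltW.
    by rewrite exprMn mulrC -exprM ler_wpM2l // sqr_ge0.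
  have -> : 2 * V * e ^- 3 * h ^+ 3 = 2 * (V * e ^- 3 * h ^+ 3) by ring.
  rewrite two ler_pM2l // cabsM.
  apply: (@le_trans _ _ ((h ^+ 2 * V) * (h ^+ 2 * e ^- 3))).
    have dt : t + h ^+ 2 - t = h ^+ 2 by rewrite addrAC subrr add0r.
    by rewrite dt in g3; apply: ler_pM; rewrite ?cabs_ge0.
  have -> : h ^+ 2 * V * (h ^+ 2 * e ^- 3) = V * e ^- 3 * h ^+ 4 by ring.
  by apply: ler_wpM2l => //; nonneg.
have hdK2 : cabs dK <= (D0 + C3) * h ^+ 2.
  have -> : dK = (dK - (h ^+ 2)%:C * D) + (h ^+ 2)%:C * D by rewrite subrK.
  rewrite [leRHS]mulrDl [leRHS]addrC; apply: le_trans (cabsD _ _) _; apply: lerD.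
    by apply: le_trans hdK _; rewrite ler_wpM2l.
  by rewrite cabsM cabs_real gtr0_norm // mulrC ler_pM2r.
have hdK3 : cabs (- dK) <= 1 / 2.
  rewrite cabsN; apply: le_trans hdK2 _; apply: (@le_trans _ _ ((D0 + C3) * h)).
    by apply: ler_wpM2l; [exact: addr_ge0|rewrite expr2 ler_piMl // ltW].
  by move: hh1; rewrite ler_pdivlMr //; lra.
have eX : cabs (1 + (h ^+ 2)%:C * (c / z) - 1 - (h ^+ 2)%:C * (c / z)) <= 0 * h ^+ 3.
  by rewrite [1 + _]addrC addrK subrr cabs0 mul0r.
have hx : cabs (c / z) <= x0 by rewrite cabsM; apply: ler_pM; rewrite ?cabs_ge0.
have hy : cabs (- (t^-1)%:C) <= y0 by rewrite cabsN.
pose Y : R := (1 + h ^+ 2 / t)^-1.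
have q0 : 0 < 1 + h ^+ 2 / t by rewrite addr_gt0 // divr_gt0.
have eY : cabs (Y%:C - 1 - (h ^+ 2)%:C * - (t^-1)%:C) <= y0 ^+ 2 * h ^+ 3.
  have -> : Y%:C - 1 - (h ^+ 2)%:C * - (t^-1)%:C = (Y - 1 + h ^+ 2 * t^-1)%:C.
    by rewrite rmorphD rmorphB rmorphM rmorph1; ring.
  have -> : Y - 1 + h ^+ 2 * t^-1 = Y * (h ^+ 4 * (t^-1) ^+ 2).
    apply: (mulfI (lt0r_neq0 q0)); rewrite mulrA mulfV ?lt0r_neq0 // mul1r mulrDr mulrBr.
    by rewrite mulfV ?lt0r_neq0 //; field; rewrite gt_eqF.
  have Y1 : Y <= 1 by rewrite invf_le1 // lerDl divr_ge0 // ltW.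
  have Y0 : 0 < Y by rewrite invr_gt0.
  have p0 : 0 < h ^+ 4 * (t^-1) ^+ 2 by rewrite mulr_gt0 ?exprn_gt0 ?invr_gt0.
  rewrite cabs_real gtr0_norm; last by rewrite mulr_gt0.
  apply: (@le_trans _ _ (h ^+ 4 * (t^-1) ^+ 2)).
    by rewrite ler_piMl // ltW.
  rewrite mulrC; apply: ler_pM; rewrite ?sqr_ge0 ?exprn_ge0 // ?(ltW hp) //.
  by rewrite lerXn2r ?nnegrE ?invr_ge0 ?(ltW tp) ?(ltW t00) // lef_pV2 ?posrE.
have eZ : cabs (cexp (- dK) - 1 - (h ^+ 2)%:C * - D) <= C4 * h ^+ 3.
  have ht := cexp_taylor hdK3.
  have -> : cexp (- dK) - 1 - (h ^+ 2)%:C * - D = (cexp (- dK) - 1 - - dK) - (dK - (h ^+ 2)%:C * D) by ring.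
  apply: le_trans (cabsB _ _) _; rewrite /C4 [leRHS]mulrDl; apply: lerD => //.
  apply: le_trans ht _; rewrite -mulrA ler_pM2l // cabsN.
  apply: (@le_trans _ _ (((D0 + C3) * h ^+ 2) ^+ 2)).
    by rewrite lerXn2r ?nnegrE ?cabs_ge0 //; nonneg.
  by rewrite exprMn -exprM ler_wpM2l // sqr_ge0.
have hDN : cabs (- D) <= D0 by rewrite cabsN.
have hxy : cabs (c / z + - (t^-1)%:C) <= x0 + y0 by apply: le_trans (cabsD _ _) _; exact: lerD.
have eXY := product_expansion h01' hx hy eX eY; rewrite -/Cxy in eXY.
have eP := product_expansion h01' hxy hDN eXY eZ; rewrite -/C5 in eP.
set P := _ * cexp _ in eP.
have vE : velocity (t + h ^+ 2) (z + w) = v * P.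
  have -> : velocity (t + h ^+ 2) (z + w) = ((t + h ^+ 2)^-1)%:C * ((z + w) * (cexp (- Kt t z) * cexp (- dK))).
    by rewrite /velocity /Wt -cexpD; congr (_ * (_ * cexp _)); rewrite /dK; ring.
  have -> : (t + h ^+ 2)^-1 = t^-1 * Y.
    by rewrite /Y -invfM; congr (_^-1); field; rewrite gt_eqF.
  rewrite /P /v /velocity /Wt /w [(t^-1 * Y)%:C]rmorphM /=.
  have -> : z + (h ^+ 2)%:C * c = z * (1 + (h ^+ 2)%:C * (c / z)).
    by rewrite mulrDr mulr1 mulrCA [z * _]mulrCA mulfV // mulr1.
  by move: (t^-1)%:C Y%:C (h ^+ 2)%:C (cexp _) (cexp _) (c / z) => *; ring.
have -> : velocity (t + h ^+ 2) (z + w) - c = (v - c) * (1 - (h ^+ 2)%:C * (v * (z^-1 + 2 * L))) +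
   v * (P - 1 - (h ^+ 2)%:C * (c / z + - (t^-1)%:C + - D)).
  by rewrite vE /D; ring.
apply: le_trans (cabsD _ _) _; apply: lerD; last first.
  by rewrite cabsM -mulrA; apply: ler_pM; rewrite ?cabs_ge0.
rewrite cabsM; apply: ler_wpM2l; first exact: cabs_ge0.
apply: le_trans (cabsB _ _) _; rewrite cabs1 lerD2l cabsM cabs_real gtr0_norm // mulrC ler_pM2r //.
rewrite cabsM; apply: ler_pM; rewrite ?cabs_ge0 //.
by apply: le_trans (cabsD _ _) _; rewrite two; apply: lerD => //; rewrite ler_pM2l.
Qed.

End Step.

End Characteristics.

(** * Frozen points *)

Lemma ImV (R : realType) (z : R[i]) : complex.Im z^-1 = - (complex.Im z / cabs z ^+ 2).
Proof. by rewrite cabs_sqr; case: z => p q. Qed.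

Lemma ReV (R : realType) (z : R[i]) : complex.Re z^-1 = complex.Re z / cabs z ^+ 2.
Proof. by rewrite cabs_sqr; case: z => p q. Qed.

Lemma between_norm (R : realDomainType) (x y c o D : R) : Num.min x y <= c <= Num.max x y ->
  `|x - o| <= D -> `|y - o| <= D -> `|c - o| <= D.
Proof.
rewrite ge_min le_max !ler_norml => /andP[/orP h1 /orP h2] /andP[a1 a2] /andP[b1 b2].
by case: h1 => h1; case: h2 => h2; lra.
Qed.

Section FrozenPoints.
Variables (R : realType) (m : nat) (p B : nat -> R).
Hypothesis p0 : forall j, (j < m)%N -> 0 < p j.
Hypothesis m0 : (0 < m)%N.
Implicit Types (u w x s : R).

Definition vfun u : R := u - \sum_(0 <= j < m) p j / (u - B j).
Definition Xfun s u : R := u - s * vfun u.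
Definition Sfun u : R := \sum_(0 <= j < m) p j / (u - B j) ^+ 2.
Definition Qfun u : R := \sum_(0 <= j < m) p j / (u - B j) ^+ 3.
Definition mixed u w : R := \sum_(0 <= j < m) p j / ((u - B j) * (w - B j)).
Definition vcpx (u : R[i]) : R[i] := u - \sum_(0 <= j < m) (p j)%:C / (u - (B j)%:C).
Definition Scpx (u : R[i]) : R := \sum_(0 <= j < m) p j / cabs (u - (B j)%:C) ^+ 2.
Definition off_poles u := forall j, (j < m)%N -> u - B j != 0.
(** No pole lies in the closed interval between the two points. *)
Definition same_gap u w := forall j, (j < m)%N -> 0 < (u - B j) * (w - B j).

Lemma sum_lt (f g : nat -> R) : (forall j, (j < m)%N -> f j <= g j) ->
  \sum_(0 <= j < m) f j <= \sum_(0 <= j < m) g j.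
Proof. by move=> h; rewrite big_nat [leRHS]big_nat; apply: ler_sum => j /andP[_]; exact: h. Qed.

Lemma same_gap_off u w : same_gap u w -> off_poles u /\ off_poles w.
Proof.
by move=> g; split=> j jm; have := g j jm; apply: contraTneq => ->; rewrite ?mul0r ?mulr0 ltxx.
Qed.

Lemma same_gap_between u w c : same_gap u w -> Num.min u w <= c <= Num.max u w ->
  same_gap u c /\ same_gap c w.
Proof.
move=> g cb; suff h j : (j < m)%N -> 0 < (u - B j) * (c - B j) /\ 0 < (c - B j) * (w - B j).
  by split=> j /h[].
move=> jm; have := g j jm; move: cb; rewrite minEle maxEle; move: (B j) => beta.
have [uw|uw] := leP u w => /andP[h1 h2] hg.
  have [hb|hb] := leP u beta.
    have : w < beta by nra.
    by split; nra.
  by split; nra.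
have [hb|hb] := leP w beta.
  have : u < beta by nra.
  by split; nra.
by split; nra.
Qed.

Lemma vfunB u w : off_poles u -> off_poles w -> vfun u - vfun w = (u - w) * (1 + mixed u w).
Proof.
move=> hu hw; rewrite /vfun /mixed mulrDr mulr1 mulr_sumr.
rewrite opprD opprK addrACA; congr (_ + _); rewrite addrC -sumrB; apply: eq_big_nat => j /andP[_ jm].
by field; rewrite hu ?hw.
Qed.

Lemma XfunB s u w : off_poles u -> off_poles w ->
  Xfun s u - Xfun s w = (u - w) * (1 - s * (1 + mixed u w)).
Proof.
move=> hu hw; rewrite /Xfun.
have -> : u - s * vfun u - (w - s * vfun w) = (u - w) - s * (vfun u - vfun w) by ring.
by rewrite vfunB //; ring.
Qed.

Lemma mixed_le u w : off_poles u -> off_poles w -> mixed u w <= (Sfun u + Sfun w) / 2.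
Proof.
move=> hu hw; rewrite /Sfun -big_split /= mulr_suml; apply: sum_lt => j jm.
have := p0 jm; have := hu j jm; have := hw j jm; move: (u - B j) (w - B j) (p j) => y z q z0 y0 q0.
have -> : (q / y ^+ 2 + q / z ^+ 2) / 2 = q / (y * z) + q * (y^-1 - z^-1) ^+ 2 / 2 by field; rewrite y0 z0.
by rewrite lerDl divr_ge0 // mulr_ge0 ?sqr_ge0 // ltW.
Qed.

Lemma mixed_gt0 u w : same_gap u w -> 0 <= mixed u w.
Proof.
move=> g; rewrite /mixed big_nat; apply: sumr_ge0 => j /andP[_ jm].
by rewrite divr_ge0 // ltW // ?p0 ?g.
Qed.

Lemma Sfun_ge0 u : 0 <= Sfun u.
Proof. by rewrite /Sfun big_nat; apply: sumr_ge0 => j /andP[_ jm]; rewrite divr_ge0 ?sqr_ge0 // ltW // p0. Qed.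

(** Convexity of S between two consecutive poles; its derivative is -2Q. *)
Lemma Sfun_tangent u w : same_gap u w -> Sfun u - Sfun w >= - 2 * Qfun w * (u - w).
Proof.
move=> g; rewrite /Sfun /Qfun -sumrB -mulrA mulr_suml mulr_sumr; apply: sum_lt => j jm.
have := g j jm; have := p0 jm.
have -> : u - w = (u - B j) - (w - B j) by ring.
move: (u - B j) (w - B j) (p j) => y z q q0 yz.
have y0 : y != 0 by apply: contraTneq yz => ->; rewrite mul0r ltxx.
have z0 : z != 0 by apply: contraTneq yz => ->; rewrite mulr0 ltxx.
rewrite -subr_ge0.
have -> : q / y ^+ 2 - q / z ^+ 2 - -2 * (q / z ^+ 3 * (y - z)) =
  q * (y^-1 - z^-1) ^+ 2 * (1 + 2 * (y * z) * z ^- 2) by field; rewrite y0 z0.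
apply: mulr_ge0; first by rewrite mulr_ge0 ?sqr_ge0 // ltW.
by rewrite addr_ge0 // mulr_ge0 ?invr_ge0 ?sqr_ge0 // mulr_ge0 // ltW.
Qed.

(** As a function of y, 1/(y z) is convex where y has the sign of z, and lies above its tangent at y
    = z. *)
Lemma mixed_tangent u w : same_gap u w -> mixed u w >= Sfun w - Qfun w * (u - w).
Proof.
move=> g; rewrite /Sfun /Qfun /mixed mulr_suml -sumrB; apply: sum_lt => j jm.
have := g j jm; have := p0 jm.
have -> : u - w = (u - B j) - (w - B j) by ring.
move: (u - B j) (w - B j) (p j) => y z q q0 yz.
have y0 : y != 0 by apply: contraTneq yz => ->; rewrite mul0r ltxx.
have z0 : z != 0 by apply: contraTneq yz => ->; rewrite mulr0 ltxx.
rewrite -subr_ge0.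
have -> : q / (y * z) - (q / z ^+ 2 - q / z ^+ 3 * (y - z)) = q * (y^-1 - z^-1) ^+ 2 * (y * z) * z ^- 2 by field; rewrite y0 z0.
apply: mulr_ge0; last by rewrite invr_ge0 sqr_ge0.
apply: mulr_ge0; last exact: ltW.
by apply: mulr_ge0; [exact: ltW|exact: sqr_ge0].
Qed.

Lemma Qfun_mono u w : same_gap u w -> u <= w -> Qfun w <= Qfun u.
Proof.
move=> g uw; apply: sum_lt => j jm; have := g j jm; have := p0 jm.
have : u - B j <= w - B j by rewrite lerD2r.
move: (u - B j) (w - B j) (p j) => y z q yz q0 h.
rewrite ler_pM2l //.
have y0 : y != 0 by apply: contraTneq h => ->; rewrite mul0r ltxx.
have z0 : z != 0 by apply: contraTneq h => ->; rewrite mulr0 ltxx.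
have hi : z^-1 <= y^-1.
  rewrite -subr_ge0; have -> : y^-1 - z^-1 = (z - y) / (y * z) by field; rewrite y0 z0.
  by rewrite divr_ge0 ?subr_ge0 // ltW.
rewrite -!exprVn -subr_ge0.
have -> : y^-1 ^+ 3 - z^-1 ^+ 3 = (y^-1 - z^-1) * ((y^-1 + z^-1 / 2) ^+ 2 + 3 * (z^-1 / 2) ^+ 2) by field; rewrite y0 z0.
by rewrite mulr_ge0 ?subr_ge0 // addr_ge0 ?sqr_ge0 // mulr_ge0 ?sqr_ge0.
Qed.

(** Q decreases inside a gap, so Q A = 0 makes S decrease towards [A] from both sides. *)
Lemma Sfun_between A u w : same_gap A u -> Qfun A = 0 -> Num.min A u <= w <= Num.max A u ->
  Sfun w <= Sfun u.
Proof.
move=> g QA wb; have [g1 g2] := same_gap_between g wb.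
have g2' : same_gap u w by move=> j jm; rewrite mulrC; exact: g2.
rewrite -subr_ge0; apply: le_trans (Sfun_tangent g2').
move: wb; rewrite minEle maxEle; have [Au|uA] := leP A u => /andP[h1 h2].
  have := Qfun_mono g1 h1; rewrite QA; nra.
have g1' : same_gap w A by move=> j jm; rewrite mulrC; exact: g1.
have := Qfun_mono g1' h2; rewrite QA; nra.
Qed.

Lemma continuous_term u j k : u - B j != 0 -> {for u, continuous (fun w => p j / (w - B j) ^+ k)}.
Proof.
move=> h; apply: cvgM; first exact: cvg_cst.
apply: (cvgV (f := fun w : R => (w - B j) ^+ k)); first by rewrite expf_neq0.
apply: (continuous_comp (f := fun w : R => w - B j) (g := fun w => w ^+ k)); last exact: exprn_continuous.
by apply: cvgB; [exact: cvg_id|exact: cvg_cst].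
Qed.

Lemma continuous_sum_terms u k : off_poles u ->
  {for u, continuous (fun w => \sum_(0 <= j < m) p j / (w - B j) ^+ k)}.
Proof.
rewrite /off_poles; elim: m => [|n IH] h.
  have -> : (fun w => \sum_(0 <= j < 0) p j / (w - B j) ^+ k) = fun=> 0.
    by apply/funext => w; rewrite big_nil.
  exact: cst_continuous.
have -> : (fun w => \sum_(0 <= j < n.+1) p j / (w - B j) ^+ k) =
   (fun w => \sum_(0 <= j < n) p j / (w - B j) ^+ k + p n / (w - B n) ^+ k).
  by apply/funext => w; rewrite big_nat_recr.
apply: cvgD; first by apply: IH => j jn; apply: h; exact: ltnW.
exact: continuous_term (h n _).
Qed.

Lemma continuous_X u s : off_poles u -> {for u, continuous (Xfun s)}.
Proof.
move=> hu; have -> : Xfun s = (fun w => w - s * (w - \sum_(0 <= j < m) p j / (w - B j) ^+ 1)) by [].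
apply: cvgB; first exact: cvg_id.
apply: cvgM; first exact: cvg_cst.
by apply: cvgB; [exact: cvg_id|exact: (continuous_sum_terms (k := 1) hu)].
Qed.

Lemma X_IVT s u w x : u <= w -> same_gap u w ->
  Num.min (Xfun s u) (Xfun s w) <= x <= Num.max (Xfun s u) (Xfun s w) ->
  exists2 c, u <= c <= w & Xfun s c = x.
Proof.
move=> uw g xb; have [|c cI <-] := @IVT R (Xfun s) u w x uw _ xb.
  apply: continuous_in_subspaceT => c; rewrite inE /= in_itv /= => cb.
  have cb' : Num.min u w <= c <= Num.max u w by rewrite minEle maxEle uw.
  by apply: continuous_X; case: (same_gap_off (same_gap_between g cb').2).
by exists c => //; move: cI; rewrite in_itv.
Qed.

(** The inequality is X_s'(u) >= 0. The bound [D] makes the constants of [close] uniform when s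
    varies. *)
Definition frozen D x s := exists u, [/\ off_poles u, Xfun s u = x, s * (1 + Sfun u) <= 1 & `|u - B 0| <= D].

(** A zero [A] of v_1 is fixed by every X_s, and v_1(u) has the sign of u - A. Lowering the
    parameter therefore moves the image of [u] away from [A], so x is still attained between [A] and
    [u], where S is at most S u. *)
Lemma freeze_down A u s s' x D : same_gap A u -> vfun A = 0 ->
  (forall w, Num.min A u <= w <= Num.max A u -> Sfun w <= Sfun u) ->
  Xfun s u = x -> s * (1 + Sfun u) <= 1 -> 0 <= s' -> s' <= s ->
  `|A - B 0| <= D -> `|u - B 0| <= D -> frozen D x s'.
Proof.
move=> g vA hS Xu su s'0 s's AD uD; have [hA hu] := same_gap_off g.
have SA : Sfun A <= Sfun u by apply: hS; rewrite ge_min le_max !lexx.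
have mx := mixed_le hu hA; have g' : same_gap u A by move=> j jm; rewrite mulrC; exact: g.
have mx0 := mixed_gt0 g'.
have vu : vfun u = (u - A) * (1 + mixed u A) by rewrite -vfunB // vA subr0.
have XA t : Xfun t A = A by rewrite /Xfun vA mulr0 subr0.
have f0 : 0 <= 1 - s * (1 + mixed u A) by nra.
have xA : x - A = (u - A) * (1 - s * (1 + mixed u A)) by rewrite -XfunB // XA Xu.
have Xs' : Xfun s' u - x = (s - s') * ((u - A) * (1 + mixed u A)) by rewrite -vu -Xu /Xfun; ring.
have h1 : 0 <= 1 + mixed u A by rewrite addr_ge0.
have ss : 0 <= s - s' by rewrite subr_ge0.
have done_ w : Num.min A u <= w <= Num.max A u -> Xfun s' w = x -> frozen D x s'.
  move=> wb Xw; exists w; split=> //.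
  - by case: (same_gap_off (same_gap_between g wb).1).
  - have := hS w wb; have := Sfun_ge0 w; nra.
  exact: between_norm wb AD uD.
have [Au|uA] := leP A u.
  have h2 : A <= x <= Xfun s' u.
    have d1 : 0 <= u - A by rewrite subr_ge0.
    have e1 : 0 <= x - A by rewrite xA mulr_ge0.
    have e2 : 0 <= Xfun s' u - x by rewrite Xs' mulr_ge0 // mulr_ge0.
    lra.
  have [|w wb Xw] := @X_IVT s' A u x Au g.
    by rewrite XA ge_min le_max; case/andP: h2 => -> ->; rewrite orbT.
  by apply: (done_ w) => //; rewrite minEle maxEle Au.
have h2 : Xfun s' u <= x <= A.
  have d1 : 0 <= A - u by rewrite subr_ge0 ltW.
  have e1 : 0 <= A - x by rewrite -opprB xA -mulNr opprB mulr_ge0.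
  have e2 : 0 <= x - Xfun s' u by rewrite -opprB Xs' -mulrN -mulNr opprB mulr_ge0 // mulr_ge0.
  lra.
have [|w wb Xw] := @X_IVT s' u A x (ltW uA) g'.
  by rewrite XA ge_min le_max; case/andP: h2 => -> ->; rewrite orbT.
by apply: (done_ w) => //; rewrite minC maxC minEle maxEle (ltW uA).
Qed.

(** To the right of all poles: raising the parameter to s' moves the image of [u] below x, while the
    image of [D] is at least (1 - s') D >= x. At the solution [w], X(w) > X(u) bounds [mixed w u],
    which dominates S w. *)
Lemma freeze_up_witness u s s' x D : (forall j, (j < m)%N -> B j < u) -> 0 < vfun u ->
  Xfun s u = x -> 0 < s' -> s < s' -> s' < 1 -> u <= D -> x / (1 - s') <= D ->
  exists w, [/\ u <= w <= D, off_poles w, Xfun s' w = x & s' * (1 + Sfun w) <= 1].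
Proof.
move=> hB vu Xu s'0 ss' s'1 uD xD.
have gw w : u <= w -> same_gap u w.
  by move=> uw j jm; rewrite mulr_gt0 ?subr_gt0 ?hB // (lt_le_trans (hB j jm)).
have XD : x <= Xfun s' D.
  have -> : Xfun s' D = (1 - s') * D + s' * \sum_(0 <= j < m) p j / (D - B j) by rewrite /Xfun /vfun; ring.
  have h1 : x <= (1 - s') * D by rewrite mulrC -ler_pdivrMr // subr_gt0.
  apply: le_trans h1 _; rewrite lerDl mulr_ge0 ?(ltW s'0) // big_nat; apply: sumr_ge0 => j /andP[_ jm].
  by rewrite divr_ge0 ?ltW ?p0 // subr_gt0 (lt_le_trans (hB j jm)).
have Xu' : Xfun s' u < x by rewrite -Xu /Xfun ltrD2l ltrN2 ltr_pM2r.
have [|w /andP[uw wD] Xw] := @X_IVT s' u D x uD (gw D uD).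
  by rewrite ge_min le_max (ltW Xu') XD orbT.
have [hu hw] := same_gap_off (gw w uw).
exists w; split=> //; first by rewrite uw.
have h1 : 0 < (w - u) * (1 - s' * (1 + mixed w u)) by rewrite -XfunB // Xw subr_gt0.
have h2 : 0 < 1 - s' * (1 + mixed w u).
  by rewrite ltNge; apply/negP => h; move: h1; rewrite ltNge mulr_ge0_le0 // subr_ge0.
have h3 : Sfun w <= mixed w u.
  apply: sum_lt => j jm; have b1 := hB j jm; have b2 := lt_le_trans b1 uw.
  rewrite ler_pM2l ?p0 // expr2 lef_pV2 ?posrE ?mulr_gt0 ?subr_gt0 //.
  by rewrite ler_pM2l ?subr_gt0 // lerD2r.
nra.
Qed.

Lemma freeze_up u s s' x D : (forall j, (j < m)%N -> B j < u) -> 0 < vfun u ->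
  Xfun s u = x -> 0 < s' -> s < s' -> s' < 1 -> u <= D -> x / (1 - s') <= D ->
  frozen (D - B 0) x s'.
Proof.
move=> hB vu Xu s'0 ss' s'1 uD xD.
have [w [/andP[uw wD] hw Xw sw]] := freeze_up_witness hB vu Xu s'0 ss' s'1 uD xD.
exists w; split=> //; have b0 := lt_le_trans (hB 0%N m0) uw; rewrite ger0_norm; lra.
Qed.

Lemma vcpx_imE (u : R[i]) : 0 < complex.Im u -> complex.Im (vcpx u) = complex.Im u * (1 + Scpx u).
Proof.
move=> y0; rewrite /vcpx ImB Im_sum mulrDr mulr1 /Scpx mulr_sumr -sumrN; congr (_ + _).
by apply: eq_bigr => j _; rewrite ImM ReC ImC mul0r addr0 ImV Im_sub mulrN opprK mulrCA.
Qed.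

(** X_s(u) - X_s(w) = (u - w)(1 - s(1 + sum_j F j)), and Re (F j) is the mean of p_j/|u - B_j|^2 and
    p_j/(w - B_j)^2 minus a positive multiple of |u - w|^2. The two hypotheses absorb the means; the
    term j = 0 of the rest gives the bound. *)
Lemma cubic s (u : R[i]) w : 0 <= s -> (forall j, (j < m)%N -> u - (B j)%:C != 0) -> off_poles w ->
  s * (1 + Scpx u) <= 1 -> s * (1 + Sfun w) <= 1 ->
  s / 2 * cabs (u - w%:C) ^+ 3 * (p 0 / (cabs (u - (B 0)%:C) ^+ 2 * (w - B 0) ^+ 2)) <=
  cabs (u - s%:C * vcpx u - (Xfun s w)%:C).
Proof.
move=> s0 hu hw su sw.
pose F j : R[i] := (p j)%:C / ((u - (B j)%:C) * (w%:C - (B j)%:C)).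
have hw' j : (j < m)%N -> w%:C - (B j)%:C != 0 :> R[i].
  by move=> jm; rewrite -rmorphB -[0]/(0%:C) (inj_eq (@complexI _)) hw.
have -> : u - s%:C * vcpx u - (Xfun s w)%:C = (u - w%:C) * (1 - s%:C * (1 + \sum_(0 <= j < m) F j)).
  have -> : (Xfun s w)%:C = w%:C - s%:C * vcpx w%:C.
    rewrite rmorphB rmorphM; congr (_ - _ * _); rewrite rmorphB rmorph_sum; congr (_ - _).
    by apply: eq_bigr => j _; rewrite fmorph_div rmorphB.
  have -> : vcpx u = vcpx w%:C + (u - w%:C) * (1 + \sum_(0 <= j < m) F j).
    rewrite /vcpx mulrDr mulr1 mulr_sumr.
    rewrite [RHS]addrC -addrA [RHS]addrCA !addrA; apply/eqP.
    rewrite -subr_eq0; apply/eqP.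
    have -> : \sum_(0 <= j < m) (u - w%:C) * F j = \sum_(0 <= j < m) (p j)%:C / (w%:C - (B j)%:C) - \sum_(0 <= j < m) (p j)%:C / (u - (B j)%:C).
      rewrite -sumrB; apply: eq_big_nat => j /andP[_ jm]; rewrite /F; field.
      by rewrite hu // hw'.
    ring.
  ring.
have E3 (c q : R) : s / 2 * c ^+ 3 * q = c * (s / 2 * c ^+ 2 * q) by ring.
rewrite cabsM E3; apply: ler_wpM2l; first exact: cabs_ge0.
apply: le_trans (le_trans (ler_norm _) (abs_Re _)).
have two_ : complex.Re (1 - s%:C * (1 + \sum_(0 <= j < m) F j)) =
   1 - s * (1 + \sum_(0 <= j < m) complex.Re (F j)).
  by rewrite ReB ReM ReC ImC mul0r subr0 ReD Re_sum.
rewrite two_.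
have key j : (j < m)%N -> complex.Re (F j) =
    (p j / cabs (u - (B j)%:C) ^+ 2 + p j / (w - B j) ^+ 2) / 2 -
    cabs (u - w%:C) ^+ 2 * (p j / (cabs (u - (B j)%:C) ^+ 2 * (w - B j) ^+ 2)) / 2.
  move=> jm; have -> : F j = (p j / (w - B j))%:C * (u - (B j)%:C)^-1.
    rewrite fmorph_div rmorphB /F; field; apply/andP; split; [exact: hu|exact: hw'].
  rewrite ReM ReC ImC mul0r subr0 ReV.
  have c0 : cabs (u - (B j)%:C) ^+ 2 != 0 by rewrite expf_neq0 // gt_eqF // cabs_gt0 // hu.
  have := hw j jm; move: c0; rewrite !cabs_sqr !ReB !ImB !ReC !ImC !subr0.
  move: (complex.Re u) (complex.Im u) => y z.
  move=> c0 w0; field; apply/andP; split=> //.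
have -> : \sum_(0 <= j < m) complex.Re (F j) = (Scpx u + Sfun w) / 2 -
    cabs (u - w%:C) ^+ 2 * (\sum_(0 <= j < m) p j / (cabs (u - (B j)%:C) ^+ 2 * (w - B j) ^+ 2)) / 2.
  rewrite /Scpx /Sfun -big_split /= mulr_sumr !mulr_suml -sumrB; apply: eq_big_nat => j /andP[_ jm].
  by rewrite key.
set T := \sum_(0 <= j < m) _ / (_ * _).
have hT : p 0 / (cabs (u - (B 0)%:C) ^+ 2 * (w - B 0) ^+ 2) <= T.
  rewrite /T big_ltn // lerDl big_nat; apply: sumr_ge0 => j /andP[_ jm].
  by apply: divr_ge0; [exact: ltW (p0 jm)|rewrite mulr_ge0 ?sqr_ge0].
have h1 : s / 2 * cabs (u - w%:C) ^+ 2 * (p 0 / (cabs (u - (B 0)%:C) ^+ 2 * (w - B 0) ^+ 2)) <=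
   s / 2 * cabs (u - w%:C) ^+ 2 * T.
  by apply: ler_wpM2l => //; apply: mulr_ge0; [exact: divr_ge0|exact: sqr_ge0].
clear hT; clearbody T; move: (cabs (u - w%:C) ^+ 2) (p 0 / _) T (Scpx u) (Sfun w) h1 su sw => c q T su' sw'; nra.
Qed.

(** No bound on the distance c of [u] to the pole is given; with r = |u - w| it is at most r + D,
    and r/(r + D) increases with r. *)
Lemma close s (u : R[i]) w D eta y : 0 < s -> (forall j, (j < m)%N -> u - (B j)%:C != 0) -> off_poles w ->
  `|w - B 0| <= D -> 0 < eta ->
  s / 2 * cabs (u - w%:C) ^+ 3 * (p 0 / (cabs (u - (B 0)%:C) ^+ 2 * (w - B 0) ^+ 2)) <= y ->
  y < s / 2 * p 0 * eta ^+ 3 / ((eta + D) ^+ 2 * D ^+ 2) -> cabs (u - w%:C) <= eta.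
Proof.
move=> s0 hu hw wD e0 h1 h2; rewrite leNgt; apply/negP => re.
have q0 := p0 m0.
have w0 : 0 < `|w - B 0| by rewrite normr_gt0 hw.
have D0 : 0 < D by apply: lt_le_trans wD.
have c0 : 0 < cabs (u - (B 0)%:C) by rewrite cabs_gt0 // hu.
set r := cabs (u - w%:C) in h1 re; set c := cabs (u - (B 0)%:C) in h1 c0.
have cr : c <= r + D.
  have -> : c = cabs ((u - w%:C) + (w - B 0)%:C) by rewrite rmorphB addrA subrK.
  by apply: le_trans (cabsD _ _) _; rewrite cabs_real lerD2l.
have r0 : 0 < r := lt_trans e0 re.
have : y < y; last by rewrite ltxx.
apply: (lt_le_trans h2); apply: le_trans h1.
have -> : s / 2 * p 0 * eta ^+ 3 / ((eta + D) ^+ 2 * D ^+ 2) =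
   s / 2 * p 0 * (eta * (eta / (eta + D)) ^+ 2 * (D ^- 2)).
  by field; rewrite !gt_eqF // addr_gt0.
have -> : s / 2 * r ^+ 3 * (p 0 / (c ^+ 2 * (w - B 0) ^+ 2)) = s / 2 * p 0 * (r * (r / c) ^+ 2 * (`|w - B 0| ^- 2)).
  rewrite real_normK ?num_real //.
  by field; rewrite ?(hw 0%N m0) ?(gt_eqF c0).
apply: ler_wpM2l; first by rewrite mulr_ge0 ?divr_ge0 // ltW.
have f0 : 0 < eta / (eta + D) by rewrite divr_gt0 // addr_gt0.
have f1 : eta / (eta + D) <= r / c.
  rewrite ler_pdivrMr ?addr_gt0 // mulrAC ler_pdivlMr //.
  apply: (@le_trans _ _ (eta * (r + D))); first by rewrite ler_pM2l.
  rewrite !mulrDr [r * eta]mulrC lerD2l ler_pM2r // ltW //.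
apply: ler_pM; rewrite ?invr_ge0 ?sqr_ge0 //.
- by rewrite mulr_ge0 ?sqr_ge0 // ltW.
- apply: ler_pM; [exact: ltW|exact: sqr_ge0|exact: ltW|].
  by rewrite ler_pXn2r ?nnegrE ?(ltW f0) ?(ltW (lt_le_trans f0 f1)).
by rewrite lef_pV2 ?posrE ?exprn_gt0 // ler_pXn2r ?nnegrE ?(ltW w0) ?(ltW D0).
Qed.

End FrozenPoints.

(** * The velocity is constant along characteristics *)

Section BurgersSolution.
Variables (R : realType) (lam : seq nat) (m : nat) (a b : nat -> int) (H : R -> R -> R).
Hypotheses (pl : is_partition lam) (l0 : lam != [::]).
Hypothesis ic : interlacing_coordinates R lam m a b.
Hypothesis lim : limiting_height lam (a 0%N) (a m) H.

Local Notation et := (Defs.eta R lam).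
Local Notation W := (size lam + nth 0%N lam 0)%N.
Local Notation al := (et * (a 0%N)%:~R).
Local Notation inr := (in_range al et W).
Local Notation Jt := (@Jt R lam a H).
Local Notation Wt := (@Wt R lam a H).
Local Notation vcomplex := (@vcomplex R lam m a b).
Local Notation velocity := (@velocity R lam a H).

Let et0 : 0 < et := eta_gt0 R pl l0.

Lemma Im_resolvent_le0 (z : R[i]) x : 0 < complex.Im z -> complex.Im (resolvent z x) <= 0.
Proof. by move=> y0; rewrite ImV Im_sub oppr_le0 divr_ge0 ?sqr_ge0 // ltW. Qed.

Lemma Im_Jt_decr (z : R[i]) t t' : 0 < complex.Im z -> 0 <= t -> t <= t' -> t' <= 1 ->
  complex.Im (Jt t' z - Jt t z) <= 0.
Proof.
move=> y0 t0 tt' t1; have t01 : 0 <= t <= 1 by rewrite t0 (le_trans tt').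
have t01' : 0 <= t' <= 1 by rewrite t1 (le_trans t0).
have kr := kernel_resolvent y0 (lexx (complex.Im z)).
have h := is_riemannB et0 (kernel_transform pl l0 ic lim t01' kr) (kernel_transform pl l0 ic lim t01 kr).
have h0 := is_riemann_cst al et W (0 : R[i]).
have -> : 0 = complex.Im ((0 : R[i]) * (et * W%:R)%:C) by rewrite mul0r.
apply: (is_riemann_le et0 h h0) => x xr /=.
rewrite -mulrBl -rmorphB ImM ReC ImC mul0r addr0 mulr_ge0_le0 ?Im_resolvent_le0 //.
by rewrite subr_ge0 (H_mono pl l0 ic lim).
Qed.

(** Im J_t decreases in t, because H increases and the resolvent has negative imaginary part; its
    rate of change is Im(z - W_t)/t. *)
Lemma Im_Wt_ge (z : R[i]) t : 0 < complex.Im z -> 0 < t < 1 -> complex.Im z <= complex.Im (Wt t z).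
Proof.
move=> y0 /andP[t0 t1].
have [C C0 HC] := increment_J_uniform pl l0 ic lim y0 (cabs_ge0 z) t0.
apply: (@eps_le _ _ _ (C * t)) => eps eps0.
pose d := Num.min eps (1 - t).
have d0 : 0 < d by rewrite lt_min eps0 subr_gt0.
have de : d <= eps by rewrite ge_min lexx.
have d1 : t + d <= 1 by rewrite -lerBrDl ge_min lexx orbT.
have td : t < t + d by rewrite ltrDl.
have h1 := HC z t (t + d) (lexx _) (lexx _) (lexx _) td d1.
have h2 := Im_Jt_decr y0 (ltW t0) (ltW td) d1.
have dt : t + d - t = d by rewrite addrAC subrr add0r.
rewrite dt in h1.
have := le_trans (abs_Im _) h1; rewrite ImB ImM ReC ImC mul0r addr0 ImB ler_norml => /andP[h3 _].
have h4 : d / t * (complex.Im z - complex.Im (Wt t z)) <= C * d ^+ 2 by lra.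
have h5 : complex.Im z - complex.Im (Wt t z) <= C * t * d.
  have -> : C * t * d = (C * d ^+ 2) / (d / t) by field; rewrite !gt_eqF.
  by rewrite ler_pdivlMr ?divr_gt0 // mulrC.
have : C * t * d <= C * t * eps by rewrite ler_wpM2l // mulr_ge0 // ltW.
lra.
Qed.

Lemma Im_velocity (z : R[i]) t : complex.Im (velocity t z) = t^-1 * complex.Im (Wt t z).
Proof. by rewrite ImM ReC ImC mul0r addr0. Qed.

Lemma Im_velocity_ge (z : R[i]) t : 0 < complex.Im z -> 0 < t < 1 -> complex.Im z / t <= complex.Im (velocity t z).
Proof.
move=> y0 t01; have /andP[t0 _] := t01.
by rewrite Im_velocity mulrC ler_pM2l ?invr_gt0 // Im_Wt_ge.
Qed.

Lemma pow_1D_le (x : R) n : 0 <= x -> (1 + x) ^+ n <= expR (n%:R * x).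
Proof.
move=> x0; rewrite expRM_natl lerXn2r ?nnegrE ?expR_ge0 ?expR_ge1Dx //.
exact: addr_ge0.
Qed.

(** The deviation from [c] starts at 0, and n steps with n h^2 = 1 - t accumulate at most n C h^3
    exp(L), which tends to 0; at time 1 the velocity is v_1. *)
Lemma burgers (z : R[i]) t : 0 < complex.Im z -> 0 < t < 1 ->
  vcomplex (z + (1 - t)%:C * velocity t z) = velocity t z.
Proof.
move=> y0 t01; have /andP[t0 t1] := t01; set c := velocity t z.
have c0 : 0 < complex.Im c by apply: lt_le_trans (Im_velocity_ge y0 t01); rewrite divr_gt0.
pose e := complex.Im z; pose M := cabs z + cabs c.
have M0 : 0 <= M by rewrite addr_ge0 ?cabs_ge0.
have zM : cabs z <= M by rewrite lerDl cabs_ge0.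
have tt1 : t <= t <= 1 by rewrite lexx ltW.
have cV : cabs c <= (M * expR (e ^- 2)) / t := cabs_velocity pl l0 ic lim y0 t0 (lexx e) zM tt1.
have [C [L [h0 [C0 L0 /andP[h00 h01] HS]]]] := velocity_step pl l0 ic lim (y0 : 0 < e) M0 t0.
apply/eqP; rewrite -subr_eq0; apply/eqP; apply: cabs_eq0; apply/eqP; rewrite eq_le cabs_ge0 andbT.
apply: (@eps_le _ _ _ (C * expR L)) => eps eps0; rewrite add0r.
pose mu := Num.min h0 eps.
have mu0 : 0 < mu by rewrite lt_min h00 eps0.
have mu20 : 0 < mu ^+ 2 by rewrite exprn_gt0.
have [n0 Hn] := @eventually_small R (1 - t) (mu ^+ 2) mu20.
have {Hn} Hn := Hn n0.+1 (leqnSn _) (ltn0Sn _).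
move: n0.+1 (ltn0Sn n0) Hn => n np Hn.
have n0' : 0 < n%:R :> R by rewrite ltr0n.
pose h := Num.sqrt ((1 - t) / n%:R).
have d0 : 0 < (1 - t) / n%:R by rewrite divr_gt0 // subr_gt0.
have h2 : h ^+ 2 = (1 - t) / n%:R by rewrite sqr_sqrtr // ltW.
have hp : 0 < h by rewrite sqrtr_gt0.
have hmu : h <= mu by rewrite -(@ler_pXn2r _ 2%N isT) ?nnegrE ?(ltW hp) ?(ltW mu0) // h2.
have hh0 : 0 < h <= h0 by rewrite hp (le_trans hmu) // ge_min lexx.
have he : h <= eps by rewrite (le_trans hmu) // ge_min lexx orbT.
have nh2 : n%:R * h ^+ 2 = 1 - t by rewrite h2; field; rewrite gt_eqF.
have h20 : 0 < h ^+ 2 by rewrite exprn_gt0.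
have h30 : 0 <= h ^+ 3 by rewrite exprn_ge0 // ltW.
have q1 : 1 <= 1 + L * h ^+ 2 by rewrite lerDl mulr_ge0 // ltW.
have step k : (k <= n)%N -> cabs (velocity (t + k%:R * h ^+ 2) (z + (k%:R * h ^+ 2)%:C * c) - c) <=
    k%:R * (C * h ^+ 3) * (1 + L * h ^+ 2) ^+ k.
  elim: k => [_|k IH kn]; first by rewrite !mul0r !addr0 subrr cabs0.
  have {}IH := IH (ltnW kn).
  have kh0 : 0 <= k%:R * h ^+ 2 by rewrite mulr_ge0 // ltW.
  have kh1 : k%:R * h ^+ 2 + h ^+ 2 <= 1 - t.
    have -> : k%:R * h ^+ 2 + h ^+ 2 = k.+1%:R * h ^+ 2 by rewrite -natr1 mulrDl mul1r.
    by rewrite -nh2 ler_pM2r // ler_nat.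
  have ez : e <= complex.Im (z + (k%:R * h ^+ 2)%:C * c).
    by rewrite ImD ImM ReC ImC mul0r addr0 lerDl mulr_ge0 // ltW.
  have zkM : cabs (z + (k%:R * h ^+ 2)%:C * c) <= M.
    apply: le_trans (cabsD _ _) _; rewrite lerD2l cabsM cabs_real ger0_norm //.
    by rewrite ler_piMl ?cabs_ge0 //; lra.
  have tk : t <= t + k%:R * h ^+ 2 by rewrite lerDl.
  have tk1 : t + k%:R * h ^+ 2 + h ^+ 2 <= 1 by lra.
  have := HS _ _ h c ez zkM (ltW c0) cV tk hh0 tk1.
  have -> : t + k%:R * h ^+ 2 + h ^+ 2 = t + k.+1%:R * h ^+ 2 by rewrite -natr1; ring.
  have -> : z + (k%:R * h ^+ 2)%:C * c + (h ^+ 2)%:C * c = z + (k.+1%:R * h ^+ 2)%:C * c.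
    by rewrite -addrA -mulrDl -rmorphD -natr1 [(_ + 1) * _]mulrDl mul1r.
  move=> /le_trans; apply; move: q1 IH; set q := 1 + L * h ^+ 2 => q1 IH.
  have -> : k.+1%:R * (C * h ^+ 3) * q ^+ k.+1 = k%:R * (C * h ^+ 3) * q ^+ k * q + C * h ^+ 3 * q ^+ k.+1.
    by rewrite -natr1 [q ^+ k.+1]exprSr; ring.
  apply: lerD; first by apply: ler_wpM2r => //; exact: le_trans ler01 q1.
  by apply: ler_peMr; [exact: mulr_ge0|exact: exprn_ege1].
have tE : t + (1 - t) = 1 by ring.
have := step n (leqnn n); rewrite nh2 tE.
have e1 : velocity 1 (z + (1 - t)%:C * c) = vcomplex (z + (1 - t)%:C * c).
  rewrite /velocity invr1 rmorph1 mul1r (Wt_end pl l0 ic lim) //.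
  by rewrite ImD ImM ReC ImC mul0r addr0 addr_gt0 // mulr_gt0 // subr_gt0.
rewrite e1 => /le_trans; apply.
have p1 : (1 + L * h ^+ 2) ^+ n <= expR L.
  apply: le_trans (pow_1D_le _ _) _; first by rewrite mulr_ge0 // ltW.
  by rewrite ler_expR mulrCA nh2 ler_piMr //; lra.
have -> : n%:R * (C * h ^+ 3) = (n%:R * h ^+ 2) * (C * h) by ring.
rewrite nh2; apply: (@le_trans _ _ (1 * (C * h) * expR L)); last first.
  by rewrite mul1r mulrAC ler_wpM2l // mulr_ge0 // expR_ge0.
have ch0 : 0 <= C * h by rewrite mulr_ge0 // ltW.
apply: ler_pM => //.
- by rewrite mulr_ge0 // subr_ge0 ltW.
- by rewrite exprn_ge0 // (le_trans ler01).
- by rewrite ler_wpM2r //; lra.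
Qed.

End BurgersSolution.

Lemma Re_mul_i (R : realType) (w : R[i]) : complex.Re (Complex 0 1 * w) = - complex.Im w.
Proof. by rewrite ReM mul0r sub0r mul1r. Qed.

Section Clamp.
Variable R : realType.

Definition clamp (p q y : R) := Num.min (Num.max y p) q.

Lemma clamp_id p q y : p <= y <= q -> clamp p q y = y.
Proof. by move=> /andP[h1 h2]; rewrite /clamp max_l // min_l. Qed.

Lemma clamp_lo p q y : p <= q -> y <= p -> clamp p q y = p.
Proof. by move=> pq h; rewrite /clamp max_r // min_l. Qed.

Lemma clamp_hi p q y : q <= y -> clamp p q y = q.
Proof. by move=> h; rewrite /clamp min_r // le_max h. Qed.

Lemma clamp_mono p q y d : 0 <= d -> 0 <= clamp p q (y + d) - clamp p q y <= d.
Proof.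
rewrite /clamp !minEle !maxEle => d0.
by case: (leP (y + d) p) => h1; case: (leP y p) => h2; case: (leP p q) => h3; case: (leP y q) => h4; case: (leP (y + d) q) => h5; lra.
Qed.

Lemma clamp_range p q y : p <= q -> p <= clamp p q y <= q.
Proof. by move=> pq; rewrite /clamp ge_min lexx orbT andbT le_min pq andbT le_max lexx orbT. Qed.

End Clamp.

(** * Bounds for Riemann sums of concentrated functions *)

Section Concentration.
Variables (R : realType) (al w : R) (W : nat).
Hypothesis w0 : 0 < w.
Local Notation inr := (in_range al w W).

Lemma nodeS n k : al + k.+1%:R * (w / n%:R) = al + k%:R * (w / n%:R) + w / n%:R.
Proof. by rewrite -natr1; ring. Qed.

(** Grid points in the window around x are counted by a telescoping sum of the clamped coordinate,
    at the cost of one extra step w/n. *)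
Lemma rsumr_upper n f c1 c2 x e : (0 < n)%N -> 0 <= c1 -> 0 <= e ->
  (forall y, inr y -> f y <= c2 + (if `|y - x| <= e then c1 else 0)) ->
  rsumr al w W n f <= c2 * (w * W%:R) + c1 * (2 * e + w / n%:R).
Proof.
move=> n0 c10 e0 h; have n0' : 0 < n%:R :> R by rewrite ltr0n.
have d0 : 0 < w / n%:R by rewrite divr_gt0.
set d := w / n%:R in d0 *; pose F := clamp (x - e) (x + e + d).
have pq : x - e <= x + e + d by lra.
rewrite /rsumr -/d mulr_sumr.
apply: (@le_trans _ _ (\sum_(0 <= k < n * W) (d * c2 + c1 * (F (al + k.+1%:R * d) - F (al + k%:R * d))))).
  rewrite big_nat [leRHS]big_nat; apply: ler_sum => k /andP[_ kn].
  have yr : inr (al + k%:R * d) by apply: grid_in_range => //; exact: ltnW.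
  have := h _ yr; rewrite nodeS -/d; move: (al + k%:R * d) => y hy.
  have /andP[g1 g2] := clamp_mono (x - e) (x + e + d) y (ltW d0).
  have : d * f y <= d * (c2 + (if `|y - x| <= e then c1 else 0)) by rewrite ler_pM2l.
  move=> /le_trans; apply; rewrite mulrDr lerD2l.
  case: ifP => [|_]; last by rewrite mulr0 mulr_ge0.
  by rewrite ler_norml => /andP[a1 a2]; rewrite /F !clamp_id; [rewrite mulrC ler_wpM2l //|apply/andP..]; lra.
rewrite big_split /= sumr_const_nat subn0 -mulr_sumr telescope_sumr //.
apply: lerD.
  by rewrite -[_ *+ (n * W)]mulr_natl natrM /d le_eqVlt; apply/orP; left; apply/eqP; field; rewrite gt_eqF.
apply: ler_wpM2l => //.
have /andP[_ u1] := clamp_range (al + (n * W)%:R * d) pq; have /andP[u2 _] := clamp_range (al + 0%:R * d) pq.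
rewrite /F; lra.
Qed.

Lemma rsumr_lower n f c p q : (0 < n)%N -> 0 <= c -> al <= p -> q <= al + w * W%:R ->
  (forall y, inr y -> 0 <= f y) -> (forall y, inr y -> p <= y <= q -> c <= f y) ->
  c * (q - p - w / n%:R) <= rsumr al w W n f.
Proof.
move=> n0 c0 ap qe f0 fc; have n0' : 0 < n%:R :> R by rewrite ltr0n.
have d0 : 0 < w / n%:R by rewrite divr_gt0.
set d := w / n%:R in d0 *.
rewrite /rsumr -/d mulr_sumr.
have yr k : (k < n * W)%N -> inr (al + k%:R * d) by move=> kn; apply: grid_in_range => //; exact: ltnW.
have [qp|qp] := leP (q - p - d) 0.
  apply: (@le_trans _ _ 0); first by rewrite mulr_ge0_le0.
  by rewrite big_nat; apply: sumr_ge0 => k /andP[_ kn]; rewrite mulr_ge0 ?(ltW d0) // f0 ?yr.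
pose F := clamp (p + d) q.
have pq : p + d <= q by lra.
have E : c * (q - p - d) = \sum_(0 <= k < n * W) c * (F (al + k.+1%:R * d) - F (al + k%:R * d)).
  rewrite -mulr_sumr telescope_sumr // /F clamp_hi; last first.
    have -> : (n * W)%:R * d = w * W%:R by rewrite natrM /d; field; rewrite gt_eqF.
    exact: qe.
  by rewrite clamp_lo //; [ring|rewrite mul0r addr0; lra].
rewrite E big_nat [leRHS]big_nat; apply: ler_sum => k /andP[_ kn].
have := yr k kn; rewrite nodeS -/d; move: (al + k%:R * d) => y hy.
have /andP[g1 g2] := clamp_mono (p + d) q y (ltW d0).
have [yp|yp] := ltP y p.
  rewrite /F !clamp_lo //; [|lra|lra].
  by rewrite subrr mulr0 mulr_ge0 ?(ltW d0) // f0.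
have [qy|qy] := ltP q y.
  rewrite /F !clamp_hi; [|lra|lra].
  by rewrite subrr mulr0 mulr_ge0 ?(ltW d0) // f0.
rewrite [leRHS]mulrC; apply: ler_pM => //.
by apply: fc => //; rewrite yp.
Qed.

Lemma Re_rsum n g : complex.Re (rsum al w W n g) = rsumr al w W n (fun x => complex.Re (g x)).
Proof. by rewrite /rsum /rsumr ReM ReC ImC mul0r subr0 Re_sum. Qed.

Lemma riemann_upper g I c1 c2 x e : is_riemann al w W g I -> 0 <= c1 -> 0 <= e ->
  (forall y, inr y -> complex.Re (g y) <= c2 + (if `|y - x| <= e then c1 else 0)) ->
  complex.Re I <= c2 * (w * W%:R) + c1 * (2 * e).
Proof.
move=> [C HC] c10 e0 h; apply: (@le_limit _ _ _ (C + c1 * w)) => n n0.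
have h1 := rsumr_upper n0 c10 e0 h; rewrite -Re_rsum in h1.
have h2 := le_trans (le_trans (ler_norm _) (abs_Re _)) (HC n n0).
have h3 := le_trans (abs_Re _) (HC n n0); rewrite ReB ler_norml in h3.
move: h3 => /andP[h3 _]; rewrite [X in _ <= _ + X]mulrDl; move: h1; rewrite [c1 * (_ + _)]mulrDr mulrA; lra.
Qed.

Lemma riemann_lower g I c p q : is_riemann al w W g I -> 0 <= c -> al <= p -> q <= al + w * W%:R ->
  (forall y, inr y -> 0 <= complex.Re (g y)) -> (forall y, inr y -> p <= y <= q -> c <= complex.Re (g y)) ->
  c * (q - p) <= complex.Re I.
Proof.
move=> [C HC] c0 ap qe f0 fc; apply: (@le_limit _ _ _ (C + c * w)) => n n0.
have h1 := rsumr_lower n0 c0 ap qe f0 fc; rewrite -Re_rsum in h1.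
have h3 := le_trans (abs_Re _) (HC n n0); rewrite ReB ler_norml in h3.
move: h3 => /andP[_ h3]; rewrite [X in _ <= _ + X]mulrDl; move: h1; rewrite [c * (_ - _ - _)]mulrBr mulrA; lra.
Qed.

End Concentration.

(** Mean value inequality: [g] is the derivative of [f] with uniform quadratic error, and
    subdivision into n steps leaves an error O(1/n). *)
Lemma increment_le (R : realType) (f g : R -> R) (C K t1 t2 : R) : t1 < t2 -> 0 <= C ->
  (forall t t', t1 <= t -> t < t' -> t' <= t2 -> `|f t' - f t - (t' - t) * g t| <= C * (t' - t) ^+ 2) ->
  (forall t, t1 <= t < t2 -> g t <= K) -> f t2 - f t1 <= K * (t2 - t1).
Proof.
move=> t12 C0 hf hg; apply: (@le_limit _ _ _ (C * (t2 - t1) ^+ 2)) => n n0.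
have n0' : 0 < n%:R :> R by rewrite ltr0n.
pose d := (t2 - t1) / n%:R; have d0 : 0 < d by rewrite divr_gt0 // subr_gt0.
have nd : n%:R * d = t2 - t1 by rewrite /d; field; rewrite gt_eqF.
have step k : (k <= n)%N -> f (t1 + k%:R * d) - f t1 <= k%:R * (K * d + C * d ^+ 2).
  elim: k => [_|k IH kn]; first by rewrite !mul0r addr0 subrr.
  have {}IH := IH (ltnW kn).
  have k1 : t1 + k%:R * d + d <= t2.
    have : k.+1%:R * d <= n%:R * d by rewrite ler_pM2r // ler_nat.
    by rewrite nd -natr1 mulrDl mul1r; lra.
  have k0 : 0 <= k%:R * d by rewrite mulr_ge0 // ltW.
  have := hf (t1 + k%:R * d) (t1 + k%:R * d + d).
  rewrite lerDl ltrDl => /(_ k0 d0 k1).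
  have -> : t1 + k%:R * d + d - (t1 + k%:R * d) = d by rewrite addrAC subrr add0r.
  have -> : t1 + k.+1%:R * d = t1 + k%:R * d + d by rewrite -natr1; ring.
  have hk : d * g (t1 + k%:R * d) <= d * K by rewrite ler_pM2l // hg // lerDl k0 /=; lra.
  rewrite ler_norml => /andP[_ h]; rewrite -natr1 [_ * (_ + C * _)]mulrDl mul1r; lra.
have tE : t1 + (t2 - t1) = t2 by ring.
have := step n (leqnn n); rewrite nd tE.
have -> : n%:R * (K * d + C * d ^+ 2) = K * (n%:R * d) + C * (n%:R * d) ^+ 2 / n%:R by field; rewrite gt_eqF.
by rewrite nd.
Qed.

(** * Stieltjes inversion: increments of H against Im v *)

Section HeightAnalysis.
Variables (R : realType) (lam : seq nat) (m : nat) (a b : nat -> int) (H : R -> R -> R).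
Hypotheses (pl : is_partition lam) (l0 : lam != [::]).
Hypothesis ic : interlacing_coordinates R lam m a b.
Hypothesis lim : limiting_height lam (a 0%N) (a m) H.

Local Notation et := (Defs.eta R lam).
Local Notation W := (size lam + nth 0%N lam 0)%N.
Local Notation al := (et * (a 0%N)%:~R).
Local Notation inr := (in_range al et W).
Local Notation Jt := (@Jt R lam a H).
Local Notation Wt := (@Wt R lam a H).
Local Notation velocity := (@velocity R lam a H).

Let et0 : 0 < et := eta_gt0 R pl l0.
Let width0 : 0 < et * W%:R.
Proof. by rewrite mulr_gt0 // ltr0n; case: (lam) l0. Qed.

Lemma side_interval x l : inr x -> 0 <= l -> l <= et * W%:R / 2 -> exists p q,
  [/\ al <= p, q <= al + et * W%:R, q - p = l & forall y, p <= y <= q -> `|y - x| <= l].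
Proof.
move=> /andP[x1 x2] l0' lw; have [h|h] := leP (x + l) (al + et * W%:R).
  by exists x, (x + l); split=> // [|y /andP[? ?]]; [ring|rewrite ler_norml; lra].
exists (x - l), x; split=> // [||y /andP[? ?]]; [lra|ring|rewrite ler_norml; lra].
Qed.

Lemma increment_near x y t t' : inr x -> inr y -> 0 <= t -> t <= t' -> t' <= 1 ->
  `|(H y t' - H y t) - (H x t' - H x t)| <= 2 * `|y - x|.
Proof.
move=> xr yr t0 tt t1; have t01 : 0 <= t <= 1 by rewrite t0 (le_trans tt).
have t01' : 0 <= t' <= 1 by rewrite t1 (le_trans t0).
have := H_lipschitz pl l0 ic lim yr xr t01; have := H_lipschitz pl l0 ic lim yr xr t01'.
by rewrite !ler_norml => /andP[? ?] /andP[? ?]; lra.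
Qed.

(** An increment of H at x persists nearby by the Lipschitz property and so takes up area, of which
    only t' - t is available. In particular H(x, .) is continuous. *)
Lemma H_increment_area x t t' : inr x -> 0 <= t -> t <= t' -> t' <= 1 ->
  (H x t' - H x t) / 2 * Num.min ((H x t' - H x t) / 4) (et * W%:R / 2) <= t' - t.
Proof.
move=> xr t0 tt t1; have t01 : 0 <= t <= 1 by rewrite t0 (le_trans tt).
have t01' : 0 <= t' <= 1 by rewrite t1 (le_trans t0).
set h := H x t' - H x t; set l := Num.min _ _.
have h0 : 0 <= h by rewrite subr_ge0 (H_mono pl l0 ic lim).
have l0' : 0 <= l by rewrite le_min !divr_ge0 // ltW.
have l1 : l <= h / 4 by rewrite ge_min lexx.
have l2 : l <= et * W%:R / 2 by rewrite ge_min lexx orbT.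
have [p [q [ap qe ql near]]] := side_interval xr l0' l2; rewrite -{1}ql.
have := is_riemannB et0 (area_H pl l0 ic lim t01') (area_H pl l0 ic lim t01) => ar.
have -> : t' - t = complex.Re (t'%:C - t%:C) by [].
apply: (riemann_lower et0 ar) => // [|y yr /=|y yr yb /=]; first by rewrite divr_ge0.
  by rewrite subr_ge0 (H_mono pl l0 ic lim).
have g1 := near y yb; have := increment_near xr yr t0 tt t1.
rewrite -/h ler_norml => /andP[g2 _].
have g3 : `|y - x| <= h / 4 := le_trans g1 l1.
suff : h / 2 <= H y t' - H y t by [].
lra.
Qed.

(** Extends constancy to an end point: the whole increment would have to occur on arbitrarily short
    time intervals. *)
Lemma H_end x t t' : inr x -> 0 <= t -> t <= t' -> t' <= 1 ->
  (forall e, 0 < e -> exists r r', [/\ t <= r, r <= r', r' <= t', H x r' - H x r = H x t' - H x t & r' - r <= e]) ->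
  H x t' = H x t.
Proof.
move=> xr t0 tt t1 hl; apply/eqP; rewrite -subr_eq0; apply/eqP.
set h := H x t' - H x t in hl *.
have h0 : 0 <= h by rewrite subr_ge0 (H_mono pl l0 ic lim).
apply/eqP; rewrite eq_le h0 andbT leNgt; apply/negP => hp.
pose e := h / 2 * Num.min (h / 4) (et * W%:R / 2) / 2.
have e0 : 0 < e by rewrite divr_gt0 // mulr_gt0 ?divr_gt0 // lt_min !divr_gt0.
have [r [r' [tr rr rt E re]]] := hl e e0.
have := H_increment_area xr (le_trans t0 tr) rr (le_trans rt t1); rewrite E.
by move: re e0; rewrite /e; lra.
Qed.

Lemma Im_increment z t0 : 0 < complex.Im z -> 0 < t0 -> exists2 C, 0 <= C & forall t t', t0 <= t -> t < t' -> t' <= 1 ->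
  `|(- complex.Im (Jt t' z)) - (- complex.Im (Jt t z)) -
     (t' - t) * (complex.Im (velocity t z) - complex.Im z / t)| <= C * (t' - t) ^+ 2.
Proof.
move=> y0 t00; have [C C0 HC] := increment_J_uniform pl l0 ic lim y0 (cabs_ge0 z) t00.
exists C => // t t' tt tt' t1; have := HC z t t' (lexx _) (lexx _) tt tt' t1.
move=> /(le_trans (abs_Im _)); rewrite ImB ImM ReC ImC mul0r addr0 !ImB Im_velocity -normrN.
by congr (`|_| <= _); field; rewrite gt_eqF // (lt_le_trans t00).
Qed.

Lemma Im_resolvent (x y e : R) : complex.Im (resolvent (Complex x e) y) = - (e / ((y - x) ^+ 2 + e ^+ 2)).
Proof. by rewrite ImV cabs_sqr Im_sub ReB ReC /= [(x - y) ^+ 2]sqrrB [(y - x) ^+ 2]sqrrB; congr (- (_ / _)); ring. Qed.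

(** Multiplication by i makes the Poisson kernel e/((y - x)^2 + e^2) appear as a real part. *)
Lemma Jt_diff_riemann x e t t' : 0 < e -> 0 <= t -> t <= t' -> t' <= 1 -> exists2 g,
  is_riemann al et W g (Complex 0 1 * (Jt t' (Complex x e) - Jt t (Complex x e))) &
  forall y, complex.Re (g y) = (H y t' - H y t) * (e / ((y - x) ^+ 2 + e ^+ 2)).
Proof.
move=> e0 t0 tt t1; have t01 : 0 <= t <= 1 by rewrite t0 (le_trans tt).
have t01' : 0 <= t' <= 1 by rewrite t1 (le_trans t0).
have y0 : 0 < complex.Im (Complex x e) by [].
have kr := kernel_resolvent y0 (lexx _).
have h := is_riemannZ (Complex 0 1) (is_riemannB et0 (kernel_transform pl l0 ic lim t01' kr) (kernel_transform pl l0 ic lim t01 kr)).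
eexists; first exact: h.
move=> y; cbv beta; rewrite Re_mul_i -mulrBl -rmorphB ImM ReC ImC mul0r addr0 Im_resolvent.
by rewrite mulrN opprK.
Qed.

(** By [Im_increment], small Im v bounds the Poisson integral of the increment of H. If the
    increment at x is h > 0, it is at least h/2 on an interval of length e <= h/4 where the kernel
    is at least 1/(2e), so the integral is at least h/4. *)
Lemma H_constant x t1 t2 : inr x -> 0 < t1 -> t1 < t2 -> t2 <= 1 ->
  (forall k, 0 < k -> exists2 e0, 0 < e0 & forall e t, 0 < e -> e <= e0 -> t1 <= t < t2 ->
     complex.Im (velocity t (Complex x e)) <= k) -> H x t1 = H x t2.
Proof.
move=> xr t10 t12 t21 hv; apply/eqP; rewrite eq_sym -subr_eq0; apply/eqP.
set h := H x t2 - H x t1.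
have h0 : 0 <= h by rewrite subr_ge0 (H_mono pl l0 ic lim) // ltW.
apply/eqP; rewrite eq_le h0 andbT leNgt; apply/negP => hp.
have [e0 e00 He] := hv (h / 8) (divr_gt0 hp (ltr0n R 8)).
pose e := Num.min e0 (Num.min (h / 4) (et * W%:R / 2)).
have ep : 0 < e by rewrite !lt_min e00 !divr_gt0.
have ee : e <= e0 by rewrite !ge_min lexx.
have eh : e <= h / 4 by rewrite !ge_min lexx !orbT.
have ew : e <= et * W%:R / 2 by rewrite !ge_min lexx !orbT.
have y0 : 0 < complex.Im (Complex x e) by [].
have [C C0 HC] := Im_increment y0 t10.
have up : (- complex.Im (Jt t2 (Complex x e))) - (- complex.Im (Jt t1 (Complex x e))) <= h / 8 * (t2 - t1).
  apply: (increment_le (f := fun t => - complex.Im (Jt t (Complex x e))) (C := C) (g := fun t => complex.Im (velocity t (Complex x e)) - complex.Im (Complex x e) / t)) => //.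
    by move=> t t' tt tt' tt2; apply: HC => //; exact: le_trans t21.
  move=> t tb; have := He e t ep ee tb; have /andP[ta _] := tb.
  by apply: le_trans; rewrite gerBl divr_ge0 ?(ltW y0) // (le_trans (ltW t10)).
have [g hg gE] := Jt_diff_riemann x ep (ltW t10) (ltW t12) t21.
have [p [q [ap qe ql near]]] := side_interval xr (ltW ep) ew.
have := @riemann_lower R al et W et0 g _ (h / (4 * e)) p q hg.
have c0 : 0 <= h / (4 * e) by rewrite divr_ge0 // mulr_ge0 // ltW.
have den y : 0 < (y - x) ^+ 2 + e ^+ 2 by rewrite ltr_wpDl ?sqr_ge0 ?exprn_gt0.
have f0 y : inr y -> 0 <= complex.Re (g y).
  move=> yr; rewrite gE; apply: mulr_ge0; last by rewrite divr_ge0 // ltW.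
  by rewrite subr_ge0 (H_mono pl l0 ic lim) // ltW.
have fc y : inr y -> p <= y <= q -> h / (4 * e) <= complex.Re (g y).
  move=> yr yb; rewrite gE.
  have := increment_near xr yr (ltW t10) (ltW t12) t21; have := near y yb; rewrite -/h => ye.
  rewrite ler_norml => /andP[g2 _].
  have -> : h / (4 * e) = h / 2 * (e / (2 * e ^+ 2)) by field; rewrite gt_eqF.
  apply: ler_pM; rewrite ?divr_ge0 ?mulr_ge0 ?sqr_ge0 ?(ltW ep) //; first lra.
  rewrite ler_pM2l // lef_pV2 ?posrE ?mulr_gt0 ?exprn_gt0 //.
  have : (y - x) ^+ 2 <= e ^+ 2 by rewrite -real_normK ?num_real // ler_pXn2r ?nnegrE // ltW.
  lra.
move=> /(_ c0 ap qe f0 fc); rewrite ql Re_mul_i ImB.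
have -> : h / (4 * e) * e = h / 4 by field; rewrite gt_eqF.
have : h / 8 * (t2 - t1) <= h / 8 * 1 by rewrite ler_wpM2l ?divr_ge0 //; lra.
lra.
Qed.

(** Converse of [H_constant]: the increment vanishes at x, hence is at most 2|y - x| near it, and
    its Poisson integral tends to 0 with e; if Im v stayed above k, that integral would exceed k/2
    (t2 - t1). *)
Lemma velocity_small x t1 t2 k e' : inr x -> 0 < t1 -> t1 < t2 -> t2 <= 1 -> H x t1 = H x t2 ->
  0 < k -> 0 < e' -> exists e t, [/\ 0 < e <= e', t1 <= t < t2 & complex.Im (velocity t (Complex x e)) <= k].
Proof.
move=> xr t10 t12 t21 HE k0 e'0; pose K := k / 2 * (t2 - t1).
have K0 : 0 < K by rewrite mulr_gt0 ?subr_gt0 // divr_gt0.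
pose n := K / 8; have np : 0 < n by rewrite divr_gt0.
(* [e <= k * t1 / 2] absorbs the term Im z / t of [Im_increment]; the last bound makes the Poisson
   integral beyond distance [n] at most K/4, and the window of half-width [n] contributes 2n =
   K/4. *)
pose e := Num.min (Num.min e' (k * t1 / 2)) (K * n / (8 * (et * W%:R))).
have w8 : 0 < 8 * (et * W%:R) by rewrite mulr_gt0.
have ep : 0 < e by rewrite !lt_min e'0 /= !divr_gt0 // mulr_gt0.
have e1 : e <= e' by rewrite !ge_min lexx.
have e2 : e <= k * t1 / 2 by rewrite !ge_min lexx !orbT.
have e3 : e <= K * n / (8 * (et * W%:R)) by rewrite !ge_min lexx !orbT.
have y0 : 0 < complex.Im (Complex x e) by [].
have [C C0 HC] := Im_increment y0 t10.
have [g hg gE] := Jt_diff_riemann x ep (ltW t10) (ltW t12) t21.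
have up : - complex.Im (Jt t2 (Complex x e)) + complex.Im (Jt t1 (Complex x e)) <= K / 2.
  have gb y : inr y -> complex.Re (g y) <= 2 * e / n + (if `|y - x| <= n then 1 else 0).
    move=> yr; rewrite gE.
    have den : 0 < (y - x) ^+ 2 + e ^+ 2 by rewrite ltr_wpDl ?sqr_ge0 ?exprn_gt0.
    have hd : H y t2 - H y t1 <= 2 * `|y - x|.
      have := increment_near xr yr (ltW t10) (ltW t12) t21; rewrite HE subrr subr0.
      by apply: le_trans; exact: ler_norm.
    have q0 : 0 <= e / ((y - x) ^+ 2 + e ^+ 2) by rewrite divr_ge0 // ltW.
    apply: (@le_trans _ _ (2 * `|y - x| * (e / ((y - x) ^+ 2 + e ^+ 2)))); first by rewrite ler_wpM2r.
    have sq : (y - x) ^+ 2 = `|y - x| ^+ 2 by rewrite real_normK ?num_real.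
    rewrite sq in den *; move: (`|y - x|) (normr_ge0 (y - x)) den => r r0 den.
    case: ifP => [rn|/negbT rn].
      apply: (@le_trans _ _ 1); last by rewrite lerDr; nonneg.
      rewrite mulrA ler_pdivrMr // mul1r -subr_ge0.
      have -> : r ^+ 2 + e ^+ 2 - 2 * r * e = (r - e) ^+ 2 by ring.
      exact: sqr_ge0.
    rewrite -ltNge in rn; rewrite addr0.
    rewrite mulrA ler_pdivrMr // [leRHS]mulrAC ler_pdivlMr //.
    have -> : 2 * r * e * n = 2 * e * (r * n) by ring.
    have -> : 2 * e * (r ^+ 2 + e ^+ 2) = 2 * e * (r * r) + 2 * e ^+ 3 by ring.
    have : 2 * e * (r * n) <= 2 * e * (r * r).
      by apply: ler_wpM2l; [rewrite mulr_ge0 // ltW|apply: ler_wpM2l => //; exact: ltW].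
    have : 0 <= e ^+ 3 by rewrite exprn_ge0 // ltW.
    lra.
  have := riemann_upper et0 hg ler01 (ltW np) gb; rewrite Re_mul_i ImB opprB addrC.
  move=> /le_trans; apply.
  have : 2 * e / n * (et * W%:R) <= K / 4.
    have gen (k' n' w : R) : n' != 0 -> w != 0 -> k' / 4 = 2 * (k' * n' / (8 * w)) / n' * w.
      by move=> hn hw; field; rewrite ?hn ?hw.
    rewrite (gen K n (et * W%:R) (lt0r_neq0 np) (lt0r_neq0 width0)).
    rewrite ler_pM2r // ler_pM2r ?invr_gt0 // ler_pM2l //.
  by rewrite /n; lra.
apply: contrapT => no.
have lo : complex.Im (Jt t2 (Complex x e)) - complex.Im (Jt t1 (Complex x e)) <= - (k / 2) * (t2 - t1).
  apply: (increment_le (f := fun t => complex.Im (Jt t (Complex x e))) (C := C) (g := fun t => - (complex.Im (velocity t (Complex x e)) - complex.Im (Complex x e) / t))) => //.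
    move=> t t' tt tt' tt2; have := HC t t' tt tt' (le_trans tt2 t21); rewrite -normrN.
    by congr (`|_| <= _); ring.
  move=> t tb; have /andP[ta _] := tb; have tp := lt_le_trans t10 ta.
  have h1 : k < complex.Im (velocity t (Complex x e)).
    by rewrite ltNge; apply/negP => h; apply: no; exists e, t; split=> //; rewrite ep.
  have h2 : e / t <= k / 2.
    rewrite ler_pdivrMr //; apply: le_trans e2 _.
    have : k * t1 <= k * t by rewrite ler_pM2l.
    lra.
  by rewrite [complex.Im (Complex x e)]/=; lra.
move: up lo K0; rewrite /K; lra.
Qed.

End HeightAnalysis.

(** * Continuity of the limiting surface *)

Section Surface.
Variables (R : realType) (lam : seq nat) (m : nat) (a b : nat -> int) (H : R -> R -> R).
Hypotheses (pl : is_partition lam) (l0 : lam != [::]).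
Hypothesis ic : interlacing_coordinates R lam m a b.
Hypothesis lim : limiting_height lam (a 0%N) (a m) H.

Local Notation et := (Defs.eta R lam).
Local Notation W := (size lam + nth 0%N lam 0)%N.
Local Notation al := (et * (a 0%N)%:~R).
Local Notation inr := (in_range al et W).

Let et0 : 0 < et := eta_gt0 R pl l0.
Let sl : sorted geq lam. Proof. by case/andP: pl. Qed.

Lemma upper_boundary_outside (X : R) : X <= - (size lam)%:R \/ (nth 0%N lam 0)%:R <= X ->
  upper_boundary lam X <= `|X|.
Proof.
move=> hX; rewrite /upper_boundary big_seq; apply: (big_ind (fun y => y <= `|X|)) => // [x y hx hy|c cL].
  by rewrite ge_max hx.
have [i [j [/andP[j0 ji] ->]]] := (boxes_mem lam c).1 cL.
have iN : (i < size lam)%N by rewrite ltnNge; apply/negP => /(nth_default 0%N) E; rewrite E leqNgt j0 in ji.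
have jN : (j <= nth 0%N lam 0)%N by apply: leq_trans ji _; exact: nth_sorted.
have e1 : (box i j).2%:~R = i%:R + j%:R :> R.
  by rewrite /box /= rmorphB /= -pmulrn natrD -natr1; ring.
have e2 : (box i j).1%:~R = j%:R - i%:R - 1 :> R.
  by rewrite /box /= rmorphB /= -!pmulrn -natr1; ring.
rewrite e1 e2.
have n1 := ler_norm (X - (j%:R - i%:R - 1)); have n2 := ler_norm (- (X - (j%:R - i%:R - 1))).
rewrite normrN in n2.
have i1 : i%:R + 1 <= (size lam)%:R :> R by rewrite natr1 ler_nat.
have j1 : j%:R <= (nth 0%N lam 0)%:R :> R by rewrite ler_nat.
have x1 := ler_norm X; have x2 := ler_norm (- X); rewrite normrN in x2.
by case: hX => hX; lra.
Qed.

Lemma domain_range (q : R * R) : surface_domain lam q -> inr q.1.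
Proof.
rewrite /surface_domain /= => /andP[h1 h2]; have := lt_trans h1 h2; rewrite /scaled_boundary => h.
apply: contrapT => nr; move: h; apply/negP; rewrite -leNgt.
have -> : `|q.1| = et * `|q.1 / et| by rewrite normrM normfV (gtr0_norm et0) mulrC divfK ?gt_eqF.
rewrite ler_pM2l //; apply: upper_boundary_outside.
have a0 : (a 0%N)%:~R = - (size lam)%:R :> R by rewrite (interlacing_first pl ic) rmorphN /= -pmulrn.
move: nr; rewrite /in_range a0 natrD => nr.
have [h|h] := leP (q.1 / et) (- (size lam)%:R); [by left|right].
have E : et * (q.1 / et) = q.1 by rewrite mulrC divfK ?gt_eqF.
rewrite leNgt; apply/negP => h'; apply: nr; rewrite -(ltr_pM2l et0) E in h; rewrite -(ltr_pM2l et0) E in h'.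
have -> : et * - (size lam)%:R + et * ((size lam)%:R + (nth 0%N lam 0)%:R) = et * (nth 0%N lam 0)%:R by ring.
by rewrite (ltW h) (ltW h').
Qed.

Definition no_plateau := forall x t1 t2, inr x -> 0 <= t1 -> t1 < t2 -> t2 <= 1 ->
  H x t1 = H x t2 -> 0 < H x t1 -> H x t1 < H x 1 -> False.

Lemma domain_height (q : R * R) : surface_domain lam q ->
  0 < (q.2 - `|q.1|) / 2 /\ (q.2 - `|q.1|) / 2 < H q.1 1.
Proof.
move=> dq; have xr := domain_range dq; move: dq; rewrite /surface_domain /= => /andP[h1 h2].
by rewrite (H_one pl l0 ic lim xr); split; [rewrite divr_gt0 ?subr_gt0|rewrite ltr_pM2r ?invr_gt0 // ltrD2r].
Qed.

Let below (q : R * R) := [set t | 0 <= t <= 1 /\ H q.1 t <= (q.2 - `|q.1|) / 2].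
Let above (q : R * R) := [set t | 0 <= t <= 1 /\ (q.2 - `|q.1|) / 2 <= H q.1 t].

Lemma below0 q : surface_domain lam q -> below q 0.
Proof.
move=> dq; have [h _] := domain_height dq; split; first by rewrite lexx ler01.
by rewrite (H_zero pl l0 ic lim (domain_range dq)) ltW.
Qed.

Lemma above1 q : surface_domain lam q -> above q 1.
Proof. by move=> dq; have [_ h] := domain_height dq; split; [rewrite lexx ler01|exact: ltW]. Qed.

Lemma below_ub q : has_ubound (below q).
Proof. by exists 1 => t [/andP[]]. Qed.

Lemma above_lb q : has_lbound (above q).
Proof. by exists 0 => t [/andP[]]. Qed.

Lemma above_of_inf q t : surface_domain lam q -> 0 <= t <= 1 -> surface_inf H q < t ->
  (q.2 - `|q.1|) / 2 <= H q.1 t.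
Proof.
move=> dq /andP[t0 t1] lt_t.
have [||r [/andP[r0 r1] hr] rt] := @inf_adherent R (above q) (t - surface_inf H q); first by rewrite subr_gt0.
  by split; [exists 1; exact: above1|exact: above_lb].
rewrite -/(surface_inf H q) addrC subrK in rt.
by apply: le_trans hr _; apply: (H_mono pl l0 ic lim (domain_range dq)) => //; exact: ltW.
Qed.

Lemma below_of_sup q t : surface_domain lam q -> 0 <= t <= 1 -> t < surface_sup H q ->
  H q.1 t <= (q.2 - `|q.1|) / 2.
Proof.
move=> dq /andP[t0 t1] lt_t.
have [||r [/andP[r0 r1] hr] rt] := @sup_adherent R (below q) (surface_sup H q - t); first by rewrite subr_gt0.
  by split; [exists 0; exact: below0|exact: below_ub].
rewrite -/(surface_sup H q) subKr in rt.
by apply: le_trans hr; apply: (H_mono pl l0 ic lim (domain_range dq)) => //; exact: ltW.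
Qed.

Lemma sup_range q : surface_domain lam q -> 0 <= surface_sup H q <= 1.
Proof.
move=> dq; apply/andP; split; first by apply: ub_le_sup; [exact: below_ub|exact: below0].
by apply: ge_sup; [exists 0; exact: below0|move=> t [/andP[]]].
Qed.

Lemma inf_range q : surface_domain lam q -> 0 <= surface_inf H q <= 1.
Proof.
move=> dq; apply/andP; split; last by apply: ge_inf; [exact: above_lb|exact: above1].
by apply: lb_le_inf; [exists 1; exact: above1|move=> t [/andP[]]].
Qed.

Lemma no_plateau_regular q : no_plateau -> surface_domain lam q -> surface_inf H q = surface_sup H q.
Proof.
move=> np dq; have /andP[s0 s1] := sup_range dq; have /andP[i0 i1] := inf_range dq.
set I := surface_inf H q in i0 i1 *; set S := surface_sup H q in s0 s1 *.
case: (ltgtP I S) => // h; exfalso.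
(* Between the infimum and the supremum H equals the level of [q], so two interior times span a
   plateau. *)
- pose t1 := (2 * I + S) / 3; pose t2 := (I + 2 * S) / 3.
  have t1r : 0 <= t1 <= 1 by rewrite /t1; lra.
  have t2r : 0 <= t2 <= 1 by rewrite /t2; lra.
  have a1 := above_of_inf (t := t1) dq t1r; have a2 := above_of_inf (t := t2) dq t2r.
  have b1 := below_of_sup (t := t1) dq t1r; have b2 := below_of_sup (t := t2) dq t2r.
  have [d1 d2] := domain_height dq.
  have {}a1 : (q.2 - `|q.1|) / 2 <= H q.1 t1 by apply: a1; rewrite -/I /t1; lra.
  have {}a2 : (q.2 - `|q.1|) / 2 <= H q.1 t2 by apply: a2; rewrite -/I /t2; lra.
  have {}b1 : H q.1 t1 <= (q.2 - `|q.1|) / 2 by apply: b1; rewrite -/S /t1; lra.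
  have {}b2 : H q.1 t2 <= (q.2 - `|q.1|) / 2 by apply: b2; rewrite -/S /t2; lra.
  have e1 : H q.1 t1 = (q.2 - `|q.1|) / 2 by apply/eqP; rewrite eq_le a1 b1.
  have e2 : H q.1 t2 = (q.2 - `|q.1|) / 2 by apply/eqP; rewrite eq_le a2 b2.
  apply: (np q.1 t1 t2 (domain_range dq)); rewrite ?e1 ?e2 //.
  + by case/andP: t1r.
  + by rewrite /t1 /t2; lra.
  + by case/andP: t2r.
- pose t := (I + S) / 2.
  have tr : 0 <= t <= 1 by rewrite /t; lra.
  have [hb|hb] := leP (H q.1 t) ((q.2 - `|q.1|) / 2).
    have : t <= S by apply: ub_le_sup; [exact: below_ub|split].
    by rewrite /t; lra.
  have : I <= t by apply: ge_inf; [exact: above_lb|split=> //; exact: ltW].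
  by rewrite /t; lra.
Qed.

Lemma regular_no_plateau : regular_domain lam H = surface_domain lam -> no_plateau.
Proof.
move=> reg x t1 t2 xr t10 t12 t21 E h0 h1.
(* The point of the domain over x whose level is the value of H on the plateau. *)
pose q : R * R := (x, `|x| + 2 * H x t1).
have qE : (q.2 - `|q.1|) / 2 = H x t1 by rewrite /q /=; field.
have dq : surface_domain lam q.
  rewrite /surface_domain /= ltrDl mulr_gt0 //=; move: h1; rewrite (H_one pl l0 ic lim xr); lra.
have [_ IS] : regular_domain lam H q by rewrite reg.
have h2 : surface_inf H q <= t1.
  apply: ge_inf; first exact: above_lb.
  by split; [rewrite t10 (le_trans (ltW t12))|rewrite qE].
have h3 : t2 <= surface_sup H q.
  apply: ub_le_sup; first exact: below_ub.
  by split; [rewrite t21 (le_trans t10 (ltW t12))|rewrite qE /q /= E].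
by move: h2 h3; rewrite IS; lra.
Qed.

Lemma height_gap_near q t (e : R) : surface_domain lam q -> 0 <= t <= 1 -> 0 < e ->
  exists2 d, 0 < d & forall q', surface_domain lam q' -> `|q.1 - q'.1| < d -> `|q.2 - q'.2| < d ->
    `|(H q'.1 t - (q'.2 - `|q'.1|) / 2) - (H q.1 t - (q.2 - `|q.1|) / 2)| < e.
Proof.
move=> dq tr e0; exists (e / 4); first by rewrite divr_gt0.
move=> q' dq' h1 h2; have h0 := H_lipschitz pl l0 ic lim (domain_range dq') (domain_range dq) tr.
rewrite distrC in h1; have h3 := ler_dist_dist q'.1 q.1.
move: h0; rewrite ler_norml => /andP[u1 u2]; move: h3; rewrite ler_norml => /andP[u3 u4].
move: h2; rewrite ltr_norml => /andP[u5 u6].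
by rewrite ltr_norml; apply/andP; split; lra.
Qed.

(** Once the surface is defined everywhere it is continuous: at a time before or after the surface
    value H is strictly on one side of the level, and this gap persists at nearby points because H
    is Lipschitz in x. *)
Lemma no_plateau_continuous : no_plateau <-> surface_continuous lam H.
Proof.
split=> [np|[reg _]]; last exact: regular_no_plateau.
have IS := fun q => @no_plateau_regular q np.
split; first by apply/seteqP; split=> q; [case|move=> dq; split=> //; exact: IS].
apply/subspace_continuousP => q dq; apply/cvgrPdist_lt => e e0.
have /andP[s0 s1] := sup_range dq; set S := surface_sup H q in s0 s1 *.
have lower : exists2 d, 0 < d & forall q', surface_domain lam q' -> `|q.1 - q'.1| < d -> `|q.2 - q'.2| < d ->
    S - e / 2 <= surface_sup H q'.
  have [hs|hs] := ltP (S - e / 2) 0.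
    by exists 1 => // q' dq' _ _; apply: ltW; apply: lt_le_trans hs _; case/andP: (sup_range dq').
  have tr : 0 <= S - e / 2 <= 1 by rewrite hs /=; lra.
  have gap : 0 < (q.2 - `|q.1|) / 2 - H q.1 (S - e / 2).
    rewrite subr_gt0 ltNge; apply/negP => h.
    have : surface_inf H q <= S - e / 2 by apply: ge_inf; [exact: above_lb|split].
    by rewrite IS // -/S; lra.
  have [d d0 hd] := height_gap_near dq tr gap.
  exists d => // q' dq' h1 h2; apply: ub_le_sup; first exact: below_ub.
  by split=> //; have := hd q' dq' h1 h2; rewrite ltr_norml => /andP[_ ?]; lra.
have upper : exists2 d, 0 < d & forall q', surface_domain lam q' -> `|q.1 - q'.1| < d -> `|q.2 - q'.2| < d ->
    surface_sup H q' <= S + e / 2.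
  have [hs|hs] := ltP 1 (S + e / 2).
    by exists 1 => // q' dq' _ _; apply: le_trans (ltW hs); case/andP: (sup_range dq').
  have tr : 0 <= S + e / 2 <= 1 by rewrite hs andbT; lra.
  have gap : 0 < H q.1 (S + e / 2) - (q.2 - `|q.1|) / 2.
    rewrite subr_gt0 ltNge; apply/negP => h.
    have : S + e / 2 <= S by apply: ub_le_sup; [exact: below_ub|split].
    lra.
  have [d d0 hd] := height_gap_near dq tr gap.
  exists d => // q' dq' h1 h2; apply: ge_sup; first by exists 0; exact: below0.
  move=> r [/andP[r0 r1] hr]; rewrite leNgt; apply/negP => tlr.
  have hm : H q'.1 (S + e / 2) <= H q'.1 r.
    by apply: (H_mono pl l0 ic lim (domain_range dq')) => //; [case/andP: tr|exact: ltW].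
  by have := hd q' dq' h1 h2; rewrite ltr_norml => /andP[? _]; lra.
have [d1 d10 hd1] := lower; have [d2 d20 hd2] := upper.
apply/nbhs_ballP; exists (Num.min d1 d2) => /=; first by rewrite lt_min d10.
move=> q' [/= b1 b2] dq'.
have b11 : `|q.1 - q'.1| < d1 by apply: lt_le_trans b1 _; rewrite ge_min lexx.
have b12 : `|q.1 - q'.1| < d2 by apply: lt_le_trans b1 _; rewrite ge_min lexx orbT.
have b21 : `|q.2 - q'.2| < d1 by apply: lt_le_trans b2 _; rewrite ge_min lexx.
have b22 : `|q.2 - q'.2| < d2 by apply: lt_le_trans b2 _; rewrite ge_min lexx orbT.
have := hd1 q' dq' b11 b21; have := hd2 q' dq' b12 b22 => g1 g2.
suff : `|S - surface_sup H q'| < e by [].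
by rewrite ltr_norml; apply/andP; split; lra.
Qed.

End Surface.

(** * One-sided first-order expansions *)

Section FirstOrder.
Variable R : realType.
Implicit Types f g : R -> R.

(** f(h) = x + h y + O(h^2) as h decreases to 0; it serves to take the logarithmic derivative of the
    product form of v_1. *)
Definition expansion f (x y : R) := exists C d, [/\ 0 <= C, 0 < d <= 1 &
  forall h, 0 < h <= d -> `|f h - (x + h * y)| <= C * h ^+ 2].

Lemma expansion_ext f g x y : (exists2 d, 0 < d & forall h, 0 < h <= d -> f h = g h) ->
  expansion f x y -> expansion g x y.
Proof.
move=> [d d0 fg] [C [d' [C0 /andP[d'0 d'1] hf]]]; exists C, (Num.min d d'); split=> //.
  by rewrite lt_min d0 d'0 ge_min d'1 orbT.
by move=> h /andP[h0]; rewrite le_min => /andP[h1 h2]; rewrite -fg ?h0 //; apply: hf; rewrite h0.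
Qed.

Lemma expansion_linear x y : expansion (fun h => x + h * y) x y.
Proof. by exists 0, 1; split=> // [|h _]; [rewrite ltr01 lexx|rewrite subrr normr0 mul0r]. Qed.

Lemma expansionD f g x y x' y' : expansion f x y -> expansion g x' y' ->
  expansion (fun h => f h + g h) (x + x') (y + y').
Proof.
move=> [C [d [C0 /andP[d0 d1] hf]]] [C' [d' [C'0 /andP[d'0 d'1] hg]]].
exists (C + C'), (Num.min d d'); split; first exact: addr_ge0.
  by rewrite lt_min d0 d'0 ge_min d1.
move=> h /andP[h0]; rewrite le_min => /andP[h1 h2].
have -> : f h + g h - (x + x' + h * (y + y')) = (f h - (x + h * y)) + (g h - (x' + h * y')) by ring.
by apply: le_trans (ler_normD _ _) _; rewrite [leRHS]mulrDl; apply: lerD; [apply: hf|apply: hg]; rewrite h0.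
Qed.

Lemma expansionM f g x y x' y' : expansion f x y -> expansion g x' y' ->
  expansion (fun h => f h * g h) (x * x') (x * y' + y * x').
Proof.
move=> [C [d [C0 /andP[d0 d1] hf]]] [C' [d' [C'0 /andP[d'0 d'1] hg]]].
exists (C * (`|x'| + `|y'| + C') + (`|x| + `|y|) * C' + `|y * y'|), (Num.min d d'); split.
- by rewrite !addr_ge0 // mulr_ge0 // !addr_ge0.
- by rewrite lt_min d0 d'0 ge_min d1.
move=> h /andP[h0]; rewrite le_min => /andP[h1 h2].
have hle : h <= 1 := le_trans h1 d1.
have {hf} hf : `|f h - (x + h * y)| <= C * h ^+ 2 by apply: hf; rewrite h0.
have {hg} hg : `|g h - (x' + h * y')| <= C' * h ^+ 2 by apply: hg; rewrite h0.
have -> : f h * g h - (x * x' + h * (x * y' + y * x')) =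
  (f h - (x + h * y)) * g h + (x + h * y) * (g h - (x' + h * y')) + y * y' * h ^+ 2 by ring.
have h2' : 0 <= h ^+ 2 by rewrite sqr_ge0.
have hy u v : `|u + h * v| <= `|u| + `|v|.
  by apply: le_trans (ler_normD _ _) _; rewrite lerD2l normrM (gtr0_norm h0) ler_piMl.
have gb : `|g h| <= `|x'| + `|y'| + C'.
  have -> : g h = (x' + h * y') + (g h - (x' + h * y')) by ring.
  apply: le_trans (ler_normD _ _) _; apply: lerD => //; apply: le_trans hg _.
  by rewrite ler_piMr // exprn_ile1 // ltW.
apply: le_trans (ler_normD _ _) _; rewrite [leRHS]mulrDl; apply: lerD; last by rewrite normrM (ger0_norm h2').
apply: le_trans (ler_normD _ _) _; rewrite [leRHS]mulrDl 2!normrM; apply: lerD.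
  by rewrite [leRHS]mulrAC; apply: ler_pM.
by rewrite -mulrA; apply: ler_pM.
Qed.

Lemma expansion_unique f x y x' y' : expansion f x y -> expansion f x' y' -> x = x' /\ y = y'.
Proof.
move=> [C [d [C0 /andP[d0 d1] hf]]] [C' [d' [C'0 /andP[d'0 d'1] hg]]].
pose D := Num.min d d'; have D0 : 0 < D by rewrite lt_min d0.
have key h : 0 < h <= D -> `|(x - x') + h * (y - y')| <= (C + C') * h ^+ 2.
  move=> /andP[h0]; rewrite le_min => /andP[h1 h2].
  have -> : (x - x') + h * (y - y') = (f h - (x' + h * y')) - (f h - (x + h * y)) by ring.
  apply: le_trans (ler_normB _ _) _; rewrite [leRHS]mulrDl [leRHS]addrC.
  by apply: lerD; [apply: hg|apply: hf]; rewrite h0.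
have D1 : D <= 1 by rewrite ge_min d1.
have xx : x - x' = 0.
  apply/eqP; rewrite -normr_le0; apply: (@eps_le _ _ _ (C + C' + `|y - y'|)) => e e0; rewrite add0r.
  pose h := Num.min D e.
  have h0 : 0 < h by rewrite lt_min D0.
  have hD : h <= D by rewrite ge_min lexx.
  have he : h <= e by rewrite ge_min lexx orbT.
  have := key h; rewrite h0 hD => /(_ isT) k.
  have -> : x - x' = (x - x' + h * (y - y')) - h * (y - y') by ring.
  apply: le_trans (ler_normB _ _) _; rewrite [leRHS]mulrDl; apply: lerD.
    apply: le_trans k _; apply: ler_wpM2l; first exact: addr_ge0.
    apply: le_trans he; rewrite expr2 ler_piMl // ?(ltW h0) //; exact: le_trans hD D1.
  by rewrite normrM (gtr0_norm h0) mulrC ler_wpM2l.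
split; first by apply/eqP; rewrite -subr_eq0 xx.
apply/eqP; rewrite -subr_eq0 -normr_le0; apply: (@eps_le _ _ _ (C + C')) => e e0; rewrite add0r.
pose h := Num.min D e.
have h0 : 0 < h by rewrite lt_min D0.
have hD : h <= D by rewrite ge_min lexx.
have he : h <= e by rewrite ge_min lexx orbT.
have := key h; rewrite h0 hD xx add0r normrM (gtr0_norm h0) => /(_ isT) k.
have : `|y - y'| <= (C + C') * h by rewrite -(ler_pM2l h0); apply: le_trans k _; rewrite expr2 mulrCA.
by move=> /le_trans; apply; rewrite ler_wpM2l // addr_ge0.
Qed.

Lemma expansion_sum (I : Type) (r : seq I) (f : I -> R -> R) (x y : I -> R) (P : pred I) :
  (forall i, P i -> expansion (f i) (x i) (y i)) ->
  expansion (fun h => \sum_(i <- r | P i) f i h) (\sum_(i <- r | P i) x i) (\sum_(i <- r | P i) y i).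
Proof.
move=> hf; elim: r => [|i r IH].
  rewrite !big_nil; apply: expansion_ext (expansion_linear 0 0); exists 1 => // h _.
  by rewrite big_nil mulr0 addr0.
rewrite !big_cons; case: ifP => Pi; last first.
  by apply: expansion_ext IH; exists 1 => // h _; rewrite big_cons Pi.
apply: expansion_ext (expansionD (hf i Pi) IH); exists 1 => // h _; by rewrite big_cons Pi.
Qed.

Lemma expansion_prod (I : Type) (r : seq I) (c : I -> R) (P : pred I) :
  expansion (fun h => \prod_(i <- r | P i) (1 + h * c i)) 1 (\sum_(i <- r | P i) c i).
Proof.
elim: r => [|i r IH].
  rewrite big_nil; apply: expansion_ext (expansion_linear 1 0); exists 1 => // h _.
  by rewrite big_nil mulr0 addr0.
rewrite big_cons; case: ifP => Pi; last first.
  by apply: expansion_ext IH; exists 1 => // h _; rewrite big_cons Pi.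
have := expansionM (expansion_linear 1 (c i)) IH; rewrite !mul1r mulr1 addrC.
by apply: expansion_ext; exists 1 => // h _; rewrite big_cons Pi.
Qed.

Lemma expansion_inv q y : y != 0 -> expansion (fun h => q / ((y + h) * y)) (q / y ^+ 2) (- (q / y ^+ 3)).
Proof.
move=> y0; have n0 : 0 < `|y| by rewrite normr_gt0.
exists (`|q| * 2 / `|y| ^+ 4), (Num.min 1 (`|y| / 2)); split.
- by rewrite divr_ge0 ?mulr_ge0 ?exprn_ge0.
- by rewrite lt_min ltr01 divr_gt0 //= ge_min lexx.
move=> h /andP[h0]; rewrite le_min => /andP[_ h1].
have yh : `|y| / 2 <= `|y + h|.
  have := ler_normB (y + h) h; rewrite addrK (gtr0_norm h0); lra.
have yh0 : y + h != 0 by rewrite -normr_gt0; apply: lt_le_trans yh; rewrite divr_gt0.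
have -> : q / ((y + h) * y) - (q / y ^+ 2 + h * - (q / y ^+ 3)) = q * h ^+ 2 / y ^+ 3 * (y + h)^-1.
  by field; rewrite y0 yh0.
rewrite !normrM !normfV !normrX (gtr0_norm h0).
have -> : `|q| * 2 / `|y| ^+ 4 * h ^+ 2 = `|q| * h ^+ 2 / `|y| ^+ 3 * (`|y| / 2)^-1 by field; rewrite gt_eqF.
apply: ler_wpM2l; first by nonneg.
by rewrite lef_pV2 ?posrE // ?normr_gt0 // divr_gt0.
Qed.

End FirstOrder.

(** * The interlacing condition as vanishing of v_1'' at inner zeros *)

Section SecondDerivative.
Variables (R : realType) (lam : seq nat) (m : nat) (a b : nat -> int).
Hypotheses (pl : is_partition lam) (l0 : lam != [::]).
Hypothesis ic : interlacing_coordinates R lam m a b.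

Local Notation et := (Defs.eta R lam).
Local Notation lo := (@lo R lam a).
Local Notation hi := (@hi R lam b).
Local Notation weight := (@weight R lam m a b).

Let et0 : 0 < et := eta_gt0 R pl l0.

Lemma lo_hi_neq i j : (i <= m)%N -> (j < m)%N -> lo i - hi j != 0.
Proof.
move=> im jm; rewrite subr_eq0; have [ij|ji] := leqP i j.
  by rewrite lt_eqF // (lo_hi pl l0 ic) // ij.
by rewrite gt_eqF // (hi_lo pl l0 ic) // ji.
Qed.

Lemma lo_lo_neq i j : (i <= m)%N -> (j <= m)%N -> i != j -> lo i - lo j != 0.
Proof.
move=> im jm; rewrite neq_ltn subr_eq0 => /orP[ij|ji].
  by rewrite lt_eqF // /lo ltr_pM2l // ltr_int (interlacing_aa pl ic) // ij.
by rewrite gt_eqF // /lo ltr_pM2l // ltr_int (interlacing_aa pl ic) // ji.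
Qed.

Lemma vfun_lo i : (i <= m)%N -> vfun m weight hi (lo i) = 0.
Proof.
move=> im; rewrite -[LHS]/(vreal lam m a b (lo i)) (vreal_ratf pl l0 ic) => [|j jm]; last first.
  by rewrite -subr_eq0 lo_hi_neq.
rewrite /ratf; case: i im => [|i] im; first by rewrite subrr mul0r.
by rewrite (bigD1_seq i) ?mem_index_iota ?iota_uniq //= subrr mul0r mul0r mulr0.
Qed.

(** 1 + mixed(A + h, A) = v_1(A + h)/h has two expansions: partial fractions give 1 + S - Q h, and
    the product over the other zeros and the poles gives a logarithmic derivative. Their
    coefficients are compared. *)
Lemma second_derivative i : (i <= m)%N ->
  Qfun m weight hi (lo i) = (1 + Sfun m weight hi (lo i)) *
    (\sum_(0 <= j < m) (lo i - hi j)^-1 - \sum_(0 <= k < m.+1 | k != i) (lo i - lo k)^-1).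
Proof.
move=> im; set A := lo i; set S := Sfun _ _ _ _; set Q := Qfun _ _ _ _.
pose G := \prod_(0 <= k < m.+1 | k != i) (A - lo k) / \prod_(0 <= j < m) (A - hi j).
have Ah j : (j < m)%N -> A - hi j != 0 by move=> jm; exact: lo_hi_neq.
have E1 : expansion (fun h => 1 + mixed m weight hi (A + h) A) (1 + S) (- Q).
  have es : expansion (fun h => \sum_(0 <= j < m) (if (j < m)%N then weight j / ((A + h - hi j) * (A - hi j)) else 0))
      (\sum_(0 <= j < m) (if (j < m)%N then weight j / (A - hi j) ^+ 2 else 0))
      (\sum_(0 <= j < m) (if (j < m)%N then - (weight j / (A - hi j) ^+ 3) else 0)).
    apply: expansion_sum => j _; case: ifP => jm.
      apply: expansion_ext (expansion_inv (weight j) (Ah j jm)); exists 1 => // h _.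
      by congr (_ / (_ * _)); ring.
    apply: expansion_ext (expansion_linear 0 0); exists 1 => // h _; by rewrite mulr0 addr0.
  have := expansionD (expansion_linear 1 0) es; rewrite add0r.
  have -> : \sum_(0 <= j < m) (if (j < m)%N then weight j / (A - hi j) ^+ 2 else 0) = S.
    by apply: eq_big_nat => j /andP[_ ->].
  have -> : \sum_(0 <= j < m) (if (j < m)%N then - (weight j / (A - hi j) ^+ 3) else 0) = - Q.
    by rewrite /Q /Qfun -sumrN; apply: eq_big_nat => j /andP[_ ->].
  apply: expansion_ext; exists 1 => // h _; rewrite mulr0 addr0; congr (_ + _).
  by apply: eq_big_nat => j /andP[_ ->].
have E2 := expansion_prod (index_iota 0 m) (fun j => (A - hi j)^-1) predT.
have E3 := expansion_prod (index_iota 0 m.+1) (fun k => (A - lo k)^-1) (fun k => k != i).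
have E4 := expansionM (expansion_linear G 0) E3.
have E5 := expansionM E1 E2.
have [d d0 hd] : exists2 d, 0 < d & forall h, 0 < h <= d -> forall j, (j < m)%N -> A + h - hi j != 0.
  elim: m {E1 E2 E3 E4 E5 G S Q im} Ah => [|n IH] Ah; first by exists 1.
  have [d d0 hd] := IH (fun j jn => Ah j (ltnW jn)).
  have An := Ah n (leqnn _); exists (Num.min d (`|A - hi n| / 2)).
    by rewrite lt_min d0 divr_gt0 // normr_gt0.
  move=> h /andP[h0]; rewrite le_min => /andP[h1 h2] j; rewrite ltnS leq_eqVlt => /orP[/eqP ->|jn].
    have := ler_normB (A + h - hi n) h; have -> : A + h - hi n - h = A - hi n by ring.
    rewrite (gtr0_norm h0) => h3; rewrite -normr_gt0.
    have : 0 < `|A - hi n| by rewrite normr_gt0.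
    lra.
  by apply: hd => //; rewrite h0.
(* The factors of the poles are moved to the left, so that both sides are products of terms 1 + h
   c. *)
have E6 : expansion (fun h => (1 + mixed m weight hi (A + h) A) * \prod_(0 <= j < m) (1 + h * (A - hi j)^-1))
   (G * 1) (G * (\sum_(0 <= k < m.+1 | k != i) (A - lo k)^-1) + 0 * 1).
  apply: expansion_ext E4; exists d => // h hh; have /andP[h0 _] := hh.
  have off1 : off_poles m hi (A + h) by move=> j jm; exact: hd.
  have off2 : off_poles m hi A by [].
  have := vfunB weight off1 off2; rewrite vfun_lo // subr0.
  have -> : A + h - A = h by ring.
  rewrite -[vfun _ _ _ _]/(vreal lam m a b (A + h)) (vreal_ratf pl l0 ic) => [|j jm]; last first.
    by rewrite -subr_eq0 off1.
  have -> : ratf (lo 0) (fun k => lo k.+1) hi m (A + h) =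
     \prod_(0 <= k < m.+1) (A + h - lo k) / \prod_(0 <= j < m) (A + h - hi j).
    by rewrite /ratf big_split /= prodfV mulrA big_nat_recl.
  rewrite (bigD1_seq i) ?mem_index_iota ?iota_uniq //=.
  have -> : A + h - lo i = h by rewrite /A; ring.
  rewrite -mulrA => /(mulfI (lt0r_neq0 h0)) <-; rewrite mulr0 addr0 /G.
  have e1 : \prod_(0 <= k < m.+1 | k != i) (A + h - lo k) =
     \prod_(0 <= k < m.+1 | k != i) (A - lo k) * \prod_(0 <= k < m.+1 | k != i) (1 + h * (A - lo k)^-1).
    rewrite -big_split /=; rewrite big_nat_cond [RHS]big_nat_cond; apply: eq_bigr => k /andP[/andP[_ km] ki].
    have n0 : A - lo k != 0 by apply: lo_lo_neq => //; rewrite eq_sym.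
    by rewrite mulrDr mulr1 mulrCA mulfV // mulr1; ring.
  have e2 : \prod_(0 <= j < m) (A + h - hi j) =
     \prod_(0 <= j < m) (A - hi j) * \prod_(0 <= j < m) (1 + h * (A - hi j)^-1).
    rewrite -big_split /=; apply: eq_big_nat => j /andP[_ jm].
    by rewrite mulrDr mulr1 mulrCA mulfV ?Ah // mulr1; ring.
  have n1 : \prod_(0 <= j < m) (A + h - hi j) != 0.
    by rewrite big_nat prodf_seq_neq0; apply/allP => j _; apply/implyP => /andP[_ jm]; exact: off1.
  move: n1; rewrite e1 e2 mulf_eq0 negb_or => /andP[n1 n2]; field; by rewrite n1 n2.
have [g1 g2] := expansion_unique E5 E6.
move: g1 g2; rewrite !mulr1 => g1; rewrite -g1 addr0 => g2.
by rewrite mulrBr -[X in _ - X]g2; ring.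
Qed.

Lemma condition_Q i : (i <= m)%N ->
  (\sum_(0 <= k < m.+1 | k != i) ((a i - a k)%:~R : R)^-1 =
   \sum_(1 <= j < m.+1) ((a i - b j)%:~R : R)^-1) <-> Qfun m weight hi (lo i) = 0.
Proof.
move=> im; rewrite second_derivative //.
have -> : \sum_(0 <= k < m.+1 | k != i) ((a i - a k)%:~R : R)^-1 = et * \sum_(0 <= k < m.+1 | k != i) (lo i - lo k)^-1.
  by rewrite mulr_sumr; apply: eq_bigr => k _; rewrite /lo -mulrBr rmorphB /= invfM mulrA mulfV ?mul1r // gt_eqF.
have -> : \sum_(1 <= j < m.+1) ((a i - b j)%:~R : R)^-1 = et * \sum_(0 <= j < m) (lo i - hi j)^-1.
  rewrite big_add1 /= mulr_sumr; apply: eq_bigr => k _.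
  by rewrite /lo /hi -mulrBr rmorphB /= invfM mulrA mulfV ?mul1r // gt_eqF.
have g0 : 1 + Sfun m weight hi (lo i) != 0.
  by rewrite gt_eqF // ltr_pwDl // Sfun_ge0 // => j; exact: (weight_gt0 pl l0 ic).
split=> [/(mulfI (lt0r_neq0 et0)) ->|/eqP]; first by rewrite subrr mulr0.
by rewrite mulf_eq0 (negbTE g0) /= subr_eq0 => /eqP ->.
Qed.

End SecondDerivative.

(** * Plateaus of the height function *)

Ltac pos := repeat first [ done | assumption | apply: addr_gt0 | apply: mulr_gt0 | apply: exprn_gt0 | rewrite invr_gt0 ].

Section Reflection.
Variables (R : realType) (m : nat) (p B : nat -> R).
Local Notation B' := (fun j => - B j).

Let opp u j : - u - B' j = - (u - B j). Proof. by rewrite opprB opprK addrC. Qed.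

Lemma vfun_opp u : vfun m p B' (- u) = - vfun m p B u.
Proof.
rewrite /vfun opprD opprK; congr (_ + _); rewrite -sumrN; apply: eq_bigr => j _.
by rewrite opp invrN mulrN opprK.
Qed.

Lemma Sfun_opp u : Sfun m p B' (- u) = Sfun m p B u.
Proof. by apply: eq_bigr => j _; rewrite opp sqrrN. Qed.

Lemma Qfun_opp u : Qfun m p B' (- u) = - Qfun m p B u.
Proof. by rewrite /Qfun -sumrN; apply: eq_bigr => j _; rewrite opp exprNn -signr_odd /= expr1 mulN1r invrN mulrN. Qed.

Lemma frozen_opp D x s : frozen m p B' D (- x) s -> frozen m p B D x s.
Proof.
move=> [u]; rewrite -[u]opprK; move: (- u) => w [hu Xu su uD]; exists w; split.
- by move=> j jm; have := hu j jm; rewrite opp oppr_eq0.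
- by apply: oppr_inj; rewrite -Xu /Xfun vfun_opp; ring.
- by rewrite -Sfun_opp.
- by move: uD; rewrite opp normrN.
Qed.

End Reflection.

(** * Persistence and failure of freezing near a point *)

Section LocalAnalysis.
Variables (R : realType) (m : nat) (p B : nat -> R).
Hypothesis p0 : forall j, (j < m)%N -> 0 < p j.
Hypothesis m0 : (0 < m)%N.
Local Notation v := (vfun m p B).
Local Notation X := (Xfun m p B).
Local Notation S := (Sfun m p B).
Local Notation Q := (Qfun m p B).

Lemma off_poles_dist c : off_poles m B c -> exists2 g, 0 < g & forall j, (j < m)%N -> g <= `|c - B j|.
Proof.
rewrite /off_poles; elim: m => [|n IH] h; first by exists 1.
have [g g0 hg] := IH (fun j jn => h j (ltnW jn)).
have hn : 0 < `|c - B n| by rewrite normr_gt0 h.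
exists (Num.min g `|c - B n|); first by rewrite lt_min g0.
move=> j; rewrite ltnS leq_eqVlt ge_min => /orP[/eqP ->|jn]; first by rewrite lexx orbT.
by rewrite hg.
Qed.

Lemma near_same_gap c g w : (forall j, (j < m)%N -> g <= `|c - B j|) -> `|w - c| < g -> same_gap m B w c.
Proof.
move=> hg; rewrite ltr_norml => /andP[h1 h2] j jm; have := hg j jm; rewrite ler_normr => /orP[] h.
  by rewrite mulr_gt0 //; lra.
by rewrite -mulrNN mulr_gt0 //; lra.
Qed.

Lemma Scpx_real u : Scpx m p B u%:C = S u.
Proof. by apply: eq_bigr => j _; rewrite -rmorphB cabs_real real_normK ?num_real. Qed.

Lemma vcpx_real u : vcpx m p B u%:C = (v u)%:C.
Proof.
rewrite /vcpx /vfun rmorphB rmorph_sum; congr (_ - _); apply: eq_bigr => j _.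
by rewrite fmorph_div rmorphB.
Qed.

Lemma off_poles_complex u : off_poles m B u -> forall j, (j < m)%N -> u%:C - (B j)%:C != 0 :> R[i].
Proof. by move=> h j jm; rewrite -rmorphB -[0]/(0%:C) (inj_eq (@complexI _)) h. Qed.

Lemma cubic_real s u w : 0 <= s -> off_poles m B u -> off_poles m B w ->
  s * (1 + S u) <= 1 -> s * (1 + S w) <= 1 ->
  s / 2 * cabs (u%:C - w%:C : R[i]) ^+ 3 * (p 0 / (cabs (u%:C - (B 0)%:C : R[i]) ^+ 2 * (w - B 0) ^+ 2)) <= `|X s u - X s w|.
Proof.
move=> s0 hu hw su sw; have hc := off_poles_complex hu.
have := cubic p0 m0 s0 hc hw; rewrite Scpx_real vcpx_real => /(_ su sw) /le_trans; apply.
by rewrite -rmorphM -!rmorphB cabs_real.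
Qed.

Lemma frozen_unique s u w : 0 < s -> off_poles m B u -> off_poles m B w ->
  s * (1 + S u) <= 1 -> s * (1 + S w) <= 1 -> X s u = X s w -> u = w.
Proof.
move=> s0 hu hw su sw E; have := cubic_real (ltW s0) hu hw su sw; rewrite E subrr normr0.
rewrite -!rmorphB !cabs_real => h; apply/eqP; rewrite -subr_eq0; apply: contraT; rewrite -normr_eq0 => uw.
have u0 : 0 < `|u - w| by rewrite lt0r uw normr_ge0.
have : 0 < s / 2 * `|u - w| ^+ 3 * (p 0 / (`|u - B 0| ^+ 2 * (w - B 0) ^+ 2)).
  have w2 : 0 < (w - B 0) ^+ 2 by rewrite lt0r sqr_ge0 sqrf_eq0 hw.
  have u2 : 0 < `|u - B 0| by rewrite normr_gt0 hu.
  by have q0 := p0 m0; pos.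
by rewrite ltNge h.
Qed.

Lemma Sfun_far u w : off_poles m B u -> (forall j, (j < m)%N -> `|u - B j| <= `|w - B j|) -> S w <= S u.
Proof.
move=> hu h; apply: sum_lt => j jm; have u0 : 0 < `|u - B j| by rewrite normr_gt0 hu.
have w0 := lt_le_trans u0 (h j jm).
rewrite -[(w - B j) ^+ 2]real_normK ?num_real // -[(u - B j) ^+ 2]real_normK ?num_real //.
by rewrite ler_pM2l ?p0 // lef_pV2 ?posrE ?exprn_gt0 // ler_pXn2r ?nnegrE // h.
Qed.

Lemma Sfun_gt0 u : off_poles m B u -> 0 < S u.
Proof.
move=> hu; rewrite /Sfun big_ltn //; apply: ltr_pwDl.
  by rewrite divr_gt0 ?p0 // lt0r sqr_ge0 sqrf_eq0 hu.
by rewrite big_nat; apply: sumr_ge0 => j /andP[_ jm]; rewrite divr_ge0 ?sqr_ge0 // ltW // p0.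
Qed.

(** Just to the right of [B k] the term p k / d^3 dominates: poles further left contribute
    positively, and those on the right stay at distance [kap] and contribute at least -P / kap^3 in
    all. *)
Lemma Qfun_nonneg k A kap : (k < m)%N -> B k < A -> 0 < kap ->
  (forall j, (j < m)%N -> B j <= B k \/ A + kap <= B j) -> exists2 w, B k < w <= A & 0 <= Q w.
Proof.
move=> km kA kap0 hB; pose P := \sum_(0 <= j < m) p j.
have P0 : 0 < P.
  rewrite /P big_ltn //; apply: ltr_pwDl; first exact: p0.
  by rewrite big_nat; apply: sumr_ge0 => j /andP[_ jm]; rewrite ltW // p0.
have pP : p k <= P.
  rewrite /P (bigD1_seq k) ?mem_index_iota ?iota_uniq //= lerDl big_nat_cond.
  by apply: sumr_ge0 => j /andP[/andP[_ jm] _]; rewrite ltW // p0.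
pose r := p k / P; have r0 : 0 < r by rewrite divr_gt0 ?p0.
have r1 : r <= 1 by rewrite ler_pdivrMr // mul1r.
(* d <= kap r gives P d^3 / kap^3 <= P r^3 <= p k, as P r = p k and r <= 1. *)
pose d := Num.min (A - B k) (kap * r).
have d0 : 0 < d by rewrite lt_min subr_gt0 kA mulr_gt0.
have d1 : d <= A - B k by rewrite ge_min lexx.
have d2 : d <= kap * r by rewrite ge_min lexx orbT.
exists (B k + d); first by rewrite ltrDl d0; lra.
have term j : (j < m)%N -> - (p j / kap ^+ 3) + (if j == k then p k / d ^+ 3 else 0) <= p j / (B k + d - B j) ^+ 3.
  move=> jm; have pj := p0 jm; have kp3 : 0 < kap ^+ 3 by rewrite exprn_gt0.
  have q0 : 0 <= p j / kap ^+ 3 by rewrite divr_ge0 ?ltW.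
  case: eqP => [->|_].
    by rewrite (_ : B k + d - B k = d); [rewrite gerDr oppr_le0 divr_ge0 ?ltW // p0|ring].
  rewrite addr0; case: (hB j jm) => hj.
    have t0 : 0 < B k + d - B j by lra.
    by apply: (@le_trans _ _ 0); [rewrite oppr_le0|rewrite divr_ge0 ?exprn_ge0 // ltW].
  have t0 : kap <= - (B k + d - B j) by lra.
  have t1 : 0 < - (B k + d - B j) := lt_le_trans kap0 t0.
  have -> : p j / (B k + d - B j) ^+ 3 = - (p j / (- (B k + d - B j)) ^+ 3).
    by rewrite exprNn -signr_odd /= expr1 mulN1r invrN mulrN opprK.
  by rewrite lerN2 ler_pM2l // lef_pV2 ?posrE ?exprn_gt0 // ler_pXn2r ?nnegrE ?(ltW kap0) ?(ltW t1).
apply: le_trans (sum_lt term).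
rewrite big_split /= sumrN -mulr_suml -/P.
have -> : \sum_(0 <= i < m) (if i == k then p k / d ^+ 3 else 0) = p k / d ^+ 3.
  by rewrite (bigD1_seq k) ?mem_index_iota ?iota_uniq //= eqxx big1 ?addr0 // => j /negbTE ->.
rewrite addrC subr_ge0 ler_pdivlMr ?exprn_gt0 //.
apply: (@le_trans _ _ (P / kap ^+ 3 * (kap * r) ^+ 3)).
  rewrite ler_pM2l ?divr_gt0 ?exprn_gt0 // ler_pXn2r ?nnegrE ?(ltW d0) //.
  by rewrite mulr_ge0 // ltW.
have -> : P / kap ^+ 3 * (kap * r) ^+ 3 = P * r * r ^+ 2 by field; rewrite gt_eqF.
have -> : P * r = p k by rewrite /r mulrC divfK // gt_eqF.
by rewrite ler_piMr ?(ltW (p0 km)) // exprn_ile1 // ltW.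
Qed.

Lemma Q_IVT u w : u <= w -> same_gap m B u w -> 0 <= Q u -> Q w <= 0 -> exists2 c, u <= c <= w & Q c = 0.
Proof.
move=> uw g hu hw; have [||c cI Qc] := @IVT R Q u w 0 uw.
- apply: continuous_in_subspaceT => c; rewrite inE /= in_itv /= => cb.
  have cb' : Num.min u w <= c <= Num.max u w by rewrite minEle maxEle uw.
  by apply: continuous_sum_terms; case: (same_gap_off (same_gap_between g cb').2).
- by rewrite ge_min le_max hu hw orbT.
by exists c => //; move: cI; rewrite in_itv.
Qed.

(** For s below s0 the derivative of X_s at [c] is positive, so X_s(c) lies strictly between the
    images of c - n and c + n, and still does for parameters near s. *)
Lemma frozen_near c s0 s : off_poles m B c -> 0 < s -> s < s0 -> s0 * (1 + S c) = 1 ->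
  exists D d, 0 < d /\ forall s', `|s' - s| <= d -> frozen m p B D (X s c) s'.
Proof.
move=> hc sp ss0 sS; have S0 := Sfun_gt0 hc; have s00 : 0 < s0 := lt_trans sp ss0.
pose sm := (s + s0) / 2; have sm0 : 0 < sm by rewrite /sm; lra.
have s_sm : s < sm by rewrite /sm; lra.
pose e := 1 / sm - (1 + S c).
have e0 : 0 < e.
  have sc : 1 + S c = s0^-1 by apply: (mulfI (lt0r_neq0 s00)); rewrite sS mulfV // gt_eqF.
  by rewrite subr_gt0 sc div1r ltf_pV2 ?posrE // /sm; lra.
have [g g0 hg] := off_poles_dist hc.
have := continuous_sum_terms (p := p) (k := 2) hc => /cvgrPdist_le /(_ e e0) /nbhs_ballP[r /= r0 hr].
pose n := Num.min (g / 2) (r / 2); have n0 : 0 < n by rewrite lt_min !divr_gt0.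
have n1 : n < g by apply: (@le_lt_trans _ _ (g / 2)); [rewrite ge_min lexx|lra].
have n2 : n < r by apply: (@le_lt_trans _ _ (r / 2)); [rewrite ge_min lexx orbT|lra].
have near w : `|w - c| <= n -> same_gap m B w c /\ S w <= S c + e.
  move=> wn; split; first by apply: near_same_gap hg _; exact: le_lt_trans n1.
  have : `|S c - S w| <= e by apply: hr; rewrite /ball /= distrC; exact: le_lt_trans n2.
  by rewrite ler_norml => /andP[? ?]; lra.
have sw w s' : `|w - c| <= n -> 0 <= s' -> s' <= sm -> s' * (1 + S w) <= 1.
  move=> wn s'0 s'm; have [_ h] := near w wn.
  have E : sm * (1 + S c + e) = 1 by rewrite /e; field; rewrite gt_eqF.
  rewrite -[leRHS]E.
  by apply: ler_pM => //; [have := Sfun_ge0 B p0 w; lra|lra].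
have hm : `|c - n - c| <= n by rewrite addrAC subrr add0r normrN ger0_norm // ltW.
have hp : `|c + n - c| <= n by rewrite addrAC subrr add0r ger0_norm // ltW.
have [gm Sm] := near _ hm; have [gp Sp] := near _ hp.
have [om _] := same_gap_off gm; have [op _] := same_gap_off gp.
pose kap := 1 - s / sm; have kap0 : 0 < kap by rewrite subr_gt0 ltr_pdivrMr // mul1r.
have fac w : `|w - c| <= n -> same_gap m B w c -> kap <= 1 - s * (1 + mixed m p B w c).
  move=> wn gw; have [ow _] := same_gap_off gw; have [_ h] := near w wn.
  have h1 := mixed_le p0 ow hc.
  have h2 : 1 + mixed m p B w c <= 1 / sm by have h3 := e0; rewrite /e in h h3; lra.
  by rewrite /kap lerD2l lerN2 ler_pM2l // -div1r.
pose M := `|v (c - n)| + `|v (c + n)| + 1.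
have M0 : 0 < M by rewrite ltr_wpDl ?addr_ge0.
pose d := Num.min (Num.min (s / 2) (sm - s)) (n * kap / M).
have d0 : 0 < d by rewrite !lt_min !divr_gt0 ?mulr_gt0 // andbT subr_gt0.
have d1 : d <= s / 2 by rewrite !ge_min lexx.
have d2 : d <= sm - s by rewrite !ge_min lexx !orbT.
have d3 : d * M <= n * kap by rewrite -ler_pdivlMr // !ge_min lexx !orbT.
exists (`|c - B 0| + n), d; split=> // s'; rewrite ler_norml => /andP[h1 h2].
have s'0 : 0 <= s' by lra.
have s'm : s' <= sm by lra.
have dv w : `|v w| <= M -> `|(s' - s) * v w| <= n * kap.
  move=> vw; apply: le_trans d3; rewrite normrM; apply: ler_pM => //.
  by rewrite ler_norml; apply/andP; split; lra.
have vm : `|v (c - n)| <= M by have := normr_ge0 (v (c + n)); rewrite /M; lra.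
have vp : `|v (c + n)| <= M by have := normr_ge0 (v (c - n)); rewrite /M; lra.
have lo_ : X s' (c - n) <= X s c.
  have -> : X s' (c - n) = X s (c - n) - (s' - s) * v (c - n) by rewrite /Xfun; ring.
  have := dv _ vm; rewrite ler_norml => /andP[g1 g2].
  have := XfunB p s om hc; have -> : c - n - c = - n by ring.
  have : n * kap <= n * (1 - s * (1 + mixed m p B (c - n) c)) by rewrite ler_pM2l // fac.
  move=> a1 a2; have : X s (c - n) = X s c - n * (1 - s * (1 + mixed m p B (c - n) c)) by rewrite -mulNr -a2; ring.
  lra.
have hi_ : X s c <= X s' (c + n).
  have -> : X s' (c + n) = X s (c + n) - (s' - s) * v (c + n) by rewrite /Xfun; ring.
  have := dv _ vp; rewrite ler_norml => /andP[g1 g2].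
  have := XfunB p s op hc; have -> : c + n - c = n by ring.
  have : n * kap <= n * (1 - s * (1 + mixed m p B (c + n) c)) by rewrite ler_pM2l // fac.
  move=> a1 a2; have : X s (c + n) = X s c + n * (1 - s * (1 + mixed m p B (c + n) c)) by rewrite -a2; ring.
  lra.
have cn : c - n <= c + n by lra.
have gmp : same_gap m B (c - n) (c + n).
  move=> j jm; have := hg j jm; rewrite ler_normr => /orP[] h; [rewrite mulr_gt0 //; lra|].
  by rewrite -mulrNN mulr_gt0 //; lra.
have [|w /andP[w1 w2] Xw] := X_IVT cn gmp (s := s') (x := X s c) (p := p); first by rewrite ge_min le_max lo_ hi_ orbT.
have wn : `|w - c| <= n by rewrite ler_norml; apply/andP; split; lra.
exists w; split=> //; first by case: (same_gap_off (near w wn).1).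
  exact: sw.
have -> : w - B 0 = (c - B 0) + (w - c) by ring.
by apply: le_trans (ler_normD _ _) _; rewrite lerD2l.
Qed.

(** A frozen w for s would have |X_s(w) - X_s(c)| = d |v c|. The cubic bound forces |w - c| <= n; as
    Q c = 0, [mixed_tangent] gives 1 + mixed >= 1/s0, so the slope of X_s between w and c is at most
    2d/s0. The choice of [n] then bounds the same difference by d |v c| / 2. *)
Lemma not_frozen c s0 : off_poles m B c -> Q c = 0 -> s0 * (1 + S c) = 1 -> 0 < s0 -> v c != 0 ->
  exists2 d0, 0 < d0 & forall d s D, 0 < d -> d <= d0 -> s = s0 \/ s = s0 - 2 * d -> ~ frozen m p B D (X (s0 - d) c) s.
Proof.
move=> hc Qc sS s00 vc; have [g g0 hg] := off_poles_dist hc.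
have V0 : 0 < `|v c| by rewrite normr_gt0.
pose n := Num.min (g / 2) (s0 * `|v c| / 4).
have n0 : 0 < n by rewrite lt_min !divr_gt0 // mulr_gt0.
have n1 : n < g by apply: (@le_lt_trans _ _ (g / 2)); [rewrite ge_min lexx|lra].
have n2 : n <= s0 * `|v c| / 4 by rewrite ge_min lexx orbT.
pose D := `|c - B 0|; have D0 : 0 < D by rewrite normr_gt0 hc.
pose T := p 0 * n ^+ 3 / ((n + D) ^+ 2 * D ^+ 2).
have T0 : 0 < T by have q0 := p0 m0; rewrite /T; pos.
exists (Num.min (s0 / 8) (s0 / 8 * T / `|v c|)); first by rewrite lt_min !divr_gt0 // mulr_gt0 // divr_gt0.
move=> d s D' dp; rewrite le_min => /andP[d1 d2] hs [w [hw Xw sw wD]].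
have s1 : s0 / 2 <= s by case: hs => ->; lra.
have s2 : s <= s0 by case: hs => ->; lra.
have sp : 0 < s by lra.
have sc : s * (1 + S c) <= 1 by rewrite -[leRHS]sS ler_wpM2r // addr_ge0 // Sfun_ge0.
have XE : X s w - X s c = (s - (s0 - d)) * v c by rewrite Xw /Xfun; ring.
have sd : `|s - (s0 - d)| = d.
  case: hs => ->; first by rewrite (_ : s0 - (s0 - d) = d) ?gtr0_norm //; ring.
  by rewrite (_ : s0 - 2 * d - (s0 - d) = - d) ?normrN ?gtr0_norm //; ring.
have Xn : `|X s w - X s c| = d * `|v c| by rewrite XE normrM sd.
have dv : d * `|v c| < s / 2 * p 0 * n ^+ 3 / ((n + D) ^+ 2 * D ^+ 2).
  have h1 : d * `|v c| <= s0 / 8 * T by rewrite -ler_pdivlMr.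
  have -> : s / 2 * p 0 * n ^+ 3 / ((n + D) ^+ 2 * D ^+ 2) = s / 2 * T by rewrite /T !mulrA.
  apply: le_lt_trans h1 _; rewrite ltr_pM2r //; lra.
have cub := cubic_real (ltW sp) hw hc sw sc; rewrite Xn in cub.
have wc := close p0 m0 sp (off_poles_complex hw) hc (lexx D) n0 cub dv.
rewrite -rmorphB cabs_real in wc.
have gw : same_gap m B w c by apply: near_same_gap hg _; exact: le_lt_trans n1.
have h1 := mixed_tangent p0 gw; rewrite Qc mul0r subr0 in h1.
have h2 := mixed_le p0 hw hc.
have XB := XfunB p s hw hc; rewrite XB normrM in Xn.
have f0 : 0 <= 1 - s * (1 + mixed m p B w c).
  have : s * (1 + mixed m p B w c) <= s * (1 + (S w + S c) / 2) by rewrite ler_pM2l // lerD2l.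
  have -> : s * (1 + (S w + S c) / 2) = (s * (1 + S w) + s * (1 + S c)) / 2 by field.
  lra.
have f1 : 1 - s * (1 + mixed m p B w c) <= 2 * d / s0.
  have a1 : s * (1 + S c) <= s * (1 + mixed m p B w c) by rewrite ler_pM2l // lerD2l.
  have a2 : s * (1 + S c) = s / s0.
    by congr (_ * _); apply: (mulfI (lt0r_neq0 s00)); rewrite sS mulfV // gt_eqF.
  rewrite a2 in a1; have a3 : 1 - s / s0 <= 2 * d / s0.
    rewrite ler_pdivlMr // mulrBl mul1r divfK ?gt_eqF //; case: hs => ->; lra.
  lra.
have : `|w - c| * `|1 - s * (1 + mixed m p B w c)| <= s0 * `|v c| / 4 * (2 * d / s0).
  by rewrite (ger0_norm f0); apply: ler_pM => //; exact: le_trans n2.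
rewrite Xn; have -> : s0 * `|v c| / 4 * (2 * d / s0) = d * `|v c| / 2 by field; rewrite gt_eqF.
have : 0 < d * `|v c| by rewrite mulr_gt0.
lra.
Qed.

End LocalAnalysis.

(** * Constancy of H(x, .) and frozen points *)

Section Plateaus.
Variables (R : realType) (lam : seq nat) (m : nat) (a b : nat -> int) (H : R -> R -> R).
Hypotheses (pl : is_partition lam) (l0 : lam != [::]).
Hypothesis ic : interlacing_coordinates R lam m a b.
Hypothesis lim : limiting_height lam (a 0%N) (a m) H.

Local Notation et := (Defs.eta R lam).
Local Notation W := (size lam + nth 0%N lam 0)%N.
Local Notation al := (et * (a 0%N)%:~R).
Local Notation inr := (in_range al et W).
Local Notation lo := (@lo R lam a).
Local Notation B := (@hi R lam b).
Local Notation p := (@weight R lam m a b).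
Local Notation velocity := (@velocity R lam a H).
Local Notation v := (vfun m p B).
Local Notation X := (Xfun m p B).
Local Notation S := (Sfun m p B).
Local Notation Q := (Qfun m p B).
Local Notation froz := (frozen m p B).

Let et0 : 0 < et := eta_gt0 R pl l0.
Let p0 j : (j < m)%N -> 0 < p j. Proof. exact: (weight_gt0 pl l0 ic). Qed.

Lemma poles_gt0 : (0 < m)%N.
Proof.
rewrite lt0n; apply/eqP => mE; have := range_end pl l0 ic.
have W0 : 0 < et * W%:R by rewrite mulr_gt0 // ltr0n; case: (lam) l0.
rewrite mE; lra.
Qed.

Let m0 := poles_gt0.

(** u is where the characteristic through x + ie arrives at time 1. Imaginary parts give Im u (1 -
    s(1 + Scpx u)) = e > 0, the complex form of X_s' >= 0. *)
Lemma characteristic (x e t : R) : 0 < e -> 0 < t < 1 -> exists u : R[i],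
  [/\ forall j, (j < m)%N -> u - (B j)%:C != 0,
      u - (1 - t)%:C * vcpx m p B u = Complex x e,
      (1 - t) * (1 + Scpx m p B u) <= 1 &
      0 < complex.Im u /\ complex.Im u = e + (1 - t) * complex.Im (velocity t (Complex x e))].
Proof.
move=> e0 t01; have /andP[t0 t1] := t01; have s0 : 0 < 1 - t by rewrite subr_gt0.
pose z := Complex x e; have y0 : 0 < complex.Im z by [].
have Bu := burgers pl l0 ic lim y0 t01; have Iv := Im_velocity_ge pl l0 ic lim y0 t01.
set c := velocity t z in Bu Iv *; pose u := z + (1 - t)%:C * c.
have Iu : complex.Im u = e + (1 - t) * complex.Im c by rewrite ImD ImM ReC ImC mul0r addr0.
have ic0 : 0 < complex.Im c by apply: lt_le_trans Iv; rewrite divr_gt0.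
have u0 : 0 < complex.Im u by rewrite Iu addr_gt0 // mulr_gt0.
have Xu : u - (1 - t)%:C * vcpx m p B u = z.
  have -> : vcpx m p B u = c by exact: Bu.
  by rewrite /u addrK.
exists u; split=> //; first by move=> j _; exact: resolvent_neq0.
have h : complex.Im u * (1 - (1 - t) * (1 + Scpx m p B u)) = e.
  have E := congr1 (@complex.Im R) Xu; rewrite ImB ImM ReC ImC mul0r addr0 vcpx_imE // in E.
  have -> : e = complex.Im z by [].
  by rewrite -E; ring.
rewrite leNgt; apply/negP => h'; move: e0; rewrite -h ltNge => /negP; apply.
by apply: mulr_ge0_le0; [exact: ltW|rewrite subr_le0 ltW].
Qed.

(** For small e the cubic bound puts the complex point u within [n] of the real frozen point,
    uniformly in t because of [D]. Then Im u and Im v are small and [H_constant] applies. *)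
Lemma frozen_constant D x t1 t2 : inr x -> 0 < t1 -> t1 < t2 -> t2 < 1 ->
  (forall t, t1 <= t <= t2 -> froz D x (1 - t)) -> H x t1 = H x t2.
Proof.
move=> xr t10 t12 t21 fz; apply: (H_constant pl l0 ic lim xr t10 t12 (ltW t21)) => k k0.
pose s2 := 1 - t2; have s20 : 0 < s2 by rewrite subr_gt0.
pose n := k * s2; have n0 : 0 < n by rewrite mulr_gt0.
have D0 : 0 < D.
  have [w [hw _ _ wD]] := fz t1 (introT andP (conj (lexx t1) (ltW t12))).
  by apply: lt_le_trans wD; rewrite normr_gt0 hw.
pose T := p 0 * n ^+ 3 / ((n + D) ^+ 2 * D ^+ 2).
have T0 : 0 < T by have q0 := p0 m0; rewrite /T; pos.
exists (s2 / 4 * T); first by rewrite mulr_gt0 // divr_gt0.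
move=> e t e0 eT /andP[ta tb].
have [w [hw Xw sw wD]] := fz t (introT andP (conj ta (ltW tb))).
have t01 : 0 < t < 1 by rewrite (lt_le_trans t10) // (lt_trans tb).
have [u [hu Xu su [u0 Iu]]] := characteristic x e0 t01.
have s0 : s2 < 1 - t by rewrite ltrD2l ltrN2.
have sp : 0 < 1 - t := lt_trans s20 s0.
have cub := cubic p0 m0 (ltW sp) hu hw su sw.
rewrite Xu Xw in cub.
have ce : cabs (Complex x e - x%:C) = e.
  by apply/eqP; rewrite -(@eqrXn2 _ 2) ?cabs_ge0 ?(ltW e0) // cabs_sqr ReB ImB ReC ImC /= subrr subr0 expr0n add0r.
rewrite ce in cub.
have small : e < (1 - t) / 2 * p 0 * n ^+ 3 / ((n + D) ^+ 2 * D ^+ 2).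
  have -> : (1 - t) / 2 * p 0 * n ^+ 3 / ((n + D) ^+ 2 * D ^+ 2) = (1 - t) / 2 * T by rewrite /T !mulrA.
  apply: le_lt_trans eT _; rewrite ltr_pM2r //; lra.
have uw := close p0 m0 sp hu hw wD n0 cub small.
have Iu_le : complex.Im u <= n.
  apply: le_trans uw; apply: le_trans (abs_Im _); rewrite Im_sub; exact: ler_norm.
rewrite -(ler_pM2l sp); apply: (@le_trans _ _ n); first by rewrite Iu in Iu_le; lra.
by rewrite /n mulrC ler_pM2r // ltW.
Qed.

(** [velocity_small] provides points u with Im u tending to 0 at times tending to t. Their real
    parts are bounded, and a cluster point is a real solution to which the equation and the
    derivative condition pass. *)
Lemma constant_frozen x t1 t2 t : inr x -> 0 <= t1 -> t1 < t -> t < t2 -> t2 <= 1 -> H x t1 = H x t2 ->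
  exists D, froz D x (1 - t).
Proof.
move=> xr t10 t1t tt2 t21 HE.
pose dl := Num.min (t - t1) (t2 - t) / 2.
have dl0 : 0 < dl by rewrite divr_gt0 // lt_min !subr_gt0 t1t.
have dl1 : dl <= (t - t1) / 2 by rewrite ler_pM2r // ge_min lexx.
have dl2 : dl <= (t2 - t) / 2 by rewrite ler_pM2r // ge_min lexx orbT.
pose s := 1 - t; pose s2 := s - dl.
have s20 : 0 < s2 by rewrite /s2 /s; lra.
have td : 0 < t - dl by lra.
(* s p_j / |u - B_j|^2 <= 1 keeps the points u at least this far from the poles, so that the
   rational functions converge. *)
pose sg j := Num.sqrt (s2 * p j).
have sg0 j : (j < m)%N -> 0 < sg j by move=> jm; rewrite sqrtr_gt0 mulr_gt0 // p0.
have sample n : exists q : R[i] * R * R, [/\ forall j, (j < m)%N -> sg j <= cabs (q.1.1 - (B j)%:C),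
    q.1.1 - q.1.2%:C * vcpx m p B q.1.1 = Complex x q.2, q.1.2 * (1 + Scpx m p B q.1.1) <= 1,
    `|q.1.2 - s| <= dl / n.+1%:R & 0 < q.2 <= n.+1%:R^-1 /\ 0 < complex.Im q.1.1 <= 2 / n.+1%:R].
  have n0 : 0 < n.+1%:R :> R by rewrite ltr0n.
  have ni : 0 < n.+1%:R^-1 :> R by rewrite invr_gt0.
  pose d := dl / n.+1%:R; have d0 : 0 < d by rewrite divr_gt0.
  have d1 : d <= dl by rewrite ler_pdivrMr // ler_peMr ?(ltW dl0) // ler1n.
  have a1 : 0 < t - d by lra.
  have a2 : t - d < t + d by lra.
  have a3 : t + d <= 1 by lra.
  have E : H x (t - d) = H x (t + d).
    have h1 : H x t1 <= H x (t - d) by apply: (H_mono pl l0 ic lim xr) => //; lra.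
    have h2 : H x (t - d) <= H x (t + d) by apply: (H_mono pl l0 ic lim xr) => //; lra.
    have h3 : H x (t + d) <= H x t2 by apply: (H_mono pl l0 ic lim xr) => //; lra.
    by apply/eqP; rewrite eq_le h2 (le_trans h3) // -HE.
  have [e [r [/andP[e0 en] /andP[r1 r2] Iv]]] := velocity_small pl l0 ic lim xr a1 a2 a3 E ni ni.
  have r01 : 0 < r < 1 by rewrite (lt_le_trans a1) // (lt_le_trans r2).
  have [u [hu Xu su [u0 Iu]]] := characteristic x e0 r01.
  have rs : `|1 - r - s| <= d by rewrite /s ler_norml; apply/andP; split; lra.
  exists (u, 1 - r, e) => /=; split=> //; last first.
    split; first by rewrite e0.
    apply/andP; split; first exact: u0.
    rewrite Iu; have /andP[rp r1'] := r01.
    have : (1 - r) * complex.Im (velocity r (Complex x e)) <= 1 * n.+1%:R^-1.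
      apply: (@le_trans _ _ ((1 - r) * n.+1%:R^-1)); first by rewrite ler_pM2l // subr_gt0.
      by rewrite ler_pM2r //; lra.
    rewrite mul1r => h; have -> : 2 / n.+1%:R = n.+1%:R^-1 + n.+1%:R^-1 :> R by rewrite mulr_natl mulr2n.
    exact: lerD.
  move=> j jm; have cj : 0 < cabs (u - (B j)%:C) by rewrite cabs_gt0 // hu.
  rewrite -(@ler_pXn2r _ 2%N isT) ?nnegrE ?sqrtr_ge0 ?cabs_ge0 // sqr_sqrtr; last by rewrite mulr_ge0 // ltW ?p0.
  have sj : p j / cabs (u - (B j)%:C) ^+ 2 <= Scpx m p B u.
    rewrite /Scpx (bigD1_seq j) ?mem_index_iota ?iota_uniq //= lerDl big_nat_cond.
    by apply: sumr_ge0 => i /andP[/andP[_ im] _]; rewrite divr_ge0 ?sqr_ge0 // ltW // p0.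
  have s2r : s2 <= 1 - r by rewrite /s2 /s; lra.
  have : s2 * (p j / cabs (u - (B j)%:C) ^+ 2) <= 1.
    apply: le_trans su; apply: ler_pM => //; [exact: ltW|by rewrite divr_ge0 ?sqr_ge0 // ltW // p0|].
    by rewrite (le_trans sj) // lerDr.
  by rewrite mulrA ler_pdivrMr ?exprn_gt0 // mul1r.
have [q hq] := choice sample.
pose A n := complex.Re (q n).1.1.
pose P1 := \sum_(0 <= j < m) p j / sg j; pose P2 := \sum_(0 <= j < m) p j / sg j ^+ 2.
pose P3 := \sum_(0 <= j < m) p j / sg j ^+ 3.
have Pge (k : nat) : 0 <= \sum_(0 <= j < m) p j / sg j ^+ k.
  by rewrite big_nat; apply: sumr_ge0 => j /andP[_ jm]; rewrite divr_ge0 ?exprn_ge0 // ltW ?p0 ?sg0.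
have P10 : 0 <= P1 by exact: (Pge 1%N).
have P20 : 0 <= P2 by exact: Pge.
have P30 : 0 <= P3 by exact: Pge.
pose sumc (w : R[i]) := \sum_(0 <= j < m) (p j)%:C / (w - (B j)%:C).
have vE w (r : R) : w - r%:C * vcpx m p B w = (1 - r)%:C * w + r%:C * sumc w.
  by rewrite /vcpx -/(sumc w) rmorphB rmorph1; ring.
have sumc_le n : cabs (sumc (q n).1.1) <= P1.
  apply: le_trans (cabs_sum _ _) _; apply: sum_lt => j jm; have [hs _ _ _ _] := hq n.
  rewrite cabsM cabsV cabs_real gtr0_norm ?p0 // ler_pM2l ?p0 //.
  have cj := lt_le_trans (sg0 j jm) (hs j jm).
  by rewrite lef_pV2 ?posrE ?sg0 // hs.
have sb n : t - dl <= 1 - (q n).1.2 /\ 0 <= (q n).1.2 <= 1.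
  have [_ _ _ h _] := hq n.
  have : dl / n.+1%:R <= dl by rewrite ler_pdivrMr // ler_peMr ?(ltW dl0) // ler1n.
  move=> h3; have := le_trans h h3; rewrite ler_norml => /andP[h1 h2].
  have sE : s = 1 - t by [].
  have s2E : s2 = s - dl by [].
  split; first by lra.
  by apply/andP; split; lra.
(* From (1 - s) u = z - s sum_j p_j/(u - B_j) with 1 - s >= t - dl > 0. *)
pose U := (`|x| + 1 + P1) / (t - dl).
have AU n : `|A n| <= U.
  have [_ Xq _ _ [/andP[e0 e1] _]] := hq n; have [b1 /andP[b2 b3]] := sb n.
  apply: le_trans (abs_Re _) _; rewrite ler_pdivlMr //.
  apply: (@le_trans _ _ (cabs (q n).1.1 * (1 - (q n).1.2))); first by rewrite ler_wpM2l ?cabs_ge0.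
  have -> : cabs (q n).1.1 * (1 - (q n).1.2) = cabs (Complex x (q n).2 - (q n).1.2%:C * sumc (q n).1.1).
    by rewrite -Xq vE addrK cabsM cabs_real ger0_norm ?(le_trans (ltW td)) // mulrC.
  apply: le_trans (cabsB _ _) _; apply: lerD.
    apply: le_trans (cabs_le_ReIm _) _; rewrite /= lerD2l gtr0_norm //.
    by apply: le_trans e1 _; rewrite invf_le1 ?ler1n ?ltr0n.
  rewrite cabsM cabs_real ger0_norm // -[P1]mul1r; apply: ler_pM => //; exact: cabs_ge0.
have [w [_ clw]] : `[- U, U] `&` cluster (A @ \oo) !=set0.
  apply: (@segment_compact R (- U) U); exists 0%N => // n _ /=.
  by rewrite in_itv /= -ler_norml.
have near e : 0 < e -> exists n, n.+1%:R^-1 <= e /\ `|A n - w| < e.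
  move=> e0; have [k0 hk] := @eventually_small R 1 e e0.
  have hF : (A @ \oo) [set A n | n in [set n | (k0 <= n)%N]] by exists k0 => // n kn; exists n.
  have [y [[n kn yE] wy]] := clw _ _ hF (nbhsx_ballx w e e0).
  exists n; split; first by rewrite -div1r; apply: hk => //; exact: leqW.
  by move: wy; rewrite -yE /ball /= distrC.
have nearu e : 0 < e -> exists n, [/\ (q n).2 <= e, `|(q n).1.2 - s| <= e * dl & cabs ((q n).1.1 - w%:C) <= 3 * e].
  move=> e0; have [n [ne An]] := near e e0; exists n.
  have [_ _ _ h [/andP[_ e1] /andP[i0 i1]]] := hq n; split; first exact: le_trans ne.
    by apply: le_trans h _; rewrite mulrC ler_pM2r.
  apply: le_trans (cabs_le_ReIm _) _; rewrite ReB ReC Im_sub (gtr0_norm i0) -/(A n).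
  have h2 : complex.Im (q n).1.1 <= 2 * e by apply: le_trans i1 _; rewrite ler_pM2l.
  have -> : 3 * e = e + 2 * e by ring.
  exact: (lerD (ltW An) h2).
have wB j : (j < m)%N -> sg j <= `|w - B j|.
  move=> jm; apply: (@eps_le _ _ _ 3) => e e0; have [n [_ _ un]] := nearu e e0.
  have [hs _ _ _ _] := hq n; have := cabsD ((q n).1.1 - w%:C) (w - B j)%:C.
  rewrite cabs_real rmorphB addrA subrK; have := hs j jm; lra.
have ow : off_poles m B w by move=> j jm; rewrite -normr_gt0 (lt_le_trans (sg0 j jm)) ?wB.
have owc := off_poles_complex ow.
pose sw := \sum_(0 <= j < m) p j / (w - B j).
have swC : sumc w%:C = sw%:C.
  by rewrite /sumc /sw rmorph_sum; apply: eq_bigr => j _; rewrite fmorph_div rmorphB.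
have inv_near n j : (j < m)%N -> cabs (((q n).1.1 - (B j)%:C)^-1 - (w%:C - (B j)%:C)^-1) <=
    cabs ((q n).1.1 - w%:C) / sg j ^+ 2.
  move=> jm; have [hs _ _ _ _] := hq n; have sj := sg0 j jm.
  have q0 : (q n).1.1 - (B j)%:C != 0.
    by apply/eqP => E; have := hs j jm; rewrite E cabs0 leNgt sj.
  have w0 := owc j jm.
  have -> : ((q n).1.1 - (B j)%:C)^-1 - (w%:C - (B j)%:C)^-1 =
    - (((q n).1.1 - w%:C) * (((q n).1.1 - (B j)%:C)^-1 * (w%:C - (B j)%:C)^-1)) by field; rewrite q0 w0.
  rewrite cabsN cabsM; apply: ler_wpM2l; first exact: cabs_ge0.
  rewrite cabsM expr2 invfM; apply: ler_pM; rewrite ?cabs_ge0 //; apply: cabs_inv_le => //; first exact: hs.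
  by rewrite -rmorphB cabs_real wB.
have Xw : X s w = x.
  apply/eqP; rewrite -subr_eq0 -normr_le0.
  apply: (@eps_le _ _ _ (3 + `|w| * dl + 3 * P2 + dl * `|sw| + 1)) => e e0; rewrite add0r.
  have [n [en sn un]] := nearu e e0; have [_ Xq _ _ [/andP[q0 _] _]] := hq n.
  have [b1 /andP[b2 b3]] := sb n.
  rewrite vE in Xq; move: Xq; set r := (q n).1.2 in sn b1 b2 b3 *; set u := (q n).1.1 in un * => Xq.
  have XwE : (X s w)%:C = (1 - s)%:C * w%:C + s%:C * sw%:C.
    by rewrite /Xfun /vfun -/sw -!rmorphM -rmorphD; congr (_%:C); ring.
  have E : (X s w - x)%:C = - ((1 - r)%:C * (u - w%:C)) - (s - r)%:C * w%:C - r%:C * (sumc u - sw%:C)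
       + (s - r)%:C * sw%:C + (Complex x (q n).2 - x%:C).
    have E0 : (X s w - x)%:C = (X s w)%:C - x%:C by exact: rmorphB.
    by rewrite E0 XwE -Xq !rmorphB; ring.
  rewrite -cabs_real E.
  have du : cabs (sumc u - sw%:C) <= 3 * P2 * e.
    rewrite -swC /sumc -sumrB; apply: le_trans (cabs_sum _ _) _.
    rewrite mulrAC mulr_sumr; apply: sum_lt => j jm.
    rewrite -mulrBr cabsM cabs_real gtr0_norm ?p0 // [leRHS]mulrCA ler_pM2l ?p0 //.
    by apply: le_trans (inv_near n j jm) _; rewrite ler_pM2r ?invr_gt0 ?exprn_gt0 ?sg0.
  have sr : `|s - r| <= e * dl by rewrite distrC.
  have g1 : cabs (- ((1 - r)%:C * (u - w%:C))) <= 3 * e.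
    rewrite cabsN cabsM cabs_real ger0_norm ?subr_ge0 //.
    by apply: le_trans un; rewrite ler_piMl ?cabs_ge0 // gerBl.
  have g2 : cabs ((s - r)%:C * w%:C) <= `|w| * dl * e.
    by rewrite cabsM !cabs_real mulrC -mulrA [dl * e]mulrC ler_wpM2l.
  have g3 : cabs (r%:C * (sumc u - sw%:C)) <= 3 * P2 * e.
    by rewrite cabsM cabs_real ger0_norm //; apply: le_trans du; rewrite ler_piMl ?cabs_ge0.
  have g4 : cabs ((s - r)%:C * sw%:C) <= dl * `|sw| * e.
    by rewrite cabsM !cabs_real mulrAC [dl * e]mulrC ler_wpM2r.
  have g5 : cabs (Complex x (q n).2 - x%:C) <= e.
    apply: le_trans (cabs_le_ReIm _) _; rewrite ReB ImB ReC ImC /= subrr normr0 add0r subr0.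
    by rewrite gtr0_norm.
  have -> : (3 + `|w| * dl + 3 * P2 + dl * `|sw| + 1) * e =
    3 * e + `|w| * dl * e + 3 * P2 * e + dl * `|sw| * e + e by ring.
  apply: le_trans (cabsD _ _) _; apply: lerD => //.
  apply: le_trans (cabsD _ _) _; apply: lerD => //.
  apply: le_trans (cabsB _ _) _; apply: lerD => //.
  by apply: le_trans (cabsB _ _) _; exact: lerD.
have Sw : s * (1 + S w) <= 1.
  apply: (@eps_le _ _ _ (6 * P3 + dl * (1 + S w))) => e e0.
  have [n [_ sn un]] := nearu e e0; have [hs _ su _ _] := hq n; have [b1 /andP[b2 b3]] := sb n.
  have SS : S w <= Scpx m p B (q n).1.1 + 6 * P3 * e.
    have -> : 6 * P3 * e = \sum_(0 <= j < m) (p j / sg j ^+ 3 * (6 * e)) by rewrite -mulr_suml -/P3; ring.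
    rewrite /Scpx -big_split /=; apply: sum_lt => j jm; have sj := sg0 j jm.
    have -> : p j / sg j ^+ 3 * (6 * e) = p j * (6 * e / sg j ^+ 3) by ring.
    rewrite -mulrDr ler_pM2l ?p0 //.
    have := inv_near n j jm; have := hs j jm; have := wB j jm.
    set y := cabs ((q n).1.1 - (B j)%:C); set y' := `|w - B j| => h1 h2 h3.
    have yp : 0 < y := lt_le_trans sj h2; have y'p : 0 < y' := lt_le_trans sj h1.
    rewrite -[(w - B j) ^+ 2]real_normK ?num_real // -/y'.
    have d1 : y'^-1 - y^-1 <= 3 * e / sg j ^+ 2.
      have := cabsD (((w%:C - (B j)%:C)^-1) - ((q n).1.1 - (B j)%:C)^-1) (((q n).1.1 - (B j)%:C)^-1).
      rewrite subrK cabsV [cabs ((q n).1.1 - _)^-1]cabsV -rmorphB cabs_real -/y -/y' cabsBC rmorphB => h4.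
      have : cabs ((q n).1.1 - w%:C) / sg j ^+ 2 <= 3 * e / sg j ^+ 2 by rewrite ler_pM2r ?invr_gt0 ?exprn_gt0.
      lra.
    have i1 : y'^-1 <= (sg j)^-1 by rewrite lef_pV2 ?posrE.
    have i2 : y^-1 <= (sg j)^-1 by rewrite lef_pV2 ?posrE.
    have yi : 0 < y^-1 by rewrite invr_gt0.
    have yi' : 0 < y'^-1 by rewrite invr_gt0.
    rewrite -!exprVn.
    have -> : y'^-1 ^+ 2 = y^-1 ^+ 2 + (y'^-1 - y^-1) * (y'^-1 + y^-1) by ring.
    rewrite lerD2l.
    have -> : 6 * e * (sg j)^-1 ^+ 3 = 3 * e / sg j ^+ 2 * ((sg j)^-1 + (sg j)^-1) by field; rewrite gt_eqF.
    apply: (@le_trans _ _ (3 * e / sg j ^+ 2 * (y'^-1 + y^-1))).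
      by rewrite ler_pM2r // addr_gt0.
    by rewrite ler_pM2l ?lerD // divr_gt0 ?mulr_gt0 ?exprn_gt0.
  have sr : s <= (q n).1.2 + e * dl by move: sn; rewrite ler_norml => /andP[? ?]; lra.
  have S0 : 0 <= 1 + S w by rewrite addr_ge0 // Sfun_ge0.
  apply: (@le_trans _ _ (((q n).1.2 + e * dl) * (1 + S w))); first by rewrite ler_wpM2r.
  have -> : 1 + (6 * P3 + dl * (1 + S w)) * e = (1 + 6 * P3 * e) + e * dl * (1 + S w) by ring.
  rewrite [leLHS]mulrDl; apply: lerD => //.
  apply: (@le_trans _ _ ((q n).1.2 * (1 + Scpx m p B (q n).1.1) + (q n).1.2 * (6 * P3 * e))).
    by rewrite -mulrDr ler_wpM2l // -addrA lerD2l.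
  by apply: lerD => //; apply: ler_piMl => //; nonneg.
by exists `|w - B 0|, w; split.
Qed.

End Plateaus.

(** * From plateaus to the second derivative at the zeros, and back *)

Section Equivalence.
Variables (R : realType) (lam : seq nat) (m : nat) (a b : nat -> int) (H : R -> R -> R).
Hypotheses (pl : is_partition lam) (l0 : lam != [::]).
Hypothesis ic : interlacing_coordinates R lam m a b.
Hypothesis lim : limiting_height lam (a 0%N) (a m) H.

Local Notation et := (Defs.eta R lam).
Local Notation W := (size lam + nth 0%N lam 0)%N.
Local Notation al := (et * (a 0%N)%:~R).
Local Notation inr := (in_range al et W).
Local Notation lo := (@lo R lam a).
Local Notation B := (@hi R lam b).
Local Notation p := (@weight R lam m a b).
Local Notation v := (vfun m p B).
Local Notation X := (Xfun m p B).
Local Notation S := (Sfun m p B).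
Local Notation Q := (Qfun m p B).
Local Notation froz := (frozen m p B).

Let et0 : 0 < et := eta_gt0 R pl l0.
Let p0 j : (j < m)%N -> 0 < p j. Proof. exact: (weight_gt0 pl l0 ic). Qed.
Let m0 : (0 < m)%N := poles_gt0 pl l0 ic.

(** [frozen_constant] works strictly inside the time interval; [H_end] adds the end point. *)
Lemma constant_up D x t : inr x -> 0 < t < 1 -> (forall s, 0 <= s -> s <= 1 - t -> froz D x s) -> H x t = H x 1.
Proof.
move=> xr /andP[t0 t1] fz; apply/esym; apply: (H_end pl l0 ic lim xr) => //; [exact: ltW|exact: ltW|].
move=> e e0; pose r := Num.max ((t + 1) / 2) (1 - e).
have r1 : r < 1 by rewrite gt_max; apply/andP; split; lra.
have rt : (t + 1) / 2 <= r by rewrite le_max lexx.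
have re : 1 - e <= r by rewrite le_max lexx orbT.
exists r, 1; split=> //; [lra|exact: ltW| |lra].
suff -> : H x t = H x r by [].
apply: (frozen_constant (D := D) pl l0 ic lim xr) => //; first lra.
by move=> t' /andP[h1 h2]; apply: fz; lra.
Qed.

Lemma constant_down x t : inr x -> 0 < t < 1 ->
  (forall t', 0 < t' -> t' < t -> exists D, forall r, t' <= r <= t -> froz D x (1 - r)) -> H x t = H x 0.
Proof.
move=> xr /andP[t0 t1] fz; apply: (H_end pl l0 ic lim xr) => //; [exact: ltW|exact: ltW|].
move=> e e0; pose r := Num.min (t / 2) e.
have r0 : 0 < r by rewrite lt_min divr_gt0.
have rt : r <= t / 2 by rewrite ge_min lexx.
have re : r <= e by rewrite ge_min lexx orbT.
exists 0, r; split=> //; [exact: ltW|lra| |lra].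
have tr : r < t by lra.
have [D hD] := fz r r0 tr.
suff -> : H x r = H x t by [].
exact: (frozen_constant (D := D) pl l0 ic lim xr).
Qed.

Lemma same_gap_lo i u : (i <= m)%N -> (forall j, (j < i)%N -> B j < u) ->
  (forall j, (i <= j < m)%N -> u < B j) -> same_gap m B (lo i) u.
Proof.
move=> im h1 h2 j jm; have [ij|ji] := leqP i j.
  have g1 : lo i < B j by rewrite (lo_hi pl l0 ic) // ij.
  have g2 : u < B j by rewrite h2 // ij.
  by rewrite -mulrNN mulr_gt0 // oppr_gt0 subr_lt0.
have g1 : B j < lo i by rewrite (hi_lo pl l0 ic) // ji.
by rewrite mulr_gt0 // subr_gt0 // h1.
Qed.

Lemma lo_down i u x t : inr x -> 0 < t < 1 -> (i <= m)%N -> same_gap m B (lo i) u ->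
  (forall w, Num.min (lo i) u <= w <= Num.max (lo i) u -> S w <= S u) ->
  X (1 - t) u = x -> (1 - t) * (1 + S u) <= 1 -> H x t = H x 1.
Proof.
move=> xr t01 im g hS Xu su.
apply: (constant_up (D := Num.max `|lo i - B 0| `|u - B 0|)) => // s s0 st.
apply: (freeze_down p0 g (vfun_lo pl l0 ic im) hS Xu su) => //; by rewrite le_max lexx ?orbT.
Qed.

Lemma right_up u x t : inr x -> 0 < t < 1 -> (forall j, (j < m)%N -> B j < u) -> 0 < v u ->
  X (1 - t) u = x -> (1 - t) * (1 + S u) <= 1 -> H x t = H x 0.
Proof.
move=> xr t01 hB vu Xu su; have /andP[t0 t1] := t01; apply: constant_down => // t' t'0 t't.
(* At time r the bound x/(1 - s) required by [freeze_up] is x/r, hence at most |x|/t'. *)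
pose D := Num.max u (`|x| / t'); exists (D - B 0) => r /andP[r1 r2].
have uD : u <= D by rewrite le_max lexx.
have [->|rt] := eqVneq r t.
  exists u; split=> //; first by move=> j jm; rewrite subr_eq0 gt_eqF // hB.
  by rewrite gtr0_norm ?subr_gt0 ?hB // lerD2r.
have rt' : r < t by rewrite lt_neqAle rt.
have r0 : 0 < r := lt_le_trans t'0 r1.
apply: (freeze_up p0 m0 hB vu Xu) => //; try lra.
have -> : 1 - (1 - r) = r by ring.
rewrite le_max; apply/orP; right; apply: (@le_trans _ _ (`|x| / r)).
  by rewrite ler_pM2r ?invr_gt0 // ler_norm.
by apply: ler_wpM2l => //; rewrite lef_pV2 ?posrE.
Qed.

Lemma left_up u x t : inr x -> 0 < t < 1 -> (forall j, (j < m)%N -> u < B j) -> v u < 0 ->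
  X (1 - t) u = x -> (1 - t) * (1 + S u) <= 1 -> H x t = H x 0.
Proof.
move=> xr t01 hB vu Xu su; have /andP[t0 t1] := t01; apply: constant_down => // t' t'0 t't.
pose D := Num.max (- u) (`|x| / t'); exists (D - - B 0) => r /andP[r1 r2].
have uD : - u <= D by rewrite le_max lexx.
have [->|rt] := eqVneq r t.
  exists u; split=> //; first by move=> j jm; rewrite subr_eq0 lt_eqF // hB.
  by rewrite ltr0_norm ?subr_lt0 ?hB // opprB opprK addrC lerD2r.
have rt' : r < t by rewrite lt_neqAle rt.
have r0 : 0 < r := lt_le_trans t'0 r1.
apply: frozen_opp.
have hB' j : (j < m)%N -> - B j < - u by move=> jm; rewrite ltrN2 hB.
have vu' : 0 < vfun m p (fun j => - B j) (- u) by rewrite vfun_opp oppr_gt0.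
have Xu' : Xfun m p (fun j => - B j) (1 - t) (- u) = - x by rewrite -Xu /Xfun vfun_opp; ring.
apply: (freeze_up p0 m0 hB' vu' Xu') => //; try lra.
have -> : 1 - (1 - r) = r by ring.
rewrite le_max; apply/orP; right; apply: (@le_trans _ _ (`|x| / r)).
  by rewrite ler_pM2r ?invr_gt0 // -normrN ler_norm.
by apply: ler_wpM2l => //; rewrite lef_pV2 ?posrE.
Qed.

Lemma B_mono i j : (i <= j < m)%N -> B i <= B j.
Proof.
move=> /andP[]; rewrite leq_eqVlt => /orP[/eqP ->//|ij] jm.
by rewrite ltW // (hi_hi pl l0 ic) // ij.
Qed.

(** Cases by the position of u among the poles. In an inner gap Q vanishes at the zero of v_1, so S
    is minimal there and freezing lasts until time 1. Outside the poles it lasts until time 1 when u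
    lies between the extreme zero and the poles, and back to time 0 when u lies beyond that zero. *)
Lemma plateau_ends : (forall i, (0 < i < m)%N -> Q (lo i) = 0) ->
  forall u x t, inr x -> 0 < t < 1 -> off_poles m B u -> X (1 - t) u = x -> (1 - t) * (1 + S u) <= 1 ->
  H x t = H x 1 \/ H x t = H x 0.
Proof.
move=> hQ u x t xr t01 hu Xu su.
have [ex|nex] := pselect (exists j, ((j < m)%N && (u < B j))); last first.
  have hB j : (j < m)%N -> B j < u.
    move=> jm; rewrite ltNge; apply/negP => h; apply: nex; exists j.
    by rewrite jm lt_neqAle h andbT -subr_eq0 hu.
  have g : same_gap m B (lo m) u.
    by apply: same_gap_lo => // j /andP[mj jm]; move: jm; rewrite ltnNge mj.
  have [uA|Au] := leP u (lo m).
    left; apply: (lo_down xr t01 (leqnn m) g) => // w; rewrite minC maxC minEle maxEle uA => /andP[uw _].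
    apply: Sfun_far => // j jm; have := hB j jm => h; rewrite !ger0_norm; lra.
  right; apply: (right_up xr t01 hB) => //.
  have [hA _] := same_gap_off g.
  have -> : v u = (u - lo m) * (1 + mixed m p B u (lo m)) by rewrite -vfunB // (vfun_lo pl l0 ic (leqnn m)) subr0.
  rewrite mulr_gt0 ?subr_gt0 // ltr_pwDl // mixed_gt0 //.
  by move=> j jm; rewrite mulrC; exact: g.
case: (ex_minnP ex) => i /andP[im uB] imin.
have hlt j : (j < i)%N -> B j < u.
  move=> ji; rewrite ltNge; apply/negP => h; have : (i <= j)%N.
    by apply: imin; rewrite (ltn_trans ji im) lt_neqAle h andbT -subr_eq0 hu // (ltn_trans ji im).
  by rewrite leqNgt ji.
have hgt j : (i <= j < m)%N -> u < B j by move=> h; exact: lt_le_trans (B_mono h).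
have g : same_gap m B (lo i) u by apply: same_gap_lo => //; exact: ltnW.
have [i0|i0] := posnP i; last first.
  left; apply: (lo_down xr t01 (ltnW im) g) => // w wb.
  by apply: (Sfun_between p0 g) => //; apply: hQ; rewrite i0.
have hB j : (j < m)%N -> u < B j by move=> jm; apply: hgt; rewrite i0.
have [Au|uA] := leP (lo i) u.
  left; apply: (lo_down xr t01 (ltnW im) g) => // w; rewrite minEle maxEle Au => /andP[_ wu].
  apply: Sfun_far => // j jm; have := hB j jm => h; rewrite !ler0_norm; lra.
right; apply: (left_up xr t01 hB) => //.
have [hA _] := same_gap_off g.
have -> : v u = (u - lo i) * (1 + mixed m p B u (lo i)) by rewrite -vfunB // (vfun_lo pl l0 ic (ltnW im)) subr0.
rewrite pmulr_llt0 ?subr_lt0 // ltr_pwDl // mixed_gt0 //.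
by move=> j jm; rewrite mulrC; exact: g.
Qed.

Lemma no_plateau_of_Q : (forall i, (0 < i < m)%N -> Q (lo i) = 0) -> no_plateau lam a H.
Proof.
move=> hQ x t1 t2 xr t10 t12 t21 E h0 h1; pose t := (t1 + t2) / 2.
have t1t : t1 < t by rewrite /t; lra.
have tt2 : t < t2 by rewrite /t; lra.
have [D [u [hu Xu su _]]] := constant_frozen pl l0 ic lim xr t10 t1t tt2 t21 E.
have t01 : 0 < t < 1 by apply/andP; split; lra.
have Ht : H x t1 = H x t.
  have g1 : H x t1 <= H x t by apply: (H_mono pl l0 ic lim xr) => //; lra.
  have g2 : H x t <= H x t2 by apply: (H_mono pl l0 ic lim xr) => //; lra.
  by apply/eqP; rewrite eq_le g1 E.
have [h|h] := plateau_ends hQ xr t01 hu Xu su; move: h0 h1; rewrite Ht h ?ltxx //.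
by rewrite (H_zero pl l0 ic lim xr) ltxx.
Qed.

(** For x outside the range, X_0(x) = x is a frozen point beyond all poles, and [freeze_up_witness]
    continues it up to parameter s. By uniqueness it equals u, which has poles on both sides. *)
Lemma frozen_range x s u : 0 < s -> s < 1 -> off_poles m B u -> X s u = x -> s * (1 + S u) <= 1 ->
  (exists2 j, (j < m)%N & u < B j) -> (exists2 j, (j < m)%N & B j < u) -> inr x.
Proof.
move=> s0 s1 hu Xu su [j1 j1m uB] [j2 j2m Bu].
have mm : (m.-1 < m)%N by rewrite prednK.
have uniq_ w : off_poles m B w -> X s w = x -> s * (1 + S w) <= 1 -> w = u.
  by move=> hw Xw sw; apply: (frozen_unique p0 m0 s0 hw hu sw su); rewrite Xw.
have lom : lo m = al + et * W%:R by rewrite -(range_end pl l0 ic).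
have vpos y : lo m < y -> (forall j, (j < m)%N -> B j < y) /\ 0 < v y.
  move=> hy; have hB j : (j < m)%N -> B j < y.
    by move=> jm; apply: lt_trans hy; rewrite (hi_lo pl l0 ic) // jm leqnn.
  split=> //; have g : same_gap m B (lo m) y.
    by apply: same_gap_lo => // j /andP[mj jm]; move: jm; rewrite ltnNge mj.
  have [hA hy'] := same_gap_off g.
  have -> : v y = (y - lo m) * (1 + mixed m p B y (lo m)) by rewrite -vfunB // (vfun_lo pl l0 ic (leqnn m)) subr0.
  rewrite mulr_gt0 ?subr_gt0 // ltr_pwDl // mixed_gt0 //.
  by move=> j jm; rewrite mulrC; exact: g.
have vneg y : y < lo 0 -> (forall j, (j < m)%N -> y < B j) /\ v y < 0.
  move=> hy; have hB j : (j < m)%N -> y < B j.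
    by move=> jm; apply: lt_trans hy _; rewrite (lo_hi pl l0 ic).
  split=> //; have g : same_gap m B (lo 0) y by apply: same_gap_lo => // j /andP[_ jm]; exact: hB.
  have [hA hy'] := same_gap_off g.
  have -> : v y = (y - lo 0) * (1 + mixed m p B y (lo 0)) by rewrite -vfunB // (vfun_lo pl l0 ic (leq0n m)) subr0.
  rewrite pmulr_llt0 ?subr_lt0 // ltr_pwDl // mixed_gt0 //.
  by move=> j jm; rewrite mulrC; exact: g.
rewrite /in_range -lom -/(lo 0); apply/andP; split; rewrite leNgt; apply/negP => hx.
  have [hB vx] := vneg x hx.
  have hB' j : (j < m)%N -> - B j < - x by move=> jm; rewrite ltrN2 hB.
  have vx' : 0 < vfun m p (fun j => - B j) (- x) by rewrite vfun_opp oppr_gt0.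
  have X0 : Xfun m p (fun j => - B j) 0 (- x) = - x by rewrite /Xfun mul0r subr0.
  pose y := Num.max (- x) (- x / (1 - s)).
  have y1 : - x <= y by rewrite le_max lexx.
  have y2 : - x / (1 - s) <= y by rewrite le_max lexx orbT.
  have [w [/andP[xw _] hw Xw sw]] := freeze_up_witness p0 hB' vx' X0 s0 s0 s1 y1 y2.
  have hw' : off_poles m B (- w).
    move=> j jm; apply/eqP => E; have := hw j jm; have E2 : w + B j = 0 by lra.
    by rewrite opprK E2 eqxx.
  have wu : - w = u.
    apply: uniq_ => //; last by rewrite -Sfun_opp opprK.
    have E := vfun_opp m p B (- w); rewrite opprK in E.
    by apply: oppr_inj; rewrite -Xw /Xfun E; ring.
  have := lt_le_trans Bu (_ : u <= x); rewrite -wu lerNl => /(_ xw); have := hB j2 j2m; lra.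
have [hB vx] := vpos x hx.
have X0 : X 0 x = x by rewrite /Xfun mul0r subr0.
pose y := Num.max x (x / (1 - s)).
have y1 : x <= y by rewrite le_max lexx.
have y2 : x / (1 - s) <= y by rewrite le_max lexx orbT.
have [w [/andP[xw _] hw Xw sw]] := freeze_up_witness p0 hB vx X0 s0 s0 s1 y1 y2.
have wu := uniq_ w hw Xw sw; rewrite wu in xw; have := hB j1 j1m; lra.
Qed.

Lemma Q_of_no_plateau : no_plateau lam a H -> forall i, (0 < i < m)%N -> Q (lo i) = 0.
Proof.
move=> np i /andP[i0 im]; apply/eqP; apply: contraT => QA; exfalso.
have im' : (i.-1 < m)%N by apply: leq_ltn_trans im; exact: leq_pred.
have i1 : (i.-1 < i)%N by rewrite prednK.
set A := lo i in QA; have lA : B i.-1 < A by rewrite (hi_lo pl l0 ic) // i1 ltnW.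
have rA : A < B i by rewrite (lo_hi pl l0 ic) // leqnn.
have Bl j : (j < i)%N -> B j <= B i.-1.
  by move=> ji; apply: B_mono; rewrite im' andbT -ltnS prednK.
have Br j : (i <= j < m)%N -> B i <= B j by exact: B_mono.
have [w1 /andP[w11 w12] Qw1] : exists2 w, B i.-1 < w <= A & 0 <= Q w.
  apply: (Qfun_nonneg p0 m0 im' lA (kap := B i - A)); first by rewrite subr_gt0.
  move=> j jm; have [ij|ji] := leqP i j; [right|by left; exact: Bl].
  by rewrite addrC subrK Br // ij.
have [w2 /andP[w21 w22] Qw2] : exists2 w, A <= w < B i & Q w <= 0.
  have rA' : - B i < - A by rewrite ltrN2.
  have kp : 0 < A - B i.-1 by rewrite subr_gt0.
  have hB' j : (j < m)%N -> - B j <= - B i \/ - A + (A - B i.-1) <= - B j.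
    move=> jm; have [ij|ji] := leqP i j; first by left; rewrite lerN2 Br // ij.
    by right; have := Bl j ji; lra.
  have [w /andP[h1 h2] h3] := Qfun_nonneg (B := fun j => - B j) p0 m0 im rA' kp hB'.
  exists (- w); first by apply/andP; split; lra.
  by have := Qfun_opp m p B (- w); rewrite opprK => E; rewrite E in h3; lra.
have g12 : same_gap m B w1 w2.
  move=> j jm; have [ij|ji] := leqP i j.
    have h : B i <= B j by rewrite Br // ij.
    by rewrite -mulrNN mulr_gt0 //; lra.
  by have h := Bl j ji; rewrite mulr_gt0 //; lra.
(* Q is nonnegative near the left pole of the gap and nonpositive near the right one. *)
have [c /andP[c1 c2] Qc] := Q_IVT (le_trans w12 w21) g12 Qw1 Qw2.
have w12' : w1 <= w2 := le_trans w12 w21.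
have gA : same_gap m B c A.
  move=> j jm; have [ij|ji] := leqP i j.
    have h : B i <= B j by rewrite Br // ij.
    by rewrite -mulrNN mulr_gt0 //; lra.
  by have h := Bl j ji; rewrite mulr_gt0 //; lra.
have [hc hA] := same_gap_off gA.
have vc : v c != 0.
  apply/eqP => v0; have := vfunB p hc hA; rewrite v0 (vfun_lo pl l0 ic (ltnW im)) subrr => /esym/eqP.
  rewrite mulf_eq0 (gt_eqF (ltr_pwDl ltr01 (mixed_gt0 p0 gA))) orbF subr_eq0 => /eqP cA.
  by move: QA; rewrite -cA Qc eqxx.
have S0 := Sfun_gt0 p0 m0 hc.
pose s0 := (1 + S c)^-1; have q0 : 0 < 1 + S c by rewrite addr_gt0.
have s00 : 0 < s0 by rewrite invr_gt0.
have s01 : s0 < 1 by rewrite invf_lt1 // ltrDl.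
have sS : s0 * (1 + S c) = 1 by rewrite mulVf // gt_eqF.
have [d0 d00 nf] := not_frozen p0 m0 hc Qc sS s00 vc.
pose d := Num.min d0 (s0 / 4).
have dp : 0 < d by rewrite lt_min d00 divr_gt0.
have dd : d <= d0 by rewrite ge_min lexx.
have ds : d <= s0 / 4 by rewrite ge_min lexx orbT.
(* The parameters s0 = s + d and s0 - 2d = s - d excluded by [not_frozen] lie outside the window of
   half-width e <= d/2 on which H(x, .) is shown to be constant. *)
pose s := s0 - d; have sp : 0 < s by rewrite /s; lra.
have ss : s < s0 by rewrite /s; lra.
have s1 : s < 1 by lra.
have [D [del [del0 fz]]] := frozen_near p0 m0 hc sp ss sS.
set x := X s c in fz.
have su : s * (1 + S c) <= 1 by rewrite -[leRHS]sS ler_wpM2r // ltW.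
have xr : inr x.
  apply: (frozen_range sp s1 hc _ su) => //; first by exists i => //; lra.
  by exists i.-1 => //; lra.
pose e := Num.min del (Num.min (d / 2) (s / 2)).
have e0 : 0 < e by rewrite !lt_min del0 !divr_gt0.
have e1 : e <= del by rewrite ge_min lexx.
have e2 : e <= d / 2 by rewrite !ge_min lexx !orbT.
have e3 : e <= s / 2 by rewrite !ge_min lexx !orbT.
pose t1 := 1 - s - e; pose t2 := 1 - s + e.
have t10 : 0 < t1 by rewrite /t1 /s; lra.
have t12 : t1 < t2 by rewrite /t1 /t2; lra.
have t21 : t2 < 1 by rewrite /t2; lra.
have HE : H x t1 = H x t2.
  apply: (frozen_constant (D := D) pl l0 ic lim xr) => // t /andP[h1 h2]; apply: fz.
  by rewrite ler_norml; apply/andP; move: h1 h2; rewrite /t1 /t2; split; lra.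
have t1r : 0 <= t1 <= 1 by apply/andP; split; lra.
(* At height 0 the plateau would reach back to time 0 and contain the parameter s0; at height H(x,
   1) it would reach time 1 and contain s0 - 2d. Heights in between contradict the absence of
   plateaus. *)
have := H_ge0 pl l0 ic lim xr t1r; rewrite le_eqVlt => /orP[/eqP h0|h0].
  have HE0 : H x 0 = H x t2 by rewrite (H_zero pl l0 ic lim xr) h0.
  have tt : 1 - s0 < t2 by rewrite /t2 /s; lra.
  have tp : 0 < 1 - s0 by lra.
  have [D' f] := constant_frozen pl l0 ic lim xr (lexx 0) tp tt (ltW t21) HE0.
  by apply: (nf d s0 D' dp dd); [left|move: f; have -> : 1 - (1 - s0) = s0 by ring].
have H1 : H x t1 = H x 1.
  apply/eqP; rewrite eq_le; apply/andP; split.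
    by apply: (H_mono pl l0 ic lim xr) => //; lra.
  rewrite leNgt; apply/negP => h; exact: (np x t1 t2 xr (ltW t10) t12 (ltW t21) HE h0 h).
have tt : t1 < 1 - (s0 - 2 * d) by rewrite /t1 /s; lra.
have tp : 1 - (s0 - 2 * d) < 1 by lra.
have [D' f] := constant_frozen pl l0 ic lim xr (ltW t10) tt tp (lexx 1) H1.
by apply: (nf d (s0 - 2 * d) D' dp dd); [right|move: f; have -> : 1 - (1 - (s0 - 2 * d)) = s0 - 2 * d by ring].
Qed.

End Equivalence.

Theorem theorem8 (R : realType) (lam : seq nat) (m : nat) (a b : nat -> int)
    (H : R -> R -> R) :
  is_partition lam -> lam != [::] ->
  interlacing_coordinates R lam m a b ->
  limiting_height lam (a 0%N) (a m) H ->
  surface_continuous lam H <->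
  (forall i0 : nat, (1 <= i0 <= m.-1)%N ->
    \sum_(0 <= i < m.+1 | i != i0) ((a i0 - a i)%:~R : R)^-1 =
    \sum_(1 <= i < m.+1) ((a i0 - b i)%:~R : R)^-1).
Proof.
move=> pl l0 ic lim; have m0 := poles_gt0 pl l0 ic.
have rng i : (1 <= i <= m.-1)%N = (0 < i < m)%N by rewrite -[(i <= _)%N]ltnS prednK.
rewrite -(no_plateau_continuous pl l0 ic lim); split=> [np i|hQ].
  rewrite rng => im; have /andP[_ im'] := im.
  by apply/(condition_Q pl l0 ic (ltnW im')); exact: (Q_of_no_plateau pl l0 ic lim np).
apply: (no_plateau_of_Q pl l0 ic lim) => i im; have /andP[_ im'] := im.
by apply/(condition_Q pl l0 ic (ltnW im')); apply: hQ; rewrite rng.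
Qed.
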